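(* Let $n\ge 2$ be a natural number and $\lambda$ a cardinal. Then $\lambda$ is exacting if and only if there is a cardinal $\mu$ such that for every first-order signature containing a unary predicate symbol $\dot P$, every class $\mathcal C$ of structures of that signature which is $\Sigma_n$-definable from parameters in $V_\mu\cup\{\lambda\}$, and every $B\in\mathcal C$ of type $\langle\mu,\lambda\rangle$, there are $\nu<\mu$, $A\in\mathcal C$ of type $\langle\nu,\lambda\rangle$, and an elementary embedding $j:A\to B$.
   Context: For $m$ a natural number, $C^{(m)}$ is the class of ordinals $\alpha$ with $V_\alpha\prec_{\Sigma_m}V$. A limit cardinal $\lambda$ is exacting if there exist $m>0$, a cardinal $\eta\in C^{(m)}$ with $\eta>\lambda$, $X\prec V_\eta$ with $V_\lambda\cup\{\lambda\}\subseteq X$, a cardinal $\zeta\in C^{(m+1)}$ with $\zeta>\lambda$, and an elementary $i:X\to V_\zeta$ with $i(\lambda)=\lambda$ and $i\restriction\lambda\ne\mathrm{id}_\lambda$. A structure $A$ has type $\langle\mu,\lambda\rangle$ if its universe has rank $\lambda$ and the interpretation $\dot P^A$ has rank $\mu$.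
   Formalization: Two conditions are added, without which the claim fails: μ ≤ λ (for μ > λ no structure has type ⟨μ,λ⟩, so the right side holds vacuously for every λ), and all symbols of the signature lie in V_μ ∪ V_ω (constants naming all ordinals below λ would block reflection). *)

(* Defs.v *)
(* The ambient universe V of ZFC is an arbitrary model of first-order ZFC, so
   that the theorem amounts to derivability in ZFC.  Natural numbers that index
   formulas of set theory (the n of Sigma_n, the m of C^(m)) are those of Rocq;
   signatures, structures, their formulas, satisfaction and elementary
   embeddings are sets of the model, as its omega may be nonstandard. *)
From Stdlib Require Import Arith ClassicalEpsilon.

Set Implicit Arguments.

Inductive fml : Type :=
| Mem (x y : nat)
| Eq (x y : nat)
| Neg (f : fml)
| And (f g : fml)
| Or (f g : fml)
| Imp (f g : fml)
| Ex (x : nat) (f : fml)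
| All (x : nat) (f : fml).

Definition upd (U : Type) (e : nat -> U) (x : nat) (a : U) : nat -> U :=
  fun y => if Nat.eqb y x then a else e y.

(* Truth in the substructure of (U, E) with domain D. *)
Fixpoint sat (U : Type) (E : U -> U -> Prop) (D : U -> Prop)
    (e : nat -> U) (f : fml) {struct f} : Prop :=
  match f with
  | Mem x y => E (e x) (e y)
  | Eq x y => e x = e y
  | Neg f => ~ sat E D e f
  | And f g => sat E D e f /\ sat E D e g
  | Or f g => sat E D e f \/ sat E D e g
  | Imp f g => sat E D e f -> sat E D e g
  | Ex x f => exists a, D a /\ sat E D (upd e x a) f
  | All x f => forall a, D a -> sat E D (upd e x a) f
  end.

Definition whole (U : Type) : U -> Prop := fun _ => True.

(* The Levy hierarchy, with blocks of like quantifiers. *)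
Inductive Delta0 : fml -> Prop :=
| D0_Mem x y : Delta0 (Mem x y)
| D0_Eq x y : Delta0 (Eq x y)
| D0_Neg f : Delta0 f -> Delta0 (Neg f)
| D0_And f g : Delta0 f -> Delta0 g -> Delta0 (And f g)
| D0_Or f g : Delta0 f -> Delta0 g -> Delta0 (Or f g)
| D0_Imp f g : Delta0 f -> Delta0 g -> Delta0 (Imp f g)
| D0_Ex x y f : x <> y -> Delta0 f -> Delta0 (Ex x (And (Mem x y) f))
| D0_All x y f : x <> y -> Delta0 f -> Delta0 (All x (Imp (Mem x y) f)).

Inductive Sigma : nat -> fml -> Prop :=
| Sigma_Delta0 n f : Delta0 f -> Sigma n f
| Sigma_Pi n f : Pi n f -> Sigma (S n) f
| Sigma_Ex n x f : Sigma (S n) f -> Sigma (S n) (Ex x f)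
with Pi : nat -> fml -> Prop :=
| Pi_Delta0 n f : Delta0 f -> Pi n f
| Pi_Sigma n f : Sigma n f -> Pi (S n) f
| Pi_All n x f : Pi (S n) f -> Pi (S n) (All x f).

Record zfc_model : Type := ZFCModel {
  carrier :> Type;
  mem : carrier -> carrier -> Prop;
  zf_extensionality : forall x y,
    (forall z, mem z x <-> mem z y) -> x = y;
  zf_foundation : forall x,
    (exists y, mem y x) -> exists y, mem y x /\ forall z, mem z x -> ~ mem z y;
  zf_pairing : forall x y, exists p, forall z, mem z p <-> z = x \/ z = y;
  zf_union : forall x, exists u, forall z,
    mem z u <-> exists y, mem y x /\ mem z y;
  zf_powerset : forall x, exists p, forall y,
    mem y p <-> forall z, mem z y -> mem z x;
  zf_infinity : exists w,
    (exists o, mem o w /\ forall z, ~ mem z o) /\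
    (forall x, mem x w ->
       exists s, mem s w /\ forall z, mem z s <-> mem z x \/ z = x);
  zf_separation : forall (f : fml) (e : nat -> carrier) (a : carrier),
    exists b, forall z,
      mem z b <-> mem z a /\ sat mem (@whole carrier) (upd e 0 z) f;
  zf_replacement : forall (f : fml) (e : nat -> carrier) (a : carrier),
    (forall x, mem x a ->
       exists! y, sat mem (@whole carrier) (upd (upd e 0 x) 1 y) f) ->
    exists b, forall y, mem y b <->
      exists x, mem x a /\ sat mem (@whole carrier) (upd (upd e 0 x) 1 y) f;
  zf_choice : forall x,
    (forall y, mem y x -> exists z, mem z y) ->
    (forall y y', mem y x -> mem y' x -> y <> y' ->
       forall z, mem z y -> ~ mem z y') ->
    exists c, forall y, mem y x -> exists! z, mem z c /\ mem z y
}.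

Arguments mem {_} _ _.

Notation "x ∈ y" := (mem x y) (at level 70, no associativity).

Lemma zfc_inhabited (M : zfc_model) : inhabited M.
Proof. destruct (zf_infinity M) as [w _]. exact (inhabits w). Qed.

Definition the {M : zfc_model} (P : M -> Prop) : M :=
  epsilon (zfc_inhabited M) P.

(* {z | P z}; unspecified when P is a proper class. *)
Definition set_of {M : zfc_model} (P : M -> Prop) : M :=
  the (fun x => forall z, z ∈ x <-> P z).

Section Sets.
Context {M : zfc_model}.
Implicit Types x y z a b f g k n p s t u w A B F R T X : M.

Definition subset x y : Prop := forall z, z ∈ x -> z ∈ y.
Definition empty : M := set_of (fun _ => False).
Definition singleton x : M := set_of (fun z => z = x).
Definition upair x y : M := set_of (fun z => z = x \/ z = y).
Definition union2 x y : M := set_of (fun z => z ∈ x \/ z ∈ y).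
Definition opair x y : M := upair (singleton x) (upair x y).
Definition triple x y z : M := opair x (opair y z).
Definition succ x : M := union2 x (singleton x).

Fixpoint num (i : nat) : M :=
  match i with O => empty | S i => succ (num i) end.

Definition inductive_set w : Prop :=
  empty ∈ w /\ forall x, x ∈ w -> succ x ∈ w.
Definition omega : M := set_of (fun k => forall w, inductive_set w -> k ∈ w).

Definition func f a b : Prop :=
  (forall p, p ∈ f -> exists x y, x ∈ a /\ y ∈ b /\ p = opair x y) /\
  (forall x, x ∈ a -> exists! y, opair x y ∈ f).
Definition app f x : M := the (fun y => opair x y ∈ f).
Definition funset a b : M := set_of (fun f => func f a b).
Definition idfun a : M := set_of (fun p => exists x, x ∈ a /\ p = opair x x).
Definition comp g f : M :=
  set_of (fun p => exists x y, opair x y ∈ f /\ p = opair x (app g y)).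
Definition bijection f a b : Prop :=
  func f a b /\ forall y, y ∈ b -> exists! x, x ∈ a /\ app f x = y.

Definition transitive x : Prop := forall y, y ∈ x -> subset y x.
Definition ordinal x : Prop :=
  transitive x /\ forall y, y ∈ x -> transitive y.
Definition cardinal x : Prop :=
  ordinal x /\ forall y, y ∈ x -> ~ exists f, bijection f y x.
Definition limit_cardinal x : Prop :=
  cardinal x /\ (exists y, y ∈ x) /\
  forall y, y ∈ x -> cardinal y -> exists z, cardinal z /\ y ∈ z /\ z ∈ x.

(* f(b) is the union of the power sets P(f(c)), c < b, for all b < dom f. *)
Definition cumulative f a : Prop :=
  ordinal a /\ (exists r : M, func f a r) /\
  forall b, b ∈ a -> forall x, x ∈ app f b <->
    exists c : M, c ∈ b /\ subset x (app f c).
Definition Vlev a : M :=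
  set_of (fun x => exists f, cumulative f (succ a) /\ x ∈ app f a).

Definition has_rank x a : Prop :=
  ordinal a /\ subset x (Vlev a) /\
  forall b, b ∈ a -> ~ subset x (Vlev b).

(* Membership in C^(m).  An assignment into the empty set does not exist,
   hence the clause that V_a is nonempty. *)
Definition in_C (m : nat) a : Prop :=
  ordinal a /\ (exists x, x ∈ Vlev a) /\
  forall f : fml, Sigma m f ->
  forall e : nat -> M, (forall i, e i ∈ Vlev a) ->
  (sat (@mem M) (fun x => x ∈ Vlev a) e f <-> sat (@mem M) (@whole M) e f).

(* The class C is {x | f(x, e 1, e 2, ...)}, with parameters in the set a. *)
Definition Sigma_definable (n : nat) a (C : M -> Prop) : Prop :=
  exists (f : fml) (e : nat -> M), Sigma n f /\ (forall i, e i ∈ a) /\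
  forall x, C x <-> sat (@mem M) (@whole M) (upd e 0 x) f.

(* First-order logic inside the model.  A symbol carries its kind, its arity
   and a name; constants are function symbols of arity 0. *)
Definition relsym n r : M := triple (num 0) n r.
Definition funsym n r : M := triple (num 1) n r.

Definition signature L : Prop :=
  forall s, s ∈ L ->
  exists n r, n ∈ omega /\ (s = relsym n r \/ s = funsym n r).

(* A structure is a pair (A, I), I a function on the signature. *)
Definition univ B : M := the (fun A => exists I, B = opair A I).
Definition interp B s : M := the (fun y => exists A I, B = opair A I /\ app I s = y).

Definition structure L B : Prop :=
  exists A I, B = opair A I /\ (exists r, func I L r) /\
  forall n r, n ∈ omega ->
    (relsym n r ∈ L -> subset (app I (relsym n r)) (funset n A)) /\
    (funsym n r ∈ L -> func (app I (funsym n r)) (funset n A) A).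

Definition tvar k : M := opair (num 0) k.
Definition tapp s t : M := triple (num 1) s t.

Definition term_closed L T : Prop :=
  (forall k, k ∈ omega -> tvar k ∈ T) /\
  (forall n r t, n ∈ omega -> funsym n r ∈ L -> func t n T ->
     tapp (funsym n r) t ∈ T).
Definition is_term L t : Prop := forall T, term_closed L T -> t ∈ T.
Definition terms L : M := set_of (is_term L).

Definition feq t u : M := triple (num 0) t u.
Definition frel s t : M := triple (num 1) s t.
Definition fneg f : M := opair (num 2) f.
Definition fand f g : M := triple (num 3) f g.
Definition fall k f : M := triple (num 4) k f.

Definition formula_closed L F : Prop :=
  (forall t u, is_term L t -> is_term L u -> feq t u ∈ F) /\
  (forall n r t, n ∈ omega -> relsym n r ∈ L -> func t n (terms L) ->
     frel (relsym n r) t ∈ F) /\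
  (forall f, f ∈ F -> fneg f ∈ F) /\
  (forall f g, f ∈ F -> g ∈ F -> fand f g ∈ F) /\
  (forall k f, k ∈ omega -> f ∈ F -> fall k f ∈ F).
Definition is_formula L f : Prop := forall F, formula_closed L F -> f ∈ F.

Definition assignment B s : Prop := func s omega (univ B).
Definition supd s k a : M :=
  set_of (fun p => (p ∈ s /\ ~ exists y, p = opair k y) \/ p = opair k a).

Definition eval_closed L B s R : Prop :=
  (forall k, k ∈ omega -> opair (tvar k) (app s k) ∈ R) /\
  (forall n r t v, n ∈ omega -> funsym n r ∈ L ->
     func t n (terms L) -> func v n (univ B) ->
     (forall i, i ∈ n -> opair (app t i) (app v i) ∈ R) ->
     opair (tapp (funsym n r) t) (app (interp B (funsym n r)) v) ∈ R).
Definition tval L B s t : M :=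
  the (fun v => forall R, eval_closed L B s R -> opair t v ∈ R).

(* R is the full satisfaction relation of B, as a set of pairs (formula,
   assignment). *)
Definition satisfaction L B R : Prop :=
  forall s, assignment B s ->
  (forall t u, is_term L t -> is_term L u ->
     (opair (feq t u) s ∈ R <-> tval L B s t = tval L B s u)) /\
  (forall n r t, n ∈ omega -> relsym n r ∈ L -> func t n (terms L) ->
     (opair (frel (relsym n r) t) s ∈ R <->
      exists v, func v n (univ B) /\
        (forall i, i ∈ n -> app v i = tval L B s (app t i)) /\
        v ∈ interp B (relsym n r))) /\
  (forall f, is_formula L f -> (opair (fneg f) s ∈ R <-> ~ opair f s ∈ R)) /\
  (forall f g, is_formula L f -> is_formula L g ->
     (opair (fand f g) s ∈ R <-> opair f s ∈ R /\ opair g s ∈ R)) /\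
  (forall k f, k ∈ omega -> is_formula L f ->
     (opair (fall k f) s ∈ R <->
      forall a, a ∈ univ B -> opair f (supd s k a) ∈ R)).
Definition models L B f s : Prop :=
  exists R, satisfaction L B R /\ opair f s ∈ R.

Definition elementary_embedding L A B j : Prop :=
  func j (univ A) (univ B) /\
  forall f s, is_formula L f -> assignment A s ->
  (models L A f s <-> models L B f (comp j s)).

Definition eps_sym : M := relsym (num 2) empty.
Definition eps_sig : M := singleton eps_sym.
Definition eps_struct X : M :=
  opair X (singleton (opair eps_sym
    (set_of (fun u => func u (num 2) X /\ app u (num 0) ∈ app u (num 1))))).
Definition eps_elementary X Y i : Prop :=
  elementary_embedding eps_sig (eps_struct X) (eps_struct Y) i.
Definition elementary_sub X Y : Prop :=
  subset X Y /\ eps_elementary X Y (idfun X).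

Definition exacting (lambda : M) : Prop :=
  limit_cardinal lambda /\
  exists m : nat, 0 < m /\
  exists eta X zeta i : M,
    cardinal eta /\ in_C m eta /\ lambda ∈ eta /\
    elementary_sub X (Vlev eta) /\
    subset (union2 (Vlev lambda) (singleton lambda)) X /\
    cardinal zeta /\ in_C (S m) zeta /\ lambda ∈ zeta /\
    eps_elementary X (Vlev zeta) i /\
    app i lambda = lambda /\
    exists a, a ∈ lambda /\ app i a <> a.

(* The unary relation of B named r, as a subset of the universe: a 1-tuple is
   a function with domain {0}. *)
Definition pred_ext B r : M :=
  set_of (fun a => a ∈ univ B /\
    singleton (opair empty a) ∈ interp B (relsym (num 1) r)).

(* The extension of a unary symbol is a subset of the universe, so type
   (mu, lambda) is realised only if mu <= lambda; for larger mu, reflection of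
   structures of that type is vacuous. *)
Definition has_type r B (mu lambda : M) : Prop :=
  has_rank (univ B) lambda /\ has_rank (pred_ext B r) mu.

End Sets.

(* Main.v *)
From Stdlib Require Import Arith Lia List Classical ClassicalEpsilon FunctionalExtensionality PropExtensionality.
Require Import Defs.

Set Implicit Arguments.
Unset Strict Implicit.

(* Suppose lambda is exacting, witnessed by i : X -> V_zeta.  Reflecting the
   least counterexample below zeta turns this single embedding into, for every
   theta > lambda and every finite list of formulas, an embedding of some
   X' ⊆ V_theta into V_theta that fixes lambda, is nontrivial below it, and is
   elementary for the list.  Its critical point is the required mu: a
   counterexample B of type (mu, lambda) could be chosen in X', so that i(B), of
   type (i(mu), lambda), would not reflect below i(mu); but i restricted to B is
   an elementary embedding into i(B), and mu < i(mu).

   Conversely, let mu be given.  Reflection of (lambda, ∈, mu) shows that lambda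
   is infinite.  Let zeta be Sigma_2-correct, and Y ≺ V_zeta of size |V_lambda|
   containing V_lambda ∪ {lambda}.  Copy (Y, ∈) onto a subset of V_lambda, with
   mu as a predicate and a further predicate marking the pair (lambda, mu).  The
   copies of such X ≺ V_eta, where no V_a with a < eta maps onto eta, form a
   Sigma_2 class.  Reflecting the copy of Y yields nu < mu, an X ≺ V_eta and an
   elementary i : X -> V_zeta with i(lambda) = lambda and i(nu) = mu; by
   collapsing hulls, eta is Sigma_1-correct.  That lambda is a limit cardinal
   follows as in Kunen's theorem: an omega-Jonsson function on a fixed point
   y < lambda of i shows that i is the identity below y, so the largest cardinal
   below lambda, which i would fix, lies below the critical point, itself a
   cardinal below lambda. *)

(** The universe is an arbitrary model of first-order ZFC, so a Rocq predicate on it need not be a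
    class: every use of separation, replacement, induction or recursion has to exhibit a formula.
    [Dfn] and the tactic [dfn] do this bookkeeping. Read over all good domains at once, [Dfn] also
    gives absoluteness, and this turns the classes to be reflected into Sigma_2 classes. Truth in
    the universe is not definable, so one embedding can respect only finitely many standard
    formulas, while mu must be chosen before the class is known. The class therefore enters through
    parameters: the code of its formula, evaluated in Sigma_n-correct levels. Likewise, elementarity
    for all formulas of the model, possibly of nonstandard length, comes from preserving one
    standard formula, the satisfaction relation. Since m > 0, the ordinal zeta of an exacting
    cardinal is Sigma_2-correct; this is exactly what moves the existence of a least counterexample
    into V_zeta. The converse produces a witness with m = 1. *)

Lemma pred_ext_eq (U : Type) (P Q : U -> Prop) : (forall x, P x <-> Q x) -> P = Q.
Proof. intros h. apply functional_extensionality. intros x. apply propositional_extensionality. apply h. Qed.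

(** * Formulas: renaming, relativization *)

#[local] Arguments Nat.max : simpl never.

(** A strict bound for all variables of the formula, quantified ones included, so that a variable
    not below it is never captured. *)
Fixpoint bnd (f : fml) : nat :=
  match f with
  | Mem x y | Eq x y => S (Nat.max x y)
  | Neg f => bnd f
  | And f g | Or f g | Imp f g => Nat.max (bnd f) (bnd g)
  | Ex x f | All x f => Nat.max (S x) (bnd f)
  end.

Lemma upd_same (U : Type) (e : nat -> U) x a : upd e x a x = a.
Proof. unfold upd. now rewrite Nat.eqb_refl. Qed.

Lemma upd_other (U : Type) (e : nat -> U) x a y : y <> x -> upd e x a y = e y.
Proof. intros h. unfold upd. apply Nat.eqb_neq in h. now rewrite h. Qed.

Lemma ex_iff (U : Type) (P Q : U -> Prop) : (forall x, P x <-> Q x) -> (exists x, P x) <-> exists x, Q x.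
Proof. intros h. split; intros [x hx]; exists x; now apply h. Qed.

Lemma all_iff (U : Type) (P Q : U -> Prop) : (forall x, P x <-> Q x) -> (forall x, P x) <-> forall x, Q x.
Proof. intros h. split; intros hx x; now apply h. Qed.

Lemma sat_ext (U : Type) (E : U -> U -> Prop) D f : forall e e',
  (forall i, i < bnd f -> e i = e' i) -> (sat E D e f <-> sat E D e' f).
Proof.
  induction f; cbn [bnd sat]; intros e e' h.
  1, 2: rewrite !h by lia; tauto.
  1: rewrite (IHf e e') by (intros; apply h; lia); tauto.
  1, 2, 3: rewrite (IHf1 e e'), (IHf2 e e') by (intros; apply h; lia); tauto.
  all: first [apply ex_iff | apply all_iff]; intros a; rewrite (IHf (upd e x a) (upd e' x a)); [tauto|];
    intros i hi; unfold upd; destruct (Nat.eqb i x); [reflexivity|apply h; lia].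
Qed.

Fixpoint maxr (r : nat -> nat) (n : nat) : nat :=
  match n with 0 => 0 | S k => Nat.max (S (r k)) (maxr r k) end.

Lemma maxr_lt r n k : k < n -> r k < maxr r n.
Proof.
  induction n as [|n IH]; simpl; intros h; [lia|].
  destruct (Nat.eq_dec k n) as [->|]; [lia|]. specialize (IH ltac:(lia)). lia.
Qed.

(** Each quantified variable is replaced by one beyond all values of [r] on the variables of the
    body, which makes renaming correct for an arbitrary, also non-injective, [r]. *)
Fixpoint ren (r : nat -> nat) (f : fml) : fml :=
  match f with
  | Mem x y => Mem (r x) (r y)
  | Eq x y => Eq (r x) (r y)
  | Neg f => Neg (ren r f)
  | And f g => And (ren r f) (ren r g)
  | Or f g => Or (ren r f) (ren r g)
  | Imp f g => Imp (ren r f) (ren r g)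
  | Ex x f => let y := maxr r (bnd f) in Ex y (ren (upd r x y) f)
  | All x f => let y := maxr r (bnd f) in All y (ren (upd r x y) f)
  end.

Lemma sat_ren (U : Type) (E : U -> U -> Prop) D f : forall r e,
  sat E D e (ren r f) <-> sat E D (fun i => e (r i)) f.
Proof.
  induction f; cbn [bnd sat ren]; intros r e; rewrite ?IHf, ?IHf1, ?IHf2; try tauto.
  all: first [apply ex_iff | apply all_iff]; intros a; rewrite IHf;
    rewrite (sat_ext E D (f := f) (e' := upd (fun i => e (r i)) x a)); [tauto|];
    intros i hi; unfold upd at 2 3; destruct (Nat.eqb i x); [now rewrite upd_same|];
    apply upd_other; pose proof (maxr_lt r hi); lia.
Qed.

Fixpoint rel (w : nat) (f : fml) : fml :=
  match f with
  | Mem x y => Mem x y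
  | Eq x y => Eq x y
  | Neg f => Neg (rel w f)
  | And f g => And (rel w f) (rel w g)
  | Or f g => Or (rel w f) (rel w g)
  | Imp f g => Imp (rel w f) (rel w g)
  | Ex x f => Ex x (And (Mem x w) (rel w f))
  | All x f => All x (Imp (Mem x w) (rel w f))
  end.

Lemma rel_Delta0 w f : bnd f <= w -> Delta0 (rel w f).
Proof. induction f; cbn [bnd rel]; intros h; constructor; try apply IHf; try apply IHf1; try apply IHf2; lia. Qed.

(** Since [bnd f <= w], no quantifier of [f] reassigns [w], and the bounding set stays the same
    throughout. *)
Lemma sat_rel (U : Type) (E : U -> U -> Prop) D w f : forall e, bnd f <= w ->
  (sat E D e (rel w f) <-> sat E (fun x => D x /\ E x (e w)) e f).
Proof.
  induction f; cbn [bnd rel sat]; intros e h; rewrite ?IHf, ?IHf1, ?IHf2 by lia; try tauto.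
  all: first [apply ex_iff | apply all_iff]; intros a; rewrite IHf by lia;
    rewrite upd_same, (upd_other e a (y := w)) by lia; tauto.
Qed.

Lemma Sigma_Pi_mono n f : (Sigma n f -> Sigma (S n) f) /\ (Pi n f -> Pi (S n) f).
Proof.
  revert f. induction n as [|n IH]; intros f; split; intros h.
  - inversion h; subst. now constructor.
  - inversion h; subst. now constructor.
  - remember (S n) as k. induction h; try discriminate; try (injection Heqk as ->).
    + now constructor.
    + apply Sigma_Pi. now apply IH.
    + apply Sigma_Ex. now apply IHh.
  - remember (S n) as k. induction h; try discriminate; try (injection Heqk as ->).
    + now constructor.
    + apply Pi_Sigma. now apply IH.
    + apply Pi_All. now apply IHh.
Qed.

Lemma Sigma_le n m f : n <= m -> Sigma n f -> Sigma m f.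
Proof. induction 1; intros h'; [assumption|]. apply Sigma_Pi_mono. auto. Qed.

(** * Elementary set operations *)

Section Basics.
Context {M : zfc_model}.
Implicit Types x y z a b c d p u v : M.

Lemma ext x y : (forall z, z ∈ x <-> z ∈ y) -> x = y.
Proof. apply zf_extensionality. Qed.

Lemma the_spec (P : M -> Prop) : (exists x, P x) -> P (the P).
Proof. intros h. unfold the. now apply epsilon_spec. Qed.

Lemma the_eq (P : M -> Prop) x : P x -> (forall y, P y -> y = x) -> the P = x.
Proof. intros h h'. apply h'. apply the_spec. eauto. Qed.

Lemma in_set_of (P : M -> Prop) : (exists x, forall z, z ∈ x <-> P z) -> forall z, z ∈ set_of P <-> P z.
Proof. intros h. exact (the_spec h). Qed.

Lemma set_of_eq (P : M -> Prop) x : (forall z, z ∈ x <-> P z) -> set_of P = x.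
Proof. intros h. apply ext. intros z. rewrite in_set_of by eauto. symmetry. apply h. Qed.

Lemma in_upair x y z : z ∈ upair x y <-> z = x \/ z = y.
Proof. unfold upair. rewrite in_set_of; [reflexivity|apply zf_pairing]. Qed.

Lemma in_singleton x z : z ∈ singleton x <-> z = x.
Proof. unfold singleton. rewrite in_set_of; [reflexivity|]. destruct (zf_pairing M x x) as [p hp]. exists p. intros w. rewrite hp. tauto. Qed.

Lemma in_empty z : ~ z ∈ empty.
Proof.
  assert (h : exists x : M, forall z, z ∈ x <-> False).
  { destruct (zf_infinity M) as (w & (o & _ & ho) & _). exists o. firstorder. }
  unfold empty. rewrite (in_set_of h). tauto.
Qed.

Lemma empty_eq x : (forall z, ~ z ∈ x) -> x = empty.
Proof. intros h. apply ext. intros z. pose proof (h z). pose proof (@in_empty z). tauto. Qed.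

Definition bigU x : M := set_of (fun z => exists y, y ∈ x /\ z ∈ y).
Definition pow x : M := set_of (fun y => subset y x).

Lemma in_bigU x z : z ∈ bigU x <-> exists y, y ∈ x /\ z ∈ y.
Proof. unfold bigU. rewrite in_set_of; [reflexivity|apply zf_union]. Qed.

Lemma in_pow x y : y ∈ pow x <-> subset y x.
Proof. unfold pow. rewrite in_set_of; [reflexivity|apply zf_powerset]. Qed.

Lemma in_union2 x y z : z ∈ union2 x y <-> z ∈ x \/ z ∈ y.
Proof.
  unfold union2. rewrite in_set_of; [reflexivity|]. exists (bigU (upair x y)). intros w. rewrite in_bigU. split.
  - intros (t & ht & hw). apply in_upair in ht as [-> | ->]; auto.
  - intros [h|h]; [exists x|exists y]; rewrite in_upair; auto.
Qed.

Lemma in_succ x z : z ∈ succ x <-> z ∈ x \/ z = x.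
Proof. unfold succ. now rewrite in_union2, in_singleton. Qed.

Lemma upair_inj x y x' y' : upair x y = upair x' y' -> (x = x' /\ y = y') \/ (x = y' /\ y = x').
Proof.
  intros h. assert (H : forall z, z = x \/ z = y <-> z = x' \/ z = y').
  { intros z. rewrite <- !in_upair. now rewrite h. }
  pose proof (proj1 (H x) (or_introl eq_refl)). pose proof (proj1 (H y) (or_intror eq_refl)).
  pose proof (proj2 (H x') (or_introl eq_refl)). pose proof (proj2 (H y') (or_intror eq_refl)).
  intuition (subst; auto).
Qed.

Lemma singleton_upair x : singleton x = upair x x.
Proof. apply ext. intros z. rewrite in_singleton, in_upair. tauto. Qed.

Lemma opair_inj x y x' y' : opair x y = opair x' y' -> x = x' /\ y = y'.
Proof.
  unfold opair. rewrite !singleton_upair. intros h.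
  apply upair_inj in h as [[h1 h2]|[h1 h2]]; apply upair_inj in h1; apply upair_inj in h2;
    intuition (subst; auto).
Qed.

Lemma opair_eq x y x' y' : opair x y = opair x' y' <-> x = x' /\ y = y'.
Proof. split; [apply opair_inj|]. now intros [-> ->]. Qed.

Lemma mem_irrefl x : ~ x ∈ x.
Proof.
  intros h. destruct (zf_foundation M (singleton x)) as (y & hy & hy').
  - exists x. now apply in_singleton.
  - apply in_singleton in hy as ->. apply (hy' x); [now apply in_singleton|exact h].
Qed.

Lemma mem_asym x y : x ∈ y -> ~ y ∈ x.
Proof.
  intros h h'. destruct (zf_foundation M (upair x y)) as (z & hz & hz').
  - exists x. apply in_upair. auto.
  - apply in_upair in hz as [-> | ->]; [apply (hz' y)|apply (hz' x)]; auto; apply in_upair; auto.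
Qed.

Lemma succ_inj x y : succ x = succ y -> x = y.
Proof.
  intros h. assert (h1 : x ∈ succ y) by (rewrite <- h; apply in_succ; auto).
  assert (h2 : y ∈ succ x) by (rewrite h; apply in_succ; auto).
  apply in_succ in h1 as [h1|h1]; [|exact h1]. apply in_succ in h2 as [h2|h2]; [|auto].
  destruct (mem_asym h1 h2).
Qed.

Lemma subset_refl x : subset x x.
Proof. intros z; auto. Qed.

Lemma subset_antisym x y : subset x y -> subset y x -> x = y.
Proof. intros h h'. apply ext. intros z. split; auto. Qed.

End Basics.

(** * Definable predicates *)

Section Definability.
Context {M : zfc_model}.

(** Closure conditions that hold in the universe and in every limit level above omega. Closure under
    subsets makes the power set, and with it the hierarchy of levels, absolute for such domains. *)
Record Good (D : M -> Prop) : Prop := {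
  good_trans : forall x y : M, x ∈ y -> D y -> D x;
  good_sub : forall x y : M, subset x y -> D y -> D x;
  good_upair : forall x y, D x -> D y -> D (upair x y);
  good_pow : forall x, D x -> D (pow x);
  good_bigU : forall x, D x -> D (bigU x);
  good_omega : D omega
}.

(* The domains in which a defining formula is evaluated, and the constants it
   may use.  Definability over [cW] feeds separation and replacement, [cA] is
   parameter-free definability absolute between all good domains. *)
Record ctx := Ctx {
  cdom : (M -> Prop) -> Prop;
  ccst : M -> Prop;
  cdom_good : forall D, cdom D -> Good D;
  ccst_dom : forall c D, ccst c -> cdom D -> D c
}.

Lemma Good_whole : Good (@whole M).
Proof. split; intros; exact I. Qed.

Definition cW : ctx.
Proof.
  refine (@Ctx (fun D => D = @whole M) (fun _ => True) _ _).
  - intros D ->. apply Good_whole.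
  - intros c D _ ->. exact I.
Defined.

(** Unlike [cW] it admits no parameters: a formula handed to an embedding must not mention sets that
    the embedding could move. *)
Definition cF : ctx.
Proof. refine (@Ctx (fun D => D = @whole M) (fun _ => False) _ _); [intros D ->; apply Good_whole|tauto]. Defined.

Definition cA : ctx.
Proof. refine (@Ctx Good (fun _ => False) _ _); tauto. Defined.

Definition cons (a : M) (e : nat -> M) : nat -> M := fun i => match i with 0 => a | S j => e j end.

Fixpoint app_env (l : list M) (e : nat -> M) : nat -> M :=
  match l with nil => e | a :: l => cons a (app_env l e) end.

Lemma app_env_lt l : forall e e' i, i < length l -> app_env l e i = app_env l e' i.
Proof. induction l; simpl; intros e e' i h; [lia|]. destruct i; simpl; [reflexivity|]. apply IHl. lia. Qed.

Lemma app_env_ge l : forall e i, app_env l e (length l + i) = e i.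
Proof. induction l; simpl; auto. Qed.

Lemma app_env_app l l' e : app_env (l ++ l') e = app_env l (app_env l' e).
Proof. induction l; simpl; congruence. Qed.

Definition dom (D : M -> Prop) (e : nat -> M) : Prop := forall i, D (e i).

Variable C : ctx.

(** The parameters take the first variables and the arguments follow them. One formula has to serve
    all domains of the context, while [P] itself speaks about the universe; over [cA] definability
    thus includes absoluteness. *)
Definition Dfn (P : (nat -> M) -> Prop) : Prop :=
  exists (f : fml) (l : list M), Forall (ccst C) l /\
  forall D, cdom C D -> forall e, dom D e -> (sat (@mem M) D (app_env l e) f <-> P e).

(** Besides a definable graph, closure of every domain under the term is demanded: a term is
    substituted into a predicate by quantifying over its value, which must exist in the domain. *)
Definition DfT (t : (nat -> M) -> M) : Prop :=
  (forall D e, cdom C D -> dom D e -> D (t e)) /\ Dfn (fun e => e 0 = t (fun i => e (S i))).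

Lemma Dfn_iff (P Q : (nat -> M) -> Prop) : Dfn P ->
  (forall D e, cdom C D -> dom D e -> (P e <-> Q e)) -> Dfn Q.
Proof.
  intros (f & l & hl & h) hPQ. exists f, l. split; [exact hl|]. intros D hD e he.
  rewrite (h D hD e he). eauto.
Qed.

Lemma Dfn_ext (P Q : (nat -> M) -> Prop) : Dfn P -> (forall e, P e <-> Q e) -> Dfn Q.
Proof. intros h h'. eapply Dfn_iff; eauto. Qed.

Lemma env_split (l : list M) i : i < length l \/ exists j, i = length l + j.
Proof. destruct (le_lt_dec (length l) i); [right; exists (i - length l); lia|auto]. Qed.

Lemma Dfn_ren (P : (nat -> M) -> Prop) (r : nat -> nat) : Dfn P -> Dfn (fun e => P (fun i => e (r i))).
Proof.
  intros (f & l & hl & h).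
  exists (ren (fun i => if i <? length l then i else length l + r (i - length l)) f), l.
  split; [exact hl|]. intros D hD e he. rewrite sat_ren.
  rewrite <- (h D hD (fun i => e (r i))) by (intros i; apply he).
  apply sat_ext. intros i _. destruct (env_split l i) as [hi|[j ->]].
  - rewrite (proj2 (Nat.ltb_lt _ _) hi). now apply app_env_lt.
  - rewrite (proj2 (Nat.ltb_ge _ _)) by lia. replace (length l + j - length l) with j by lia.
    now rewrite !app_env_ge.
Qed.

(** The two parameter lists are concatenated. The arguments of the first formula move past the
    second list, and all variables of the second formula move past the first list. *)
Lemma Dfn_merge (P Q R : (nat -> M) -> Prop) (op : fml -> fml -> fml) : Dfn P -> Dfn Q ->
  (forall D e f g e1 e2, cdom C D -> dom D e1 ->
     (sat (@mem M) D e f <-> P e1) -> (sat (@mem M) D e g <-> Q e2) -> e1 = e2 ->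
     (sat (@mem M) D e (op f g) <-> R e1)) -> Dfn R.
Proof.
  intros (f & l & hl & h) (g & l' & hl' & h') hop.
  exists (op (ren (fun i => if i <? length l then i else length l' + i) f) (ren (fun i => length l + i) g)), (l ++ l').
  split; [now apply Forall_app|]. intros D hD e he. eapply hop; eauto.
  - rewrite sat_ren, <- (h D hD e he). apply sat_ext. intros i _. rewrite app_env_app.
    destruct (env_split l i) as [hi|[j ->]].
    + rewrite (proj2 (Nat.ltb_lt _ _) hi). now apply app_env_lt.
    + rewrite (proj2 (Nat.ltb_ge _ _)) by lia. rewrite app_env_ge.
      replace (length l' + (length l + j)) with (length l + (length l' + j)) by lia. now rewrite !app_env_ge.
  - rewrite sat_ren, <- (h' D hD e he). apply sat_ext. intros i _. now rewrite app_env_app, app_env_ge.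
Qed.

Lemma Dfn_and P Q : Dfn P -> Dfn Q -> Dfn (fun e => P e /\ Q e).
Proof. intros h h'. apply (Dfn_merge (op := And) h h'). intros; subst; simpl; tauto. Qed.

Lemma Dfn_or P Q : Dfn P -> Dfn Q -> Dfn (fun e => P e \/ Q e).
Proof. intros h h'. apply (Dfn_merge (op := Or) h h'). intros; subst; simpl; tauto. Qed.

Lemma Dfn_imp (P Q : (nat -> M) -> Prop) : Dfn P -> Dfn Q -> Dfn (fun e => P e -> Q e).
Proof. intros h h'. apply (Dfn_merge (op := Imp) h h'). intros; subst; simpl; tauto. Qed.

Lemma Dfn_not P : Dfn P -> Dfn (fun e => ~ P e).
Proof.
  intros (f & l & hl & h). exists (Neg f), l. split; [exact hl|]. intros D hD e he.
  simpl. rewrite (h D hD e he). tauto.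
Qed.

Lemma Dfn_iff2 P Q : Dfn P -> Dfn Q -> Dfn (fun e => P e <-> Q e).
Proof. intros h h'. apply Dfn_and; now apply Dfn_imp. Qed.

(** The second hypothesis places every witness found in the universe inside the domain, so that an
    unbounded quantifier means the same in all domains of the context. *)
Lemma Dfn_ex (Q : (nat -> M) -> M -> Prop) :
  Dfn (fun e => Q (fun i => e (S i)) (e 0)) ->
  (forall D e a, cdom C D -> dom D e -> Q e a -> D a) -> Dfn (fun e => exists a, Q e a).
Proof.
  intros (f & l & hl & h) hb. set (y := length l + bnd f).
  exists (Ex y (ren (fun i => if i <? length l then i else if i =? length l then y else i - 1) f)), l.
  split; [exact hl|]. intros D hD e he. simpl.
  assert (H : forall a, D a -> sat (@mem M) D (upd (app_env l e) y a)
      (ren (fun i => if i <? length l then i else if i =? length l then y else i - 1) f) <-> Q e a).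
  { intros a ha. rewrite sat_ren. rewrite <- (h D hD (cons a e)).
    - apply sat_ext. intros i hi. destruct (env_split l i) as [hin|[j ->]].
      + rewrite (proj2 (Nat.ltb_lt _ _) hin). rewrite upd_other by (unfold y; lia). now apply app_env_lt.
      + rewrite (proj2 (Nat.ltb_ge _ _)) by lia. rewrite app_env_ge.
        destruct j as [|j]; simpl.
        * rewrite (proj2 (Nat.eqb_eq _ _)) by lia. apply upd_same.
        * rewrite (proj2 (Nat.eqb_neq _ _)) by lia.
          rewrite upd_other by (unfold y; lia).
          replace (length l + S j - 1) with (length l + j) by lia. apply app_env_ge.
    - intros [|i]; simpl; auto. }
  split.
  - intros (a & ha & hs). exists a. now apply H.
  - intros (a & ha). assert (D a) by (apply (hb D e); assumption). exists a. split; [assumption|]. now apply H.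
Qed.

Lemma Dfn_all (Q : (nat -> M) -> M -> Prop) :
  Dfn (fun e => Q (fun i => e (S i)) (e 0)) ->
  (forall D e a, cdom C D -> dom D e -> ~ Q e a -> D a) -> Dfn (fun e => forall a, Q e a).
Proof.
  intros h hb. eapply Dfn_ext.
  - apply Dfn_not. apply (Dfn_ex (Q := fun e a => ~ Q e a)); [now apply Dfn_not|exact hb].
  - intros e. split; [|intros h1 [a h2]; auto]. intros h1 a. apply NNPP. eauto.
Qed.

Lemma Dfn_const_mem : Dfn (fun e => e 0 ∈ e 1).
Proof. exists (Mem 0 1), nil. split; [constructor|]. simpl. tauto. Qed.

Lemma DfT_var k : DfT (fun e => e k).
Proof.
  split; [intros D e _ h; apply h|]. exists (Eq 0 (S k)), nil. split; [constructor|]. simpl. tauto.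
Qed.

Lemma DfT_const c : ccst C c -> DfT (fun _ => c).
Proof.
  intros hc. split; [intros; eapply ccst_dom; eassumption|]. exists (Eq 0 1), (c :: nil).
  split; [auto|]. simpl. intuition.
Qed.

Lemma DfT_ren t (r : nat -> nat) : DfT t -> DfT (fun e => t (fun i => e (r i))).
Proof.
  intros [h h']. split; [intros D e hD he; apply (h D); [exact hD|intros i; apply he]|].
  eapply Dfn_ext; [apply (Dfn_ren (fun i => match i with 0 => 0 | S j => S (r j) end) h')|].
  intros e. simpl. tauto.
Qed.

Lemma Dfn_subst (Q : (nat -> M) -> M -> Prop) t :
  Dfn (fun e => Q (fun i => e (S i)) (e 0)) -> DfT t -> Dfn (fun e => Q e (t e)).
Proof.
  intros h [ht ht']. eapply Dfn_ext.
  - apply (Dfn_ex (Q := fun e a => a = t e /\ Q e a)).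
    + now apply Dfn_and.
    + intros D e a hD he [-> _]. now apply (ht D).
  - intros e. simpl. split; [now intros (a & -> & h')|eauto].
Qed.

Lemma Dfn_mem t u : DfT t -> DfT u -> Dfn (fun e => t e ∈ u e).
Proof.
  intros ht hu. apply (@Dfn_subst (fun e a => a ∈ u e)); [|exact ht].
  apply (@Dfn_subst (fun e b => e 0 ∈ b) (fun e => u (fun i => e (S i)))).
  - apply (Dfn_ren (fun i => match i with 0 => 1 | _ => 0 end) Dfn_const_mem).
  - now apply DfT_ren.
Qed.

Lemma Dfn_eq t u : DfT t -> DfT u -> Dfn (fun e => t e = u e).
Proof. intros ht hu. apply (@Dfn_subst (fun e a => a = u e)); [|exact ht]. apply hu. Qed.

Lemma Dfn_app1 (P : M -> Prop) t : Dfn (fun e => P (e 0)) -> DfT t -> Dfn (fun e => P (t e)).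
Proof.
  intros h ht. apply (Dfn_subst (Q := fun _ => P)); [|exact ht]. exact h.
Qed.

Lemma Dfn_app2 (P : M -> M -> Prop) t u : Dfn (fun e => P (e 0) (e 1)) -> DfT t -> DfT u -> Dfn (fun e => P (t e) (u e)).
Proof.
  intros h ht hu. apply (Dfn_subst (Q := fun e a => P a (u e))); [|exact ht].
  apply (Dfn_subst (Q := fun e a => P (e 0) a) (t := fun e => u (fun i => e (S i)))); [|now apply DfT_ren].
  apply (Dfn_ren (fun i => match i with 0 => 1 | _ => 0 end) h).
Qed.

Lemma Dfn_app3 (P : M -> M -> M -> Prop) t u v : Dfn (fun e => P (e 0) (e 1) (e 2)) ->
  DfT t -> DfT u -> DfT v -> Dfn (fun e => P (t e) (u e) (v e)).
Proof.
  intros h ht hu hv. apply (Dfn_subst (Q := fun e a => P a (u e) (v e))); [|exact ht].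
  apply (Dfn_subst (Q := fun e a => P (e 0) a (v (fun i => e (S i)))) (t := fun e => u (fun i => e (S i)))); [|now apply DfT_ren].
  apply (Dfn_subst (Q := fun e a => P (e 1) (e 0) a) (t := fun e => v (fun i => e (S (S i)))));
    [|now apply (DfT_ren (fun i => S (S i)))].
  apply (Dfn_ren (fun i => match i with 0 => 2 | 1 => 1 | _ => 0 end) h).
Qed.

Lemma Dfn_bex t (Q : (nat -> M) -> M -> Prop) : DfT t ->
  Dfn (fun e => Q (fun i => e (S i)) (e 0)) -> Dfn (fun e => exists a, a ∈ t e /\ Q e a).
Proof.
  intros ht hQ. apply (Dfn_ex (Q := fun e a => a ∈ t e /\ Q e a)).
  - apply Dfn_and; [|exact hQ]. apply Dfn_mem; [apply DfT_var|now apply DfT_ren].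
  - intros D e a hD he [h _]. apply (good_trans (cdom_good hD) h). now apply (proj1 ht).
Qed.

Lemma Dfn_ball t (Q : (nat -> M) -> M -> Prop) : DfT t ->
  Dfn (fun e => Q (fun i => e (S i)) (e 0)) -> Dfn (fun e => forall a, a ∈ t e -> Q e a).
Proof.
  intros ht hQ. apply (Dfn_all (Q := fun e a => a ∈ t e -> Q e a)).
  - apply Dfn_imp; [|exact hQ]. apply Dfn_mem; [apply DfT_var|now apply DfT_ren].
  - intros D e a hD he h. apply (good_trans (cdom_good hD) (y := t e)); [tauto|]. now apply (proj1 ht).
Qed.

Lemma Dfn_true : Dfn (fun _ => True).
Proof. exists (Eq 0 0), nil. split; [constructor|]. simpl. tauto. Qed.

Lemma DfT_upair t u : DfT t -> DfT u -> DfT (fun e => upair (t e) (u e)).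
Proof.
  intros ht hu. assert (hD : forall D e, cdom C D -> dom D e -> D (upair (t e) (u e))).
  { intros D e hD he. apply (good_upair (cdom_good hD)); [now apply (proj1 ht)|now apply (proj1 hu)]. }
  split; [exact hD|]. eapply Dfn_iff.
  - apply (Dfn_all (Q := fun e z => z ∈ e 0 <-> z = t (fun i => e (S i)) \/ z = u (fun i => e (S i)))).
    + apply Dfn_iff2; [apply Dfn_mem; apply DfT_var|].
      apply Dfn_or; apply Dfn_eq; try apply DfT_var; now apply (@DfT_ren _ (fun i => S (S i))).
    + intros D e z hD' he hz. destruct (classic (z ∈ e 0)) as [h0|h0].
      * apply (good_trans (cdom_good hD') h0). apply he.
      * assert (hz' : z = t (fun i => e (S i)) \/ z = u (fun i => e (S i))) by tauto.
        destruct hz' as [-> | ->]; [apply (proj1 ht D)|apply (proj1 hu D)]; try exact hD'; intros i; apply he.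
  - intros D e _ _. split; [|intros ->; intros z; apply in_upair]. intros h. apply ext. intros z.
    now rewrite h, in_upair.
Qed.

Lemma DfT_bigU t : DfT t -> DfT (fun e => bigU (t e)).
Proof.
  intros ht. assert (hD : forall D e, cdom C D -> dom D e -> D (bigU (t e))).
  { intros D e hD he. apply (good_bigU (cdom_good hD)). now apply (proj1 ht). }
  split; [exact hD|]. eapply Dfn_iff.
  - apply (Dfn_all (Q := fun e z => z ∈ e 0 <-> exists y, y ∈ t (fun i => e (S i)) /\ z ∈ y)).
    + apply Dfn_iff2; [apply Dfn_mem; apply DfT_var|].
      apply (Dfn_bex (t := fun e => t (fun i => e (S (S i)))) (Q := fun e y => e 0 ∈ y)).
      * now apply (@DfT_ren _ (fun i => S (S i))).
      * apply Dfn_mem; apply DfT_var.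
    + intros D e z hD' he hz. destruct (classic (z ∈ e 0)) as [h0|h0].
      * apply (good_trans (cdom_good hD') h0). apply he.
      * assert (hz' : z ∈ bigU (t (fun i => e (S i)))) by (rewrite in_bigU; tauto).
        apply (good_trans (cdom_good hD') hz'). apply hD; [exact hD'|]. intros i; apply he.
  - intros D e _ _. split; [|intros ->; intros z; apply in_bigU]. intros h. apply ext. intros z.
    now rewrite h, in_bigU.
Qed.

Lemma Dfn_subset t u : DfT t -> DfT u -> Dfn (fun e => subset (t e) (u e)).
Proof.
  intros ht hu. apply (Dfn_ball (Q := fun e z => z ∈ u e) ht). apply Dfn_mem; [apply DfT_var|now apply DfT_ren].
Qed.

Lemma DfT_pow t : DfT t -> DfT (fun e => pow (t e)).
Proof.
  intros ht. assert (hD : forall D e, cdom C D -> dom D e -> D (pow (t e))).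
  { intros D e hD he. apply (good_pow (cdom_good hD)). now apply (proj1 ht). }
  split; [exact hD|]. eapply Dfn_iff.
  - apply (Dfn_all (Q := fun e z => z ∈ e 0 <-> subset z (t (fun i => e (S i))))).
    + apply Dfn_iff2; [apply Dfn_mem; apply DfT_var|].
      apply Dfn_subset; [apply DfT_var|]. now apply (@DfT_ren _ (fun i => S (S i))).
    + intros D e z hD' he hz. destruct (classic (z ∈ e 0)) as [h0|h0].
      * apply (good_trans (cdom_good hD') h0). apply he.
      * assert (hz' : z ∈ pow (t (fun i => e (S i)))) by (rewrite in_pow; tauto).
        apply (good_trans (cdom_good hD') hz'). apply hD; [exact hD'|]. intros i; apply he.
  - intros D e _ _. split; [|intros ->; intros z; apply in_pow]. intros h. apply ext. intros z.
    now rewrite h, in_pow.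
Qed.

Lemma singleton_dfn t : DfT t -> DfT (fun e => singleton (t e)).
Proof.
  intros h. replace (fun e => singleton (t e)) with (fun e => upair (t e) (t e)); [now apply DfT_upair|].
  apply functional_extensionality. intros e. now rewrite singleton_upair.
Qed.

Lemma union2_bigU (x y : M) : union2 x y = bigU (upair x y).
Proof.
  apply ext. intros z. rewrite in_union2, in_bigU. split.
  - intros [h|h]; [exists x|exists y]; rewrite in_upair; auto.
  - intros (w & hw & h). apply in_upair in hw as [-> | ->]; auto.
Qed.

Lemma DfT_union2 t u : DfT t -> DfT u -> DfT (fun e => union2 (t e) (u e)).
Proof.
  intros h h'. replace (fun e => union2 (t e) (u e)) with (fun e => bigU (upair (t e) (u e))).
  - now apply DfT_bigU, DfT_upair.
  - apply functional_extensionality. intros e. now rewrite union2_bigU.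
Qed.

Lemma DfT_opair t u : DfT t -> DfT u -> DfT (fun e => opair (t e) (u e)).
Proof. intros h h'. apply DfT_upair; [now apply singleton_dfn|now apply DfT_upair]. Qed.

Lemma DfT_triple t u v : DfT t -> DfT u -> DfT v -> DfT (fun e => triple (t e) (u e) (v e)).
Proof. intros. now apply DfT_opair; [|apply DfT_opair]. Qed.

Lemma DfT_succ t : DfT t -> DfT (fun e => succ (t e)).
Proof. intros h. apply DfT_union2; [exact h|now apply singleton_dfn]. Qed.

Lemma DfT_empty : DfT (fun _ => empty).
Proof.
  assert (hD : forall D, cdom C D -> D empty).
  { intros D hD. apply (good_sub (cdom_good hD) (y := omega)); [|apply (good_omega (cdom_good hD))].
    intros z hz. destruct (in_empty hz). }
  split; [intros D e h _; exact (hD D h)|]. eapply Dfn_ext.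
  - apply (Dfn_ball (t := fun e => e 0) (Q := fun e z => ~ True)); [apply DfT_var|]. apply Dfn_not, Dfn_true.
  - intros e. simpl. split; [|intros ->; intros z hz; destruct (in_empty hz)].
    intros h. apply empty_eq. intros z hz. now apply (h z).
Qed.

Lemma DfT_num i : DfT (fun _ => num i).
Proof. induction i; simpl; [apply DfT_empty|now apply DfT_succ]. Qed.

End Definability.

Arguments cW {M}.
Arguments cF {M}.
Arguments cA {M}.

(* In a context all of whose domains are the whole universe, the boundedness
   conditions on quantifiers are void. *)
Class whole_ctx {M : zfc_model} (C : ctx (M := M)) : Prop := whole_ctx_dom : forall D a, cdom C D -> D a.
#[export] Instance whole_cW (M : zfc_model) : whole_ctx (@cW M).
Proof. intros D a h. simpl in h. now subst. Qed.
#[export] Instance whole_cF (M : zfc_model) : whole_ctx (@cF M).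
Proof. intros D a h. simpl in h. now subst. Qed.

(** Over the whole universe closure is automatic, and by extensionality it is enough to define
    membership in the value. *)
Lemma DfT_whole (M : zfc_model) (C : ctx (M := M)) {hC : whole_ctx C} t :
  Dfn C (fun e => e 0 ∈ t (fun i => e (S i))) -> DfT C t.
Proof.
  intros h. split; [intros D e hD _; exact (@whole_ctx_dom _ C _ D _ hD)|]. eapply Dfn_iff.
  - apply (Dfn_all (Q := fun e z => z ∈ e 0 <-> z ∈ t (fun i => e (S i)))).
    + apply Dfn_iff2; [apply Dfn_mem; apply DfT_var|].
      apply (Dfn_ren (fun i => match i with 0 => 0 | S j => S (S j) end) h).
    + intros D e z hD _ _. exact (@whole_ctx_dom _ C _ D _ hD).
  - intros D e _ _. split; [apply ext|]. intros ->. tauto.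
Qed.

(** A hook that is redefined whenever further notions have been shown definable. *)
Ltac dfn_ext := fail.
Ltac dfn_side := intros; cbv beta in *;
  first [ assumption | exact I | match goal with h : cdom ?C ?D |- ?D _ => exact (@whole_ctx_dom _ C _ D _ h) end | idtac ].

(** Follows the syntax of the goal. Bounded quantifiers are tried before unbounded ones, because the
    latter leave a side condition on where the witnesses lie. *)
Ltac dfn_step := cbv beta;
  lazymatch goal with
  | |- Dfn _ (fun e => @?P e /\ @?Q e) => apply Dfn_and
  | |- Dfn _ (fun e => @?P e \/ @?Q e) => apply Dfn_or
  | |- Dfn _ (fun e => @?P e <-> @?Q e) => apply Dfn_iff2
  | |- Dfn _ (fun e => ~ @?P e) => apply Dfn_not
  | |- Dfn _ (fun e => @?t e ∈ @?u e) => apply Dfn_mem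
  | |- Dfn _ (fun e => @eq (carrier _) (@?t e) (@?u e)) => apply Dfn_eq
  | |- Dfn _ (fun _ => True) => apply Dfn_true
  | |- Dfn ?C (fun e => exists a, a ∈ @?t e /\ @?Q e a) => apply (Dfn_bex (C := C) (t := t) (Q := Q))
  | |- Dfn ?C (fun e => forall a, a ∈ @?t e -> @?Q e a) => apply (Dfn_ball (C := C) (t := t) (Q := Q))
  | |- Dfn ?C (fun e => exists a, @?Q e a) => apply (Dfn_ex (C := C) (Q := Q)); [|dfn_side]
  | |- Dfn _ (fun e => @?P e -> @?Q e) => apply Dfn_imp
  | |- Dfn ?C (fun e => forall a, @?Q e a) => apply (Dfn_all (C := C) (Q := Q)); [|dfn_side]
  | |- DfT _ (fun e => e ?k) => apply DfT_var
  | |- DfT _ (fun e => opair (@?t e) (@?u e)) => apply DfT_opair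
  | |- DfT _ (fun e => triple (@?t e) (@?u e) (@?v e)) => apply DfT_triple
  | |- DfT _ (fun e => singleton (@?t e)) => apply singleton_dfn
  | |- DfT _ (fun e => upair (@?t e) (@?u e)) => apply DfT_upair
  | |- DfT _ (fun e => union2 (@?t e) (@?u e)) => apply DfT_union2
  | |- DfT _ (fun e => succ (@?t e)) => apply DfT_succ
  | |- DfT _ (fun e => bigU (@?t e)) => apply DfT_bigU
  | |- DfT _ (fun e => pow (@?t e)) => apply DfT_pow
  | |- DfT _ (fun e => num ?k) => apply DfT_num
  | |- DfT _ (fun e => empty) => apply DfT_empty
  | |- DfT _ (fun e => ?t (fun i => e (@?r i))) => apply (DfT_ren (t := t) r); assumption
  | |- Dfn _ (fun e => ?t (fun i => e (@?r i))) => apply (Dfn_ren (P := t) r); assumption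
  | |- Dfn _ (fun e => subset (@?t e) (@?u e)) => apply Dfn_subset
  | |- whole_ctx _ => typeclasses eauto
  | h : Dfn ?C (fun e => ?P (e 0)) |- Dfn ?C (fun e => ?P (@?t e)) => apply (Dfn_app1 (P := P) h)
  | h : Dfn ?C (fun e => ?P (e 0) (e 1)) |- Dfn ?C (fun e => ?P (@?t e) (@?u e)) => apply (Dfn_app2 (P := P) h)
  | h : Dfn ?C (fun e => ?P (e 0) (e 1) (e 2)) |- Dfn ?C (fun e => ?P (@?t e) (@?u e) (@?v e)) =>
      apply (Dfn_app3 (P := P) h)
  | h : ?A |- ?A => exact h
  | |- DfT _ (fun e => ?t e) => first [ is_var t; match goal with h : DfT _ t |- _ => exact h end | dfn_ext ]
  | |- DfT _ (fun _ => ?c) => first [ dfn_ext | apply DfT_const; exact I ]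
  | |- _ => dfn_ext
  end.
Ltac dfn := repeat dfn_step.

(** * Separation, replacement, functions *)

Section Sets1.
Context {M : zfc_model}.
Implicit Types x y z a b c d f g p u v w t : M.

(** The axiom scheme tests variable 0, whereas the argument of [P] is the variable right after the
    parameters; the renaming sends it to 0 and shifts all others up by one. *)
Lemma sep (P : M -> Prop) a : Dfn cW (fun e => P (e 0)) -> exists b, forall z, z ∈ b <-> z ∈ a /\ P z.
Proof.
  intros (f & l & _ & h). set (n := length l).
  destruct (@zf_separation M (ren (fun i => if i =? n then 0 else S i) f) (fun i => app_env l (fun _ => a) (i - 1)) a)
    as [b hb].
  exists b. intros z. rewrite hb, sat_ren.
  rewrite <- (h (@whole M) eq_refl (cons z (fun _ => a))) by (intros i; exact I).
  apply and_iff_compat_l, sat_ext. intros i _. destruct (Nat.eqb_spec i n) as [->|hn].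
  - rewrite upd_same. unfold n. replace (length l) with (length l + 0) by lia. now rewrite app_env_ge.
  - rewrite upd_other by discriminate. replace (S i - 1) with i by lia.
    destruct (env_split l i) as [hi|[j ->]]; [now apply app_env_lt|].
    rewrite !app_env_ge. destruct j; [unfold n in hn; lia|reflexivity].
Qed.

Lemma repl (R : M -> M -> Prop) a : Dfn cW (fun e => R (e 0) (e 1)) ->
  (forall x, x ∈ a -> exists! y, R x y) -> exists b, forall y, y ∈ b <-> exists x, x ∈ a /\ R x y.
Proof.
  intros (f & l & _ & h) hR. set (n := length l).
  set (f' := ren (fun i => if i =? n then 0 else if i =? S n then 1 else S (S i)) f).
  set (e0 := fun i => app_env l (fun _ => a) (i - 2)).
  assert (H : forall x y, sat (@mem M) (@whole M) (upd (upd e0 0 x) 1 y) f' <-> R x y).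
  { intros x y. unfold f'. rewrite sat_ren.
    rewrite <- (h (@whole M) eq_refl (cons x (cons y (fun _ => a)))) by (intros i; exact I).
    apply sat_ext. intros i _. destruct (Nat.eqb_spec i n) as [->|hn].
    - rewrite upd_other, upd_same by discriminate. unfold n.
      replace (length l) with (length l + 0) by lia. now rewrite app_env_ge.
    - destruct (Nat.eqb_spec i (S n)) as [->|hn'].
      + rewrite upd_same. unfold n. replace (S (length l)) with (length l + 1) by lia. now rewrite app_env_ge.
      + rewrite !upd_other by discriminate. unfold e0. replace (S (S i) - 2) with i by lia.
        destruct (env_split l i) as [hi|[j ->]]; [now apply app_env_lt|].
        rewrite !app_env_ge. destruct j as [|[|j]]; [unfold n in *; lia|unfold n in *; lia|reflexivity]. }
  destruct (@zf_replacement M f' e0 a) as [b hb].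
  - intros x hx. destruct (hR x hx) as (y & hy & hy'). exists y. split; [now apply H|].
    intros y' h'. apply hy'. now apply H.
  - exists b. intros y. rewrite hb. split; intros (x & hx & hxy); exists x; split; auto; now apply H.
Qed.

Lemma fun_of (R : M -> M -> Prop) a : Dfn cW (fun e => R (e 0) (e 1)) ->
  (forall x, x ∈ a -> exists! y, R x y) ->
  exists f, forall p, p ∈ f <-> exists x y, x ∈ a /\ R x y /\ p = opair x y.
Proof.
  intros hd h. destruct (@repl (fun x p => exists y, R x y /\ p = opair x y) a) as [f hf].
  - dfn.
  - intros x hx. destruct (h x hx) as (y & hy & hy'). exists (opair x y). split; [eauto|].
    intros p (y' & h' & ->). now rewrite (hy' y' h').
  - exists f. intros p. rewrite hf. split.
    + intros (x & hx & y & hy & ->). eauto 6.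
    + intros (x & y & hx & hy & ->). eauto.
Qed.

Lemma func_ap f a b x : func f a b -> x ∈ a -> opair x (app f x) ∈ f.
Proof.
  intros [_ h] hx. destruct (h x hx) as (y & hy & _). unfold app.
  apply (the_spec (P := fun y => opair x y ∈ f)). eauto.
Qed.

Lemma func_dom f a b x y : func f a b -> opair x y ∈ f -> x ∈ a /\ y ∈ b.
Proof. intros [h _] hp. destruct (h _ hp) as (x' & y' & hx & hy & e). apply opair_inj in e as [-> ->]. auto. Qed.

Lemma func_fun f a b x y z : func f a b -> opair x y ∈ f -> opair x z ∈ f -> y = z.
Proof.
  intros hf h h'. destruct (func_dom hf h) as [hx _]. destruct hf as [_ hf].
  destruct (hf x hx) as (y' & _ & u). now rewrite <- (u y h), <- (u z h').
Qed.

Lemma func_app f a b x y : func f a b -> opair x y ∈ f -> app f x = y.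
Proof.
  intros hf h. destruct (func_dom hf h) as [hx _]. apply (func_fun hf (func_ap hf hx) h).
Qed.

Lemma func_in f a b x : func f a b -> x ∈ a -> app f x ∈ b.
Proof. intros hf hx. apply (func_dom hf (func_ap hf hx)). Qed.

Lemma func_ex f a b x : func f a b -> x ∈ a -> exists y, y ∈ b /\ opair x y ∈ f.
Proof. intros hf hx. exists (app f x). split; [now apply (func_in hf)|now apply (func_ap hf)]. Qed.

Lemma func_intro f a b : (forall p, p ∈ f -> exists x y, x ∈ a /\ y ∈ b /\ p = opair x y) ->
  (forall x, x ∈ a -> exists y, opair x y ∈ f) ->
  (forall x y z, opair x y ∈ f -> opair x z ∈ f -> y = z) -> func f a b.
Proof. intros h1 h2 h3. split; [exact h1|]. intros x hx. destruct (h2 x hx) as [y hy]. exists y. split; eauto. Qed.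

Lemma func_ext f g a b b' : func f a b -> func g a b' -> (forall x y, opair x y ∈ f -> opair x y ∈ g) -> f = g.
Proof.
  intros hf hg h. apply ext. intros p. split; intros hp.
  - destruct (proj1 hf p hp) as (x & y & _ & _ & ->). auto.
  - destruct (proj1 hg p hp) as (x & y & hx & _ & ->). destruct (func_ex hf hx) as (z & _ & hz).
    now rewrite (func_fun hg hp (h _ _ hz)).
Qed.

Lemma func_cod f a b b' : func f a b -> (forall x y, opair x y ∈ f -> y ∈ b') -> func f a b'.
Proof.
  intros hf h. split; [|apply hf]. intros p hp. destruct (proj1 hf p hp) as (x & y & hx & _ & ->). eauto 7.
Qed.

Lemma fun_of_func (R : M -> M -> Prop) a b : Dfn cW (fun e => R (e 0) (e 1)) ->
  (forall x, x ∈ a -> exists! y, R x y) -> (forall x y, x ∈ a -> R x y -> y ∈ b) ->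
  exists f, func f a b /\ forall x y, opair x y ∈ f <-> x ∈ a /\ R x y.
Proof.
  intros hd h hb. destruct (fun_of hd h) as [f hf]. exists f.
  assert (H : forall x y, opair x y ∈ f <-> x ∈ a /\ R x y).
  { intros x y. rewrite hf. split; [|intros []; eauto 6].
    intros (x' & y' & hx & hR & e). apply opair_inj in e as [-> ->]. auto. }
  split; [|exact H]. apply func_intro.
  - intros p hp. apply hf in hp as (x & y & hx & hy & ->). eauto 7.
  - intros x hx. destruct (h x hx) as (y & hy & _). exists y. apply H. auto.
  - intros x y z h1 h2. apply H in h1 as [hx h1]. apply H in h2 as [_ h2].
    destruct (h x hx) as (w & _ & u). now rewrite <- (u y h1), <- (u z h2).
Qed.

(** All quantifiers are bounded by [f], [a] and [b] in this form, which is what makes functionality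
    absolute. *)
Lemma func_iff f a b : func f a b <->
  (forall p, p ∈ f -> exists x, x ∈ a /\ exists y, y ∈ b /\ p = opair x y) /\
  (forall x, x ∈ a -> exists y, y ∈ b /\ (opair x y ∈ f /\ forall z, z ∈ b -> opair x z ∈ f -> y = z)).
Proof.
  split.
  - intros hf. split.
    + intros p hp. destruct (proj1 hf p hp) as (x & y & hx & hy & ->). eauto 7.
    + intros x hx. destruct (func_ex hf hx) as (y & hy & h). exists y. repeat split; auto.
      intros z _ hz. apply (func_fun hf h hz).
  - intros [h1 h2]. assert (h : forall x y, opair x y ∈ f -> x ∈ a /\ y ∈ b).
    { intros x y hp. destruct (h1 _ hp) as (x' & hx & y' & hy & e). apply opair_inj in e as [-> ->]. auto. }
    apply func_intro.
    + intros p hp. destruct (h1 p hp) as (x & hx & y & hy & ->). eauto 7.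
    + intros x hx. destruct (h2 x hx) as (y & _ & hy & _). eauto.
    + intros x y z hy hz. destruct (h2 x (proj1 (h _ _ hy))) as (w & _ & _ & u).
      rewrite <- (u y), <- (u z); auto; [apply (h x z hz)|apply (h x y hy)].
Qed.

Lemma opair_in_pow a b x y : x ∈ a -> y ∈ b -> opair x y ∈ pow (pow (union2 a b)).
Proof.
  intros hx hy. apply in_pow. intros z hz. apply in_pow. intros w hw.
  apply in_union2. apply in_upair in hz as [-> | ->]; [apply in_singleton in hw as ->|apply in_upair in hw as [-> | ->]]; auto.
Qed.

Lemma func_in_pow f a b : func f a b -> f ∈ pow (pow (pow (union2 a b))).
Proof.
  intros hf. apply in_pow. intros p hp. destruct (proj1 hf p hp) as (x & y & hx & hy & ->). now apply opair_in_pow.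
Qed.

Lemma opair_mem2 x y f : opair x y ∈ f -> x ∈ bigU (bigU f) /\ y ∈ bigU (bigU f).
Proof.
  intros h. split; apply in_bigU; exists (upair x y); rewrite in_bigU, in_upair; split; auto;
    exists (opair x y); split; auto; apply in_upair; auto.
Qed.

Lemma Good_union2 D x y : Good D -> D x -> D y -> D (union2 x y).
Proof. intros h hx hy. rewrite union2_bigU. now apply (good_bigU h), (good_upair h). Qed.

Lemma Good_opair D x y : Good D -> D x -> D y -> D (opair x y).
Proof. intros h hx hy. unfold opair. rewrite singleton_upair. now repeat apply (good_upair h). Qed.

Lemma Good_succ D x : Good D -> D x -> D (succ x).
Proof. intros h hx. apply (Good_union2 h hx). rewrite singleton_upair. now apply (good_upair h). Qed.

Lemma Good_func D f a b : Good D -> D a -> D b -> func f a b -> D f.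
Proof.
  intros h ha hb hf. apply (good_trans h (func_in_pow hf)). repeat apply (good_pow h). now apply Good_union2.
Qed.

Lemma Good_opair_inv D x y f : Good D -> D f -> opair x y ∈ f -> D x /\ D y.
Proof.
  intros h hf hp. apply opair_mem2 in hp as [h1 h2].
  assert (D (bigU (bigU f))) by now repeat apply (good_bigU h).
  split; [apply (good_trans h h1)|apply (good_trans h h2)]; assumption.
Qed.

Lemma Dfn_func C (f a b : (nat -> M) -> M) : DfT C f -> DfT C a -> DfT C b -> Dfn C (fun e => func (f e) (a e) (b e)).
Proof. intros. eapply Dfn_ext; [|intros e; symmetry; apply func_iff]. dfn. Qed.

Lemma Dfn_transitive C (a : (nat -> M) -> M) : DfT C a -> Dfn C (fun e => transitive (a e)).
Proof. intros. unfold transitive. dfn. Qed.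

End Sets1.

Lemma Dfn_ordinal (M : zfc_model) C (a : (nat -> M) -> M) : DfT C a -> Dfn C (fun e => ordinal (a e)).
Proof. intros. unfold ordinal. dfn; apply Dfn_transitive; dfn. Qed.

Ltac dfn_ext ::= lazymatch goal with
  | |- Dfn _ (fun e => func (@?a e) (@?b e) (@?c e)) => apply Dfn_func
  | |- Dfn _ (fun e => transitive (@?a e)) => apply Dfn_transitive
  | |- Dfn _ (fun e => ordinal (@?a e)) => apply Dfn_ordinal
  end.

(** * The natural numbers, transitive closure, induction on membership *)

Section Omega.
Context {M : zfc_model}.
Implicit Types x y z a b c d f g h p u v w t k n : M.

Lemma Dfn_inductive C (a : (nat -> M) -> M) : DfT (M := M) C a -> Dfn C (fun e => inductive_set (a e)).
Proof. intros. unfold inductive_set. dfn. Qed.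

Lemma in_omega k : k ∈ omega <-> forall w, inductive_set w -> k ∈ w.
Proof.
  unfold omega. rewrite in_set_of; [reflexivity|].
  assert (hw : exists w : M, inductive_set w).
  { destruct (zf_infinity M) as (w & (o & ho & ho') & hs). exists w. split.
    - now rewrite <- (empty_eq ho').
    - intros x hx. destruct (hs x hx) as (s & hs1 & hs2).
      replace (succ x) with s; [exact hs1|]. apply ext. intros z. now rewrite hs2, in_succ. }
  destruct hw as [w hw].
  destruct (@sep M (fun k => forall w, inductive_set w -> k ∈ w) w) as [b hb].
  - dfn. apply Dfn_inductive. dfn.
  - exists b. intros z. rewrite hb. split; [tauto|]. auto.
Qed.

Lemma omega_inductive : inductive_set (@omega M).
Proof.
  split; [apply in_omega; now intros w []|].
  intros x hx. apply in_omega. intros w hw. apply hw. rewrite in_omega in hx. auto.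
Qed.

Lemma omega0 : empty ∈ @omega M. Proof. apply omega_inductive. Qed.
Lemma omegaS k : k ∈ omega -> succ k ∈ omega. Proof. apply omega_inductive. Qed.
Lemma num_omega i : num i ∈ @omega M.
Proof. induction i; simpl; [apply omega0|now apply omegaS]. Qed.

Lemma omega_ind (P : M -> Prop) : Dfn cW (fun e => P (e 0)) ->
  P empty -> (forall k, k ∈ omega -> P k -> P (succ k)) -> forall k, k ∈ omega -> P k.
Proof.
  intros hd h0 hs k hk. destruct (sep omega hd) as [b hb].
  assert (hk' : k ∈ b); [|now apply hb in hk'].
  rewrite in_omega in hk. apply hk. split; [apply hb; split; [apply omega0|assumption]|].
  intros x hx. apply hb in hx as [hx hx']. apply hb. split; [now apply omegaS|auto].
Qed.

Lemma omega_case k : k ∈ omega -> k = empty \/ exists n, n ∈ omega /\ k = succ n.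
Proof.
  apply (omega_ind (P := fun k => k = empty \/ exists n, n ∈ omega /\ k = succ n)); [dfn|auto|eauto].
Qed.

(** Minimality is tested only against subsets of the candidate, and these belong to every good
    domain that contains it. *)
Lemma DfT_omega C : DfT (M := M) C (fun _ => omega).
Proof.
  split; [intros D e hD _; apply (good_omega (cdom_good hD))|].
  eapply (Dfn_iff (P := fun e => inductive_set (e 0) /\
     forall y, subset y (e 0) -> inductive_set y -> subset (e 0) y)).
  - dfn; try (apply Dfn_inductive; dfn).
    apply (good_sub (cdom_good H) (y := e 0)); [|apply H0]. apply NNPP. tauto.
  - intros D e _ _. split.
    + intros [h1 h2]. apply subset_antisym.
      * apply h2; [|apply omega_inductive]. intros k hk. rewrite in_omega in hk. auto.
      * intros k hk. rewrite in_omega in hk. auto.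
    + intros ->. split; [apply omega_inductive|]. intros y _ hy k hk. rewrite in_omega in hk. auto.
Qed.

End Omega.

Ltac dfn_ext ::= lazymatch goal with
  | |- Dfn _ (fun e => func (@?a e) (@?b e) (@?c e)) => apply Dfn_func
  | |- Dfn _ (fun e => transitive (@?a e)) => apply Dfn_transitive
  | |- Dfn _ (fun e => ordinal (@?a e)) => apply Dfn_ordinal
  | |- Dfn _ (fun e => inductive_set (@?a e)) => apply Dfn_inductive
  | |- DfT _ (fun _ => omega) => apply DfT_omega
  end.

Section Induction.
Context {M : zfc_model}.
Implicit Types x y z a b c d f g h p u v w t k n : M.

Lemma succ_neq_empty x : succ x <> empty.
Proof. intros h. apply (@in_empty M x). rewrite <- h. apply in_succ. auto. Qed.

(** The iterated unions of [x] are built by hand, because the recursion theorem rests on transitive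
    closures. [att f n] says that [f] records the iterates correctly up to [n]; induction gives the
    existence of such [f] and the uniqueness of the last iterate. *)
Lemma transitive_superset x : exists t, transitive t /\ subset x t.
Proof.
  set (att := fun f n => (forall y, opair empty y ∈ f <-> y = x) /\
    forall k, k ∈ n -> forall y, opair (succ k) y ∈ f <-> exists z, opair k z ∈ f /\ y = bigU z).
  assert (H : forall n, n ∈ omega -> exists y, (exists f, att f n) /\
      forall f, att f n -> forall z, opair n z ∈ f <-> z = y).
  { apply omega_ind.
    - unfold att. dfn.
    - exists x. split.
      + exists (singleton (opair empty x)). split.
        * intros y. rewrite in_singleton, opair_eq. tauto.
        * intros k hk. destruct (in_empty hk).
      + intros f [h _]. exact h.
    - intros n hn (y & [f hf] & hu). exists (bigU y). split.
      + destruct (@sep M (fun p => ~ exists z, p = opair (succ n) z) f) as [f0 hf0]; [dfn|].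
        assert (hf' : forall k z, opair k z ∈ union2 f0 (singleton (opair (succ n) (bigU y))) <->
            (opair k z ∈ f /\ k <> succ n) \/ (k = succ n /\ z = bigU y)).
        { intros k z. rewrite in_union2, hf0, in_singleton, opair_eq. split; [|intros [[h1 h2]|h]; [left|right]; auto].
          - intros [[h1 h2]|h]; [left|right]; auto. split; auto. intros ->. eauto.
          - split; auto. intros [z' e]. apply opair_inj in e as [e _]. auto. }
        exists (union2 f0 (singleton (opair (succ n) (bigU y)))). split.
        * intros z. rewrite hf', (proj1 hf z). pose proof (succ_neq_empty (x := n)). split; [|intuition].
          intros [[h _]|[h _]]; auto. symmetry in h. tauto.
        * intros k hk z. apply in_succ in hk as [hk| ->].
          -- assert (hkn : k <> succ n).
             { intros ->. apply (mem_asym hk). apply in_succ. auto. }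
             assert (hkn' : succ k <> succ n).
             { intros h. apply succ_inj in h. subst. apply (mem_irrefl hk). }
             rewrite hf', (proj2 hf k hk z). split.
             ++ intros [[(w & h1 & h2) _]|[h _]]; [|tauto]. exists w. rewrite hf'. auto.
             ++ intros (w & h1 & h2). apply hf' in h1 as [[h1 _]|[h1 _]]; [|tauto]. left. eauto.
          -- assert (hkn : n <> succ n).
             { intros h. apply (@mem_irrefl M n). rewrite h at 2. apply in_succ. auto. }
             rewrite hf'. split.
             ++ intros [[_ h]|[_ ->]]; [tauto|]. exists y. rewrite hf', (hu f hf). auto.
             ++ intros (w & h1 & ->). apply hf' in h1 as [[h1 _]|[h1 _]]; [|tauto].
                apply (hu f hf) in h1 as ->. auto.
      + intros g hg z. assert (hg' : att g n).
        { split; [apply hg|]. intros k hk. apply hg. apply in_succ. auto. }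
        rewrite (proj2 hg n) by (apply in_succ; auto). split.
        * intros (w & h1 & ->). now apply (hu g hg') in h1 as ->.
        * intros ->. exists y. split; auto. now apply (hu g hg'). }
  destruct (@repl M (fun n y => exists f, att f n /\ opair n y ∈ f) omega) as [b hb].
  - unfold att. dfn.
  - intros n hn. destruct (H n hn) as (y & [f hf] & hu). exists y. split.
    + exists f. split; auto. now apply hu.
    + intros z (g & hg & hz). now apply (hu g hg) in hz.
  - exists (bigU b). split.
    + intros y hy z hz. apply in_bigU in hy as (w & hw & hy). apply hb in hw as (n & hn & f & hf & hw).
      apply in_bigU. exists (bigU w). split; [|rewrite in_bigU; eauto]. apply hb.
      exists (succ n). split; [now apply omegaS|].
      destruct (H _ (omegaS hn)) as (y' & [g hg] & hu). exists g. split; [exact hg|].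
      assert (hg' : att g n).
      { split; [apply hg|]. intros k hk. apply hg. apply in_succ. auto. }
      apply (proj2 hg n); [apply in_succ; auto|]. exists w. split; auto.
      destruct (H n hn) as (w' & _ & hu'). apply (hu' g hg'). now apply (hu' f hf).
    + intros z hz. apply in_bigU. exists x. split; auto. apply hb. exists empty. split; [apply omega0|].
      destruct (H _ omega0) as (y & [f hf] & _). exists f. split; auto. now apply hf.
Qed.

(** Foundation applies to sets only, so the counterexamples are first collected inside a transitive
    set containing [x]. *)
Lemma mem_ind (P : M -> Prop) : Dfn cW (fun e => P (e 0)) ->
  (forall x, (forall y, y ∈ x -> P y) -> P x) -> forall x, P x.
Proof.
  intros hd h x. apply NNPP. intros hx.
  destruct (transitive_superset (singleton x)) as (t & ht & hxt).
  destruct (@sep M (fun z => ~ P z) t) as [b hb]; [dfn|].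
  destruct (zf_foundation M b) as (m & hm & hm').
  - exists x. apply hb. split; auto. apply hxt. now apply in_singleton.
  - apply hb in hm as [hm hPm]. apply hPm. apply h. intros y hy. apply NNPP. intros hy'.
    apply (hm' y); auto. apply hb. split; auto. now apply (ht m).
Qed.

Definition tc x : M := set_of (fun z => forall t, transitive t -> subset x t -> z ∈ t).

Lemma in_tc x z : z ∈ tc x <-> forall t, transitive t -> subset x t -> z ∈ t.
Proof.
  unfold tc. rewrite in_set_of; [reflexivity|]. destruct (transitive_superset x) as (t & ht & hx).
  destruct (@sep M (fun z => forall t, transitive t -> subset x t -> z ∈ t) t) as [b hb]; [dfn|].
  exists b. intros w. rewrite hb. split; [tauto|]. auto.
Qed.

Lemma tc_sub x : subset x (tc x).
Proof. intros z hz. apply in_tc. intros t _ h. auto. Qed.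

Lemma tc_trans x : transitive (tc x).
Proof. intros y hy z hz. apply in_tc. intros t ht h. rewrite in_tc in hy. apply (ht y); auto. Qed.

Lemma tc_least x t : transitive t -> subset x t -> subset (tc x) t.
Proof. intros ht h z hz. rewrite in_tc in hz. auto. Qed.

Lemma tc_tc x z : z ∈ tc x -> subset (tc z) (tc x).
Proof. intros h. apply tc_least; [apply tc_trans|]. now apply tc_trans. Qed.

Lemma tc_cases x z : z ∈ tc x -> z ∈ x \/ exists y, y ∈ x /\ z ∈ tc y.
Proof.
  intros h. destruct (@sep M (fun z => z ∈ x \/ exists y, y ∈ x /\ forall t, transitive t -> subset y t -> z ∈ t) (tc x))
    as [b hb]; [dfn|].
  assert (hz : z ∈ b).
  { revert z h. apply tc_least.
    - intros y hy w hw. apply hb in hy as [hy1 hy2]. apply hb. split; [now apply (tc_trans hy1)|].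
      right. destruct hy2 as [hy2|(u & hu & hy2)].
      + exists y. split; auto.
      + exists u. split; auto. intros t ht h. apply (ht y); auto.
    - intros y hy. apply hb. split; auto. now apply tc_sub. }
  apply hb in hz as [_ [hz|(y & hy & hz)]]; [auto|]. right. exists y. split; auto. now apply in_tc.
Qed.

Lemma Dfn_in_tc C `{whole_ctx M C} (x z : (nat -> M) -> M) : DfT C x -> DfT C z -> Dfn C (fun e => z e ∈ tc (x e)).
Proof. intros. eapply Dfn_ext; [|intros e; symmetry; apply in_tc]. dfn. Qed.

Lemma DfT_tc C `{whole_ctx M C} (x : (nat -> M) -> M) : DfT C x -> DfT C (fun e => tc (x e)).
Proof. intros. apply DfT_whole; [assumption|]. apply Dfn_in_tc; dfn. Qed.

Ltac dfn_ext ::= lazymatch goal with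
  | |- Dfn _ (fun e => func (@?a e) (@?b e) (@?c e)) => apply Dfn_func
  | |- Dfn _ (fun e => transitive (@?a e)) => apply Dfn_transitive
  | |- Dfn _ (fun e => ordinal (@?a e)) => apply Dfn_ordinal
  | |- Dfn _ (fun e => inductive_set (@?a e)) => apply Dfn_inductive
  | |- DfT _ (fun _ => omega) => apply DfT_omega
  | |- DfT _ (fun e => tc (@?a e)) => apply DfT_tc
  end.

(** Membership induction applied to the statement about all elements of [tc x]. *)
Lemma tc_ind (P : M -> Prop) : Dfn cW (fun e => P (e 0)) ->
  (forall x, (forall y, y ∈ tc x -> P y) -> P x) -> forall x, P x.
Proof.
  intros hd h. assert (H : forall x z, z ∈ tc x -> P z).
  { apply (mem_ind (P := fun x => forall z, z ∈ tc x -> P z)).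
    - dfn.
    - intros x IH z hz. apply tc_cases in hz as [hz|(y & hy & hz)]; [|eauto]. apply h. eauto. }
  intros x. apply h. eauto.
Qed.

(** Here [g] is the restriction of [F] to the whole transitive closure of [x], not just to its
    elements: the components of a tuple are not its elements, and functions on formulas recurse on
    components. [A x g] characterizes this restriction; its existence and uniqueness are proved by
    induction on transitive closures. *)
Theorem recursion (H : M -> M -> M -> Prop) : Dfn cW (fun e => H (e 0) (e 1) (e 2)) ->
  (forall x g, exists! y, H x g y) ->
  exists F : M -> M -> Prop, Dfn cW (fun e => F (e 0) (e 1)) /\ (forall x, exists! y, F x y) /\
  forall x y, F x y <-> exists g, (forall p, p ∈ g <-> exists z w, z ∈ tc x /\ F z w /\ p = opair z w) /\ H x g y.
Proof.
  intros hd hH.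
  set (A := fun x g => (forall p, p ∈ g -> exists z w, z ∈ tc x /\ p = opair z w) /\
    (forall z, z ∈ tc x -> exists w, opair z w ∈ g) /\
    (forall z w w', opair z w ∈ g -> opair z w' ∈ g -> w = w') /\
    forall z w, opair z w ∈ g ->
      exists h, H z h w /\ forall p, p ∈ h <-> p ∈ g /\ exists z' w', z' ∈ tc z /\ p = opair z' w').
  assert (hdA : Dfn cW (fun e => A (e 0) (e 1))).
  { unfold A. dfn. }
  set (F := fun x y => exists g, A x g /\ H x g y).
  assert (hdF : Dfn cW (fun e => F (e 0) (e 1))).
  { unfold F. dfn. }
  assert (hres : forall x g z, A x g -> z ∈ tc x -> exists h, A z h /\
      forall p, p ∈ h <-> p ∈ g /\ exists z' w', z' ∈ tc z /\ p = opair z' w').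
  { intros x g z (h1 & h2 & h3 & h4) hz.
    destruct (@sep M (fun p => exists z' w', z' ∈ tc z /\ p = opair z' w') g) as [h hh].
    { dfn. }
    exists h. split; [|exact hh]. split; [|split; [|split]].
    - intros p hp. now apply hh in hp as [_ hp].
    - intros z' hz'. destruct (h2 z') as [w hw]; [now apply (tc_tc hz)|]. exists w. apply hh. eauto.
    - intros z' w w' hw hw'. apply hh in hw, hw'. now apply (h3 z').
    - intros z' w hw. apply hh in hw as [hw (z'' & w'' & hz'' & e)]. apply opair_inj in e as [<- <-].
      destruct (h4 z' w hw) as (k & hk & hk'). exists k. split; [exact hk|]. intros p. rewrite hk', hh.
      split; [|tauto]. intros [hp (u & v & hu & ->)]. repeat split; eauto.
      exists u, v. split; auto. now apply (tc_tc hz''). }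
  assert (hA : forall x, exists! g, A x g).
  { apply (tc_ind (P := fun x => exists! g, A x g)).
    - unfold unique. dfn.
    - intros x IH. assert (hF : forall z, z ∈ tc x -> exists! y, F z y).
      { intros z hz. destruct (IH z hz) as (g & hg & hu). destruct (hH z g) as (y & hy & hy').
        exists y. split; [exists g; auto|]. intros y' (g' & hg' & h'). rewrite <- (hu g' hg') in h'. auto. }
      destruct (fun_of (a := tc x) hdF hF) as [g hg].
      assert (hg' : forall z y, opair z y ∈ g <-> z ∈ tc x /\ F z y).
      { intros z y. rewrite hg. split; [|intros []; eauto 6].
        intros (z' & y' & h1 & h2 & e). apply opair_inj in e as [-> ->]. auto. }
      exists g. split.
      + split; [|split; [|split]].
        * intros p hp. apply hg in hp as (z & y & hz & _ & ->). eauto.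
        * intros z hz. destruct (hF z hz) as (y & hy & _). exists y. apply hg'. auto.
        * intros z y y' h1 h2. apply hg' in h1 as [hz h1], h2 as [_ h2].
          destruct (hF z hz) as (w & _ & hu). now rewrite <- (hu y h1), <- (hu y' h2).
        * intros z y h1. apply hg' in h1 as [hz (k & hk & hy)]. exists k. split; [exact hy|].
          intros p. split.
          -- intros hp. destruct (proj1 hk p hp) as (z' & w & hz' & ->). split; [|eauto].
             apply hg'. split; [now apply (tc_tc hz)|]. destruct (hres z k z' hk hz') as (h & hh & hh').
             exists h. split; auto. destruct (proj2 (proj2 (proj2 hk)) z' w hp) as (h0 & hh0 & hh0').
             replace h with h0; [exact hh0|]. apply ext. intros q. now rewrite hh', hh0'.
          -- intros [hp (z' & w & hz' & ->)]. apply hg' in hp as [_ (h & hh & hw)].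
             destruct (hres z k z' hk hz') as (h' & hh1 & hh2). destruct (proj1 (proj2 hk) z' hz') as [w' hw'].
             replace w with w'; [exact hw'|]. destruct (IH z') as (h0 & _ & hu); [now apply (tc_tc hz)|].
             destruct (proj2 (proj2 (proj2 hk)) z' w' hw') as (h3 & hh3 & hh3').
             assert (h = h3).
             { rewrite <- (hu h hh). rewrite (hu h' hh1). apply ext. intros q. now rewrite hh2, hh3'. }
             subst h3. destruct (hH z' h) as (v & _ & hv). now rewrite <- (hv w hw), <- (hv w' hh3).
      + intros g' hg1. apply ext. intros p.
        assert (hsub : forall z w, opair z w ∈ g' -> F z w).
        { intros z w hw. destruct (proj1 hg1 _ hw) as (z' & w' & hz & e). apply opair_inj in e as [<- <-].
          destruct (hres x g' z hg1 hz) as (h & hh & hh'). exists h. split; auto.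
          destruct (proj2 (proj2 (proj2 hg1)) z w hw) as (h0 & hh0 & hh0').
          replace h with h0; [exact hh0|]. apply ext. intros q. now rewrite hh', hh0'. }
        split; intros hp.
        * apply hg in hp as (z & y & hz & hy & ->). destruct (proj1 (proj2 hg1) z hz) as [y' hy'].
          destruct (hF z hz) as (v & _ & hv). now rewrite <- (hv y hy), (hv y' (hsub _ _ hy')).
        * destruct (proj1 hg1 p hp) as (z & w & hz & ->). apply hg'. auto. }
  exists F. split; [exact hdF|]. split.
  - intros x. destruct (hA x) as (g & hg & hu). destruct (hH x g) as (y & hy & hy').
    exists y. split; [exists g; auto|]. intros y' (g' & hg' & h'). rewrite <- (hu g' hg') in h'. auto.
  - assert (hAF : forall x g, A x g <-> forall p, p ∈ g <-> exists z w, z ∈ tc x /\ F z w /\ p = opair z w).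
    { intros x g0. assert (H1 : forall g, A x g -> forall p, p ∈ g <-> exists z w, z ∈ tc x /\ F z w /\ p = opair z w).
      { intros g hg.
        assert (hsub : forall z w, opair z w ∈ g -> z ∈ tc x /\ F z w).
        { intros z w hw. destruct (proj1 hg _ hw) as (z' & w' & hz & e). apply opair_inj in e as [<- <-].
          split; auto. destruct (hres x g z hg hz) as (h & hh & hh'). exists h. split; auto.
          destruct (proj2 (proj2 (proj2 hg)) z w hw) as (h0 & hh0 & hh0').
          replace h with h0; [exact hh0|]. apply ext. intros q. now rewrite hh', hh0'. }
        intros p. split.
        - intros hp. destruct (proj1 hg p hp) as (z & w & hz & ->). exists z, w. split; auto. split; auto. now apply hsub.
        - intros (z & w & hz & hw & ->). destruct (proj1 (proj2 hg) z hz) as [w' hw'].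
          replace w with w'; auto. destruct (hsub _ _ hw') as [_ (k1 & a1 & a2)]. destruct hw as (k2 & a3 & a4).
          destruct (hA z) as (k & _ & hu). rewrite <- (hu k1 a1) in a2. rewrite <- (hu k2 a3) in a4.
          destruct (hH z k) as (v & _ & hv). now rewrite <- (hv w a4), <- (hv w' a2). }
      split; [apply H1|]. intros h. destruct (hA x) as (g & hg & _). replace g0 with g; auto.
      apply ext. intros p. now rewrite h, (H1 g hg p). }
    intros x y. split; intros (g & hg & hy); exists g; split; auto; now apply hAF.
Qed.

End Induction.

Ltac dfn_ext ::= lazymatch goal with
  | |- Dfn _ (fun e => func (@?a e) (@?b e) (@?c e)) => apply Dfn_func
  | |- Dfn _ (fun e => transitive (@?a e)) => apply Dfn_transitive
  | |- Dfn _ (fun e => ordinal (@?a e)) => apply Dfn_ordinal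
  | |- Dfn _ (fun e => inductive_set (@?a e)) => apply Dfn_inductive
  | |- DfT _ (fun _ => omega) => apply DfT_omega
  | |- DfT _ (fun e => tc (@?a e)) => apply DfT_tc
  end.

(** * Ordinals *)

Section Ordinals.
Context {M : zfc_model}.
Implicit Types x y z a b c d f g p u v w t k n : M.

Lemma ord_mem a b : ordinal a -> b ∈ a -> ordinal b.
Proof. intros [h1 h2] hb. split; [now apply h2|]. intros y hy. apply h2. now apply (h1 b). Qed.

Lemma ord_trans a b c : ordinal a -> b ∈ a -> c ∈ b -> c ∈ a.
Proof. intros [h _] hb hc. now apply (h b). Qed.

(** Double induction: two incomparable ordinals whose elements are comparable with the other ordinal
    would have the same elements. *)
Lemma ord_tri a b : ordinal a -> ordinal b -> a ∈ b \/ a = b \/ b ∈ a.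
Proof.
  revert a b. apply (mem_ind (P := fun a => forall b, ordinal a -> ordinal b -> a ∈ b \/ a = b \/ b ∈ a)); [dfn|].
  intros a IHa. apply (mem_ind (P := fun b => ordinal a -> ordinal b -> a ∈ b \/ a = b \/ b ∈ a)); [dfn|].
  intros b IHb ha hb. apply NNPP. intros h. apply h. right. left. apply ext. intros z. split; intros hz.
  - destruct (IHa z hz b) as [h'|[h'|h']]; auto; [now apply (ord_mem ha)| |].
    + subst. tauto.
    + destruct h. right. right. now apply (ord_trans ha hz).
  - destruct (IHb z hz ha) as [h'|[h'|h']]; auto; [now apply (ord_mem hb)| |].
    + destruct h. left. now apply (ord_trans hb hz).
    + subst. tauto.
Qed.

Lemma ord_sub a b : ordinal a -> ordinal b -> subset a b -> a ∈ b \/ a = b.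
Proof.
  intros ha hb h. destruct (ord_tri ha hb) as [h'|[h'|h']]; auto. destruct (mem_irrefl (h _ h')).
Qed.

Lemma ord_le a b : ordinal b -> a ∈ b \/ a = b -> subset a b.
Proof. intros hb [h| ->] z hz; auto. now apply (ord_trans hb h). Qed.

Lemma ord_lt_or a b : ordinal a -> ordinal b -> a ∈ b \/ subset b a.
Proof. intros ha hb. destruct (ord_tri ha hb) as [h|[h|h]]; auto; right; apply ord_le; auto. Qed.

Lemma ord_sub_mem a b c : ordinal a -> ordinal c -> subset a b -> b ∈ c -> a ∈ c.
Proof.
  intros ha hc h hb. destruct (ord_sub ha (ord_mem hc hb) h) as [h'| ->]; auto. now apply (ord_trans hc hb).
Qed.

Lemma ord_succ a : ordinal a -> ordinal (succ a).
Proof.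
  intros [h1 h2]. split.
  - intros y hy z hz. apply in_succ. left. apply in_succ in hy as [hy| ->]; auto. now apply (h1 y).
  - intros y hy. apply in_succ in hy as [hy| ->]; auto.
Qed.

Lemma succ_le a b : ordinal a -> b ∈ a -> succ b ∈ a \/ succ b = a.
Proof.
  intros ha hb. apply ord_sub; auto; [apply ord_succ; now apply (ord_mem ha)|].
  intros z hz. apply in_succ in hz as [hz| ->]; auto. now apply (ord_trans ha hb).
Qed.

Lemma ord_empty : ordinal (@empty M).
Proof. split; intros y hy; destruct (in_empty hy). Qed.

Lemma ord_nonempty a : ordinal a -> a <> empty -> empty ∈ a.
Proof.
  intros ha hn. destruct (ord_tri ha ord_empty) as [h|[h|h]]; auto; [destruct (in_empty h)|tauto].
Qed.

Lemma nat_ord k : k ∈ omega -> ordinal k.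
Proof. apply (omega_ind (P := ordinal)); [dfn|apply ord_empty|]. intros n _. apply ord_succ. Qed.

Lemma nat_sub k n : k ∈ omega -> n ∈ k -> n ∈ omega.
Proof.
  intros hk. revert k hk n. apply (omega_ind (P := fun k => forall n, n ∈ k -> n ∈ omega)); [dfn| |].
  - intros n hn. destruct (in_empty hn).
  - intros k hk IH n hn. apply in_succ in hn as [hn| ->]; auto.
Qed.

Lemma ord_omega : ordinal (@omega M).
Proof. split; intros y hy; [intros z hz; exact (nat_sub hy hz)|exact (proj1 (nat_ord hy))]. Qed.

Lemma ord_min (P : M -> Prop) : Dfn cW (fun e => P (e 0)) -> (exists a, ordinal a /\ P a) ->
  exists a, ordinal a /\ P a /\ forall b, b ∈ a -> ~ P b.
Proof.
  intros hd (a & ha & hPa). apply NNPP. intros hn.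
  assert (H : forall b, ordinal b -> ~ P b); [|now apply (H a)].
  apply (mem_ind (P := fun b => ordinal b -> ~ P b)); [dfn|].
  intros b IH hb hPb. apply hn. exists b. split; [exact hb|]. split; [exact hPb|].
  intros c hc. apply IH; auto. now apply (ord_mem hb).
Qed.

Lemma ord_bigU x : (forall b, b ∈ x -> ordinal b) -> ordinal (bigU x).
Proof.
  intros h. split.
  - intros y hy z hz. apply in_bigU in hy as (b & hb & hy). apply in_bigU. exists b. split; auto.
    now apply (ord_trans (h b hb) hy).
  - intros y hy. apply in_bigU in hy as (b & hb & hy). exact (proj1 (ord_mem (h b hb) hy)).
Qed.

Definition limit a : Prop := ordinal a /\ (exists y, y ∈ a) /\ forall b, b ∈ a -> succ b ∈ a.

Lemma limit_omega_sub a : limit a -> subset omega a.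
Proof.
  intros (ha & [y hy] & hs). intros k hk. revert k hk. apply omega_ind; [dfn| |auto].
  apply ord_nonempty; auto. intros ->. destruct (in_empty hy).
Qed.

Lemma limit_omega : limit (@omega M).
Proof. split; [apply ord_omega|]. split; [exists empty; apply omega0|apply omegaS]. Qed.

(** Replacement collects the least witnesses, and monotonicity lets their union serve all [x] at
    once. *)
Lemma bound_ord (Q : M -> M -> Prop) a : Dfn cW (fun e => Q (e 0) (e 1)) ->
  (forall x b c, ordinal b -> ordinal c -> subset b c -> Q x b -> Q x c) ->
  (forall x, x ∈ a -> exists b, ordinal b /\ Q x b) -> exists b, ordinal b /\ forall x, x ∈ a -> Q x b.
Proof.
  intros hd hm h.
  destruct (@repl M (fun x b => ordinal b /\ Q x b /\ forall c, c ∈ b -> ~ Q x c) a) as [s hs]; [dfn| |].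
  - intros x hx. destruct (@ord_min (fun b => Q x b)) as (b & hb & hq & hmin); [dfn|auto|].
    exists b. split; auto. intros b' (hb' & hq' & hmin').
    destruct (ord_tri hb hb') as [h'|[h'|h']]; auto; [now destruct (hmin' b)|now destruct (hmin b')].
  - assert (hord : ordinal (bigU s)).
    { apply ord_bigU. intros b hb. now apply hs in hb as (_ & _ & hb & _). }
    exists (bigU s). split; auto. intros x hx.
    destruct (@ord_min (fun b => Q x b)) as (b & hb & hq & hmin); [dfn|auto|].
    apply (hm x b); auto. intros z hz. apply in_bigU. exists b. split; auto. apply hs. eauto.
Qed.

(** A limit ordinal may have cofinality omega, so witnesses can be bounded below it only when there
    are finitely many of them, in the sense of the model. *)
Lemma fin_bound (Q : M -> M -> Prop) d n : Dfn cW (fun e => Q (e 0) (e 1)) -> limit d ->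
  (forall x b c, b ∈ d -> c ∈ d -> subset b c -> Q x b -> Q x c) -> n ∈ omega ->
  (forall x, x ∈ n -> exists b, b ∈ d /\ Q x b) -> exists b, b ∈ d /\ forall x, x ∈ n -> Q x b.
Proof.
  intros hd (ho & [y hy] & hs) hm hn. revert n hn.
  apply (omega_ind (P := fun n => (forall x, x ∈ n -> exists b, b ∈ d /\ Q x b) ->
    exists b, b ∈ d /\ forall x, x ∈ n -> Q x b)); [dfn| |].
  - intros _. exists y. split; auto. intros x hx. destruct (in_empty hx).
  - intros k _ IH h. destruct IH as (b & hb & hq); [intros x hx; apply h; apply in_succ; auto|].
    destruct (h k) as (c & hc & hq'); [apply in_succ; auto|].
    destruct (ord_lt_or (ord_mem ho hb) (ord_mem ho hc)) as [h'|h'].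
    + exists c. split; auto. intros x hx. apply in_succ in hx as [hx| ->]; auto.
      apply (hm x b); auto. apply (ord_le (ord_mem ho hc)). auto.
    + exists b. split; auto. intros x hx. apply in_succ in hx as [hx| ->]; auto. apply (hm k c); auto.
Qed.

(** Iterating omega times leads to a limit ordinal closed under [Q]. [K g y] makes the next stage
    [y] exceed every earlier stage [w] together with a common bound for the witnesses of the
    elements of [w]. *)
Lemma club (Q : M -> M -> Prop) a : Dfn cW (fun e => Q (e 0) (e 1)) -> ordinal a ->
  (forall x b c, ordinal b -> ordinal c -> subset b c -> Q x b -> Q x c) ->
  (forall b, ordinal b -> exists c, ordinal c /\ Q b c) ->
  exists t, limit t /\ a ∈ t /\ omega ∈ t /\ forall b, b ∈ t -> exists c, c ∈ t /\ Q b c.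
Proof.
  intros hd ha hm hQ.
  set (K := fun g y => a ∈ y /\ omega ∈ y /\ forall z w, opair z w ∈ g -> ordinal w ->
              w ∈ y /\ exists c, c ∈ y /\ ordinal c /\ forall b, b ∈ w -> Q b c).
  assert (hK : forall g, exists y, ordinal y /\ K g y).
  { intros g.
    destruct (@bound_ord (fun w y => ordinal w -> w ∈ y /\ exists c, c ∈ y /\ ordinal c /\ forall b, b ∈ w -> Q b c) (bigU (bigU g)))
      as (y & hy & h).
    - dfn.
    - intros w b c _ hc hbc h hw. destruct (h hw) as [h1 (d & h2 & h3)]. split; auto. exists d. auto.
    - intros w _. destruct (classic (ordinal w)) as [hw|hw]; [|exists empty; split; [apply ord_empty|tauto]].
      destruct (@bound_ord Q w hd) as (c & hc & h); auto.
      { intros b hb. apply hQ. now apply (ord_mem hw). }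
      assert (hwc : ordinal (union2 (succ w) (succ c))).
      { rewrite union2_bigU. apply ord_bigU. intros b hb. apply in_upair in hb as [-> | ->]; now apply ord_succ. }
      exists (union2 (succ w) (succ c)). split; auto. intros _. split.
      + apply in_union2. left. apply in_succ. auto.
      + exists c. split; auto. apply in_union2. right. apply in_succ. auto.
    - assert (hz : ordinal (bigU (upair y (union2 (succ a) (succ omega))))).
      { apply ord_bigU. intros b hb. apply in_upair in hb as [-> | ->]; auto.
        rewrite union2_bigU. apply ord_bigU. intros b hb. apply in_upair in hb as [-> | ->]; apply ord_succ; auto.
        apply ord_omega. }
      assert (hyz : subset y (bigU (upair y (union2 (succ a) (succ omega))))).
      { intros z hz'. apply in_bigU. exists y. rewrite in_upair. auto. }
      exists (bigU (upair y (union2 (succ a) (succ omega)))). split; auto. split; [|split].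
      + apply in_bigU. eexists. rewrite in_upair. split; [right; reflexivity|]. rewrite in_union2, !in_succ. auto.
      + apply in_bigU. eexists. rewrite in_upair. split; [right; reflexivity|]. rewrite in_union2, !in_succ. auto.
      + intros z w hw how. destruct (h w) as [h1 (c & h2 & h3)]; auto; [apply (opair_mem2 hw)|].
        split; auto. exists c. auto. }
  assert (hKd : Dfn cW (fun e => K (e 0) (e 1))) by (unfold K; dfn).
  destruct (@recursion M (fun x g y => ordinal y /\ K g y /\ forall z, z ∈ y -> ~ K g z)) as (F & hFd & hFu & hF).
  - dfn.
  - intros _ g. destruct (@ord_min (K g)) as (y & hy & h1 & h2); [dfn|apply hK|].
    exists y. split; auto. intros y' (hy' & h1' & h2').
    destruct (ord_tri hy hy') as [h|[h|h]]; auto; [now destruct (h2' y)|now destruct (h2 y')].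
  - destruct (@repl M F omega hFd) as [s hs]; [auto|].
    assert (hFo : forall x y, F x y -> ordinal y).
    { intros x y h. apply hF in h as (g & _ & h & _). exact h. }
    assert (ho : ordinal (bigU s)).
    { apply ord_bigU. intros b hb. apply hs in hb as (x & _ & h). eauto. }
    assert (hstep : forall n w, n ∈ omega -> F n w -> exists w', w' ∈ s /\ w ∈ w' /\
        exists c, c ∈ w' /\ ordinal c /\ forall b, b ∈ w -> Q b c).
    { intros n w hn hw. destruct (hFu (succ n)) as (w' & hw' & _). exists w'. split; [apply hs; exists (succ n); split; auto; now apply omegaS|].
      apply hF in hw' as (g & hg & _ & (_ & _ & h) & _). apply (h n w); eauto.
      apply hg. exists n, w. split; auto. apply tc_sub. apply in_succ. auto. }
    assert (h0 : a ∈ bigU s /\ omega ∈ bigU s).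
    { destruct (hFu empty) as (w & hw & _). assert (hws : w ∈ s) by (apply hs; exists empty; split; auto; apply omega0).
      apply hF in hw as (g & _ & _ & (h1 & h2 & _) & _). split; apply in_bigU; eauto. }
    exists (bigU s). split; [|split; [apply h0|split; [apply h0|]]].
    + split; [exact ho|]. split; [exists a; apply h0|]. intros b hb. apply in_bigU in hb as (w & hw & hb).
      apply hs in hw as (n & hn & hw). destruct (hstep n w hn hw) as (w' & hw' & hww & _).
      apply in_bigU. exists w'. split; auto. apply hs in hw' as (n' & _ & hw').
      destruct (succ_le (hFo _ _ hw) hb) as [h| ->]; auto. now apply (ord_trans (hFo _ _ hw') hww).
    + intros b hb. apply in_bigU in hb as (w & hw & hb). apply hs in hw as (n & hn & hw).
      destruct (hstep n w hn hw) as (w' & hw' & hww & c & hc & _ & h). exists c. split; auto.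
      apply in_bigU. eauto.
Qed.

(** * The cumulative hierarchy *)

(** [Vlev] is given by a description in terms of [cumulative] functions; recursion supplies a total
    function with a definable graph that agrees with it on the ordinals. *)
Lemma Vlev_exists : exists (V : M -> M) (F : M -> M -> Prop), Dfn cW (fun e => F (e 0) (e 1)) /\
  (forall a y, F a y <-> y = V a) /\ forall a, ordinal a ->
  Vlev a = V a /\ forall x, x ∈ V a <-> exists c, c ∈ a /\ subset x (V c).
Proof.
  destruct (@recursion M (fun x g y => forall u, u ∈ y <-> exists c, c ∈ x /\ exists w, opair c w ∈ g /\ subset u w))
    as (F & hFd & hFu & hF).
  - dfn.
  - intros x g. destruct (@sep M (fun u => exists c, c ∈ x /\ exists w, opair c w ∈ g /\ subset u w)
      (pow (bigU (bigU (bigU g))))) as [y hy]; [dfn|].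
    assert (h : forall u, u ∈ y <-> exists c, c ∈ x /\ exists w, opair c w ∈ g /\ subset u w).
    { intros u. rewrite hy. split; [tauto|]. intros (c & hc & w & hw & hu). split; eauto.
      apply in_pow. intros z hz. apply in_bigU. exists w. split; auto. apply (opair_mem2 hw). }
    exists y. split; auto. intros y' h'. apply ext. intros u. now rewrite h, h'.
  - set (V := fun a => the (F a)).
    assert (hV : forall a, F a (V a)).
    { intros a. apply the_spec. destruct (hFu a) as (y & hy & _). eauto. }
    assert (hVe : forall a x, x ∈ V a <-> exists c, c ∈ a /\ subset x (V c)).
    { intros a x. destruct (proj1 (hF a (V a)) (hV a)) as (g & hg & h). rewrite h. split.
      - intros (c & hc & w & hw & hx). exists c. split; auto. apply hg in hw as (z & w' & _ & hz & e).
        apply opair_inj in e as [-> ->]. destruct (hFu z) as (v & _ & hu). now rewrite <- (hu _ (hV z)), (hu _ hz).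
      - intros (c & hc & hx). exists c. split; auto. exists (V c). split; auto. apply hg. exists c, (V c).
        repeat split; auto. now apply tc_sub. }
    exists V, F. split; [exact hFd|]. split.
    { intros a y. split; [|intros ->; apply hV]. intros h. destruct (hFu a) as (v & _ & hu).
      now rewrite <- (hu _ h), (hu _ (hV a)). }
    intros a ha. split; [|apply hVe].
    destruct (@repl M F (succ a) hFd) as [r hr]; [auto|].
    destruct (@fun_of_func M F (succ a) r hFd) as (f & hf & hff).
    { auto. } { intros x y hx hy. apply hr. eauto. }
    assert (hfV : forall c, c ∈ succ a -> app f c = V c).
    { intros c hc. apply (func_app hf). apply hff. auto. }
    assert (hcum : cumulative f (succ a)).
    { split; [now apply ord_succ|]. split; [eauto|]. intros b hb x. rewrite hfV, hVe by auto.
      split; intros (c & hc & hx); exists c; split; auto;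
        [rewrite hfV|rewrite <- hfV]; auto; now apply (ord_trans (ord_succ ha) hb). }
    apply set_of_eq. intros x. split.
    + intros hx. exists f. split; auto. rewrite hfV; auto. apply in_succ. auto.
    + intros (f' & (_ & [r' hf'] & hc) & hx). replace (V a) with (app f' a); auto.
      assert (H : forall b, b ∈ succ a -> app f' b = V b).
      { apply (mem_ind (P := fun b => b ∈ succ a -> app f' b = V b)).
        - eapply (Dfn_ext (P := fun e => e 0 ∈ succ a -> exists y, opair (e 0) y ∈ f' /\ F (e 0) y)); [dfn|].
          intros e. split; intros h h0; specialize (h h0).
          + destruct h as (y & h1 & h2). rewrite (func_app hf' h1).
            destruct (hFu (e 0)) as (v & _ & hu). now rewrite <- (hu _ h2), (hu _ (hV (e 0))).
          + exists (app f' (e 0)). split; [now apply (func_ap hf')|]. rewrite h. apply hV.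
        - intros b IH hb. apply ext. intros z. rewrite hc, hVe by auto.
          assert (H : forall c, c ∈ b -> app f' c = V c).
          { intros c hcb. apply IH; auto. now apply (ord_trans (ord_succ ha) hb). }
          split; intros (c & hcb & hz); exists c; split; auto; [rewrite <- H|rewrite H]; auto. }
      apply H. apply in_succ. auto.
Qed.

Lemma in_Vlev a x : ordinal a -> (x ∈ Vlev a <-> exists c, c ∈ a /\ subset x (Vlev c)).
Proof.
  destruct Vlev_exists as (V & _ & _ & _ & hV). intros ha. destruct (hV a ha) as [-> h]. rewrite h.
  split; intros (c & hc & hx); exists c; split; auto; destruct (hV c (ord_mem ha hc)) as [e _];
    [now rewrite e|now rewrite <- e].
Qed.

Lemma Vlev_mono a b : ordinal b -> ordinal a -> subset a b -> subset (Vlev a) (Vlev b).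
Proof. intros hb ha h x hx. apply in_Vlev in hx as (c & hc & hx); auto. apply in_Vlev; eauto. Qed.

Lemma Vlev_sub a x y : ordinal a -> subset x y -> y ∈ Vlev a -> x ∈ Vlev a.
Proof.
  intros ha h hy. apply in_Vlev in hy as (c & hc & hy); auto. apply in_Vlev; auto. exists c. split; auto.
  intros z hz. auto.
Qed.

Lemma Vlev_trans a : ordinal a -> transitive (Vlev a).
Proof.
  intros ha y hy z hz. apply in_Vlev in hy as (c & hc & hy); auto.
  apply (@Vlev_mono c a); auto; [now apply (ord_mem ha)|]. intros u. now apply (ord_trans ha hc).
Qed.

Lemma Vlev_succ a x : ordinal a -> (x ∈ Vlev (succ a) <-> subset x (Vlev a)).
Proof.
  intros ha. rewrite in_Vlev by now apply ord_succ. split.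
  - intros (c & hc & hx). apply in_succ in hc as [hc| ->]; auto. intros z hz.
    apply (@Vlev_mono c a); auto; [now apply (ord_mem ha)|]. intros u. now apply (ord_trans ha hc).
  - intros h. exists a. split; auto. apply in_succ. auto.
Qed.

Lemma Vlev_lt a b : ordinal a -> b ∈ a -> Vlev b ∈ Vlev a.
Proof. intros ha hb. apply in_Vlev; auto. exists b. split; auto. apply subset_refl. Qed.

Definition isV v a : Prop := ordinal a /\ v = Vlev a.

(** A level is certified by the hierarchy function on [succ a], whose values are subsets of [v]. The
    sets to be compared lie in [v] or in [pow v], so each quantifier is bounded or concerns a
    function that good domains contain; hence levels are absolute. *)
Lemma Dfn_isV C (v a : (nat -> M) -> M) : DfT C v -> DfT C a -> Dfn C (fun e => isV (v e) (a e)).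
Proof.
  intros hv ha. unfold isV. eapply (Dfn_ext (P := fun e => ordinal (a e) /\ exists f, func f (succ (a e)) (pow (v e)) /\
    (forall b, b ∈ succ (a e) -> forall y, y ∈ pow (v e) -> opair b y ∈ f ->
       forall x, x ∈ union2 (v e) (pow (v e)) ->
         (x ∈ y <-> exists c, c ∈ b /\ exists w, w ∈ pow (v e) /\ (opair c w ∈ f /\ subset x w))) /\
    opair (a e) (v e) ∈ f)).
  - dfn. destruct H1 as [H1 _].
    refine (Good_func (cdom_good H) _ _ H1); [apply (Good_succ (cdom_good H))|apply (good_pow (cdom_good H))];
      [now apply (proj1 ha)|now apply (proj1 hv)].
  - intros e. generalize (a e) (v e). clear. intros a v.
    destruct Vlev_exists as (V & F & hFd & hF & hV). split; intros [ha H]; split; auto.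
    + destruct H as (f & hf & hc & hv). rewrite <- (func_app hf hv).
      assert (ha' : a ∈ succ a) by (apply in_succ; auto).
      assert (hsub : forall b y, opair b y ∈ f -> y ∈ pow v) by (intros b y h; apply (func_dom hf h)).
      assert (H : forall b, b ∈ succ a -> exists y, opair b y ∈ f /\ F b y).
      { apply (mem_ind (P := fun b => b ∈ succ a -> exists y, opair b y ∈ f /\ F b y)); [dfn|].
        intros b IH hb. destruct (func_ex hf hb) as (y & hy & hby). exists y. split; auto. apply hF.
        assert (hob : ordinal b) by now apply (ord_mem (ord_succ ha)). apply ext. intros x.
        rewrite (proj2 (hV b hob)). split.
        - intros hx. apply (hc b hb y hy hby) in hx as (c & hcb & w & _ & hw & hx).
          + exists c. split; auto. destruct (IH c hcb) as (w' & h1 & h2); [now apply (ord_trans (ord_succ ha) hb)|].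
            apply hF in h2 as <-. now rewrite <- (func_fun hf hw h1).
          + apply in_union2. left. apply in_pow in hy. auto.
        - intros (c & hcb & hx). destruct (IH c hcb) as (w & h1 & h2); [now apply (ord_trans (ord_succ ha) hb)|].
          apply hF in h2. rewrite <- h2 in hx. apply (hc b hb y hy hby); [|eauto 7].
          apply in_union2. right. apply in_pow. intros z hz. apply hsub, in_pow in h1. auto. }
      destruct (H a ha') as (y & h1 & h2). rewrite (func_app hf h1). apply hF in h2. rewrite h2. symmetry. now apply hV.
    + subst v. destruct (@fun_of_func M F (succ a) (pow (Vlev a)) hFd) as (f & hf & hff).
      { intros x _. exists (V x). split; [now apply hF|]. intros y hy. symmetry. now apply hF. }
      { intros x y hx hy. apply hF in hy as ->. apply in_pow. rewrite <- (proj1 (hV x (ord_mem (ord_succ ha) hx))).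
        apply Vlev_mono; auto; [now apply (ord_mem (ord_succ ha))|]. apply ord_le; auto. now apply in_succ. }
      exists f. split; auto. split.
      * intros b hb y _ hby x hx. apply hff in hby as [_ hby]. apply hF in hby as ->.
        rewrite (proj2 (hV b (ord_mem (ord_succ ha) hb))). split.
        -- intros (c & hcb & h). exists c. split; auto. exists (V c).
           assert (hca : c ∈ succ a) by now apply (ord_trans (ord_succ ha) hb).
           assert (hcf : opair c (V c) ∈ f) by (apply hff; split; auto; now apply hF).
           split; auto. apply (func_dom hf hcf).
        -- intros (c & hcb & w & _ & hw & h). exists c. split; auto. apply hff in hw as [_ hw]. now apply hF in hw as ->.
      * apply hff. split; [apply in_succ; auto|]. apply hF. now apply hV.
Qed.


Lemma ord_sub_Vlev a : ordinal a -> subset a (Vlev a).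
Proof.
  revert a. apply (mem_ind (P := fun a => ordinal a -> subset a (Vlev a))).
  - eapply (Dfn_ext (P := fun e => forall v, isV v (e 0) -> subset (e 0) v)).
    + dfn; apply Dfn_isV; dfn.
    + intros e. split; [intros h ho; apply h; now split|]. intros h v [ho ->]. auto.
  - intros a IH ha b hb. apply in_Vlev; auto. exists b. split; auto. apply IH; auto. now apply (ord_mem ha).
Qed.

Lemma ord_notin_Vlev a : ordinal a -> ~ a ∈ Vlev a.
Proof.
  revert a. apply (mem_ind (P := fun a => ordinal a -> ~ a ∈ Vlev a)).
  - eapply (Dfn_ext (P := fun e => forall v, isV v (e 0) -> ~ e 0 ∈ v)).
    + dfn; apply Dfn_isV; dfn.
    + intros e. split; [intros h ho; apply h; now split|]. intros h v [ho ->]. auto.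
  - intros a IH ha h. apply in_Vlev in h as (c & hc & h); auto. apply (IH c hc (ord_mem ha hc)). auto.
Qed.

Lemma ord_in_Vlev a b : ordinal a -> ordinal b -> (b ∈ Vlev a <-> b ∈ a).
Proof.
  intros ha hb. split; [|apply (ord_sub_Vlev ha)]. intros h. destruct (ord_lt_or hb ha) as [h'|h']; auto.
  destruct (@ord_notin_Vlev a); auto. now apply (Vlev_sub ha h').
Qed.

Lemma has_rank_unique x a b : has_rank x a -> has_rank x b -> a = b.
Proof.
  intros (ha & h1 & h2) (hb & h3 & h4). destruct (ord_tri ha hb) as [h|[h|h]]; auto; [now destruct (h4 a)|now destruct (h2 b)].
Qed.

Lemma has_rank_between a x : ordinal a -> subset a x -> subset x (Vlev a) -> has_rank x a.
Proof.
  intros ha h h'. split; [exact ha|]. split; [exact h'|]. intros b hb hx.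
  apply (@ord_notin_Vlev b); [now apply (ord_mem ha)|]. auto.
Qed.

Lemma ex_level x : exists a, ordinal a /\ x ∈ Vlev a.
Proof.
  revert x. apply mem_ind.
  - eapply (Dfn_ext (P := fun e => exists a v, isV v a /\ e 0 ∈ v)).
    + dfn; apply Dfn_isV; dfn.
    + intros e. split; [intros (a & v & [h ->] & h'); eauto|]. intros (a & h & h'). exists a, (Vlev a). split; [now split|auto].
  - intros x IH. destruct (@bound_ord (fun y b => forall v, isV v b -> y ∈ v) x) as (b & hb & h).
    + dfn; apply Dfn_isV; dfn.
    + intros y b c hb hc hbc h v [_ ->]. apply (Vlev_mono hc hb hbc). apply h. now split.
    + intros y hy. destruct (IH y hy) as (a & ha & h). exists a. split; auto. now intros v [_ ->].
    + exists (succ b). split; [now apply ord_succ|]. apply Vlev_succ; auto. intros y hy. apply (h y hy). now split.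
Qed.

End Ordinals.

Ltac dfn_ext ::= lazymatch goal with
  | |- Dfn _ (fun e => func (@?a e) (@?b e) (@?c e)) => apply Dfn_func
  | |- Dfn _ (fun e => transitive (@?a e)) => apply Dfn_transitive
  | |- Dfn _ (fun e => ordinal (@?a e)) => apply Dfn_ordinal
  | |- Dfn _ (fun e => inductive_set (@?a e)) => apply Dfn_inductive
  | |- DfT _ (fun _ => omega) => apply DfT_omega
  | |- DfT _ (fun e => tc (@?a e)) => apply DfT_tc
  | |- Dfn _ (fun e => isV (@?a e) (@?b e)) => apply Dfn_isV
  end.

(** * Limit levels, choice functions and Hartogs ordinals *)

Section Levels.
Context {M : zfc_model}.
Implicit Types x y z a b c d f g p u v w t k n : M.

Lemma limit_in_Vlev a x : limit a -> (x ∈ Vlev a <-> exists b, b ∈ a /\ x ∈ Vlev b).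
Proof.
  intros (ha & _ & hs). split.
  - intros h. apply in_Vlev in h as (c & hc & h); auto. exists (succ c). split; auto.
    apply Vlev_succ; auto. now apply (ord_mem ha).
  - intros (b & hb & h). apply (@Vlev_mono M b a); auto; [now apply (ord_mem ha)|]. apply ord_le; auto.
Qed.

Lemma limit_sub_Vlev a x b : limit a -> b ∈ a -> subset x (Vlev b) -> x ∈ Vlev a.
Proof. intros (ha & _ & hs) hb h. apply in_Vlev; eauto. Qed.

Lemma limit_pair a x y : limit a -> x ∈ Vlev a -> y ∈ Vlev a -> exists b, b ∈ a /\ x ∈ Vlev b /\ y ∈ Vlev b.
Proof.
  intros ha hx hy. apply (limit_in_Vlev x ha) in hx as (b & hb & hx). apply (limit_in_Vlev y ha) in hy as (c & hc & hy).
  pose proof (ord_mem (proj1 ha) hb) as ob. pose proof (ord_mem (proj1 ha) hc) as oc.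
  destruct (ord_lt_or ob oc) as [h|h]; [exists c|exists b]; repeat split; auto.
  - apply (Vlev_mono oc ob (ord_le oc (or_introl h)) hx).
  - apply (Vlev_mono ob oc h hy).
Qed.

Lemma limit_upair a x y : limit a -> x ∈ Vlev a -> y ∈ Vlev a -> upair x y ∈ Vlev a.
Proof.
  intros ha hx hy. destruct (limit_pair ha hx hy) as (b & hb & h1 & h2). apply (limit_sub_Vlev ha hb).
  intros z hz. apply in_upair in hz as [-> | ->]; auto.
Qed.

Lemma limit_opair a x y : limit a -> x ∈ Vlev a -> y ∈ Vlev a -> opair x y ∈ Vlev a.
Proof. intros. unfold opair. rewrite singleton_upair. now repeat apply limit_upair. Qed.

Lemma limit_Good a : limit a -> omega ∈ a -> Good (fun x => x ∈ Vlev a).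
Proof.
  intros ha ho. assert (hoa := proj1 ha). split.
  - intros x y hx hy. now apply (Vlev_trans hoa hy).
  - intros x y h hy. now apply (Vlev_sub hoa h).
  - intros x y. now apply limit_upair.
  - intros x hx. apply (limit_in_Vlev x ha) in hx as (b & hb & hx). apply (limit_sub_Vlev ha hb).
    intros y hy. apply in_pow in hy. apply (Vlev_sub (ord_mem hoa hb) hy hx).
  - intros x hx. apply (limit_in_Vlev x ha) in hx as (b & hb & hx). apply (limit_sub_Vlev ha hb).
    intros z hz. apply in_bigU in hz as (y & hy & hz).
    apply (Vlev_trans (ord_mem hoa hb) (y := y)); auto. apply (Vlev_trans (ord_mem hoa hb) hx hy).
  - apply ord_in_Vlev; auto. apply ord_omega.
Qed.

(** The ranks of finitely many pairs are bounded below the limit; finiteness is that of the model,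
    so nonstandard lengths are covered. *)
Lemma fin_func_V a n t : limit a -> n ∈ omega -> func t n (Vlev a) -> t ∈ Vlev a.
Proof.
  intros ha hn ht. assert (hoa := proj1 ha).
  destruct (@fin_bound M (fun i b => forall v, isV v b -> exists y, opair i y ∈ t /\ opair i y ∈ v) a n) as (b & hb & h); auto.
  - dfn.
  - intros i b c hb hc hbc h v [_ ->]. destruct (h (Vlev b)) as (y & h1 & h2); [split; [now apply (ord_mem hoa)|reflexivity]|].
    exists y. split; auto. apply (Vlev_mono (ord_mem hoa hc) (ord_mem hoa hb) hbc h2).
  - intros i hi. destruct (func_ex ht hi) as (y & hy & hiy).
    assert (hp : opair i y ∈ Vlev a).
    { apply limit_opair; auto. apply (ord_sub_Vlev hoa). apply (limit_omega_sub ha). now apply (nat_sub hn). }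
    apply (limit_in_Vlev _ ha) in hp as (b & hb & hp). exists b. split; auto. intros v [_ ->]. eauto.
  - apply (limit_sub_Vlev ha hb). intros p hp. destruct (proj1 ht p hp) as (i & y & hi & _ & ->).
    destruct (h i hi (Vlev b)) as (y' & h1 & h2); [split; [now apply (ord_mem hoa)|reflexivity]|].
    now rewrite (func_fun ht hp h1).
Qed.

Lemma ex_good_level x a : ordinal a -> exists t, limit t /\ omega ∈ t /\ a ∈ t /\ x ∈ Vlev t.
Proof.
  intros ha. destruct (ex_level x) as (b & hb & hx).
  destruct (@club M (fun _ _ => True) (union2 a b)) as (t & ht & h1 & h2 & _).
  - dfn.
  - rewrite union2_bigU. apply ord_bigU. intros c hc. apply in_upair in hc as [-> | ->]; auto.
  - auto.
  - intros. exists empty. split; auto. apply ord_empty.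
  - assert (hto := proj1 ht). exists t. split; [exact ht|]. split; [exact h2|]. split.
    + apply (@ord_sub_mem M a (union2 a b) t); auto. intros z hz. apply in_union2. auto.
    + apply (@Vlev_mono M b t); auto. apply ord_le; auto. left.
      apply (@ord_sub_mem M b (union2 a b) t); auto. intros z hz. apply in_union2. auto.
Qed.

(** The axiom chooses from disjoint families only; disjointness is achieved by replacing each [y]
    with the set of pairs (y, z), z in y. The choice is a relation, undefined at the empty set. *)
Lemma choice_fun x : exists f, (forall y z, opair y z ∈ f -> y ∈ x /\ z ∈ y) /\
  (forall y z z', opair y z ∈ f -> opair y z' ∈ f -> z = z') /\
  forall y, y ∈ x -> (exists z, z ∈ y) -> exists z, opair y z ∈ f.
Proof.
  destruct (@sep M (fun y => exists z, z ∈ y) x) as [x' hx']; [dfn|].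
  set (R := fun y u => forall p, p ∈ u <-> exists z, z ∈ y /\ p = opair y z).
  assert (hR : forall y, exists! u, R y u).
  { intros y. destruct (@sep M (fun p => exists z, z ∈ y /\ p = opair y z) (pow (pow (union2 (singleton y) y)))) as [u hu]; [dfn|].
    assert (h : R y u).
    { intros p. rewrite hu. split; [tauto|]. intros (z & hz & ->). split; eauto. apply opair_in_pow; auto. now apply in_singleton. }
    exists u. split; auto. intros u' h'. apply ext. intros p. now rewrite (h p), (h' p). }
  destruct (@repl M R x') as [X hX]; [unfold R; dfn|auto|].
  destruct (@zf_choice M X) as [c hc].
  - intros u hu. apply hX in hu as (y & hy & hu). apply hx' in hy as [_ [z hz]]. exists (opair y z). apply hu. eauto.
  - intros u u' hu hu' hne p hp hp'. apply hX in hu as (y & hy & hu), hu' as (y' & hy' & hu').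
    apply hu in hp as (z & hz & ->). apply hu' in hp' as (z' & hz' & e). apply opair_inj in e as [-> ->].
    destruct (hR y') as (v & _ & hv). apply hne. now rewrite <- (hv u hu), <- (hv u' hu').
  - destruct (@sep M (fun p => p ∈ c) (bigU X)) as [f hf]; [dfn|].
    assert (hf' : forall y z, opair y z ∈ f -> exists u, u ∈ X /\ R y u /\ y ∈ x /\ z ∈ y /\ opair y z ∈ u /\ opair y z ∈ c).
    { intros y z h. apply hf in h as [h h']. apply in_bigU in h as (u & hu & h). assert (hu0 := hu).
      apply hX in hu as (y' & hy' & hu). assert (h2 := h). apply hu in h as (z' & hz' & e). apply opair_inj in e as [-> ->].
      apply hx' in hy' as [hy' _]. exists u. auto 8. }
    exists f. split; [|split].
    + intros y z h. apply hf' in h as (u & h). tauto.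
    + intros y z z' h h'. apply hf' in h as (u & hu & h1 & _ & _ & h2 & h3).
      apply hf' in h' as (u' & _ & h1' & _ & _ & h2' & h3').
      assert (u = u') by (destruct (hR y) as (v & _ & hv); now rewrite <- (hv u h1), <- (hv u' h1')). subst u'.
      destruct (hc u hu) as (p & _ & hp). assert (e : opair y z = opair y z') by (rewrite <- (hp (opair y z)), <- (hp (opair y z')); auto).
      now apply opair_inj in e.
    + intros y hy hne. destruct (hR y) as (u & hu & _). assert (huX : u ∈ X).
      { apply hX. exists y. split; auto. apply hx'. auto. }
      destruct (hc u huX) as (p & [h1 h2] & _). assert (h3 := h2). apply hu in h3 as (z & _ & ->).
      exists z. apply hf. split; auto. apply in_bigU. eauto.
Qed.

Definition surj g a b : Prop := func g a b /\ forall y, y ∈ b -> exists x, x ∈ a /\ opair x y ∈ g.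

Lemma Dfn_surj C (g a b : (nat -> M) -> M) : DfT C g -> DfT C a -> DfT C b -> Dfn C (fun e => surj (g e) (a e) (b e)).
Proof. intros. unfold surj. dfn. Qed.

(** Points without a value in [d] are sent to the default [empty], which therefore has to belong to
    [d]. *)
Lemma surj_from (R : M -> M -> Prop) a d : Dfn cW (fun e => R (e 0) (e 1)) -> empty ∈ d ->
  (forall x y y', x ∈ a -> R x y -> R x y' -> y = y') -> (forall y, y ∈ d -> exists x, x ∈ a /\ R x y) ->
  exists g, surj g a d.
Proof.
  intros hd h0 hu hs.
  destruct (@fun_of_func M (fun x y => (R x y /\ y ∈ d) \/ ((~ exists z, R x z /\ z ∈ d) /\ y = empty)) a d) as (g & hg & hgE); [dfn| | |].
  - intros x hx. destruct (classic (exists z, R x z /\ z ∈ d)) as [[z hz]|hn].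
    + exists z. split; auto. intros y [[h _]|[h _]]; [apply (hu x); tauto|destruct h; eauto].
    + exists empty. split; auto. intros y [h|[_ h]]; auto. destruct hn. eauto.
  - intros x y _ [[_ h]|[_ ->]]; auto.
  - exists g. split; auto. intros y hy. destruct (hs y hy) as (x & hx & h). exists x. split; auto. apply hgE. auto.
Qed.

(** If every nonempty ordinal [d] were an image of [a], then [d] could be recovered from the
    relation that a surjection pulls back to [a] from membership. The relations on [a] form a set,
    so by replacement the ordinals would form one as well. *)
Lemma hartogs a : exists d, ordinal d /\ empty ∈ d /\ ~ exists g, surj g a d.
Proof.
  apply NNPP. intros hn. assert (hs : forall d, ordinal d -> empty ∈ d -> exists g, surj g a d).
  { intros d hd hd0. apply NNPP. intros h. apply hn. eauto. }
  set (S := fun r d => ordinal d /\ exists g, surj g a d /\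
     forall x y, x ∈ a -> y ∈ a -> (opair x y ∈ r <-> exists u v, opair x u ∈ g /\ opair y v ∈ g /\ u ∈ v)).
  assert (hSd : Dfn cW (fun e => S (e 0) (e 1))) by (unfold S; dfn; apply Dfn_surj; dfn).
  assert (hg : forall r d d' g g', 
     surj g a d -> (forall x y, x ∈ a -> y ∈ a -> (opair x y ∈ r <-> exists u v, opair x u ∈ g /\ opair y v ∈ g /\ u ∈ v)) ->
     surj g' a d' -> (forall x y, x ∈ a -> y ∈ a -> (opair x y ∈ r <-> exists u v, opair x u ∈ g' /\ opair y v ∈ g' /\ u ∈ v)) ->
     ordinal d -> ordinal d' -> forall u x, opair x u ∈ g -> opair x u ∈ g').
  { intros r d d' g g' [hg hs1] hr [hg' hs1'] hr' hd hd'.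
    apply (mem_ind (P := fun u => forall x, opair x u ∈ g -> opair x u ∈ g')); [dfn|].
    intros u IH x hx. destruct (func_dom hg hx) as [hxa hud]. destruct (func_ex hg' hxa) as (u' & hu' & hx').
    replace u with u'; auto. apply ext. intros v. split; intros hv.
    - destruct (hs1' v) as (y & hy & hyv); [now apply (ord_trans hd' hu')|].
      assert (h : opair y x ∈ r) by (apply hr'; eauto).
      apply hr in h as (v1 & u1 & h1 & h2 & h3); auto. rewrite <- (func_fun hg hx h2) in h3.
      now rewrite <- (func_fun hg' (IH v1 h3 y h1) hyv).
    - destruct (hs1 v) as (y & hy & hyv); [now apply (ord_trans hd hud)|].
      assert (h : opair y x ∈ r) by (apply hr; eauto).
      apply hr' in h as (v1 & u1 & h1 & h2 & h3); auto. rewrite <- (func_fun hg' hx' h2) in h3.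
      now rewrite (func_fun hg' (IH v hv y hyv) h1). }
  assert (hSu : forall r d d', S r d -> S r d' -> d = d').
  { assert (H : forall r d d', S r d -> S r d' -> subset d d').
    { intros r d d' (hd & g & hg1 & hr) (hd' & g' & hg1' & hr') u hu.
      destruct (proj2 hg1 u hu) as (x & hx & hxu).
      apply (func_dom (proj1 hg1') (hg r d d' g g' hg1 hr hg1' hr' hd hd' u x hxu)). }
    intros r d d' h h'. apply subset_antisym; eauto. }
  destruct (@sep M (fun r => exists d, S r d) (pow (pow (pow (union2 a a))))) as [rs hrs]; [dfn|].
  destruct (@repl M S rs hSd) as [ds hds].
  - intros r hr. apply hrs in hr as [_ [d hd]]. exists d. split; auto. intros d'. apply hSu; auto.
  - assert (hall : forall d, ordinal d -> empty ∈ d -> d ∈ ds).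
    { intros d hd hd0. destruct (hs d hd hd0) as (g & hg1).
      destruct (@sep M (fun p => exists x y u v, p = opair x y /\ opair x u ∈ g /\ opair y v ∈ g /\ u ∈ v) (pow (pow (union2 a a)))) as [r hr]; [dfn|].
      assert (hSr : S r d).
      { split; auto. exists g. split; auto. intros x y hx hy. rewrite hr. split.
        - intros (_ & x' & y' & u & v & e & h). apply opair_inj in e as [-> ->]. eauto.
        - intros (u & v & h). split; [now apply opair_in_pow|]. exists x, y, u, v. auto. }
      apply hds. exists r. split; auto. apply hrs. split; eauto. apply in_pow. intros p hp. now apply hr in hp. }
    assert (ho : ordinal (bigU ds)).
    { apply ord_bigU. intros d hd. now apply hds in hd as (r & _ & hd & _). }
    apply (@mem_irrefl M (bigU ds)). apply in_bigU. exists (succ (bigU ds)). split; [|apply in_succ; auto].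
    apply hall; [now apply ord_succ|]. apply ord_nonempty; [now apply ord_succ|apply succ_neq_empty].
Qed.

End Levels.

Ltac dfn_ext ::= lazymatch goal with
  | |- Dfn _ (fun e => func (@?a e) (@?b e) (@?c e)) => apply Dfn_func
  | |- Dfn _ (fun e => transitive (@?a e)) => apply Dfn_transitive
  | |- Dfn _ (fun e => ordinal (@?a e)) => apply Dfn_ordinal
  | |- Dfn _ (fun e => inductive_set (@?a e)) => apply Dfn_inductive
  | |- DfT _ (fun _ => omega) => apply DfT_omega
  | |- DfT _ (fun e => tc (@?a e)) => apply DfT_tc
  | |- Dfn _ (fun e => isV (@?a e) (@?b e)) => apply Dfn_isV
  | |- Dfn _ (fun e => surj (@?a e) (@?b e) (@?c e)) => apply Dfn_surj
  end.

(** * Syntax and semantics inside the model *)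

Ltac dfn_unf := unfold eps_sym, tvar, tapp, feq, frel, fneg, fand, fall, relsym, funsym.
Ltac dfnu := dfn_unf; dfn.

Section Logic.
Context {M : zfc_model}.
Implicit Types x y z a b c d f g p u v w t k n L U I B s r R F m : M.

Lemma num_inj i j : @num M i = num j -> i = j.
Proof.
  revert j. induction i; intros [|j] h; simpl in h; auto.
  - symmetry in h. destruct (succ_neq_empty h).
  - destruct (succ_neq_empty h).
  - apply succ_inj in h. f_equal. auto.
Qed.

Lemma tag_neq i j x y : opair (num i) x = opair (num j) y -> i = j.
Proof. intros e. apply opair_inj in e as [e _]. now apply num_inj in e. Qed.

Lemma univ_opair U I : univ (opair U I) = U.
Proof.
  unfold univ. apply the_eq; [eauto|]. intros y [I' e]. now apply opair_inj in e as [-> _].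
Qed.

Lemma interp_opair U I s : interp (opair U I) s = app I s.
Proof.
  unfold interp. apply the_eq; [eauto|]. intros y (U' & I' & e & <-). now apply opair_inj in e as [_ ->].
Qed.

Lemma limit_num a i : limit a -> num i ∈ Vlev a.
Proof. intros ha. apply (ord_sub_Vlev (proj1 ha)). apply (limit_omega_sub ha). apply num_omega. Qed.

Lemma limit_omega_in a k : limit a -> k ∈ omega -> k ∈ Vlev a.
Proof. intros ha hk. apply (ord_sub_Vlev (proj1 ha)). now apply (limit_omega_sub ha). Qed.

Lemma term_closed_V L a : limit a -> subset L (Vlev a) -> term_closed L (Vlev a).
Proof.
  intros ha hL. split.
  - intros k hk. apply limit_opair; auto; [apply (limit_num 0 ha)|]. now apply limit_omega_in.
  - intros n r t hn hs ht. apply limit_opair; [auto|apply (limit_num 1 ha)|].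
    apply limit_opair; auto. now apply (@fin_func_V M a n).
Qed.

Lemma ex_level_sub L : exists a, limit a /\ subset L (Vlev a).
Proof.
  destruct (@ex_good_level M L empty) as (a & ha & _ & _ & h); [apply ord_empty|].
  exists a. split; auto. apply (Vlev_trans (proj1 ha) h).
Qed.

Lemma Dfn_term_closed C `{whole_ctx M C} (L T : (nat -> M) -> M) : DfT C L -> DfT C T -> Dfn C (fun e => term_closed (L e) (T e)).
Proof. intros. unfold term_closed. dfnu. Qed.

Lemma Dfn_is_term C `{whole_ctx M C} (L t : (nat -> M) -> M) : DfT C L -> DfT C t -> Dfn C (fun e => is_term (L e) (t e)).
Proof. intros. unfold is_term. dfn. apply Dfn_term_closed; dfn. Qed.

Lemma in_terms L t : t ∈ terms L <-> is_term L t.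
Proof.
  unfold terms. rewrite in_set_of; [reflexivity|]. destruct (ex_level_sub L) as (a & ha & hL).
  destruct (@sep M (is_term L) (Vlev a)) as [b hb]; [apply Dfn_is_term; dfn|].
  exists b. intros z. rewrite hb. split; [tauto|]. intros h. split; auto. apply h. now apply term_closed_V.
Qed.

Lemma DfT_terms C `{whole_ctx M C} (L : (nat -> M) -> M) : DfT C L -> DfT C (fun e => terms (L e)).
Proof.
  intros. apply DfT_whole; [assumption|]. eapply Dfn_ext; [|intros e; symmetry; apply in_terms].
  apply Dfn_is_term; dfn.
Qed.

Lemma term_var L k : k ∈ omega -> is_term L (tvar k).
Proof. intros hk T [h _]. auto. Qed.

Lemma term_app L n r t : n ∈ omega -> funsym n r ∈ L -> func t n (terms L) -> is_term L (tapp (funsym n r) t).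
Proof.
  intros hn hs ht T hT. apply hT; auto. apply (func_cod ht). intros i y h.
  assert (hy : is_term L y) by (apply in_terms; apply (func_dom ht h)). now apply hy.
Qed.

Lemma term_ind L (P : M -> Prop) : Dfn cW (fun e => P (e 0)) ->
  (forall k, k ∈ omega -> P (tvar k)) ->
  (forall n r t, n ∈ omega -> funsym n r ∈ L -> func t n (terms L) ->
     (forall i y, opair i y ∈ t -> P y) -> P (tapp (funsym n r) t)) ->
  forall t, is_term L t -> P t.
Proof.
  intros hd hv ha t ht. destruct (sep (terms L) hd) as [T hT].
  assert (h : t ∈ T); [|now apply hT in h]. apply ht. split.
  - intros k hk. apply hT. split; auto. apply in_terms. now apply term_var.
  - intros n r t' hn hs ht'. assert (h : func t' n (terms L)).
    { apply (func_cod ht'). intros i y h. apply (func_dom ht') in h as [_ h]. now apply hT in h. }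
    apply hT. split; [apply in_terms; now apply term_app|]. apply ha; auto.
    intros i y hy. apply (func_dom ht') in hy as [_ hy]. now apply hT in hy.
Qed.

Lemma Dfn_formula_closed C `{whole_ctx M C} (L T : (nat -> M) -> M) : DfT C L -> DfT C T -> Dfn C (fun e => formula_closed (L e) (T e)).
Proof.
  intros. unfold formula_closed. dfnu; try (apply Dfn_is_term; dfn). apply DfT_terms; dfn.
Qed.

Lemma Dfn_is_formula C `{whole_ctx M C} (L t : (nat -> M) -> M) : DfT C L -> DfT C t -> Dfn C (fun e => is_formula (L e) (t e)).
Proof. intros. unfold is_formula. dfn. apply Dfn_formula_closed; dfn. Qed.

Lemma formula_closed_V L a : limit a -> subset L (Vlev a) -> formula_closed L (Vlev a).
Proof.
  intros ha hL. assert (ht : forall t, is_term L t -> t ∈ Vlev a) by (intros t h; apply h; now apply term_closed_V).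
  unfold feq, frel, fneg, fand, fall, triple.
  split; [|split; [|split; [|split]]].
  - intros t u h h'. repeat apply limit_opair; auto. apply (limit_num 0 ha).
  - intros n r t hn hs h. apply limit_opair; [auto|apply (limit_num 1 ha)|]. apply limit_opair; auto.
    apply (@fin_func_V M a n); auto. apply (func_cod h). intros i y hy. apply ht, in_terms. apply (func_dom h hy).
  - intros f hf. apply limit_opair; auto. apply (limit_num 2 ha).
  - intros f g hf hg. repeat apply limit_opair; auto. apply (limit_num 3 ha).
  - intros k f hk hf. repeat apply limit_opair; auto; [apply (limit_num 4 ha)|]. now apply limit_omega_in.
Qed.

Definition forms L : M := set_of (is_formula L).

Lemma in_forms L t : t ∈ forms L <-> is_formula L t.
Proof.
  unfold forms. rewrite in_set_of; [reflexivity|]. destruct (ex_level_sub L) as (a & ha & hL).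
  destruct (@sep M (is_formula L) (Vlev a)) as [b hb]; [apply Dfn_is_formula; dfn|].
  exists b. intros z. rewrite hb. split; [tauto|]. intros h. split; auto. apply h. now apply formula_closed_V.
Qed.

Lemma formula_intro L : formula_closed L (forms L).
Proof.
  split; [|split; [|split; [|split]]].
  - intros t u h h'. apply in_forms. intros F hF. now apply hF.
  - intros n r t hn hs h. apply in_forms. intros F hF. now apply hF.
  - intros f hf. rewrite in_forms in *. intros F hF. apply hF. now apply hf.
  - intros f g hf hg. rewrite in_forms in *. intros F hF. apply hF; [now apply hf|now apply hg].
  - intros k f hk hf. rewrite in_forms in *. intros F hF. apply hF; auto.
Qed.

Lemma form_eq L t u : is_term L t -> is_term L u -> is_formula L (feq t u).
Proof. intros. apply in_forms. now apply (formula_intro L). Qed.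
Lemma form_rel L n r t : n ∈ omega -> relsym n r ∈ L -> func t n (terms L) -> is_formula L (frel (relsym n r) t).
Proof. intros. apply in_forms. now apply (formula_intro L). Qed.
Lemma form_neg L f : is_formula L f -> is_formula L (fneg f).
Proof. rewrite <- !in_forms. apply (formula_intro L). Qed.
Lemma form_and L f g : is_formula L f -> is_formula L g -> is_formula L (fand f g).
Proof. rewrite <- !in_forms. apply (formula_intro L). Qed.
Lemma form_all L k f : k ∈ omega -> is_formula L f -> is_formula L (fall k f).
Proof. rewrite <- !in_forms. apply (formula_intro L). Qed.

Lemma form_ind L (P : M -> Prop) : Dfn cW (fun e => P (e 0)) ->
  (forall t u, is_term L t -> is_term L u -> P (feq t u)) ->
  (forall n r t, n ∈ omega -> relsym n r ∈ L -> func t n (terms L) -> P (frel (relsym n r) t)) ->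
  (forall f, is_formula L f -> P f -> P (fneg f)) ->
  (forall f g, is_formula L f -> is_formula L g -> P f -> P g -> P (fand f g)) ->
  (forall k f, k ∈ omega -> is_formula L f -> P f -> P (fall k f)) ->
  forall f, is_formula L f -> P f.
Proof.
  intros hd h1 h2 h3 h4 h5 f hf. destruct (sep (forms L) hd) as [F hF].
  assert (h : f ∈ F); [|now apply hF in h]. apply hf. split; [|split; [|split; [|split]]].
  - intros t u ht hu. apply hF. rewrite in_forms. split; auto. now apply form_eq.
  - intros n r t hn hs ht. apply hF. rewrite in_forms. split; auto. now apply form_rel.
  - intros g hg. apply hF in hg as [hg hg']. rewrite in_forms in hg. apply hF. rewrite in_forms. split; auto. now apply form_neg.
  - intros g g' hg hg'. apply hF in hg as [hg a], hg' as [hg' b]. rewrite in_forms in *. apply hF. rewrite in_forms. split; auto. now apply form_and.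
  - intros k g hk hg. apply hF in hg as [hg hg']. rewrite in_forms in *. apply hF. rewrite in_forms. split; auto. now apply form_all.
Qed.

(* Relational forms of the notions of the semantics: application and
   description are junk outside their domain, so they are eliminated before
   definability is considered. *)
Definition evc L U I s R : Prop :=
  (forall k a, opair k a ∈ s -> opair (tvar k) a ∈ R) /\
  (forall n r t v F y, n ∈ omega -> funsym n r ∈ L -> opair (funsym n r) F ∈ I ->
     func t n (terms L) -> func v n U ->
     (forall i a b, opair i a ∈ t -> opair i b ∈ v -> opair a b ∈ R) ->
     opair v y ∈ F -> opair (tapp (funsym n r) t) y ∈ R).

Definition vrel L U I s t v : Prop := forall R, evc L U I s R -> opair t v ∈ R.

Lemma Dfn_vrel C `{whole_ctx M C} (L U I s t v : (nat -> M) -> M) : DfT C L -> DfT C U -> DfT C I -> DfT C s ->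
  DfT C t -> DfT C v -> Dfn C (fun e => vrel (L e) (U e) (I e) (s e) (t e) (v e)).
Proof. intros. unfold vrel, evc. dfnu; apply DfT_terms; dfn. Qed.

Definition in_funset n U v : v ∈ funset n U <-> func v n U.
Proof.
  unfold funset. rewrite in_set_of; [reflexivity|].
  destruct (@sep M (fun f => func f n U) (pow (pow (pow (union2 n U))))) as [b hb]; [dfn|].
  exists b. intros z. rewrite hb. split; [tauto|]. intros h. split; auto. now apply func_in_pow.
Qed.

Record strc L U I : Prop := {
  strc_fun : exists r, func I L r;
  strc_rel : forall n r, n ∈ omega -> relsym n r ∈ L -> forall v, v ∈ app I (relsym n r) -> func v n U;
  strc_fsym : forall n r, n ∈ omega -> funsym n r ∈ L -> func (app I (funsym n r)) (funset n U) U
}.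

Lemma structure_strc L U I : structure L (opair U I) -> strc L U I.
Proof.
  intros (U' & I' & e & h1 & h2). apply opair_inj in e as [<- <-]. split; auto.
  - intros n r hn hs v hv. apply in_funset. now apply (h2 n r hn).
  - intros n r hn hs. now apply (h2 n r hn).
Qed.

Lemma structure_inv L B : structure L B -> exists U I, B = opair U I /\ strc L U I.
Proof. intros h. assert (h' := h). destruct h as (U & I & -> & _). exists U, I. split; auto. now apply structure_strc. Qed.

Lemma strc_app L U I s y : strc L U I -> (opair s y ∈ I <-> s ∈ L /\ app I s = y).
Proof.
  intros [[r hI] _ _]. split.
  - intros h. split; [apply (func_dom hI h)|apply (func_app hI h)].
  - intros [h <-]. now apply (func_ap hI).
Qed.

(** * Values of terms, and finite supports, in a fixed structure *)

Section Struct.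
Variables (L U I : M).
Hypothesis HS : strc L U I.

Lemma evc_iff s R : func s omega U -> (eval_closed L (opair U I) s R <-> evc L U I s R).
Proof.
  intros hs. unfold eval_closed, evc. rewrite univ_opair. split; intros [h1 h2]; split.
  - intros k a h. destruct (func_dom hs h) as [hk _]. rewrite <- (func_app hs h). auto.
  - intros n r t v F y hn hr hF ht hv hR hy. apply (strc_app _ _ HS) in hF as [_ <-].
    rewrite <- (func_app (strc_fsym HS hn hr) hy).
    rewrite <- (interp_opair U I). apply h2; auto. intros i hi. apply (hR i); [now apply (func_ap ht)|now apply (func_ap hv)].
  - intros k hk. apply h1. now apply (func_ap hs).
  - intros n r t v hn hr ht hv hR. rewrite interp_opair. apply (h2 n r t v (app I (funsym n r))); auto.
    + now apply (strc_app _ _ HS).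
    + intros i a b ha hb. rewrite <- (func_app ht ha), <- (func_app hv hb). apply hR. apply (func_dom ht ha).
    + apply (func_ap (strc_fsym HS hn hr)). now apply in_funset.
Qed.

Lemma vrel_var s k a : opair k a ∈ s -> vrel L U I s (tvar k) a.
Proof. intros h R [hR _]. auto. Qed.

Lemma vrel_app s n r t v : n ∈ omega -> funsym n r ∈ L -> func t n (terms L) -> func v n U ->
  (forall i a b, opair i a ∈ t -> opair i b ∈ v -> vrel L U I s a b) ->
  vrel L U I s (tapp (funsym n r) t) (app (app I (funsym n r)) v).
Proof.
  intros hn hr ht hv h R hR. apply (proj2 hR n r t v (app I (funsym n r))); auto.
  - now apply (strc_app _ _ HS).
  - intros i a b ha hb. now apply (h i a b).
  - apply (func_ap (strc_fsym HS hn hr)). now apply in_funset.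
Qed.

Lemma vrel_evc s T : (forall t v, opair t v ∈ T <-> is_term L t /\ v ∈ U /\ vrel L U I s t v) -> func s omega U -> evc L U I s T.
Proof.
  intros hT hs. split.
  - intros k a h. apply hT. destruct (func_dom hs h). split; [now apply term_var|]. split; auto. now apply vrel_var.
  - intros n r t v F y hn hr hF ht hv hR hy. apply (strc_app _ _ HS) in hF as [_ <-]. apply hT.
    split; [now apply term_app|]. split; [apply (func_dom (strc_fsym HS hn hr) hy)|].
    rewrite <- (func_app (strc_fsym HS hn hr) hy). apply vrel_app; auto. intros i a b ha hb. now apply hT, (hR i).
Qed.

(** For uniqueness, take all value pairs and remove those with the given term but a different value:
    the remaining set is still closed under evaluation, so the least closed relation does not
    contain the removed pairs. *)
Lemma vrel_ex s t : func s omega U -> is_term L t -> exists v, v ∈ U /\ vrel L U I s t v /\ forall v', vrel L U I s t v' -> v' = v.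
Proof.
  intros hs ht. revert t ht.
  assert (hd : Dfn cW (fun e => vrel L U I s (e 0) (e 1))) by (apply Dfn_vrel; dfn).
  assert (hW : forall (Q : M -> M -> Prop), Dfn cW (fun e => Q (e 0) (e 1)) -> exists T, forall t v, opair t v ∈ T <->
      (is_term L t /\ v ∈ U /\ vrel L U I s t v) /\ Q t v).
  { intros Q hQ. destruct (@sep M (fun p => exists t v, p = opair t v /\ (is_term L t /\ v ∈ U /\ vrel L U I s t v) /\ Q t v)
      (pow (pow (union2 (terms L) U)))) as [T hT]; [dfn; apply Dfn_is_term; dfn|].
    exists T. intros t v. rewrite hT. split.
    - intros (_ & t' & v' & e & h). now apply opair_inj in e as [-> ->].
    - intros h. split; [apply opair_in_pow; [apply in_terms|]; tauto|]. eauto. }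
  apply term_ind; [dfn| |].
  - intros k hk. destruct (func_ex hs hk) as (a & ha & hka). exists a. split; auto. split; [now apply vrel_var|].
    intros v hv. destruct (hW (fun t v => t = tvar k -> v = a)) as [T hT]; [dfnu|].
    assert (h : opair (tvar k) v ∈ T); [|apply hT in h; now apply h]. apply hv.
    destruct (hW (fun _ _ => True)) as [T' hT']; [dfn|].
    assert (he : evc L U I s T') by (apply vrel_evc; auto; intros t' v'; rewrite hT'; tauto). split.
    + intros k' a' h. apply hT. split; [now apply hT', he|]. intros e. apply opair_inj in e as [_ ->]. apply (func_fun hs h hka).
    + intros n r t w F y hn hr hF ht hw hR hy. apply hT. split.
      * apply hT'. apply (proj2 he n r t w F); auto. intros i b c hb hc. apply hT'. specialize (hR i b c hb hc). apply hT in hR. tauto.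
      * intros e. apply tag_neq in e. discriminate e.
  - intros n r t hn hr ht IH.
    destruct (@fun_of_func M (fun i v => exists a, opair i a ∈ t /\ vrel L U I s a v) n U) as (w & hw & hwt); [dfn| | |].
    { intros i hi. destruct (func_ex ht hi) as (a & _ & ha). destruct (IH i a ha) as (v & _ & h1 & h2). exists v. split; eauto.
      intros v' (a' & ha' & hv'). rewrite <- (func_fun ht ha ha') in hv'. symmetry. auto. }
    { intros i v hi (a & ha & hv). destruct (IH i a ha) as (v' & hv' & _ & h2). now rewrite (h2 v hv). }
    assert (hwR : forall i a b, opair i a ∈ t -> opair i b ∈ w -> vrel L U I s a b).
    { intros i a b ha hb. apply hwt in hb as [_ (a' & ha' & hb)]. now rewrite (func_fun ht ha ha'). }
    exists (app (app I (funsym n r)) w). split; [apply (func_in (strc_fsym HS hn hr)); now apply in_funset|].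
    split; [now apply vrel_app|]. intros v hv.
    destruct (hW (fun t' v => t' = tapp (funsym n r) t -> v = app (app I (funsym n r)) w)) as [T hT]; [dfnu|].
    assert (h : opair (tapp (funsym n r) t) v ∈ T); [|apply hT in h; now apply h]. apply hv.
    destruct (hW (fun _ _ => True)) as [T' hT']; [dfn|].
    assert (he : evc L U I s T') by (apply vrel_evc; auto; intros t' v'; rewrite hT'; tauto). split.
    + intros k' a' h. apply hT. split; [now apply hT', he|]. intros e. apply tag_neq in e. discriminate e.
    + intros n' r' t' w' F y hn' hr' hF ht' hw' hR hy. apply hT. split.
      * apply hT'. apply (proj2 he n' r' t' w' F); auto. intros i b c hb hc. apply hT'. specialize (hR i b c hb hc). apply hT in hR. tauto.
      * intros e. apply opair_inj in e as [_ e]. apply opair_inj in e as [e ->]. rewrite e in hF.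
        apply (strc_app _ _ HS) in hF as [_ <-]. unfold funsym, triple in e. apply opair_inj in e as [_ e]. apply opair_inj in e as [-> ->].
        rewrite <- (func_app (strc_fsym HS hn hr) hy). f_equal. apply (func_ext hw' hw). intros i b hb.
        destruct (func_dom hw' hb) as [hi _]. destruct (func_ex ht hi) as (a & _ & ha). apply hwt. split; auto. exists a. split; auto.
        specialize (hR i a b ha hb). apply hT in hR. tauto.
Qed.

Lemma tval_vrel s t v : func s omega U -> is_term L t -> (vrel L U I s t v <-> tval L (opair U I) s t = v).
Proof.
  intros hs ht. destruct (vrel_ex hs ht) as (v0 & _ & h1 & h2).
  assert (e : tval L (opair U I) s t = v0).
  { unfold tval. apply the_eq.
    - intros R hR. apply h1. now apply evc_iff.
    - intros v' h. apply h2. intros R hR. apply h. now apply evc_iff. }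
  rewrite e. split; [|intros <-; auto]. intros h. symmetry. auto.
Qed.

Definition agree m s s' : Prop := forall k, k ∈ m -> forall a, opair k a ∈ s <-> opair k a ∈ s'.

(** An assignment is an omega-sequence, and one into V_lambda need not be an element of V_lambda
    when lambda has cofinality omega. Dependence on finitely many variables lets eventually constant
    assignments take its place. *)
Lemma term_support t : is_term L t -> exists m, m ∈ omega /\ forall s s', func s omega U -> func s' omega U -> agree m s s' ->
  forall v, vrel L U I s t v <-> vrel L U I s' t v.
Proof.
  assert (hd : Dfn cW (fun e => vrel L U I (e 0) (e 1) (e 2))) by (apply Dfn_vrel; dfn).
  revert t. apply term_ind; [unfold agree; dfn| |].
  - intros k hk. exists (succ k). split; [now apply omegaS|]. intros s s' hs hs' ha.
    destruct (func_ex hs hk) as (a & _ & h). assert (h' : opair k a ∈ s') by (apply ha; auto; apply in_succ; auto).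
    intros v. rewrite !tval_vrel by (auto; now apply term_var).
    apply (vrel_var) in h, h'. apply tval_vrel in h, h'; auto; try now apply term_var. rewrite h, h'. tauto.
  - intros n r t hn hr ht IH.
    destruct (@fin_bound M (fun i m => forall a, opair i a ∈ t -> forall s s', func s omega U -> func s' omega U -> agree m s s' ->
      forall v, vrel L U I s a v <-> vrel L U I s' a v) omega n) as (m & hm & h).
    + unfold agree; dfn.
    + apply limit_omega.
    + intros i b c _ _ hbc h a ha s s' hs hs' hag. apply h; auto. intros k hk. apply hag. auto.
    + exact hn.
    + intros i hi. destruct (func_ex ht hi) as (a & _ & ha). destruct (IH i a ha) as (m & hm & h). exists m. split; auto.
      intros a' ha'. now rewrite (func_fun ht ha' ha).
    + exists m. split; auto. intros s s' hs hs' hag.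
      assert (H : forall s s', func s omega U -> func s' omega U -> agree m s s' -> forall v, vrel L U I s (tapp (funsym n r) t) v -> vrel L U I s' (tapp (funsym n r) t) v).
      { clear s s' hs hs' hag. intros s s' hs hs' hag v hv.
        assert (hta : forall i a, opair i a ∈ t -> is_term L a) by (intros i a h'; apply in_terms; apply (func_dom ht h')).
        destruct (@fun_of_func M (fun i v => exists a, opair i a ∈ t /\ vrel L U I s a v) n U) as (w & hw & hwt); [dfn| | |].
        { intros i hi. destruct (func_ex ht hi) as (a & _ & ha). destruct (vrel_ex hs (hta i a ha)) as (v1 & _ & h1 & h2).
          exists v1. split; eauto. intros v' (a' & ha' & hv'). rewrite <- (func_fun ht ha ha') in hv'. symmetry. auto. }
        { intros i v1 hi (a & ha & hv1). destruct (vrel_ex hs (hta i a ha)) as (v' & hv' & _ & h2). now rewrite (h2 v1 hv1). }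
        assert (hwR : forall i a b, opair i a ∈ t -> opair i b ∈ w -> vrel L U I s a b).
        { intros i a b ha hb. apply hwt in hb as [_ (a' & ha' & hb)]. now rewrite (func_fun ht ha ha'). }
        assert (h1 := vrel_app hn hr ht hw hwR).
        assert (htt : is_term L (tapp (funsym n r) t)) by now apply term_app.
        apply tval_vrel in hv, h1; auto. rewrite <- hv, h1. apply vrel_app; auto. intros i a b ha hb.
        apply (h i (proj1 (func_dom ht ha)) a ha s s'); eauto. }
      intros v. split; apply H; auto. intros k hk a. symmetry. now apply hag.
Qed.

Lemma in_supd s k a p : p ∈ supd s k a <-> (p ∈ s /\ ~ exists y, p = opair k y) \/ p = opair k a.
Proof.
  unfold supd. rewrite in_set_of; [reflexivity|].
  destruct (@sep M (fun p => ~ exists y, p = opair k y) s) as [b hb]; [dfn|].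
  exists (union2 b (singleton (opair k a))). intros z. now rewrite in_union2, hb, in_singleton.
Qed.

Lemma supd_in s k a j y : opair j y ∈ supd s k a <-> (j <> k /\ opair j y ∈ s) \/ (j = k /\ y = a).
Proof.
  rewrite in_supd, opair_eq. split; (intros [[h1 h2]|h]; [left|right; tauto]); split; auto.
  - intros ->. eauto.
  - intros [y' e]. apply opair_inj in e as [-> _]. auto.
Qed.

Lemma supd_func s k a : func s omega U -> k ∈ omega -> a ∈ U -> func (supd s k a) omega U.
Proof.
  intros hs hk ha. apply func_intro.
  - intros p hp. apply in_supd in hp as [[hp _]| ->]; [|eauto 6]. now apply (proj1 hs).
  - intros j hj. destruct (classic (j = k)) as [->|hn]; [exists a; apply supd_in; auto|].
    destruct (func_ex hs hj) as (y & _ & hy). exists y. apply supd_in. auto.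
  - intros j y z h h'. apply supd_in in h, h'. destruct h as [[h1 h2]|[-> ->]], h' as [[h1' h2']|[h1' ->]]; try tauto.
    apply (func_fun hs h2 h2').
Qed.

Lemma agree_supd m s s' k a : agree m s s' -> agree m (supd s k a) (supd s' k a).
Proof. intros h j hj y. rewrite !supd_in. now rewrite (h j hj y). Qed.

Lemma form_support R f : satisfaction L (opair U I) R -> is_formula L f ->
  exists m, m ∈ omega /\ forall s s', func s omega U -> func s' omega U -> agree m s s' -> (opair f s ∈ R <-> opair f s' ∈ R).
Proof.
  intros hR. unfold satisfaction, assignment in hR. rewrite univ_opair in hR.
  assert (hle : forall m m' s s', subset m m' -> agree m' s s' -> agree m s s') by (intros m m' s s' h h' k hk; auto).
  assert (hmax : forall m m', m ∈ omega -> m' ∈ omega -> exists m0, m0 ∈ omega /\ subset m m0 /\ subset m' m0).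
  { intros m m' hm hm'. destruct (ord_lt_or (nat_ord hm) (nat_ord hm')) as [h|h];
      [exists m'|exists m]; repeat split; auto using subset_refl. apply ord_le; auto. now apply nat_ord. }
  revert f. apply form_ind; [unfold agree; dfn| | | | |].
  - intros t u ht hu. destruct (term_support ht) as (m & hm & h), (term_support hu) as (m' & hm' & h').
    destruct (hmax m m' hm hm') as (m0 & hm0 & h1 & h2). exists m0. split; auto. intros s s' hs hs' ha.
    rewrite (proj1 (hR s hs) t u ht hu), (proj1 (hR s' hs') t u ht hu).
    assert (e : forall t m, is_term L t -> subset m m0 -> (forall s s', func s omega U -> func s' omega U -> agree m s s' -> forall v, vrel L U I s t v <-> vrel L U I s' t v) ->
       tval L (opair U I) s t = tval L (opair U I) s' t).
    { clear - HS hs hs' ha hle. intros t m ht hm h. apply tval_vrel; auto. apply (h s s' hs hs' (hle _ _ _ _ hm ha)). now apply tval_vrel. }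
    rewrite (e t m), (e u m'); auto. tauto.
  - intros n r t hn hr ht.
    destruct (@fin_bound M (fun i m => forall a, opair i a ∈ t -> forall s s', func s omega U -> func s' omega U -> agree m s s' ->
      forall v, vrel L U I s a v <-> vrel L U I s' a v) omega n) as (m & hm & h); auto.
    + assert (hd : Dfn cW (fun e => vrel L U I (e 0) (e 1) (e 2))) by (apply Dfn_vrel; dfn). unfold agree; dfn.
    + apply limit_omega.
    + intros i b c _ _ hbc h a ha s s' hs hs' hag. apply h; auto. eapply hle; eauto.
    + intros i hi. destruct (func_ex ht hi) as (a & ha' & ha). apply in_terms in ha'. destruct (term_support ha') as (m & hm & h). exists m. split; auto.
      intros a' ha1. now rewrite (func_fun ht ha1 ha).
    + exists m. split; auto. intros s s' hs hs' hag.
      rewrite (proj1 (proj2 (hR s hs)) n r t hn hr ht), (proj1 (proj2 (hR s' hs')) n r t hn hr ht).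
      apply ex_iff. intros v. apply and_iff_compat_l, and_iff_compat_r, all_iff. intros i.
      assert (H : i ∈ n -> tval L (opair U I) s (app t i) = tval L (opair U I) s' (app t i)).
      { intros hi. assert (hi' : is_term L (app t i)) by (apply in_terms; now apply (func_in ht)).
        apply tval_vrel; auto. apply (h i hi _ (func_ap ht hi) s s'); auto. now apply tval_vrel. }
      split; intros h' hi; rewrite (h' hi); rewrite H; auto.
  - intros f hf (m & hm & h). exists m. split; auto. intros s s' hs hs' ha.
    rewrite (proj1 (proj2 (proj2 (hR s hs))) f hf), (proj1 (proj2 (proj2 (hR s' hs'))) f hf). now rewrite (h s s').
  - intros f g hf hg (m & hm & h) (m' & hm' & h'). destruct (hmax m m' hm hm') as (m0 & hm0 & h1 & h2). exists m0. split; auto.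
    intros s s' hs hs' ha. rewrite (proj1 (proj2 (proj2 (proj2 (hR s hs)))) f g hf hg), (proj1 (proj2 (proj2 (proj2 (hR s' hs')))) f g hf hg).
    rewrite (h s s'), (h' s s'); eauto. tauto.
  - intros k f hk hf (m & hm & h). exists m. split; auto. intros s s' hs hs' ha.
    rewrite (proj2 (proj2 (proj2 (proj2 (hR s hs)))) k f hk hf), (proj2 (proj2 (proj2 (proj2 (hR s' hs')))) k f hk hf).
    apply all_iff. intros a. split; intros H hau; specialize (H hau);
      refine (proj1 (h _ _ _ _ _) H); auto using supd_func, agree_supd. apply agree_supd. intros j hj y. symmetry. now apply ha.
Qed.

Lemma models_support f : is_formula L f ->
  exists m, m ∈ omega /\ forall s s', func s omega U -> func s' omega U -> agree m s s' ->
    (models L (opair U I) f s <-> models L (opair U I) f s').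
Proof.
  intros hf. destruct (classic (exists R, satisfaction L (opair U I) R)) as [[R0 h0]|hn].
  - assert (H : forall R, satisfaction L (opair U I) R -> forall f, is_formula L f -> forall s, func s omega U -> (opair f s ∈ R <-> opair f s ∈ R0)).
    { intros R hR. unfold satisfaction, assignment in hR, h0. rewrite univ_opair in hR, h0.
      apply (form_ind (P := fun f => forall s, func s omega U -> (opair f s ∈ R <-> opair f s ∈ R0))); [dfn| | | | |].
      - intros t u ht hu s hs. now rewrite (proj1 (hR s hs)), (proj1 (h0 s hs)).
      - intros n r t hn hr ht s hs. now rewrite (proj1 (proj2 (hR s hs))), (proj1 (proj2 (h0 s hs))).
      - intros g hg IH s hs. now rewrite (proj1 (proj2 (proj2 (hR s hs)))), (proj1 (proj2 (proj2 (h0 s hs)))), IH.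
      - intros g g' hg hg' IH IH' s hs. now rewrite (proj1 (proj2 (proj2 (proj2 (hR s hs))))), (proj1 (proj2 (proj2 (proj2 (h0 s hs))))), IH, IH'.
      - intros k g hk hg IH s hs. rewrite (proj2 (proj2 (proj2 (proj2 (hR s hs))))), (proj2 (proj2 (proj2 (proj2 (h0 s hs))))); auto.
        apply all_iff. intros a. split; intros h ha; apply IH; auto using supd_func. }
    destruct (form_support h0 hf) as (m & hm & h). exists m. split; auto. intros s s' hs hs' ha.
    split; intros (R & hR & hr); exists R0; split; auto; apply (H R hR f hf) in hr; auto; now apply (h s s').
  (* Without any satisfaction relation [models] would be false throughout; existence of one is
     proved only later. *)
  - exists empty. split; [apply omega0|]. intros s s' _ _ _. split; intros (R & hR & _); destruct hn; eauto.
Qed.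

End Struct.

Lemma DfT_supd C `{whole_ctx M C} (s k a : (nat -> M) -> M) : DfT C s -> DfT C k -> DfT C a -> DfT C (fun e => supd (s e) (k e) (a e)).
Proof. intros. apply DfT_whole; [assumption|]. eapply Dfn_ext; [|intros e; symmetry; apply in_supd]. dfn. Qed.

Definition satc L U I R : Prop :=
  forall s, func s omega U ->
  (forall t u, is_term L t -> is_term L u ->
     (opair (feq t u) s ∈ R <-> exists v, vrel L U I s t v /\ vrel L U I s u v)) /\
  (forall n r t, n ∈ omega -> relsym n r ∈ L -> func t n (terms L) ->
     (opair (frel (relsym n r) t) s ∈ R <->
      exists v, func v n U /\ (forall i a b, opair i a ∈ t -> opair i b ∈ v -> vrel L U I s a b) /\
        exists Y, opair (relsym n r) Y ∈ I /\ v ∈ Y)) /\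
  (forall f, is_formula L f -> (opair (fneg f) s ∈ R <-> ~ opair f s ∈ R)) /\
  (forall f g, is_formula L f -> is_formula L g ->
     (opair (fand f g) s ∈ R <-> opair f s ∈ R /\ opair g s ∈ R)) /\
  (forall k f, k ∈ omega -> is_formula L f ->
     (opair (fall k f) s ∈ R <-> forall a, a ∈ U -> opair f (supd s k a) ∈ R)).

Lemma satc_iff L U I R : strc L U I -> (satisfaction L (opair U I) R <-> satc L U I R).
Proof.
  intros HS. unfold satisfaction, satc, assignment. rewrite univ_opair.
  apply all_iff. intros s.
  assert (H1 : func s omega U -> forall t u, is_term L t -> is_term L u ->
    (tval L (opair U I) s t = tval L (opair U I) s u <-> exists v, vrel L U I s t v /\ vrel L U I s u v)).
  { intros hs t u ht hu. split.
    - intros e. exists (tval L (opair U I) s t). split; apply (tval_vrel HS); auto.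
    - intros (v & h1 & h2). apply (tval_vrel HS) in h1, h2; auto. congruence. }
  assert (H2 : func s omega U -> forall n r t, n ∈ omega -> relsym n r ∈ L -> func t n (terms L) ->
    ((exists v, func v n U /\ (forall i, i ∈ n -> app v i = tval L (opair U I) s (app t i)) /\ v ∈ interp (opair U I) (relsym n r)) <->
     exists v, func v n U /\ (forall i a b, opair i a ∈ t -> opair i b ∈ v -> vrel L U I s a b) /\
        exists Y, opair (relsym n r) Y ∈ I /\ v ∈ Y)).
  { intros hs n r t hn hr ht. apply ex_iff. intros v. rewrite interp_opair. split; intros (hv & h1 & h2); split; auto; split.
    - intros i a b ha hb. destruct (func_dom ht ha) as [hi ha']. apply (tval_vrel HS); auto; [now apply in_terms|].
      rewrite <- (func_app ht ha), <- (func_app hv hb). symmetry. auto.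
    - exists (app I (relsym n r)). split; auto. now apply (strc_app _ _ HS).
    - intros i hi. symmetry. apply (tval_vrel HS); auto; [apply in_terms; now apply (func_in ht)|].
      apply (h1 i); [now apply (func_ap ht)|now apply (func_ap hv)].
    - destruct h2 as (Y & hY & h2). apply (strc_app _ _ HS) in hY as [_ <-]. auto. }
  split; intros h hs; specialize (h hs); destruct h as (h1 & h2 & h3); (split; [|split; [|exact h3]]).
  - intros t u ht hu. rewrite h1 by auto. auto.
  - intros n r t hn hr ht. rewrite h2 by auto. auto.
  - intros t u ht hu. rewrite h1 by auto. symmetry. auto.
  - intros n r t hn hr ht. rewrite h2 by auto. symmetry. auto.
Qed.

Definition modc L B f s : Prop := exists U I R, B = opair U I /\ satc L U I R /\ opair f s ∈ R.

Lemma modc_iff L B f s : structure L B -> (models L B f s <-> modc L B f s).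
Proof.
  intros hB. apply structure_inv in hB as (U & I & -> & HS). split.
  - intros (R & hR & h). exists U, I, R. split; auto. split; auto. now apply satc_iff.
  - intros (U' & I' & R & e & hR & h). apply opair_inj in e as [<- <-]. exists R. split; auto. now apply satc_iff.
Qed.

Lemma Dfn_modc C `{whole_ctx M C} (L B f s : (nat -> M) -> M) : DfT C L -> DfT C B -> DfT C f -> DfT C s ->
  Dfn C (fun e => modc (L e) (B e) (f e) (s e)).
Proof.
  intros. unfold modc, satc. dfnu; try (apply Dfn_is_term; dfn); try (apply Dfn_is_formula; dfn); try (apply Dfn_vrel; dfn);
    try (apply DfT_terms; dfn); try (apply DfT_supd; dfn).
Qed.

Definition compc j s : M := set_of (fun p => exists x y z, opair x y ∈ s /\ opair y z ∈ j /\ p = opair x z).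

Lemma in_compc j s p : p ∈ compc j s <-> exists x y z, opair x y ∈ s /\ opair y z ∈ j /\ p = opair x z.
Proof.
  unfold compc. rewrite in_set_of; [reflexivity|].
  destruct (@sep M (fun p => exists x y z, opair x y ∈ s /\ opair y z ∈ j /\ p = opair x z) (pow (pow (union2 (bigU (bigU s)) (bigU (bigU j)))))) as [b hb]; [dfn|].
  exists b. intros q. rewrite hb. split; [tauto|]. intros (x & y & z & h1 & h2 & ->). split; eauto 7.
  apply opair_in_pow; [apply (opair_mem2 h1)|apply (opair_mem2 h2)].
Qed.

Lemma compc_in j s x z : opair x z ∈ compc j s <-> exists y, opair x y ∈ s /\ opair y z ∈ j.
Proof.
  rewrite in_compc. split.
  - intros (x' & y & z' & h1 & h2 & e). apply opair_inj in e as [-> ->]. eauto.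
  - intros (y & h1 & h2). eauto 7.
Qed.

Lemma compc_func j s a b c : func s a b -> func j b c -> func (compc j s) a c.
Proof.
  intros hs hj. apply func_intro.
  - intros p hp. apply in_compc in hp as (x & y & z & h1 & h2 & ->). exists x, z.
    split; [apply (func_dom hs h1)|]. split; auto. apply (func_dom hj h2).
  - intros x hx. destruct (func_ex hs hx) as (y & hy & h1), (func_ex hj hy) as (z & _ & h2). exists z. apply compc_in. eauto.
  - intros x y z h h'. apply compc_in in h as (u & h1 & h2), h' as (u' & h1' & h2').
    rewrite (func_fun hs h1 h1') in h2. apply (func_fun hj h2 h2').
Qed.

Lemma comp_compc j s a b c : func s a b -> func j b c -> comp j s = compc j s.
Proof.
  intros hs hj. apply set_of_eq. intros p. rewrite in_compc. split.
  - intros (x & y & z & h1 & h2 & ->). exists x, y. split; auto. now rewrite (func_app hj h2).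
  - intros (x & y & h1 & ->). exists x, y, (app j y). split; auto. split; auto. apply (func_ap hj). apply (func_dom hs h1).
Qed.

Lemma DfT_compc C `{whole_ctx M C} (j s : (nat -> M) -> M) : DfT C j -> DfT C s -> DfT C (fun e => compc (j e) (s e)).
Proof. intros. apply DfT_whole; [assumption|]. eapply Dfn_ext; [|intros e; symmetry; apply in_compc]. dfn. Qed.

End Logic.

Ltac dfn_ext ::= lazymatch goal with
  | |- Dfn _ (fun e => func (@?a e) (@?b e) (@?c e)) => apply Dfn_func
  | |- Dfn _ (fun e => transitive (@?a e)) => apply Dfn_transitive
  | |- Dfn _ (fun e => ordinal (@?a e)) => apply Dfn_ordinal
  | |- Dfn _ (fun e => inductive_set (@?a e)) => apply Dfn_inductive
  | |- DfT _ (fun _ => omega) => apply DfT_omega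
  | |- DfT _ (fun e => tc (@?a e)) => apply DfT_tc
  | |- Dfn _ (fun e => isV (@?a e) (@?b e)) => apply Dfn_isV
  | |- Dfn _ (fun e => surj (@?a e) (@?b e) (@?c e)) => apply Dfn_surj
  | |- Dfn _ (fun e => is_term (@?a e) (@?b e)) => apply Dfn_is_term
  | |- Dfn _ (fun e => is_formula (@?a e) (@?b e)) => apply Dfn_is_formula
  | |- DfT _ (fun e => terms (@?a e)) => apply DfT_terms
  | |- DfT _ (fun e => supd (@?a e) (@?b e) (@?c e)) => apply DfT_supd
  | |- DfT _ (fun e => compc (@?a e) (@?b e)) => apply DfT_compc
  | |- Dfn _ (fun e => vrel (@?a e) (@?b e) (@?c e) (@?d e) (@?f e) (@?g e)) => apply Dfn_vrel
  | |- Dfn _ (fun e => modc (@?a e) (@?b e) (@?c e) (@?d e)) => apply Dfn_modc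
  end.

Section Tarski.
Context {M : zfc_model}.
Implicit Types x y z a b c d f g p u v w t k n L U I B s r R F m X Y Z j i : M.

Lemma tc_opair x y : x ∈ tc (opair x y) /\ y ∈ tc (opair x y).
Proof.
  assert (h : upair x y ∈ tc (opair x y)) by (apply tc_sub; apply in_upair; auto).
  split; apply (tc_trans h); apply in_upair; auto.
Qed.

Lemma tc_triple x y z : y ∈ tc (triple x y z) /\ z ∈ tc (triple x y z).
Proof.
  destruct (tc_opair x (opair y z)) as [_ h]. destruct (tc_opair y z) as [h1 h2].
  split; apply (tc_tc h); assumption.
Qed.

(** Recursion on formulas assigns to [f] the set of assignments satisfying it. [K f g s] is Tarski's
    clause for [f] at [s], reading the sets of the immediate subformulas from [g]; as components of
    [f] they belong to its transitive closure. *)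
Lemma satisfaction_exists L U I : strc L U I -> exists R, satisfaction L (opair U I) R.
Proof.
  intros HS.
  set (K := fun f g s =>
    (exists t u v, f = feq t u /\ vrel L U I s t v /\ vrel L U I s u v) \/
    (exists n r t, f = frel (relsym n r) t /\
      exists v, func v n U /\ (forall i a b, opair i a ∈ t -> opair i b ∈ v -> vrel L U I s a b) /\
        exists Y, opair (relsym n r) Y ∈ I /\ v ∈ Y) \/
    (exists f' Y, f = fneg f' /\ opair f' Y ∈ g /\ ~ s ∈ Y) \/
    (exists f1 f2 Y1 Y2, f = fand f1 f2 /\ opair f1 Y1 ∈ g /\ opair f2 Y2 ∈ g /\ s ∈ Y1 /\ s ∈ Y2) \/
    (exists k f' Y, f = fall k f' /\ opair f' Y ∈ g /\ forall a, a ∈ U -> supd s k a ∈ Y)).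
  assert (hK : Dfn cW (fun e => K (e 0) (e 1) (e 2))) by (unfold K; dfnu).
  destruct (@recursion M (fun f g y => forall s, s ∈ y <-> s ∈ funset omega U /\ K f g s)) as (F & hFd & hFu & hF).
  - dfn.
  - intros f g. destruct (@sep M (fun s => K f g s) (funset omega U)) as [y hy]; [dfn|].
    exists y. split; auto. intros y' hy'. apply ext. intros s. now rewrite hy, hy'.
  - destruct (@sep M (fun p => exists f s Y, p = opair f s /\ F f Y /\ s ∈ Y) (pow (pow (union2 (forms L) (funset omega U))))) as [R hR]; [dfn|].
    assert (hV : forall f, exists Y, F f Y /\ forall s, s ∈ Y <-> s ∈ funset omega U /\ exists g, (forall p, p ∈ g <-> exists z w, z ∈ tc f /\ F z w /\ p = opair z w) /\ K f g s).
    { intros f. destruct (hFu f) as (Y & hY & _). exists Y. split; auto.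
      apply hF in hY as (g & hg & hY). intros s. rewrite hY. split; [intros [h1 h2]; eauto|].
      intros [h1 (g' & hg' & h2)]. split; auto. replace g with g'; auto. apply ext. intros p. now rewrite hg, hg'. }
    assert (hRs : forall f s Y, is_formula L f -> func s omega U -> F f Y -> (opair f s ∈ R <-> s ∈ Y)).
    { intros f s Y hf hs hY. rewrite hR. split.
      - intros (_ & f' & s' & Y' & e & h1 & h2). apply opair_inj in e as [<- <-]. destruct (hFu f) as (Y0 & _ & hu).
        now rewrite <- (hu Y hY), (hu Y' h1).
      - intros h. split; [apply opair_in_pow; [now apply in_forms|now apply in_funset]|]. eauto 8. }
    assert (hRf : forall f s, is_formula L f -> func s omega U -> (opair f s ∈ R <-> exists g, (forall p, p ∈ g <-> exists z w, z ∈ tc f /\ F z w /\ p = opair z w) /\ K f g s)).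
    { intros f s hf hs. destruct (hV f) as (Y & hY & h). rewrite (hRs f s Y hf hs hY), h, in_funset. tauto. }
    assert (hgE : forall f, exists g, forall p, p ∈ g <-> exists z w, z ∈ tc f /\ F z w /\ p = opair z w).
    { intros f. destruct (@fun_of M F (tc f) hFd) as [g hg]; eauto. }
    assert (hgR : forall f g f' Y, (forall p, p ∈ g <-> exists z w, z ∈ tc f /\ F z w /\ p = opair z w) -> opair f' Y ∈ g -> F f' Y).
    { intros f g f' Y hg h. apply hg in h as (z & w & _ & h & e). now apply opair_inj in e as [-> ->]. }
    exists R. apply (satc_iff _ HS). intros s hs. split; [|split; [|split; [|split]]].
    + intros t u ht hu. rewrite hRf; auto using form_eq. split.
      * intros (g & _ & [h|[h|[h|[h|h]]]]).
        -- destruct h as (t' & u' & v & e & h). apply opair_inj in e as [_ e]. apply opair_inj in e as [-> ->]. eauto.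
        -- destruct h as (n & r & t' & e & _). apply tag_neq in e. discriminate e.
        -- destruct h as (f' & Y & e & _). apply tag_neq in e. discriminate e.
        -- destruct h as (f1 & f2 & Y1 & Y2 & e & _). apply tag_neq in e. discriminate e.
        -- destruct h as (k & f' & Y & e & _). apply tag_neq in e. discriminate e.
      * intros (v & h). destruct (hgE (feq t u)) as [g hg]. exists g. split; auto. left. exists t, u, v. tauto.
    + intros n r t hn hr ht. rewrite hRf; auto using form_rel. split.
      * intros (g & _ & [h|[h|[h|[h|h]]]]).
        -- destruct h as (t' & u' & v & e & h). apply tag_neq in e. discriminate e.
        -- destruct h as (n' & r' & t' & e & h). apply opair_inj in e as [_ e]. apply opair_inj in e as [e ->].
           apply opair_inj in e as [_ e]. apply opair_inj in e as [-> ->]. exact h.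
        -- destruct h as (f' & Y & e & _). apply tag_neq in e. discriminate e.
        -- destruct h as (f1 & f2 & Y1 & Y2 & e & _). apply tag_neq in e. discriminate e.
        -- destruct h as (k & f' & Y & e & _). apply tag_neq in e. discriminate e.
      * intros h. destruct (hgE (frel (relsym n r) t)) as [g hg]. exists g. split; auto. right. left. eauto.
    + intros f hf. rewrite (hRf (fneg f)); auto using form_neg. destruct (hFu f) as (Y & hY & hu). rewrite (hRs f s Y hf hs hY). split.
      * intros (g & hg & [h|[h|[h|[h|h]]]]).
        -- destruct h as (t' & u' & v & e & h). apply tag_neq in e. discriminate e.
        -- destruct h as (n' & r' & t' & e & h). apply tag_neq in e. discriminate e.
        -- destruct h as (f' & Y' & e & h1 & h2). apply opair_inj in e as [_ <-]. now rewrite (hu Y' (hgR _ _ _ _ hg h1)).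
        -- destruct h as (f1 & f2 & Y1 & Y2 & e & _). apply tag_neq in e. discriminate e.
        -- destruct h as (k & f' & Y' & e & _). apply tag_neq in e. discriminate e.
      * intros h. destruct (hgE (fneg f)) as [g hg]. exists g. split; auto. right. right. left. exists f, Y. split; auto.
        split; auto. apply hg. exists f, Y. split; auto. apply tc_opair.
    + intros f1 f2 hf1 hf2. rewrite (hRf (fand f1 f2)); auto using form_and.
      destruct (hFu f1) as (Y1 & hY1 & hu1), (hFu f2) as (Y2 & hY2 & hu2).
      rewrite (hRs f1 s Y1 hf1 hs hY1), (hRs f2 s Y2 hf2 hs hY2). split.
      * intros (g & hg & [h|[h|[h|[h|h]]]]).
        -- destruct h as (t' & u' & v & e & h). apply tag_neq in e. discriminate e.
        -- destruct h as (n' & r' & t' & e & h). apply tag_neq in e. discriminate e.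
        -- destruct h as (f' & Y' & e & h1 & h2). apply tag_neq in e. discriminate e.
        -- destruct h as (f1' & f2' & Y1' & Y2' & e & h1 & h2 & h3). apply opair_inj in e as [_ e]. apply opair_inj in e as [<- <-].
           rewrite (hu1 Y1' (hgR _ _ _ _ hg h1)), (hu2 Y2' (hgR _ _ _ _ hg h2)). exact h3.
        -- destruct h as (k & f' & Y' & e & _). apply tag_neq in e. discriminate e.
      * intros [h1 h2]. destruct (hgE (fand f1 f2)) as [g hg]. exists g. split; auto. right. right. right. left. exists f1, f2, Y1, Y2.
        split; auto. split; [|split; [|split]]; auto; apply hg; [exists f1, Y1|exists f2, Y2]; split; auto; apply tc_triple.
    + intros k f hk hf. rewrite (hRf (fall k f)); auto using form_all. destruct (hFu f) as (Y & hY & hu).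
      transitivity (forall a, a ∈ U -> supd s k a ∈ Y).
      * split.
        -- intros (g & hg & [h|[h|[h|[h|h]]]]).
           ++ destruct h as (t' & u' & v & e & h). apply tag_neq in e. discriminate e.
           ++ destruct h as (n' & r' & t' & e & h). apply tag_neq in e. discriminate e.
           ++ destruct h as (f' & Y' & e & h1 & h2). apply tag_neq in e. discriminate e.
           ++ destruct h as (f1 & f2 & Y1 & Y2 & e & _). apply tag_neq in e. discriminate e.
           ++ destruct h as (k' & f' & Y' & e & h1 & h2). apply opair_inj in e as [_ e]. apply opair_inj in e as [<- <-].
              rewrite (hu Y' (hgR _ _ _ _ hg h1)). exact h2.
        -- intros h. destruct (hgE (fall k f)) as [g hg]. exists g. split; auto. right. right. right. right. exists k, f, Y.
           split; auto. split; auto. apply hg. exists f, Y. split; auto. apply tc_triple.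
      * apply all_iff. intros a. split; intros h ha; specialize (h ha).
        -- apply (hRs f (supd s k a) Y); auto. now apply supd_func.
        -- apply (hRs f (supd s k a) Y) in h; auto. now apply supd_func.
Qed.

(** * Tarski's clauses for [models] *)

Section Clauses.
Variables (L U I : M).
Hypothesis HS : strc L U I.
Let B := opair U I.

(** Two full satisfaction relations agree on formulas, by induction; the existential quantifier in
    [models] can thus be replaced by any one of them. *)
Lemma models_R R f s : satisfaction L B R -> is_formula L f -> func s omega U -> (models L B f s <-> opair f s ∈ R).
Proof.
  intros h0 hf hs. split; [|intros h; exists R; auto]. intros (R' & hR & h). revert f hf s hs h.
  enough (H : forall f, is_formula L f -> forall s, func s omega U -> (opair f s ∈ R' <-> opair f s ∈ R)) by (intros; now apply H).
  unfold satisfaction, assignment, B in hR, h0. rewrite univ_opair in hR, h0.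
  apply (form_ind (P := fun f => forall s, func s omega U -> (opair f s ∈ R' <-> opair f s ∈ R))); [dfn| | | | |].
  - intros t u ht hu s hs. now rewrite (proj1 (hR s hs)), (proj1 (h0 s hs)).
  - intros n r t hn hr ht s hs. now rewrite (proj1 (proj2 (hR s hs))), (proj1 (proj2 (h0 s hs))).
  - intros g hg IH s hs. now rewrite (proj1 (proj2 (proj2 (hR s hs)))), (proj1 (proj2 (proj2 (h0 s hs)))), IH.
  - intros g g' hg hg' IH IH' s hs. now rewrite (proj1 (proj2 (proj2 (proj2 (hR s hs))))), (proj1 (proj2 (proj2 (proj2 (h0 s hs))))), IH, IH'.
  - intros k g hk hg IH s hs. rewrite (proj2 (proj2 (proj2 (proj2 (hR s hs))))), (proj2 (proj2 (proj2 (proj2 (h0 s hs))))); auto.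
    apply all_iff. intros a. split; intros h ha; apply IH; auto using supd_func.
Qed.

Lemma models_sat : exists R, satisfaction L B R /\ forall f s, is_formula L f -> func s omega U -> (models L B f s <-> opair f s ∈ R).
Proof. destruct (satisfaction_exists HS) as [R hR]. exists R. split; auto. intros. now apply models_R. Qed.

Lemma models_eq t u s : is_term L t -> is_term L u -> func s omega U ->
  (models L B (feq t u) s <-> tval L B s t = tval L B s u).
Proof.
  intros ht hu hs. destruct models_sat as (R & hR & h). rewrite h; auto using form_eq.
  unfold satisfaction, assignment, B in hR. rewrite univ_opair in hR. exact (proj1 (hR s hs) t u ht hu).
Qed.

Lemma models_rel n r t s : n ∈ omega -> relsym n r ∈ L -> func t n (terms L) -> func s omega U ->
  (models L B (frel (relsym n r) t) s <->
   exists v, func v n U /\ (forall i, i ∈ n -> app v i = tval L B s (app t i)) /\ v ∈ app I (relsym n r)).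
Proof.
  intros hn hr ht hs. destruct models_sat as (R & hR & h). rewrite h; auto using form_rel.
  unfold satisfaction, assignment, B in hR. rewrite univ_opair in hR. rewrite <- (interp_opair U I). exact (proj1 (proj2 (hR s hs)) n r t hn hr ht).
Qed.

Lemma models_neg f s : is_formula L f -> func s omega U -> (models L B (fneg f) s <-> ~ models L B f s).
Proof.
  intros hf hs. destruct models_sat as (R & hR & h). rewrite !h; auto using form_neg.
  unfold satisfaction, assignment, B in hR. rewrite univ_opair in hR. exact (proj1 (proj2 (proj2 (hR s hs))) f hf).
Qed.

Lemma models_and f g s : is_formula L f -> is_formula L g -> func s omega U ->
  (models L B (fand f g) s <-> models L B f s /\ models L B g s).
Proof.
  intros hf hg hs. destruct models_sat as (R & hR & h). rewrite !h; auto using form_and.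
  unfold satisfaction, assignment, B in hR. rewrite univ_opair in hR. exact (proj1 (proj2 (proj2 (proj2 (hR s hs)))) f g hf hg).
Qed.

Lemma models_all k f s : k ∈ omega -> is_formula L f -> func s omega U ->
  (models L B (fall k f) s <-> forall a, a ∈ U -> models L B f (supd s k a)).
Proof.
  intros hk hf hs. destruct models_sat as (R & hR & h). rewrite h; auto using form_all.
  unfold satisfaction, assignment, B in hR. rewrite univ_opair in hR. rewrite (proj2 (proj2 (proj2 (proj2 (hR s hs)))) k f hk hf).
  apply all_iff. intros a. split; intros h1 ha; apply h; auto using supd_func.
Qed.

Lemma tval_var s k : k ∈ omega -> func s omega U -> tval L B s (tvar k) = app s k.
Proof. intros hk hs. apply (tval_vrel HS); auto; [now apply term_var|]. apply vrel_var. now apply (func_ap hs). Qed.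

Lemma models_eqv k l s : k ∈ omega -> l ∈ omega -> func s omega U ->
  (models L B (feq (tvar k) (tvar l)) s <-> app s k = app s l).
Proof. intros hk hl hs. rewrite models_eq, !tval_var; auto using term_var. tauto. Qed.

(** The function on 2 with values [a] and [b]: this, and not [opair], is how the argument tuple of a
    binary symbol is encoded. *)
Definition pr a b : M := upair (opair (num 0) a) (opair (num 1) b).

Lemma in_num1 x : x ∈ num 1 <-> x = @num M 0.
Proof. simpl. rewrite in_succ. pose proof (@in_empty M x). tauto. Qed.

Lemma in_num2 x : x ∈ num 2 <-> x = num 0 \/ x = @num M 1.
Proof. change (num 2) with (succ (@num M 1)). rewrite in_succ, in_num1. tauto. Qed.

Lemma pr_in a b x y : opair x y ∈ pr a b <-> (x = num 0 /\ y = a) \/ (x = num 1 /\ y = b).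
Proof. unfold pr. now rewrite in_upair, !opair_eq. Qed.

Lemma num01 : @num M 0 <> num 1.
Proof. intros h. apply num_inj in h. discriminate h. Qed.

Lemma pr_func a b Z : a ∈ Z -> b ∈ Z -> func (pr a b) (num 2) Z.
Proof.
  intros ha hb. apply func_intro.
  - intros p hp. apply in_upair in hp as [-> | ->]; [exists (num 0), a|exists (num 1), b]; rewrite in_num2; auto.
  - intros x hx. apply in_num2 in hx as [-> | ->]; [exists a|exists b]; apply pr_in; auto.
  - intros x y z h h'. apply pr_in in h, h'. pose proof num01. intuition congruence.
Qed.

Lemma func2_pr v Z : func v (num 2) Z -> v = pr (app v (num 0)) (app v (num 1)).
Proof.
  intros hv. apply (func_ext hv (pr_func (func_in hv (x := num 0) ltac:(apply in_num2; auto)) (func_in hv (x := num 1) ltac:(apply in_num2; auto)))).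
  intros x y h. apply pr_in. assert (hx := proj1 (func_dom hv h)). apply in_num2 in hx as [-> | ->]; [left|right]; split; auto;
    symmetry; now apply (func_app hv).
Qed.

Lemma app_pr a b : app (pr a b) (num 0) = a /\ app (pr a b) (num 1) = b.
Proof.
  assert (h := @pr_func a b (upair a b) ltac:(apply in_upair; auto) ltac:(apply in_upair; auto)).
  split; apply (func_app h); apply pr_in; auto.
Qed.

Lemma models_rel2 r k l s : relsym (num 2) r ∈ L -> k ∈ omega -> l ∈ omega -> func s omega U ->
  (models L B (frel (relsym (num 2) r) (pr (tvar k) (tvar l))) s <-> pr (app s k) (app s l) ∈ app I (relsym (num 2) r)).
Proof.
  intros hr hk hl hs. rewrite models_rel; auto; [|apply (num_omega 2)|apply pr_func; apply in_terms; now apply term_var].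
  destruct (app_pr (tvar k) (tvar l)) as [e0 e1]. split.
  - intros (v & hv & h & hI). rewrite (func2_pr hv) in hI. rewrite !h in hI by (apply in_num2; auto).
    now rewrite e0, e1, !tval_var in hI.
  - intros h. exists (pr (app s k) (app s l)). split; [apply pr_func; now apply (func_in hs)|]. split; auto.
    intros i hi. destruct (app_pr (app s k) (app s l)) as [e2 e3].
    apply in_num2 in hi as [-> | ->]; [rewrite e0, e2|rewrite e1, e3]; symmetry; now apply tval_var.
Qed.

Lemma one_in x y a : opair x y ∈ singleton (opair empty a) <-> x = empty /\ y = a.
Proof. now rewrite in_singleton, opair_eq. Qed.

Lemma one_func a Z : a ∈ Z -> func (singleton (opair empty a)) (num 1) Z.
Proof.
  intros ha. apply func_intro.
  - intros p hp. apply in_singleton in hp as ->. exists empty, a. rewrite in_num1. auto.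
  - intros x hx. apply in_num1 in hx as ->. exists a. now apply one_in.
  - intros x y z h h'. apply one_in in h, h'. intuition congruence.
Qed.

Lemma models_rel1 r k s : relsym (num 1) r ∈ L -> k ∈ omega -> func s omega U ->
  (models L B (frel (relsym (num 1) r) (singleton (opair empty (tvar k)))) s <-> singleton (opair empty (app s k)) ∈ app I (relsym (num 1) r)).
Proof.
  intros hr hk hs. assert (h1 := @one_func (tvar k) (terms L) ltac:(now apply in_terms, term_var)).
  assert (e0 : app (singleton (opair empty (tvar k))) empty = tvar k) by (apply (func_app h1), one_in; auto).
  assert (h2 := @one_func (app s k) U (func_in hs hk)).
  rewrite models_rel; auto; [|apply (num_omega 1)]. split.
  - intros (v & hv & h & hI). replace (singleton (opair empty (app s k))) with v; auto.
    apply (func_ext hv h2). intros x y hxy. apply one_in. assert (hx := proj1 (func_dom hv hxy)). apply in_num1 in hx as ->. split; auto.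
    rewrite <- (func_app hv hxy), h by now apply in_num1. change (@num M 0) with (@empty M). rewrite e0. now apply tval_var.
  - intros h. eexists. split; [exact h2|]. split; auto. intros i hi. apply in_num1 in hi as ->. change (@num M 0) with (@empty M).
    rewrite e0, tval_var by auto. apply (func_app h2). apply one_in. auto.
Qed.

End Clauses.

(** * Standard formulas as formulas of the model *)

Definition eps_rel X : M := set_of (fun u => func u (num 2) X /\ app u (num 0) ∈ app u (num 1)).

Lemma in_eps_rel X u : u ∈ eps_rel X <-> func u (num 2) X /\ app u (num 0) ∈ app u (num 1).
Proof.
  unfold eps_rel. rewrite in_set_of; [reflexivity|].
  destruct (@sep M (fun u => func u (num 2) X /\ exists a b, opair (num 0) a ∈ u /\ opair (num 1) b ∈ u /\ a ∈ b) (pow (pow (pow (union2 (num 2) X)))))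
    as [b hb]; [dfn|].
  exists b. intros z. rewrite hb. split.
  - intros (_ & hz & a & a' & h1 & h2 & h3). split; auto. now rewrite (func_app hz h1), (func_app hz h2).
  - intros [hz h]. split; [now apply func_in_pow|]. split; auto. exists (app z (num 0)), (app z (num 1)).
    split; [|split; auto]; apply (func_ap hz); apply in_num2; auto.
Qed.

Lemma pr_eps_rel X a b : pr a b ∈ eps_rel X <-> a ∈ X /\ b ∈ X /\ a ∈ b.
Proof.
  rewrite in_eps_rel. destruct (app_pr a b) as [-> ->]. split.
  - intros [h h']. split; [|split; auto]; [apply (func_dom h (x := num 0))|apply (func_dom h (x := num 1))]; apply pr_in; auto.
  - intros (h1 & h2 & h3). split; auto. now apply pr_func.
Qed.

Definition eps_I X : M := singleton (opair eps_sym (eps_rel X)).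

Lemma eps_structE X : eps_struct X = opair X (eps_I X).
Proof. reflexivity. Qed.

Lemma eps_sigE n r : relsym n r ∈ eps_sig <-> n = @num M 2 /\ r = empty.
Proof.
  unfold eps_sig, eps_sym, relsym, triple. rewrite in_singleton, !opair_eq. tauto.
Qed.

Lemma eps_nofun n r : ~ funsym n r ∈ @eps_sig M.
Proof.
  unfold eps_sig, eps_sym, relsym, funsym, triple. rewrite in_singleton. intros h. apply tag_neq in h. discriminate h.
Qed.

Lemma eps_I_func X : func (eps_I X) eps_sig (singleton (eps_rel X)).
Proof.
  unfold eps_I, eps_sig. apply func_intro.
  - intros p hp. apply in_singleton in hp as ->. exists eps_sym, (eps_rel X). rewrite !in_singleton. auto.
  - intros x hx. apply in_singleton in hx as ->. exists (eps_rel X). now apply in_singleton.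
  - intros x y z h h'. rewrite in_singleton, opair_eq in h, h'. intuition congruence.
Qed.

Lemma eps_I_app X : app (eps_I X) eps_sym = eps_rel X.
Proof. apply (func_app (eps_I_func X)). now apply in_singleton. Qed.

Lemma eps_strc X : strc eps_sig X (eps_I X).
Proof.
  split; [exists (singleton (eps_rel X)); apply eps_I_func| |].
  - intros n r _ h v hv. apply eps_sigE in h as [-> ->]. change (relsym (num 2) empty) with (@eps_sym M) in hv.
    rewrite eps_I_app, in_eps_rel in hv. apply hv.
  - intros n r _ h. destruct (eps_nofun h).
Qed.

Lemma eps_structure X : structure eps_sig (eps_struct X).
Proof.
  exists X, (eps_I X). split; [reflexivity|]. split; [exists (singleton (eps_rel X)); apply eps_I_func|].
  intros n r hn. split; intros h; [|destruct (eps_nofun h)]. intros v hv. apply in_funset. now apply (strc_rel (eps_strc X) hn h).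
Qed.

Definition emodels X f s : Prop := models eps_sig (eps_struct X) f s.

Lemma emodels_mem X k l s : k ∈ omega -> l ∈ omega -> func s omega X ->
  (emodels X (frel eps_sym (pr (tvar k) (tvar l))) s <-> app s k ∈ app s l).
Proof.
  intros hk hl hs. unfold emodels. rewrite eps_structE. unfold eps_sym.
  rewrite (models_rel2 (eps_strc X)); auto; [|now apply in_singleton].
  change (relsym (num 2) empty) with (@eps_sym M). rewrite eps_I_app, pr_eps_rel.
  pose proof (func_in hs hk). pose proof (func_in hs hl). tauto.
Qed.

(** Turns a formula of Rocq into a set of the model, expressing it by the fewer connectives
    available there. *)
Fixpoint code (f : fml) : M :=
  match f with
  | Mem x y => frel eps_sym (pr (tvar (num x)) (tvar (num y)))
  | Eq x y => feq (tvar (num x)) (tvar (num y))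
  | Neg f => fneg (code f)
  | And f g => fand (code f) (code g)
  | Or f g => fneg (fand (fneg (code f)) (fneg (code g)))
  | Imp f g => fneg (fand (code f) (fneg (code g)))
  | Ex x f => fneg (fall (num x) (fneg (code f)))
  | All x f => fall (num x) (code f)
  end.

Lemma code_form (f : fml) : is_formula eps_sig (code f).
Proof.
  induction f; simpl; auto using form_neg, form_and, form_all, num_omega.
  - apply form_rel; [apply (num_omega 2)|now apply in_singleton|].
    apply pr_func; apply in_terms; apply term_var; apply num_omega.
  - apply form_eq; apply term_var; apply num_omega.
Qed.

Lemma sat_code X (f : fml) : forall (e : nat -> M) s, func s omega X -> (forall i : nat, i < bnd f -> opair (num i) (e i) ∈ s) ->
  (emodels X (code f) s <-> sat (@mem M) (fun x => x ∈ X) e f).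
Proof.
  assert (HS := eps_strc X). unfold emodels. rewrite eps_structE.
  induction f; cbn [code sat bnd]; intros e s hs he.
  - change (models eps_sig (opair X (eps_I X))) with (emodels X). rewrite emodels_mem by (auto using num_omega).
    rewrite (func_app hs (he x ltac:(lia))), (func_app hs (he y ltac:(lia))). tauto.
  - rewrite (models_eqv HS) by (auto using num_omega).
    rewrite (func_app hs (he x ltac:(lia))), (func_app hs (he y ltac:(lia))). tauto.
  - rewrite (models_neg HS), (IHf e s) by (auto using code_form). tauto.
  - rewrite (models_and HS), (IHf1 e s), (IHf2 e s) by (auto using code_form; intros; apply he; lia). tauto.
  - rewrite (models_neg HS), (models_and HS), !(models_neg HS), (IHf1 e s), (IHf2 e s)
      by (auto using code_form, form_neg, form_and; intros; apply he; lia). tauto.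
  - rewrite (models_neg HS), (models_and HS), (models_neg HS), (IHf1 e s), (IHf2 e s)
      by (auto using code_form, form_neg, form_and; intros; apply he; lia). tauto.
  - rewrite (models_neg HS), (models_all HS) by (auto using code_form, form_neg, form_all, num_omega).
    assert (H : forall a, a ∈ X -> models eps_sig (opair X (eps_I X)) (code f) (supd s (num x) a) <-> sat (@mem M) (fun x => x ∈ X) (upd e x a) f).
    { intros a ha. apply IHf; [apply supd_func; auto using num_omega|]. intros i hi. apply supd_in.
      destruct (Nat.eq_dec i x) as [->|hn]; [right; now rewrite upd_same|left].
      rewrite upd_other by auto. split; [intros h; apply num_inj in h; auto|apply he; lia]. }
    split.
    + intros h. apply NNPP. intros hn. apply h. intros a ha. rewrite (models_neg HS) by (auto using code_form, supd_func, num_omega).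
      rewrite H by auto. intros h'. eauto.
    + intros (a & ha & h') h. specialize (h a ha). rewrite (models_neg HS) in h by (auto using code_form, supd_func, num_omega).
      apply h. now apply H.
  - rewrite (models_all HS) by (auto using code_form, num_omega). apply all_iff. intros a.
    assert (H : a ∈ X -> models eps_sig (opair X (eps_I X)) (code f) (supd s (num x) a) <-> sat (@mem M) (fun x => x ∈ X) (upd e x a) f).
    { intros ha. apply IHf; [apply supd_func; auto using num_omega|]. intros i hi. apply supd_in.
      destruct (Nat.eq_dec i x) as [->|hn]; [right; now rewrite upd_same|left].
      rewrite upd_other by auto. split; [intros h; apply num_inj in h; auto|apply he; lia]. }
    split; intros h ha; apply H; auto.
Qed.

Definition cst a : M := set_of (fun p => exists k, k ∈ omega /\ p = opair k a).

Lemma cst_in a x y : opair x y ∈ cst a <-> x ∈ omega /\ y = a.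
Proof.
  unfold cst. rewrite in_set_of.
  - split; [intros (k & hk & e); now apply opair_inj in e as [-> ->]|intros [h ->]; eauto].
  - destruct (@sep M (fun p => exists k, k ∈ omega /\ p = opair k a) (pow (pow (union2 omega (singleton a))))) as [b hb]; [dfn|].
    exists b. intros z. rewrite hb. split; [tauto|]. intros (k & hk & ->). split; eauto. apply opair_in_pow; auto. now apply in_singleton.
Qed.

Lemma cst_func a Z : a ∈ Z -> func (cst a) omega Z.
Proof.
  intros ha. apply func_intro.
  - intros p hp. unfold cst in hp. rewrite in_set_of in hp.
    + destruct hp as (k & hk & ->). eauto 6.
    + destruct (@sep M (fun p => exists k, k ∈ omega /\ p = opair k a) (pow (pow (union2 omega (singleton a))))) as [b hb]; [dfn|].
      exists b. intros z. rewrite hb. split; [tauto|]. intros (k & hk & ->). split; eauto. apply opair_in_pow; auto. now apply in_singleton.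
  - intros k hk. exists a. now apply cst_in.
  - intros x y z h h'. apply cst_in in h, h'. intuition congruence.
Qed.

(** A Rocq sequence need not be a set of the model, so only its first [q] values are recorded. The
    other variables, nonstandard ones included, receive [e 0], which keeps the values in any set
    containing the range of [e]. *)
Fixpoint asg (e : nat -> M) (q : nat) : M :=
  match q with 0 => cst (e 0) | S q => supd (asg e q) (num q) (e q) end.

Lemma asg_func (e : nat -> M) (q : nat) Z : (forall i : nat, e i ∈ Z) -> func (asg e q) omega Z.
Proof. intros h. induction q; simpl; [now apply cst_func|]. apply supd_func; auto using num_omega. Qed.

Lemma asg_in (e : nat -> M) (q i : nat) : i < q -> opair (num i) (e i) ∈ asg e q.
Proof.
  induction q; simpl; intros h; [lia|]. apply supd_in. destruct (Nat.eq_dec i q) as [->|hn]; [auto|left].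
  split; [intros h'; apply num_inj in h'; auto|]. apply IHq. lia.
Qed.

Lemma asg_Good D (e : nat -> M) (q : nat) : Good D -> (forall i : nat, D (e i)) -> D (asg e q).
Proof.
  intros hD he. induction q; simpl.
  - apply (Good_func hD (good_omega hD) (b := singleton (e 0))).
    + rewrite singleton_upair. now apply (good_upair hD).
    + apply cst_func. now apply in_singleton.
  - apply (good_sub hD (y := union2 (asg e q) (singleton (opair (num q) (e q))))).
    + intros p hp. rewrite in_union2, in_singleton. apply in_supd in hp. tauto.
    + apply (Good_union2 hD); auto. rewrite singleton_upair. apply (good_upair hD); apply (Good_opair hD); auto;
        apply (good_trans hD (num_omega q) (good_omega hD)).
Qed.

Lemma sat_asg X (f : fml) (e : nat -> M) (q : nat) : (forall i : nat, e i ∈ X) -> bnd f <= q ->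
  (emodels X (code f) (asg e q) <-> sat (@mem M) (fun x => x ∈ X) e f).
Proof. intros he hq. apply sat_code; [now apply asg_func|]. intros i hi. apply asg_in. lia. Qed.

Lemma eps_elementary_func X Y i : eps_elementary X Y i -> func i X Y.
Proof. intros [h _]. now rewrite !eps_structE, !univ_opair in h. Qed.

Lemma elementary_sat X Y i : eps_elementary X Y i -> forall (f : fml) (e : nat -> M), (forall n : nat, e n ∈ X) ->
  (sat (@mem M) (fun x => x ∈ X) e f <-> sat (@mem M) (fun x => x ∈ Y) (fun n : nat => app i (e n)) f).
Proof.
  intros h f e he. assert (hi := eps_elementary_func h). destruct h as [_ h].
  assert (hs := asg_func (bnd f) he). rewrite <- (sat_asg (f := f) (q := bnd f) he) by lia. unfold emodels.
  rewrite h; [|apply code_form|]. 2: { unfold assignment. now rewrite eps_structE, univ_opair. }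
  apply sat_code.
  - rewrite (comp_compc hs hi). apply (compc_func hs hi).
  - intros n hn. rewrite (comp_compc hs hi), compc_in. exists (e n). split; [now apply asg_in|]. now apply (func_ap hi).
Qed.

Lemma idfun_in a x y : opair x y ∈ idfun a <-> x ∈ a /\ y = x.
Proof.
  unfold idfun. rewrite in_set_of.
  - split; [intros (z & hz & e); now apply opair_inj in e as [-> ->]|intros [h ->]; eauto].
  - destruct (@sep M (fun p => exists x, x ∈ a /\ p = opair x x) (pow (pow (union2 a a)))) as [b hb]; [dfn|].
    exists b. intros z. rewrite hb. split; [tauto|]. intros (k & hk & ->). split; eauto. now apply opair_in_pow.
Qed.

Lemma idfun_func a b : subset a b -> func (idfun a) a b.
Proof.
  intros hab. apply func_intro.
  - intros p hp. unfold idfun in hp. rewrite in_set_of in hp.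
    + destruct hp as (x & hx & ->). eauto 7.
    + destruct (@sep M (fun p => exists x, x ∈ a /\ p = opair x x) (pow (pow (union2 a a)))) as [c hc]; [dfn|].
      exists c. intros z. rewrite hc. split; [tauto|]. intros (k & hk & ->). split; eauto. now apply opair_in_pow.
  - intros x hx. exists x. now apply idfun_in.
  - intros x y z h h'. apply idfun_in in h, h'. intuition congruence.
Qed.

Lemma comp_id s X Y : subset X Y -> func s omega X -> comp (idfun X) s = s.
Proof.
  intros hXY hs. assert (hi := idfun_func hXY). rewrite (comp_compc hs hi). symmetry.
  apply (func_ext hs (compc_func hs hi)). intros x y h. apply compc_in. exists y. split; auto. apply idfun_in.
  split; auto. apply (func_dom hs h).
Qed.

Lemma elementary_sub_sat X Y : elementary_sub X Y -> forall (f : fml) (e : nat -> M), (forall n : nat, e n ∈ X) ->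
  (sat (@mem M) (fun x => x ∈ X) e f <-> sat (@mem M) (fun x => x ∈ Y) e f).
Proof.
  intros [hXY h] f e he. rewrite (elementary_sat h f he). assert (hi := idfun_func hXY).
  replace (fun n : nat => app (idfun X) (e n)) with e; [tauto|]. apply functional_extensionality. intros n. symmetry.
  apply (func_app hi). apply idfun_in. auto.
Qed.

Lemma Dfn_emodels C `{whole_ctx M C} (X f s : (nat -> M) -> M) : DfT C X -> DfT C f -> DfT C s -> Dfn C (fun e => emodels (X e) (f e) (s e)).
Proof.
  intros. eapply Dfn_ext; [|intros e; symmetry; unfold emodels; apply modc_iff, eps_structure].
  unfold eps_struct, eps_sig. dfnu. change (DfT C (fun e => eps_rel (X e))).
  apply DfT_whole; [assumption|].
  eapply (Dfn_ext (P := fun e => func (e 0) (num 2) (X (fun i : nat => e (S i))) /\ exists a b, opair (num 0) a ∈ e 0 /\ opair (num 1) b ∈ e 0 /\ a ∈ b)); [dfn|].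
  intros e. rewrite in_eps_rel. generalize (e 0). intros u. split.
  - intros (hu & a & b & h1 & h2 & h3). split; auto. now rewrite (func_app hu h1), (func_app hu h2).
  - intros [hu h]. split; auto. exists (app u (num 0)), (app u (num 1)). split; [|split; auto]; apply (func_ap hu), in_num2; auto.
Qed.

Lemma eps_term t : is_term eps_sig t -> exists k, k ∈ omega /\ t = tvar k.
Proof.
  apply (term_ind (P := fun t => exists k, k ∈ omega /\ t = tvar k)); [dfnu|eauto|]. intros n r t' _ h. destruct (eps_nofun h).
Qed.

Lemma eps_ind (P : M -> Prop) : Dfn cW (fun e => P (e 0)) ->
  (forall k l, k ∈ omega -> l ∈ omega -> P (feq (tvar k) (tvar l))) ->
  (forall k l, k ∈ omega -> l ∈ omega -> P (frel eps_sym (pr (tvar k) (tvar l)))) ->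
  (forall f, is_formula eps_sig f -> P f -> P (fneg f)) ->
  (forall f g, is_formula eps_sig f -> is_formula eps_sig g -> P f -> P g -> P (fand f g)) ->
  (forall k f, k ∈ omega -> is_formula eps_sig f -> P f -> P (fall k f)) ->
  forall f, is_formula eps_sig f -> P f.
Proof.
  intros hd h1 h2 h3 h4 h5. apply form_ind; auto.
  - intros t u ht hu. apply eps_term in ht as (k & hk & ->), hu as (l & hl & ->). auto.
  - intros n r t _ hr ht. apply eps_sigE in hr as [-> ->]. rewrite (func2_pr ht).
    assert (h : forall i, i ∈ num 2 -> exists k, k ∈ omega /\ app t i = tvar k) by (intros i hi; apply eps_term, in_terms; now apply (func_in ht)).
    destruct (h (num 0)) as (k & hk & ->); [apply in_num2; auto|].
    destruct (h (num 1)) as (l & hl & ->); [apply in_num2; auto|]. now apply h2.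
Qed.

Lemma eps_form_V f a : limit a -> is_formula eps_sig f -> f ∈ Vlev a.
Proof.
  intros ha hf. apply hf. apply formula_closed_V; auto. intros x hx. apply in_singleton in hx as ->.
  repeat apply limit_opair; auto; try apply (limit_num 0 ha). apply (limit_num 2 ha).
Qed.

Lemma emodels_support X f : is_formula eps_sig f ->
  exists m, m ∈ omega /\ forall s s', func s omega X -> func s' omega X -> agree m s s' -> (emodels X f s <-> emodels X f s').
Proof. apply (models_support (eps_strc X)). Qed.

Lemma tarski_vaught X Y : subset X Y ->
  (forall f k s, is_formula eps_sig f -> k ∈ omega -> func s omega X ->
     (exists a, a ∈ Y /\ emodels Y f (supd s k a)) -> exists a, a ∈ X /\ emodels Y f (supd s k a)) ->
  elementary_sub X Y.
Proof.
  intros hXY hTV.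
  assert (hsY : forall s, func s omega X -> func s omega Y) by (intros s hs; apply (func_cod hs); intros x y h; apply hXY; apply (func_dom hs h)).
  assert (HX := eps_strc X). assert (HY := eps_strc Y).
  assert (H : forall f, is_formula eps_sig f -> forall s, func s omega X -> (emodels X f s <-> emodels Y f s)).
  { apply (eps_ind (P := fun f => forall s, func s omega X -> (emodels X f s <-> emodels Y f s))).
    - dfn; apply Dfn_emodels; dfn.
    - intros k l hk hl s hs. unfold emodels. rewrite !eps_structE, (models_eqv HX), (models_eqv HY) by auto. tauto.
    - intros k l hk hl s hs. rewrite !emodels_mem by auto. tauto.
    - intros f hf IH s hs. unfold emodels. rewrite !eps_structE, (models_neg HX), (models_neg HY) by auto.
      apply not_iff_compat. now apply IH.
    - intros f g hf hg IH IH' s hs. unfold emodels. rewrite !eps_structE, (models_and HX), (models_and HY) by auto.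
      assert (h1 := IH s hs). assert (h2 := IH' s hs). unfold emodels in h1, h2. rewrite !eps_structE in h1, h2. tauto.
    - intros k f hk hf IH s hs. unfold emodels. rewrite !eps_structE, (models_all HX), (models_all HY) by auto. split.
      + intros h a ha. apply NNPP. intros hn. destruct (hTV (fneg f) k s) as (b & hb & h'); auto using form_neg.
        * exists a. split; auto. unfold emodels. rewrite eps_structE, (models_neg HY); auto using supd_func.
        * unfold emodels in h'. rewrite eps_structE, (models_neg HY) in h'; auto using supd_func. apply h'.
          apply (IH (supd s k b)); [now apply supd_func|]. apply h. auto.
      + intros h a ha. apply (IH (supd s k a)); [now apply supd_func|]. apply h. auto. }
  split; auto. split.
  - rewrite !eps_structE, !univ_opair. now apply idfun_func.
  - intros f s hf hs. unfold assignment in hs. rewrite eps_structE, univ_opair in hs. rewrite (comp_id hXY hs). now apply H.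
Qed.

(** * Skolem hulls *)

(** Elements of the hull are named by codes in V_al: the pair (0, x) names x, and the pair (1, (f,
    k, si)) names a chosen witness for f at variable k, where the finite sequence si lists codes of
    the parameters. A limit level contains its finite sequences, so it contains all codes and maps
    onto the hull. The default value, for non-codes and for variables outside si, is [p0]. *)
Lemma skolem_hull al Z p0 : limit al -> subset (Vlev al) Z -> p0 ∈ Z ->
  exists Y G, elementary_sub Y Z /\ subset (Vlev al) Y /\ p0 ∈ Y /\ surj G (Vlev al) Y.
Proof.
  intros hal hVZ hp0. destruct (choice_fun (pow Z)) as (ch & hch1 & hch2 & hch3).
  set (asgof := fun si g s => forall q, q ∈ s <-> exists i w, q = opair i w /\
     ((exists u, opair i u ∈ si /\ opair u w ∈ g) \/ (i ∈ omega /\ (~ exists u, opair i u ∈ si) /\ w = p0))).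
  set (val := fun c g v => (exists x, x ∈ Z /\ c = opair (num 0) x /\ v = x) \/
     (exists f k si s y, c = opair (num 1) (triple f k si) /\ asgof si g s /\
        (forall a, a ∈ y <-> a ∈ Z /\ emodels Z f (supd s k a)) /\ opair y v ∈ ch)).
  assert (hvd : Dfn cW (fun e => val (e 0) (e 1) (e 2))) by (unfold val, asgof; dfnu; apply Dfn_emodels; dfn).
  assert (hvu : forall c g v v', val c g v -> val c g v' -> v = v').
  { intros c g v v' [(x & _ & -> & ->)|(f & k & si & s & y & -> & h1 & h2 & h3)].
    - intros [(x' & _ & e & ->)|(f & k & si & s & y & e & _)]; [now apply opair_inj in e|apply tag_neq in e; discriminate e].
    - intros [(x' & _ & e & ->)|(f' & k' & si' & s' & y' & e & h1' & h2' & h3')]; [apply tag_neq in e; discriminate e|].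
      apply opair_inj in e as [_ e]. apply opair_inj in e as [<- e]. apply opair_inj in e as [<- <-].
      assert (s = s') by (apply ext; intros q; now rewrite (h1 q), (h1' q)). subst s'.
      assert (y = y') by (apply ext; intros q; now rewrite (h2 q), (h2' q)). subst y'. apply (hch2 y v v'); auto. }
  destruct (@recursion M (fun c g v => val c g v \/ ((~ exists v', val c g v') /\ v = p0))) as (F & hFd & hFu & hF).
  { dfn. }
  { intros c g. destruct (classic (exists v, val c g v)) as [[v hv]|hn].
    - exists v. split; auto. intros v' [h|[h _]]; [now apply (hvu c g)|destruct h; eauto].
    - exists p0. split; auto. intros v' [h|[_ h]]; auto. destruct hn. eauto. }
  assert (hFZ : forall c v, F c v -> v ∈ Z).
  { intros c v h. apply hF in h as (g & _ & [[(x & hx & _ & ->)|(f & k & si & s & y & _ & _ & _ & h)]|[_ ->]]); auto.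
    apply hch1 in h as [h1 h2]. apply in_pow in h1. auto. }
  destruct (@repl M F (Vlev al) hFd) as [Y hY]; [auto|].
  destruct (@fun_of_func M F (Vlev al) Y hFd) as (G & hG & hGF); [auto|intros; apply hY; eauto|].
  assert (hVY : subset (Vlev al) Y).
  { intros x hx. apply hY. exists (opair (num 0) x). split; [apply limit_opair; auto; apply (limit_num 0 hal)|].
    destruct (hFu (opair (num 0) x)) as (v & hv & _). assert (e : v = x); [|now rewrite e in hv].
    apply hF in hv as (g & _ & [hv|[hn _]]).
    - apply (hvu (opair (num 0) x) g); auto. left. eauto.
    - destruct hn. exists x. left. eauto. }
  assert (hpY : p0 ∈ Y).
  { apply hY. exists empty. split; [apply (limit_num 0 hal)|]. destruct (hFu empty) as (v & hv & _). replace p0 with v; auto.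
    apply hF in hv as (g & _ & [hv|[_ hv]]); auto. exfalso.
    assert (hne : forall x y, @empty M <> opair x y).
    { intros x y e. apply (@in_empty M (upair x y)). rewrite e. apply in_upair. auto. }
    destruct hv as [(x & _ & e & _)|(f & k & si & s & y & e & _)]; destruct (hne _ _ e). }
  assert (hYZ : subset Y Z) by (intros v hv; apply hY in hv as (c & _ & h); eauto).
  exists Y, G. split; [|split; [auto|split; [auto|]]].
  - apply tarski_vaught; auto. intros f k s hf hk hs (a & ha & hm).
    destruct (emodels_support Z (f := f) hf) as (m & hmo & hsup).
    assert (hsZ : func s omega Z) by (apply (func_cod hs); intros x y h; apply hYZ, (func_dom hs h)).
    (* A code is chosen for each of the finitely many parameters on which [f] depends; the code
       assembled from these names the required witness. *)
    destruct (choice_fun (pow (Vlev al))) as (ch' & hc1 & hc2 & hc3).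
    assert (hcod : forall i, i ∈ m -> exists! c, exists y u, opair i u ∈ s /\ (forall d, d ∈ y <-> d ∈ Vlev al /\ F d u) /\ opair y c ∈ ch').
    { intros i hi. destruct (func_ex hs (nat_sub hmo hi)) as (u & hu & hiu).
      destruct (@sep M (fun d => F d u) (Vlev al)) as [y hy]; [dfn|].
      destruct (hc3 y) as [c hc].
      - apply in_pow. intros d hd. now apply hy in hd.
      - apply hY in hu as (d & hd & h). exists d. apply hy. auto.
      - exists c. split; [eauto 6|]. intros c' (y' & u' & h1 & h2 & h3). rewrite (func_fun hs h1 hiu) in h2.
        replace y' with y in h3; [apply (hc2 y); auto|]. apply ext. intros d. now rewrite hy, h2. }
    destruct (@fun_of_func M (fun i c => exists y u, opair i u ∈ s /\ (forall d, d ∈ y <-> d ∈ Vlev al /\ F d u) /\ opair y c ∈ ch') m (Vlev al)) as (si & hsi & hsiE); [dfn|auto| |].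
    { intros i c hi (y & u & h1 & h2 & h3). apply hc1 in h3 as [_ h3]. now apply h2 in h3. }
    assert (hsiF : forall i c u, opair i c ∈ si -> opair i u ∈ s -> F c u).
    { intros i c u h1 h2. apply hsiE in h1 as [_ (y & u' & h3 & h4 & h5)]. apply hc1 in h5 as [_ h5]. apply h4 in h5 as [_ h5].
      now rewrite (func_fun hs h2 h3). }
    set (c := opair (num 1) (triple f k si)).
    assert (hc : c ∈ Vlev al).
    { unfold c, triple. apply limit_opair; [auto|apply (limit_num 1 hal)|]. apply limit_opair; auto; [now apply eps_form_V|].
      apply limit_opair; auto; [now apply limit_omega_in|]. now apply (@fin_func_V M al m). }
    destruct (hFu c) as (v & hv & _). assert (hv0 := hv). apply hF in hv as (g & hg & hv).
    assert (hsic : forall i u, opair i u ∈ si -> u ∈ tc c).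
    { intros i u h. assert (h1 : si ∈ tc c).
      { unfold c. destruct (tc_opair (num 1) (triple f k si)) as [_ h1]. apply (tc_tc h1). apply tc_triple. }
      apply (tc_tc (tc_trans h1 h)). apply tc_opair. }
    destruct (@fun_of_func M (fun i w => (exists u, opair i u ∈ si /\ opair u w ∈ g) \/ (i ∈ omega /\ (~ exists u, opair i u ∈ si) /\ w = p0)) omega Z) as (s' & hs' & hsE'); [dfn| | |].
    { intros i hi. destruct (classic (exists u, opair i u ∈ si)) as [[u hu]|hn].
      - destruct (hFu u) as (w & hw & huw). exists w. split.
        + left. exists u. split; auto. apply hg. exists u, w. eauto.
        + intros w' [(u' & h1 & h2)|(_ & h & _)]; [|destruct h; eauto]. rewrite (func_fun hsi h1 hu) in h2.
          apply huw. apply hg in h2 as (z & w1 & _ & h2 & e). now apply opair_inj in e as [-> ->].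
      - exists p0. split; auto. intros w' [(u' & h1 & h2)|(_ & _ & h)]; auto. destruct hn. eauto. }
    { intros i w _ [(u & _ & h)|(_ & _ & ->)]; auto. apply hg in h as (z & w1 & _ & h & e). apply opair_inj in e as [-> ->]. eauto. }
    assert (hag : agree m s' s).
    { assert (H : forall i u w, i ∈ m -> opair i u ∈ s -> opair i w ∈ s' -> u = w).
      { intros i u w hi h1 h2. destruct (func_ex hsi hi) as (d & _ & hd).
        apply hsE' in h2 as [_ [(d' & h3 & h4)|(_ & h & _)]]; [|destruct h; eauto].
        rewrite (func_fun hsi h3 hd) in h4. apply hg in h4 as (z & w1 & _ & h4 & e). apply opair_inj in e as [-> ->].
        destruct (hFu z) as (w0 & _ & hw0). rewrite <- (hw0 _ h4). symmetry. apply hw0. eauto. }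
      intros i hi u. assert (hio := nat_sub hmo hi). split; intros h.
      - destruct (func_ex hs hio) as (u' & _ & h'). now rewrite <- (H i u' u hi h' h).
      - destruct (func_ex hs' hio) as (u' & _ & h'). now rewrite (H i u u' hi h h'). }
    assert (hasg : asgof si g s').
    { intros q. split.
      - intros hq. destruct (proj1 hs' q hq) as (i & w & _ & _ & ->). exists i, w. split; auto. now apply hsE' in hq as [_ hq].
      - intros (i & w & -> & h). apply hsE'. split; auto. destruct h as [(u & h & _)|h]; [|tauto].
        apply (nat_sub hmo). apply (func_dom hsi h). }
    assert (hsup' : forall b, b ∈ Z -> (emodels Z f (supd s' k b) <-> emodels Z f (supd s k b))).
    { intros b hb. apply hsup; auto using supd_func, agree_supd. }
    destruct (@sep M (fun b => emodels Z f (supd s' k b)) Z) as [y hy]; [dfn; apply Dfn_emodels; dfn|].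
    destruct (hch3 y) as [w hw].
    + apply in_pow. intros b hb. now apply hy in hb.
    + exists a. apply hy. split; auto. now apply hsup'.
    + assert (hvw : val c g w) by (right; exists f, k, si, s', y; auto).
      assert (v = w) as ->.
      { destruct hv as [hv|[hn _]]; [now apply (hvu c g)|]. destruct hn. eauto. }
      exists w. split; [apply hY; eauto|]. apply hch1 in hw as [_ hw]. apply hy in hw as [hw1 hw2]. now apply hsup'.
  - split; auto. intros v hv. apply hY in hv as (c & hc & h). exists c. split; auto. apply hGF. auto.
Qed.

End Tarski.

Ltac dfn_ext ::= lazymatch goal with
  | |- Dfn _ (fun e => func (@?a e) (@?b e) (@?c e)) => apply Dfn_func
  | |- Dfn _ (fun e => transitive (@?a e)) => apply Dfn_transitive
  | |- Dfn _ (fun e => ordinal (@?a e)) => apply Dfn_ordinal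
  | |- Dfn _ (fun e => inductive_set (@?a e)) => apply Dfn_inductive
  | |- DfT _ (fun _ => omega) => apply DfT_omega
  | |- DfT _ (fun e => tc (@?a e)) => apply DfT_tc
  | |- Dfn _ (fun e => isV (@?a e) (@?b e)) => apply Dfn_isV
  | |- Dfn _ (fun e => surj (@?a e) (@?b e) (@?c e)) => apply Dfn_surj
  | |- Dfn _ (fun e => is_term (@?a e) (@?b e)) => apply Dfn_is_term
  | |- Dfn _ (fun e => is_formula (@?a e) (@?b e)) => apply Dfn_is_formula
  | |- DfT _ (fun e => terms (@?a e)) => apply DfT_terms
  | |- DfT _ (fun e => supd (@?a e) (@?b e) (@?c e)) => apply DfT_supd
  | |- DfT _ (fun e => compc (@?a e) (@?b e)) => apply DfT_compc
  | |- Dfn _ (fun e => vrel (@?a e) (@?b e) (@?c e) (@?d e) (@?f e) (@?g e)) => apply Dfn_vrel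
  | |- Dfn _ (fun e => modc (@?a e) (@?b e) (@?c e) (@?d e)) => apply Dfn_modc
  | |- Dfn _ (fun e => emodels (@?a e) (@?b e) (@?c e)) => apply Dfn_emodels
  end.

(** * Reflecting levels *)

Section Reflection.
Context {M : zfc_model}.
Implicit Types x y z a b c d s v w t xi th : M.

(* DD 0 is the class of limit levels; the members of DD (S k) are those
   reflecting every statement of the form "some level in DD k satisfies c". *)
Fixpoint DD (k : nat) (th : M) : Prop :=
  match k with
  | 0 => limit th /\ omega ∈ th
  | S k => DD k th /\ forall c s v, isV v th -> s ∈ v -> is_formula eps_sig c ->
      (exists xi w, DD k xi /\ isV w xi /\ func s omega w /\ emodels w c s) ->
      exists xi w, xi ∈ th /\ DD k xi /\ isV w xi /\ func s omega w /\ emodels w c s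
  end.

Lemma Dfn_DD C `{whole_ctx M C} k (t : (nat -> M) -> M) : DfT C t -> Dfn C (fun e => DD k (t e)).
Proof.
  revert t. induction k; intros t ht; cbn [DD].
  - unfold limit. dfn.
  - assert (IH := IHk (fun e => e 0) (DfT_var C 0)). cbv beta in IH. unfold eps_sig. dfnu.
Qed.

Lemma DD_limit k th : DD k th -> limit th /\ omega ∈ th.
Proof. induction k; cbn [DD]; tauto. Qed.

Lemma DD_Good k th : DD k th -> Good (fun x => x ∈ Vlev th).
Proof. intros h. apply DD_limit in h as [h1 h2]. now apply limit_Good. Qed.

Lemma DD_ord k th : DD k th -> ordinal th.
Proof. intros h. apply DD_limit in h as [h1 h2]. apply h1. Qed.

Lemma Vlev_lt_sub xi th : ordinal th -> xi ∈ th -> subset (Vlev xi) (Vlev th).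
Proof. intros h h'. apply Vlev_mono; auto; [now apply (ord_mem h)|]. apply ord_le; auto. Qed.

(** A parameter of the limit level already occurs in an earlier level of the class, and the
    reflecting ordinal found there stays below. *)
Lemma DD_closed k th : limit th -> omega ∈ th -> (forall b, b ∈ th -> exists xi, xi ∈ th /\ b ∈ xi /\ DD k xi) -> DD k th.
Proof.
  intros hl ho. induction k; cbn [DD]; intros h; auto. split.
  - apply IHk. intros b hb. destruct (h b hb) as (xi & h1 & h2 & h3 & _). eauto.
  - intros c s v [_ ->] hs hc hE. apply (limit_in_Vlev s hl) in hs as (b & hb & hs).
    destruct (h b hb) as (xi & h1 & h2 & h3 & h4). destruct (h4 c s (Vlev xi)) as (x0 & w & h5 & h6); auto.
    + split; auto. apply (DD_ord h3).
    + apply (Vlev_lt_sub (DD_ord h3) h2 hs).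
    + exists x0, w. split; auto. now apply (ord_trans (proj1 hl) h1).
Qed.

Lemma ord_max a b : ordinal a -> ordinal b -> exists c, ordinal c /\ a ∈ c /\ b ∈ c.
Proof.
  intros ha hb. destruct (ord_lt_or ha hb) as [h|h].
  - exists (succ b). rewrite !in_succ. split; [now apply ord_succ|auto].
  - exists (succ a). split; [now apply ord_succ|]. split; [apply in_succ; auto|].
    apply in_succ. destruct (ord_sub hb ha h) as [h'| ->]; auto.
Qed.

(** The ordinals needed to reflect all formulas at all parameters from a given level are bounded by
    replacement, and [club] provides an ordinal closed under these bounds. *)
Lemma DD_unbounded k : forall a, ordinal a -> exists th, a ∈ th /\ DD k th.
Proof.
  induction k; intros a ha.
  - destruct (@ex_good_level M a a ha) as (t & h1 & h2 & h3 & _). exists t. cbn [DD]. auto.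
  - assert (hdk : Dfn cW (fun e => DD k (e 0))) by (apply Dfn_DD; dfn).
    set (Q1 := fun c s d => is_formula eps_sig c -> (exists xi w, DD k xi /\ isV w xi /\ func s omega w /\ emodels w c s) ->
        exists xi w, xi ∈ d /\ DD k xi /\ isV w xi /\ func s omega w /\ emodels w c s).
    assert (hQ1 : Dfn cW (fun e => Q1 (e 0) (e 1) (e 2))) by (unfold Q1, eps_sig; dfnu).
    assert (hmono : forall c s d d', subset d d' -> Q1 c s d -> Q1 c s d').
    { intros c s d d' hdd h hc hE. destruct (h hc hE) as (xi & w & h1 & h2). exists xi, w. auto. }
    destruct (@club M (fun b b' => (exists xi, xi ∈ b' /\ b ∈ xi /\ DD k xi) /\ forall v, isV v b -> forall s, s ∈ v -> forall c, c ∈ forms eps_sig -> Q1 c s b') a)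
      as (t & h1 & h2 & h3 & h4).
    + dfn.
    + exact ha.
    + intros x b c _ hc hbc [(xi & h1 & h2) h3]. split; [exists xi; auto|]. intros v hv s hs c' hc'. exact (hmono _ _ _ _ hbc (h3 v hv s hs c' hc')).
    + intros b hb. destruct (IHk b hb) as (xi & hbx & hxi).
      destruct (@bound_ord M (fun s d => forall c, c ∈ forms eps_sig -> Q1 c s d) (Vlev b)) as (d & hd & h).
      * dfn.
      * intros s d d' _ _ hdd h c hc. exact (hmono _ _ _ _ hdd (h c hc)).
      * intros s _. destruct (@bound_ord M (fun c d => Q1 c s d) (forms eps_sig)) as (d & hd & h).
        -- dfn.
        -- intros c d d' _ _. apply hmono.
        -- intros c hc. destruct (classic (exists xi w, DD k xi /\ isV w xi /\ func s omega w /\ emodels w c s)) as [(x0 & w & h)|hn].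
           ++ exists (succ x0). split; [apply ord_succ; apply (DD_ord (proj1 h))|]. intros _ _. exists x0, w. split; auto. apply in_succ. auto.
           ++ exists empty. split; [apply ord_empty|]. intros _ h. destruct (hn h).
        -- eauto.
      * destruct (ord_max hd (DD_ord hxi)) as (d' & hd' & h1 & h2). exists d'. split; auto. split; [eauto|].
        intros v [_ ->] s hs c hc. apply (hmono _ _ d); [apply ord_le; auto|exact (h s hs c hc)].
    + exists t. split; auto. cbn [DD]. split.
      * apply DD_closed; auto. intros b hb. destruct (h4 b hb) as (d & hd & (xi & h5 & h6) & _). exists xi. split; auto.
        now apply (ord_trans (proj1 h1) hd).
      * intros c s v [_ ->] hs hc hE. apply (limit_in_Vlev s h1) in hs as (b & hb & hs).
        destruct (h4 b hb) as (d & hd & _ & h). destruct (h (Vlev b)) with (s := s) (c := c) as (xi & w & h5 & h6); auto.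
        -- split; auto. now apply (ord_mem (proj1 h1)).
        -- now apply in_forms.
        -- exists xi, w. split; auto. now apply (ord_trans (proj1 h1) hd).
Qed.

Notation satV th := (sat (@mem M) (fun x => x ∈ Vlev th)).
Notation satW := (sat (@mem M) (@whole M)).

Definition refl (k : nat) (f : fml) : Prop := forall th, DD k th -> forall e : nat -> M, (forall i, e i ∈ Vlev th) ->
  (satV th e f <-> satW e f).

(** The behaviour of an existential statement over [DD k]: it persists upwards, to larger such
    levels and to the universe, and once true it holds at arbitrarily large ones. The last clause
    permits changing the valuation off the variables of [f], because infinitely many values of [e]
    need not fit into one level. *)
Definition S1 (k : nat) (f : fml) : Prop :=
  (forall xi e, DD k xi -> (forall i, e i ∈ Vlev xi) -> satV xi e f -> satW e f) /\
  (forall xi th e, DD k xi -> DD k th -> xi ∈ th -> (forall i, e i ∈ Vlev xi) -> satV xi e f -> satV th e f) /\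
  (forall e a, ordinal a -> satW e f -> exists xi, a ∈ xi /\ DD k xi /\
     forall e', (forall i, e' i ∈ Vlev xi) -> (forall i, i < bnd f -> e' i = e i) -> satV xi e' f).

Lemma fin_level (e : nat -> M) q : exists a, ordinal a /\ forall i, i < q -> e i ∈ Vlev a.
Proof.
  induction q as [|q (a & ha & h)]; [exists empty; split; [apply ord_empty|lia]|].
  destruct (ex_level (e q)) as (b & hb & h'). destruct (ord_max ha hb) as (c & hc & h1 & h2). exists c. split; auto. intros i hi.
  destruct (Nat.eq_dec i q) as [->|hn].
  - apply (Vlev_mono hc hb (ord_le hc (or_introl h2)) h').
  - apply (Vlev_mono hc ha (ord_le hc (or_introl h1))). apply h. lia.
Qed.

Lemma refl_S1 k f : refl k f -> S1 k f.
Proof.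
  intros h. split; [|split].
  - intros xi e hx he. now apply h.
  - intros xi th e hx ht hxt he hs. apply (h th ht); [|now apply (h xi hx)]. intros i. apply (Vlev_lt_sub (DD_ord ht) hxt). auto.
  - intros e a ha hs. destruct (DD_unbounded k ha) as (xi & h1 & h2). exists xi. split; auto. split; auto. intros e' he' hee.
    apply (h xi h2); auto. revert hs. apply sat_ext. intros i hi. now rewrite hee.
Qed.

Lemma S1_Ex k (x : nat) f : S1 k f -> S1 k (Ex x f).
Proof.
  intros (h1 & h2 & h3). unfold S1. cbn [sat bnd]. split; [|split].
  - intros xi e hx he (a & ha & hs). exists a. split; [exact I|]. apply (h1 xi); auto. intros i. unfold upd. destruct (i =? x); auto.
  - intros xi th e hx ht hxt he (a & ha & hs). exists a. split; [now apply (Vlev_lt_sub (DD_ord ht) hxt)|].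
    apply (h2 xi th); auto. intros i. unfold upd. destruct (i =? x); auto.
  - intros e a ha (b & _ & hs). destruct (ex_level b) as (d & hd & hbd). destruct (ord_max ha hd) as (c & hc & hac & hdc).
    destruct (h3 (upd e x b) c hc hs) as (xi & h4 & h5 & h6). assert (ox := DD_ord h5). exists xi. split; [now apply (ord_trans ox h4)|].
    split; auto. intros e' he' hee. assert (hb : b ∈ Vlev xi).
    { apply (Vlev_lt_sub ox (ord_trans ox h4 hdc) hbd). }
    exists b. split; auto. apply h6.
    + intros i. unfold upd. destruct (i =? x); auto.
    + intros i hi. unfold upd. destruct (i =? x); auto. apply hee. lia.
Qed.

Lemma S1_Neg_All k (x : nat) f : S1 k (Neg f) -> S1 k (Neg (All x f)).
Proof.
  intros h. apply (S1_Ex x) in h. destruct h as (h1 & h2 & h3).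
  assert (H : forall D (e : nat -> M), sat (@mem M) D e (Neg (All x f)) <-> sat (@mem M) D e (Ex x (Neg f))).
  { intros D e. cbn [sat]. split.
    - intros h. apply NNPP. intros hn. apply h. intros a ha. apply NNPP. eauto.
    - intros (a & ha & h) h'. auto. }
  split; [|split].
  - intros xi e hx he. rewrite !H. now apply h1.
  - intros xi th e hx ht hxt he. rewrite !H. now apply h2.
  - intros e a ha. rewrite H. intros hs. destruct (h3 e a ha hs) as (xi & h4 & h5 & h6). exists xi. split; auto. split; auto.
    intros e' he hee. apply H. auto.
Qed.

Lemma bnd_pos f : 0 < bnd f.
Proof. induction f; cbn [bnd]; lia. Qed.

(** A true [f] holds at some level of [DD k], possibly far above [th]. Membership of [th] in
    [DD (S k)] reflects the existence of such a level to one below [th], and from there [f] persists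
    upwards to [th]. *)
Lemma S1_refl k f : S1 k f -> refl (S k) f.
Proof.
  intros (h1 & h2 & h3) th [ht hr] e he. split; [apply h1; auto|]. intros hs. set (q := bnd f).
  assert (hq := bnd_pos f).
  set (e1 := fun i => if i <? q then e i else e 0). destruct (fin_level e q) as (a & ha & hea).
  assert (hee : forall i, i < q -> e1 i = e i) by (intros i hi; unfold e1; now rewrite (proj2 (Nat.ltb_lt _ _) hi)).
  destruct (h3 e a ha hs) as (xi & hax & hx & h4).
  assert (hex : forall i, e1 i ∈ Vlev xi).
  { intros i. unfold e1. destruct (Nat.ltb_spec i q); apply (Vlev_lt_sub (DD_ord hx) hax), hea; auto. }
  assert (het : forall i, e1 i ∈ Vlev th) by (intros i; unfold e1; destruct (i <? q); auto).
  specialize (h4 e1 hex hee).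
  destruct (hr (code f) (asg e1 q) (Vlev th)) as (x' & w & hx't & hx' & [_ ->] & hfs & hm).
  - split; auto. apply (DD_ord ht).
  - now apply (asg_Good q (DD_Good ht)).
  - apply code_form.
  - exists xi, (Vlev xi). split; auto. split; [split; auto; apply (DD_ord hx)|]. split; [now apply asg_func|].
    apply sat_asg; auto.
  - set (e2 := fun i => app (asg e1 q) (num i)).
    assert (he2 : forall i, e2 i ∈ Vlev x') by (intros i; apply (func_in hfs); apply num_omega).
    assert (he21 : forall i, i < q -> e2 i = e1 i) by (intros i hi; apply (func_app hfs); now apply asg_in).
    apply (@sat_code M (Vlev x') f e2) in hm; auto.
    + apply (h2 x' th e2 hx' ht hx't he2) in hm. revert hm. apply sat_ext. intros i hi. now rewrite he21, hee.
    + intros i hi. apply (func_ap hfs). apply num_omega.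
Qed.

Lemma refl_mono k f : refl k f -> refl (S k) f.
Proof. intros h th [ht _]. now apply h. Qed.

Lemma Delta0_sat D D' f : Delta0 f -> (forall x y, x ∈ y -> D y -> D x) -> (forall x, D x -> D' x) ->
  forall e : nat -> M, (forall i, D (e i)) -> (sat (@mem M) D e f <-> sat (@mem M) D' e f).
Proof.
  intros hf htr hDD. induction hf; cbn [sat]; intros e he; try rewrite IHhf by auto; try rewrite IHhf1, IHhf2 by auto; try tauto.
  - split; intros (a & ha & hm & hs); exists a; rewrite upd_same, upd_other in hm |- * by auto.
    + split; auto. split; auto. apply IHhf; auto. intros i. unfold upd. destruct (i =? x); auto.
    + assert (hDa : D a) by (apply (htr a (e y)); auto). split; auto. split; auto. apply IHhf; auto. intros i. unfold upd. destruct (i =? x); auto.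
  - split; intros h a ha hm.
    + assert (hDa : D a) by (apply (htr a (e y)); auto; rewrite upd_same, upd_other in hm; auto).
      apply IHhf; [intros i; unfold upd; destruct (i =? x); auto|]. apply h; auto.
    + apply IHhf; [intros i; unfold upd; destruct (i =? x); auto|]. apply h; auto.
Qed.

Lemma refl_Delta0 k f : Delta0 f -> refl k f.
Proof.
  intros hf. enough (h : refl 0 f) by (induction k; auto using refl_mono).
  intros th [ht _] e he. apply Delta0_sat; auto; [|intros; exact I]. intros x y hx hy. now apply (Vlev_trans (proj1 ht) hy).
Qed.

Lemma refl_Neg k f : refl k (Neg f) <-> refl k f.
Proof.
  split; intros h th ht e he; specialize (h th ht e he); cbn [sat] in *; [|tauto]. split; intros h'; apply NNPP; tauto.
Qed.

Lemma refl_Sigma_Pi k : (forall f, Sigma k f -> refl k f) /\ (forall f, Pi k f -> refl k f).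
Proof.
  induction k as [|k [IH1 IH2]].
  - split; intros f h; inversion h; subst; now apply refl_Delta0.
  - split; intros f h.
    + assert (H : Delta0 f \/ S1 k f).
      { remember (S k) as n. induction h; try discriminate; auto.
        - injection Heqn as ->. right. now apply refl_S1, IH2.
        - right. apply S1_Ex. destruct (IHh Heqn) as [h'|h']; auto. now apply refl_S1, refl_Delta0. }
      destruct H as [H|H]; [now apply refl_Delta0|now apply S1_refl].
    + assert (H : Delta0 f \/ S1 k (Neg f)).
      { remember (S k) as n. induction h; try discriminate; auto.
        - injection Heqn as ->. right. now apply refl_S1, refl_Neg, IH1.
        - right. apply S1_Neg_All. destruct (IHh Heqn) as [h'|h']; auto. now apply refl_S1, refl_Neg, refl_Delta0. }
      destruct H as [H|H]; [now apply refl_Delta0|now apply refl_Neg, S1_refl].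
Qed.

Lemma DD_in_C k th : DD k th -> in_C k th.
Proof.
  intros h. split; [apply (DD_ord h)|]. split.
  - exists empty. apply (limit_num 0). apply (DD_limit h).
  - intros f hf e he. now apply (proj1 (refl_Sigma_Pi k) f hf).
Qed.

Lemma refl_le k k' f : k <= k' -> refl k f -> refl k' f.
Proof. induction 1; auto using refl_mono. Qed.

(** The reflection theorem, by induction on formulas of Rocq: each quantifier costs one step in the
    hierarchy [DD]. *)
Lemma refl_ex f : exists k, refl k f.
Proof.
  induction f.
  - exists 0. apply refl_Delta0. constructor.
  - exists 0. apply refl_Delta0. constructor.
  - destruct IHf as [k h]. exists k. now apply refl_Neg.
  - destruct IHf1 as [k h], IHf2 as [k' h']. exists (Nat.max k k'). apply (refl_le (k' := Nat.max k k')) in h, h'; try lia.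
    intros th ht e he. cbn [sat]. now rewrite (h th ht e he), (h' th ht e he).
  - destruct IHf1 as [k h], IHf2 as [k' h']. exists (Nat.max k k'). apply (refl_le (k' := Nat.max k k')) in h, h'; try lia.
    intros th ht e he. cbn [sat]. now rewrite (h th ht e he), (h' th ht e he).
  - destruct IHf1 as [k h], IHf2 as [k' h']. exists (Nat.max k k'). apply (refl_le (k' := Nat.max k k')) in h, h'; try lia.
    intros th ht e he. cbn [sat]. now rewrite (h th ht e he), (h' th ht e he).
  - destruct IHf as [k h]. exists (S k). now apply S1_refl, S1_Ex, refl_S1.
  - destruct IHf as [k h]. exists (S k). now apply refl_Neg, S1_refl, S1_Neg_All, refl_S1, refl_Neg.
Qed.

Lemma refl_list (l : list fml) : exists k, forall f, In f l -> refl k f.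
Proof.
  induction l as [|f l [k h]]; [exists 0; intros f []|]. destruct (refl_ex f) as [k' h']. exists (Nat.max k k').
  intros g [->|hg]; [apply (refl_le (k := k'))|apply (refl_le (k := k))]; auto; lia.
Qed.

(** For a limit ordinal [th] this says, in the presence of choice, that [th] is a fixed point of the
    beth function: every V_a with a < th has cardinality below [th]. *)
Definition beth th : Prop := (forall b, b ∈ th -> exists a, a ∈ th /\ b ∈ a /\ limit a) /\
  forall a, a ∈ th -> forall v, isV v a -> ~ exists g, surj g v th.

Lemma beth_cardinal th : limit th -> beth th -> cardinal th.
Proof.
  intros hl hb. assert (ho := proj1 hl). split; auto. intros y hy (f & hf & hf').
  assert (hoy := ord_mem ho hy). apply (proj2 hb y hy (Vlev y)); [now split|].
  apply (@surj_from M (fun x z => opair x z ∈ f)).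
  - dfn.
  - apply (limit_omega_sub hl). apply omega0.
  - intros x z z' _ h h'. apply (func_fun hf h h').
  - intros z hz. destruct (hf' z hz) as (x & [hx <-] & _). exists x. split; [now apply (ord_sub_Vlev hoy)|]. now apply (func_ap hf).
Qed.

(** Each closure step also passes an ordinal onto which V_b does not map, so that no earlier level
    maps onto the limit of the steps. *)
Lemma beth_DD k a : ordinal a -> exists th, a ∈ th /\ DD k th /\ beth th.
Proof.
  intros ha. assert (hdk : Dfn cW (fun e => DD k (e 0))) by (apply Dfn_DD; dfn).
  destruct (@club M (fun b b' => (exists xi, xi ∈ b' /\ b ∈ xi /\ DD k xi) /\
      exists d, d ∈ b' /\ ordinal d /\ empty ∈ d /\ forall v, isV v b -> ~ exists g, surj g v d) a) as (t & h1 & h2 & h3 & h4).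
  - dfn.
  - exact ha.
  - intros x b c _ _ hbc [(xi & h1 & h2) (d & h3 & h4)]. split; [exists xi|exists d]; auto.
  - intros b hb. destruct (DD_unbounded k hb) as (xi & hbx & hxi). destruct (hartogs (Vlev b)) as (d & hd & hd0 & hn).
    destruct (ord_max (DD_ord hxi) hd) as (c & hc & h1 & h2). exists c. split; auto. split; [eauto|]. exists d. split; auto. split; auto.
    split; auto. intros v [_ ->]. exact hn.
  - exists t. split; auto. assert (ho := proj1 h1). split.
    + apply DD_closed; auto. intros b hb. destruct (h4 b hb) as (d & hd & (xi & h5 & h6) & _). exists xi. split; auto. now apply (ord_trans ho hd).
    + split.
      { intros b hb. destruct (h4 b hb) as (d & hd & (xi & h5 & h6 & h7) & _). exists xi. split; [now apply (ord_trans ho hd)|].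
        split; auto. apply (DD_limit h7). }
      intros b hb v hv (g & hg & hgs). destruct (h4 b hb) as (c & hc & _ & d & hd & hod & hd0 & hn). apply (hn v hv).
      apply (@surj_from M (fun x z => opair x z ∈ g)); auto.
      * dfn.
      * intros x z z' _ h h'. apply (func_fun hg h h').
      * intros z hz. apply hgs. apply (ord_trans ho (ord_trans ho hc hd) hz).
Qed.

End Reflection.

(** * Sigma_2 formulas that speak about levels *)

(** Asks only for sets covering pairs, power sets and unions, and for an inductive set; in a
    transitive domain closed under subsets this amounts to [Good]. *)
Definition good_fml : fml :=
  And (And (All 0 (All 1 (Ex 2 (And (Mem 0 2) (Mem 1 2)))))
           (All 0 (Ex 1 (All 2 (Imp (All 3 (Imp (Mem 3 2) (Mem 3 0))) (Mem 2 1))))))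
      (And (All 0 (Ex 1 (All 2 (Imp (Mem 2 0) (All 3 (Imp (Mem 3 2) (Mem 3 1)))))))
           (Ex 0 (And (Ex 1 (And (Mem 1 0) (All 2 (Neg (Mem 2 1)))))
              (All 1 (Imp (Mem 1 0) (Ex 2 (And (Mem 2 0)
                 (All 3 (And (Imp (Mem 3 2) (Or (Mem 3 1) (Eq 3 1))) (Imp (Or (Mem 3 1) (Eq 3 1)) (Mem 3 2))))))))))).

Fixpoint vars_in (w n : nat) : fml :=
  match n with 0 => Eq 0 0 | S n => And (Mem n w) (vars_in w n) end.

(* The universal quantifier over variable w + 1 expresses that the set w
   contains all subsets of its elements. *)
Definition level_fml (w : nat) (f : fml) : fml :=
  All (S w) (And
    (And (All (S (S w)) (Imp (Mem (S (S w)) w) (All (S (S (S w))) (Imp (Mem (S (S (S w))) (S (S w))) (Mem (S (S (S w))) w)))))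
         (All (S (S w)) (Imp (Mem (S (S w)) w)
            (Imp (All (S (S (S w))) (Imp (Mem (S (S (S w))) (S w)) (Mem (S (S (S w))) (S (S w))))) (Mem (S w) w)))))
    (And (vars_in w (bnd f)) (And (rel w good_fml) (rel w f)))).

Lemma vars_in_Delta0 w n : Delta0 (vars_in w n).
Proof. induction n; simpl; repeat constructor; auto. Qed.

(** After the leading universal quantifier everything is bounded, so that the existence of a good
    [w] in which [f] holds is Sigma_2. The bound 4 makes room for the variables of [good_fml]. *)
Lemma level_fml_Pi w f : bnd f <= w -> 4 <= w -> Pi 1 (level_fml w f).
Proof.
  intros h h4. apply Pi_All, Pi_Delta0. repeat apply D0_And; try (apply D0_All; [lia|]); repeat constructor; try lia;
    auto using vars_in_Delta0.
  all: apply rel_Delta0; auto; simpl; lia.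
Qed.

Section Template.
Context {M : zfc_model}.
Implicit Types x y z a b c d s v t xi th lam eta zeta X : M.

Lemma sat_good W : (forall x y, x ∈ y -> y ∈ W -> x ∈ W) -> (forall x y, subset x y -> y ∈ W -> x ∈ W) ->
  forall e : nat -> M, (sat (@mem M) (fun x => x ∈ W) e good_fml <-> Good (fun x => x ∈ W)).
Proof.
  intros htr hsub e. unfold good_fml. cbn [sat]. cbn. split.
  - intros [[hp hw] [hu (w & hw0 & (o & ho & ho1 & ho2) & hs)]]. split; auto.
    + intros x y hx hy. destruct (hp x hx y hy) as (z & hz & h1 & h2). apply (hsub _ z); auto.
      intros u hu'. apply in_upair in hu' as [-> | ->]; auto.
    + intros x hx. destruct (hw x hx) as (p & hpW & h). apply (hsub _ p); auto. intros z hz. apply in_pow in hz.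
      apply h; [apply (hsub _ x); auto|]. intros u _. apply hz.
    + intros x hx. destruct (hu x hx) as (u & huW & h). apply (hsub _ u); auto. intros z hz. apply in_bigU in hz as (y & hy & hz).
      apply (h y); eauto.
    + apply (hsub _ w); auto. intros k hk. rewrite in_omega in hk. apply hk. split.
      * replace empty with o; auto. apply empty_eq. intros z hz. apply (ho2 z); auto. eauto.
      * intros x hx. destruct (hs x (htr _ _ hx hw0) hx) as (s & hsW & hsw & h). replace (succ x) with s; auto.
        apply ext. intros z. rewrite in_succ. split; intros hz.
        -- apply (h z); auto. eauto.
        -- apply (h z); auto. destruct hz as [hz| ->]; [eauto|]. apply (htr _ _ hx hw0).
  - intros hG. split; [split|split].
    + intros x hx y hy. exists (upair x y). rewrite !in_upair. split; auto. now apply (good_upair hG).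
    + intros x hx. exists (pow x). split; [now apply (good_pow hG)|]. intros z hz h. apply in_pow. intros u hu. apply h; eauto.
    + intros x hx. exists (bigU x). split; [now apply (good_bigU hG)|]. intros y hy hyx z hz hzy. apply in_bigU. eauto.
    + exists omega. split; [apply (good_omega hG)|]. split.
      * exists empty. split; [apply (htr _ omega); [apply omega0|apply (good_omega hG)]|]. split; [apply omega0|].
        intros z _ hz. destruct (in_empty hz).
      * intros x hx hxo. exists (succ x). split; [now apply (Good_succ hG)|]. split; [now apply omegaS|].
        intros z _. rewrite in_succ. tauto.
Qed.

Lemma sat_vars_in D (e : nat -> M) w n : sat (@mem M) D e (vars_in w n) <-> forall i, i < n -> e i ∈ e w.
Proof.
  induction n; simpl; [split; auto; lia|]. rewrite IHn. split.
  - intros [h1 h2] i hi. destruct (Nat.eq_dec i n) as [->|]; auto. apply h2. lia.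
  - intros h. split; [apply h; lia|]. intros i hi. apply h. lia.
Qed.

Lemma sat_dom (D D' : M -> Prop) (e : nat -> M) f : (forall x, D x <-> D' x) -> (sat (@mem M) D e f <-> sat (@mem M) D' e f).
Proof. intros h. now rewrite (pred_ext_eq h). Qed.

(** The formula means the same in the universe and in each level: a transitive domain closed under
    subsets sees every subset of an element of [e w]. *)
Lemma sat_level D w f (e : nat -> M) : (forall x y, x ∈ y -> D y -> D x) -> (forall x y, subset x y -> D y -> D x) ->
  bnd f <= w -> 4 <= w -> dom D e ->
  (sat (@mem M) D e (level_fml w f) <->
   Good (fun x => x ∈ e w) /\ (forall i, i < bnd f -> e i ∈ e w) /\ sat (@mem M) (fun x => x ∈ e w) e f).
Proof.
  intros htr hsub hf h4 he. unfold level_fml. cbn [sat].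
  assert (Hrel : forall g c, bnd g <= w -> (sat (@mem M) D (upd e (S w) c) (rel w g) <-> sat (@mem M) (fun x => x ∈ e w) e g)).
  { intros g c hg. rewrite sat_rel by auto. rewrite upd_other by lia.
    rewrite (sat_dom (D' := fun x => x ∈ e w)) by (intros x; split; [tauto|intros h; split; auto; apply (htr _ _ h); apply he]).
    apply sat_ext. intros i hi. apply upd_other. lia. }
  assert (Hin : forall c n, n <= w -> (sat (@mem M) D (upd e (S w) c) (vars_in w n) <-> forall i, i < n -> e i ∈ e w)).
  { intros c n hn. rewrite sat_vars_in. split; intros h i hi; specialize (h i hi); rewrite !upd_other in * by lia; auto. }
  assert (hg4 : bnd good_fml <= w) by (apply (Nat.le_trans _ 4); [now apply Nat.leb_le|exact h4]).
  split.
  - intros h. assert (h0 := h (e 0) (he 0)). destruct h0 as ((htr0 & _) & hin & hg & hs).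
    rewrite Hin in hin by auto. rewrite Hrel in hg, hs by auto.
    assert (hWt : forall x y, x ∈ y -> y ∈ e w -> x ∈ e w).
    { intros x y hx hy. assert (Dy : D y) by (apply (htr _ _ hy), he). specialize (htr0 y Dy).
      rewrite !upd_same, (upd_other _ _ (y := w)), (upd_other _ _ (y := w)) in htr0 by lia. specialize (htr0 hy x (htr _ _ hx Dy)).
      rewrite !upd_same, !(upd_other _ _ (y := w)), (upd_other _ _ (y := S (S w))), upd_same in htr0 by lia. auto. }
    split; [|split; auto]. apply sat_good in hg; auto.
    intros x y hxy hy. assert (Dy : D y) by (apply (htr _ _ hy), he). assert (Dx : D x) by apply (hsub _ _ hxy Dy).
    destruct (h x Dx) as ((_ & hst) & _). specialize (hst y Dy). rewrite upd_same, !(upd_other _ _ (y := w)) in hst by lia.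
    specialize (hst hy). rewrite (upd_other _ _ (y := S w)), upd_same in hst by lia. apply hst. intros z Dz.
    rewrite upd_same, (upd_other _ _ (y := S w)), (upd_other _ _ (y := S w)), upd_same, (upd_other _ _ (y := S (S w))), upd_same by lia. apply hxy.
  - intros (hG & hin & hs) c Dc. split; [split|split; [|split]].
    + intros y Dy hy x Dx hx.
      rewrite !upd_same, !(upd_other _ _ (y := w)) in * by lia.
      rewrite (upd_other _ _ (y := S (S w))), upd_same in hx by lia. apply (good_trans hG hx hy).
    + intros y Dy hy hsx.
      rewrite upd_same, !(upd_other _ _ (y := w)) in * by lia.
      rewrite (upd_other _ _ (y := S w)), upd_same in * by lia. apply (good_sub hG (y := y)); auto.
      intros z hz. assert (Dz : D z) by apply (htr _ _ hz Dc). specialize (hsx z Dz).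
      rewrite upd_same, (upd_other _ _ (y := S w)), (upd_other _ _ (y := S w)), upd_same, (upd_other _ _ (y := S (S w))), upd_same in hsx by lia. auto.
    + now apply Hin.
    + apply Hrel; auto. apply sat_good; [apply hG|apply hG|auto].
    + now apply Hrel.
Qed.

Lemma Dfn_fml (C : ctx (M := M)) P : Dfn C P -> (forall c, ~ ccst C c) -> exists f, forall D, cdom C D -> forall e, dom D e -> (sat (@mem M) D e f <-> P e).
Proof.
  intros (f & l & hl & h) hc. exists f. destruct l as [|c l]; [exact h|]. inversion hl; subst. destruct (hc c). assumption.
Qed.

Lemma DfnA_fml (P : (nat -> M) -> Prop) : Dfn cA P -> exists f, forall D, Good D -> forall e, dom D e -> (sat (@mem M) D e f <-> P e).
Proof. intros h. apply (Dfn_fml h). auto. Qed.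

Lemma DfnF_fml (P : (nat -> M) -> Prop) : Dfn cF P -> exists f, forall e, sat (@mem M) (@whole M) e f <-> P e.
Proof. intros h. destruct (@Dfn_fml cF P h) as [f hf]; [auto|]. exists f. intros e. apply hf; [reflexivity|]. intros i. exact I. Qed.

Lemma DfnA_F (P : (nat -> M) -> Prop) : Dfn cA P -> Dfn cF P.
Proof.
  intros h. destruct (DfnA_fml h) as [f hf]. exists f, nil. split; [constructor|]. intros D -> e he. apply hf; auto. apply Good_whole.
Qed.

(** The trivial equation raises [bnd f], so that [vars_in] inside [level_fml] reaches all the
    intended arguments. *)
Lemma DfnA_fml_bnd (P : (nat -> M) -> Prop) (N : nat) : Dfn cA P ->
  exists f, N <= bnd f /\ forall D, Good D -> forall e, dom D e -> (sat (@mem M) D e f <-> P e).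
Proof.
  intros h. destruct (DfnA_fml h) as [f hf]. exists (And f (Eq N N)). split; [cbn [bnd]; lia|].
  intros D hD e he. cbn [sat]. rewrite (hf D hD e he). tauto.
Qed.

(** * Elementary embeddings of levels for finitely many formulas *)

(** Induction on the Rocq formula: its quantifiers range over a set, so they are bounded and hence
    absolute. *)
Lemma Dfn_sat (C : ctx (M := M)) (f : fml) : forall (X : (nat -> M) -> M) (t : nat -> (nat -> M) -> M), DfT C X -> (forall k, DfT C (t k)) ->
  Dfn C (fun e => sat (@mem M) (fun x => x ∈ X e) (fun k => t k e) f).
Proof.
  induction f; cbn [sat]; intros X t hX ht; dfn; auto.
  all: eapply Dfn_ext; [apply (IHf (fun e => X (fun i => e (S i))) (fun k e => if k =? x then e 0 else t k (fun i => e (S i)))); [dfn|]|].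
  1, 3: intros k; destruct (k =? x); [dfn|apply (DfT_ren (t := t k) S); auto].
  all: intros e; cbv beta; replace (fun k : nat => if k =? x then e 0 else t k (fun i : nat => e (S i)))
    with (upd (fun k => t k (fun i => e (S i))) x (e 0)) by (apply functional_extensionality; intros k; reflexivity); tauto.
Qed.

Definition elem_pair (f : fml) v X (e1 e2 : nat -> M) : Prop :=
  (sat (@mem M) (fun x => x ∈ X) e1 f <-> sat (@mem M) (fun x => x ∈ v) e1 f) /\
  (sat (@mem M) (fun x => x ∈ X) e1 f <-> sat (@mem M) (fun x => x ∈ v) e2 f).

(** Replaces quantification over two Rocq sequences, which are not sets of the model, by [q] nested
    quantifiers over pairs in [i]. *)
Fixpoint all_pairs (q : nat) (i : M) (Q : (nat -> M) -> (nat -> M) -> Prop) (e1 e2 : nat -> M) : Prop :=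
  match q with
  | 0 => Q e1 e2
  | S q => forall x y, opair x y ∈ i -> all_pairs q i Q (upd e1 q x) (upd e2 q y)
  end.

Lemma all_pairs_iff q i (Q : (nat -> M) -> (nat -> M) -> Prop) : forall c1 c2 : nat -> M, all_pairs q i Q c1 c2 <->
  forall e1 e2 : nat -> M, (forall k, k < q -> opair (e1 k) (e2 k) ∈ i) ->
    Q (fun k => if k <? q then e1 k else c1 k) (fun k => if k <? q then e2 k else c2 k).
Proof.
  induction q; intros c1 c2; cbn [all_pairs].
  - split; [auto|]. intros h. apply (h c1 c2). lia.
  - assert (E : forall e c : nat -> M, (fun k => if k <? q then e k else upd c q (e q) k) = (fun k => if k <? S q then e k else c k)).
    { intros e c. apply functional_extensionality. intros k. unfold upd. destruct (Nat.ltb_spec k q), (Nat.ltb_spec k (S q)); try lia; auto.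
      - replace k with q by lia. now rewrite Nat.eqb_refl.
      - destruct (Nat.eqb_spec k q); [lia|reflexivity]. }
    split.
    + intros h e1 e2 he. specialize (h (e1 q) (e2 q) (he q ltac:(lia))). rewrite IHq in h.
      specialize (h e1 e2 ltac:(intros; apply he; lia)). now rewrite !E in h.
    + intros h x y hxy. apply IHq. intros e1 e2 he.
      specialize (h (upd e1 q x) (upd e2 q y)). rewrite <- !E in h.
      assert (E' : forall (e : nat -> M) x (c : nat -> M), (fun k => if k <? q then upd e q x k else upd c q (upd e q x q) k) = fun k => if k <? q then e k else upd c q x k).
      { intros e x' c. apply functional_extensionality. intros k. destruct (Nat.ltb_spec k q); [apply upd_other; lia|]. now rewrite upd_same. }
      rewrite !E' in h. apply h. intros k hk. destruct (Nat.eq_dec k q) as [->|]; [now rewrite !upd_same|].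
      rewrite !upd_other by lia. apply he. lia.
Qed.

Lemma Dfn_all_pairs (C : ctx (M := M)) (f : fml) q : forall (i v X : (nat -> M) -> M) (t1 t2 : nat -> (nat -> M) -> M),
  DfT C i -> DfT C v -> DfT C X -> (forall k, DfT C (t1 k)) -> (forall k, DfT C (t2 k)) ->
  Dfn C (fun e => all_pairs q (i e) (elem_pair f (v e) (X e)) (fun k => t1 k e) (fun k => t2 k e)).
Proof.
  induction q; intros i v X t1 t2 hi hv hX h1 h2; cbn [all_pairs].
  - unfold elem_pair. dfn; now apply Dfn_sat.
  - dfn.
    + eapply Dfn_ext.
      * apply (IHq (fun e => i (fun k => e (S (S k)))) (fun e => v (fun k => e (S (S k)))) (fun e => X (fun k => e (S (S k))))
          (fun k e => if k =? q then e 1 else t1 k (fun i => e (S (S i)))) (fun k e => if k =? q then e 0 else t2 k (fun i => e (S (S i))))); [dfn|dfn|dfn| |];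
          intros k; destruct (k =? q); try apply DfT_var; [apply (DfT_ren (t := t1 k) (fun i => S (S i)))|apply (DfT_ren (t := t2 k) (fun i => S (S i)))]; auto.
      * intros e. cbv beta. tauto.
    + destruct (classic (opair (e 0) a ∈ i (fun k => e (S k)))) as [h|h]; [|tauto].
      apply (fun D' => proj2 (Good_opair_inv (cdom_good H) D' h)). apply (proj1 hi); auto. intros k. apply H0.
    + apply not_all_ex_not in H1 as [y h]. destruct (classic (opair a y ∈ i e)) as [h'|h']; [|tauto].
      apply (fun D' => proj1 (Good_opair_inv (cdom_good H) D' h')). now apply (proj1 hi).
Qed.

(** In contrast to [exacting], domain and target belong to the same level [v]. Elementarity for a
    finite list of standard formulas keeps the condition expressible by one absolute formula. The
    argument [u] stands for V_lambda. *)
Definition emb (l : list fml) v X i u lam : Prop :=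
  subset X v /\ func i X v /\ subset u X /\ lam ∈ X /\ opair lam lam ∈ i /\ (exists a, a ∈ lam /\ ~ opair a a ∈ i) /\
  forall f, In f l -> forall e1 e2 : nat -> M, (forall k, opair (e1 k) (e2 k) ∈ i) -> elem_pair f v X e1 e2.

Lemma Dfn_emb (C : ctx (M := M)) l (v X i u lam : (nat -> M) -> M) : DfT C v -> DfT C X -> DfT C i -> DfT C u -> DfT C lam ->
  Dfn C (fun e => emb l (v e) (X e) (i e) (u e) (lam e)).
Proof.
  intros hv hX hi hu hl.
  eapply (Dfn_ext (P := fun e => (subset (X e) (v e) /\ func (i e) (X e) (v e) /\ subset (u e) (X e) /\ lam e ∈ X e /\
    (exists a, a ∈ lam e /\ ~ opair a a ∈ i e)) /\ opair (lam e) (lam e) ∈ i e /\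
    forall f, In f l -> all_pairs (bnd f) (i e) (elem_pair f (v e) (X e)) (fun _ => lam e) (fun _ => lam e))).
  - apply Dfn_and; [dfn|]. apply Dfn_and; [dfn|]. induction l as [|f l IH].
    + eapply Dfn_ext; [apply Dfn_true|]. intros e. simpl. tauto.
    + eapply Dfn_ext; [apply Dfn_and; [apply (@Dfn_all_pairs C f (bnd f) i v X (fun _ => lam) (fun _ => lam)); auto|exact IH]|].
      intros e. simpl. split; [intros [h1 h2] g [<-|hg]; auto|]. intros h. split; [apply h; auto|]. intros g hg. apply h. auto.
  - intros e. unfold emb. generalize (v e) (X e) (i e) (u e) (lam e). clear. intros v X i u lam.
    assert (H : opair lam lam ∈ i -> forall f, all_pairs (bnd f) i (elem_pair f v X) (fun _ => lam) (fun _ => lam) <->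
       forall e1 e2 : nat -> M, (forall k, opair (e1 k) (e2 k) ∈ i) -> elem_pair f v X e1 e2).
    { intros hl f. rewrite all_pairs_iff.
      assert (E : forall e1 e2 e1' e2' : nat -> M, (forall k, k < bnd f -> e1 k = e1' k) -> (forall k, k < bnd f -> e2 k = e2' k) -> elem_pair f v X e1 e2 -> elem_pair f v X e1' e2').
      { intros e1 e2 e1' e2' h1 h2 [h3 h4]. unfold elem_pair. rewrite <- !(sat_ext (@mem M) _ h1), <- !(sat_ext (@mem M) _ h2). auto. }
      split; intros h e1 e2 he.
      - assert (h' := h e1 e2 (fun k _ => he k)). revert h'. apply E; intros k hk; now rewrite (proj2 (Nat.ltb_lt _ _) hk).
      - apply h. intros k. destruct (Nat.ltb_spec k (bnd f)); auto. }
    split.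
    + intros ((h1 & h2 & h3 & h4 & h5) & h6 & h7).
      exact (conj h1 (conj h2 (conj h3 (conj h4 (conj h6 (conj h5 (fun f hf => proj1 (H h6 f) (h7 f hf)))))))).
    + intros (h1 & h2 & h3 & h4 & h6 & h5 & h7).
      exact (conj (conj h1 (conj h2 (conj h3 (conj h4 h5)))) (conj h6 (fun f hf => proj2 (H h6 f) (h7 f hf)))).
Qed.

(** [X] and [i] are taken from iterated power sets, and levels below [th] from [v], so that good
    domains decide the condition correctly. *)
Definition least_bad (l : list fml) lam th v u : Prop :=
  isV v th /\ isV u lam /\ lam ∈ th /\
  (~ exists X, X ∈ pow v /\ exists i, i ∈ pow (pow (pow (union2 X v))) /\ emb l v X i u lam) /\
  forall th', th' ∈ th -> lam ∈ th' -> forall v', v' ∈ v -> isV v' th' ->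
    exists X, X ∈ pow v' /\ exists i, i ∈ pow (pow (pow (union2 X v'))) /\ emb l v' X i u lam.

(** Leastness makes [th] definable from [lam] alone; this forces an embedding that fixes [lam] to
    fix [th]. *)
Lemma least_bad_unique l lam th v u th' v' u' : least_bad l lam th v u -> least_bad l lam th' v' u' -> th = th' /\ v = v'.
Proof.
  assert (H : forall th v u th' v' u', least_bad l lam th v u -> least_bad l lam th' v' u' -> ~ th' ∈ th).
  { clear. intros th v u th' v' u' (h1 & h2 & h3 & _ & h5) (h1' & h2' & h3' & h4' & _) h. apply h4'.
    destruct h2 as [_ ->], h2' as [_ ->]. apply (h5 th' h h3' v'); auto.
    destruct h1 as [ho ->], h1' as [_ ->]. now apply Vlev_lt. }
  intros h h'. assert (e : th = th').
  { destruct (@ord_tri M th th') as [h1|[h1|h1]]; auto; [apply h|apply h'| |].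
    - destruct (H _ _ _ _ _ _ h' h h1).
    - destruct (H _ _ _ _ _ _ h h' h1). }
  split; auto. destruct h as [[_ ->] _], h' as [[_ ->] _]. now rewrite e.
Qed.

(** The Sigma_2 statement that a least bad ordinal exists passes from V to V_zeta, as zeta is in
    C^(m+1) with m > 0, and back along [i] to [X]. A witness a in [X] is least bad by absoluteness,
    and so is i(a); hence i(a) = a, and the restriction of [i] to the part of [X] inside V_a is an
    embedding whose existence was denied. *)
Lemma emb_exists l lam th : exacting lam -> ordinal th -> lam ∈ th -> exists X i, emb l (Vlev th) X i (Vlev lam) lam.
Proof.
  intros (hlc & m & hm & eta & X & zeta & i & heta & _ & hle & hXeta & hVX & hzeta & hzC & hlz & hi & hil & hmov) hth hlth.
  apply NNPP. intros hbad.
  assert (hol : ordinal lam) by now apply (ord_mem hth).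
  assert (hB : forall v' X' i', emb l v' X' i' (Vlev lam) lam -> exists X, X ∈ pow v' /\ exists i, i ∈ pow (pow (pow (union2 X v'))) /\ emb l v' X i (Vlev lam) lam).
  { intros v' X' i' h. exists X'. split; [apply in_pow; apply h|]. exists i'. split; auto. apply func_in_pow. apply h. }
  destruct (@ord_min M (fun t => lam ∈ t /\ ~ exists v, isV v t /\ exists X, X ∈ pow v /\ exists i, i ∈ pow (pow (pow (union2 X v))) /\ emb l v X i (Vlev lam) lam))
    as (t & ht & [hlt hbt] & hmin).
  { dfn. apply Dfn_emb; dfn. }
  { exists th. split; auto. split; auto. intros (v & [_ ->] & X' & _ & i' & _ & h). eauto. }
  assert (hLB : least_bad l lam t (Vlev t) (Vlev lam)).
  { split; [now split|]. split; [now split|]. split; auto. split.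
    - intros h. apply hbt. exists (Vlev t). split; [now split|auto].
    - intros t' ht' hlt' v' _ hv'. apply NNPP. intros hn. apply (hmin t' ht'). split; auto. intros (v & hv & h). apply hn.
      destruct hv as [_ ->], hv' as [_ ->]. exact h. }
  destruct (@DfnA_fml_bnd (fun e => least_bad l (e 0) (e 1) (e 2) (e 3)) 4) as (f & h4 & hf).
  { unfold least_bad. dfn; apply Dfn_emb; dfn. }
  set (w := Nat.max (bnd f) 4). assert (hw1 : bnd f <= w) by (unfold w; lia). assert (hw2 : 4 <= w) by (unfold w; lia).
  (* Variable 0 carries [lam], variables 1, 2 and 3 carry the ordinal, its level and V_lambda, and
     [w] the good set in which leastness is evaluated. *)
  set (T := Ex 1 (Ex 2 (Ex 3 (Ex w (level_fml w f))))).
  set (ec := fun _ : nat => lam).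
  set (en := fun a b c d : M => upd (upd (upd (upd ec 1 a) 2 b) 3 c) w d).
  assert (hT : Sigma 2 T) by (unfold T; repeat apply Sigma_Ex; apply Sigma_Pi; now apply level_fml_Pi).
  assert (hLf : forall D a b c W, (forall x y, x ∈ y -> D y -> D x) -> (forall x y, subset x y -> D y -> D x) ->
     D lam -> D a -> D b -> D c -> D W -> (sat (@mem M) D (en a b c W) (level_fml w f) <->
       Good (fun x => x ∈ W) /\ (forall i, i < bnd f -> en a b c W i ∈ W) /\ least_bad l lam a b c)).
  { intros D a b c W htr hsub Dl Da Db Dc DW.
    assert (hd : dom D (en a b c W)).
    { intros k. unfold en, upd, ec. destruct (k =? w), (k =? 3), (k =? 2), (k =? 1); auto. }
    rewrite sat_level; auto. assert (e0 : en a b c W w = W) by apply upd_same. rewrite e0.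
    assert (H : Good (fun x => x ∈ W) -> (forall i, i < bnd f -> en a b c W i ∈ W) -> (sat (@mem M) (fun x => x ∈ W) (en a b c W) f <-> least_bad l lam a b c)).
    { intros hG hin. set (e' := fun k => if k <? bnd f then en a b c W k else en a b c W 0).
      assert (hb0 := bnd_pos f).
      rewrite (sat_ext (@mem M) (fun x => x ∈ W) (f := f) (e' := e')).
      2: { intros k hk. unfold e'. now rewrite (proj2 (Nat.ltb_lt _ _) hk). }
      assert (hde : dom (fun x => x ∈ W) e').
      { intros k. unfold e'. destruct (Nat.ltb_spec k (bnd f)); auto. }
      assert (hf1 := hf _ hG e' hde). rewrite hf1.
      unfold e'. rewrite !(proj2 (Nat.ltb_lt _ _)) by lia.
      assert (E : en a b c W 0 = lam /\ en a b c W 1 = a /\ en a b c W 2 = b /\ en a b c W 3 = c).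
      { unfold en. rewrite !(upd_other _ W) by lia. now repeat split. }
      destruct E as (-> & -> & -> & ->). tauto. }
    split; intros (h1 & h2 & h3); (split; [|split]; auto); now apply H. }
  assert (Hen : forall a b c W k, en a b c W k = W \/ en a b c W k = a \/ en a b c W k = b \/ en a b c W k = c \/ en a b c W k = lam).
  { intros a b c W k. unfold en, upd, ec. destruct (k =? w), (k =? 3), (k =? 2), (k =? 1); auto 6. }
  assert (hTW : sat (@mem M) (@whole M) ec T).
  { destruct (@ex_good_level M t t ht) as (tt & h1 & h2 & h3 & _). assert (hott := proj1 h1).
    exists t. split; [exact I|]. exists (Vlev t). split; [exact I|]. exists (Vlev lam). split; [exact I|]. exists (Vlev tt). split; [exact I|].
    change (sat (@mem M) (@whole M) (en t (Vlev t) (Vlev lam) (Vlev tt)) (level_fml w f)).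
    apply hLf; try (intros; exact I). split; [now apply limit_Good|]. split; auto. intros k hk.
    assert (hkw : k <> w) by lia. assert (E : en t (Vlev t) (Vlev lam) (Vlev tt) k = upd (upd (upd ec 1 t) 2 (Vlev t)) 3 (Vlev lam) k) by now apply upd_other.
    rewrite E. unfold upd, ec. assert (hltt : lam ∈ tt) by now apply (ord_trans hott h3).
    destruct (k =? 3); [now apply Vlev_lt|]. destruct (k =? 2); [now apply Vlev_lt|]. destruct (k =? 1); now apply (ord_sub_Vlev hott). }
  assert (hoz : ordinal zeta) by apply hzC. assert (hoe : ordinal eta) by apply heta.
  assert (hif := eps_elementary_func hi). assert (hlX : lam ∈ X) by (apply hVX; rewrite in_union2, in_singleton; auto).
  assert (htrV : forall a, ordinal a -> (forall x y : M, x ∈ y -> y ∈ Vlev a -> x ∈ Vlev a)).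
  { intros a ha x y hx hy. now apply (Vlev_trans ha hy). }
  assert (hsubV : forall a, ordinal a -> (forall x y : M, subset x y -> y ∈ Vlev a -> x ∈ Vlev a)).
  { intros a ha x y hx hy. now apply (Vlev_sub ha hx). }
  assert (hTz : sat (@mem M) (fun x => x ∈ Vlev zeta) ec T).
  { destruct hzC as (_ & _ & hz). apply hz; auto; [apply (Sigma_le (n := 2)); auto; lia|]. intros k. now apply (ord_sub_Vlev hoz). }
  assert (hTX : sat (@mem M) (fun x => x ∈ X) ec T).
  { apply (elementary_sat hi); [intros k; exact hlX|]. unfold ec. rewrite hil. exact hTz. }
  destruct hTX as (a & ha & b & hb & c & hc & W & hW & hs). change (sat (@mem M) (fun x => x ∈ X) (en a b c W) (level_fml w f)) in hs.
  assert (hend : forall k, en a b c W k ∈ X).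
  { intros k. destruct (Hen a b c W k) as [->|[->|[->|[->| ->]]]]; auto. }
  assert (hXe := proj1 hXeta).
  assert (h1 : least_bad l lam a b c).
  { assert (h := hs). rewrite (elementary_sub_sat hXeta) in h by exact hend. apply (hLf (fun x => x ∈ Vlev eta)) in h; auto; [apply h|apply (htrV eta hoe)|apply (hsubV eta hoe)]. }
  assert (h2 : least_bad l lam (app i a) (app i b) (app i c)).
  { assert (h := hs). rewrite (elementary_sat hi) in h by exact hend.
    replace (fun n => app i (en a b c W n)) with (en (app i a) (app i b) (app i c) (app i W)) in h.
    - apply (hLf (fun x => x ∈ Vlev zeta)) in h; [apply h|apply (htrV zeta hoz)|apply (hsubV zeta hoz)|..].
      + now apply (ord_sub_Vlev hoz).
      + now apply (func_in hif).
      + now apply (func_in hif).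
      + now apply (func_in hif).
      + now apply (func_in hif).
    - apply functional_extensionality. intros k. unfold en, upd, ec. destruct (k =? w), (k =? 3), (k =? 2), (k =? 1); auto. }
  destruct (least_bad_unique h1 h2) as [ea eb]. destruct h1 as ([hoa hbV] & [_ hcV] & hla & hnb & _).
  apply hnb. rewrite hcV. assert (hbe : subset b (Vlev eta)) by (intros x hx; apply (htrV eta hoe x b); auto).
  destruct (@sep M (fun x => x ∈ b) X) as [X' hX']; [dfn|].
  destruct (@sep M (fun p => exists x y, x ∈ b /\ p = opair x y) i) as [i' hi']; [dfn|].
  assert (hii : forall x y, opair x y ∈ i' <-> x ∈ X' /\ app i x = y).
  { intros x y. rewrite hi', hX'. split.
    - intros [h (x' & y' & hx & e)]. apply opair_inj in e as [<- <-]. split; [split; auto; apply (func_dom hif h)|apply (func_app hif h)].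
    - intros [[hx hx'] <-]. split; [now apply (func_ap hif)|eauto]. }
  assert (him : forall x y, x ∈ X -> y ∈ X -> (x ∈ y <-> app i x ∈ app i y)).
  { intros x y hx hy. assert (h := @elementary_sat M X (Vlev zeta) i hi (Mem 0 1) (fun k => if k =? 0 then x else y)).
    cbn [sat Nat.eqb] in h. apply h. intros n. destruct (n =? 0); auto. }
  apply (hB b X' i'). split; [|split; [|split; [|split; [|split; [|split]]]]].
  - intros x hx. now apply hX' in hx.
  - apply func_intro.
    + intros p hp. assert (hp' := hp). apply hi' in hp as [_ (x & y & _ & ->)]. apply hii in hp' as [hx <-]. exists x, (app i x). split; auto.
      split; auto. apply hX' in hx as [hx hxb]. rewrite eb. apply (him x b); auto.
    + intros x hx. exists (app i x). now apply hii.
    + intros x y z h h'. apply hii in h as [_ <-], h' as [_ <-]. reflexivity.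
  - intros x hx. apply hX'. split; [apply hVX, in_union2; auto|]. rewrite hbV. apply (@Vlev_lt_sub M lam a); auto.
  - apply hX'. split; auto. rewrite hbV. now apply (ord_sub_Vlev hoa).
  - apply hii. split; auto. apply hX'. split; auto. rewrite hbV. now apply (ord_sub_Vlev hoa).
  - destruct hmov as (d & hd & hmd). exists d. split; auto. intros h. apply hii in h as [_ h]. auto.
  (* Truth in [b] is expressed by relativizing [g] to a fresh variable with value [b]. As [i] fixes
     [b], elementarity of [X] in V_eta and of [i] applies to the relativized formula. *)
  - intros g _ e1 e2 he. set (q := bnd g). set (e1' := upd e1 q b).
    assert (he1 : forall k, e1 k ∈ X') by (intros k; exact (proj1 (proj1 (hii _ _) (he k)))).
    assert (he1X : forall k, e1' k ∈ X) by (intros k; unfold e1', upd; destruct (k =? q); auto; now apply hX').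
    assert (hq : e1' q = b) by apply upd_same.
    assert (A1 : sat (@mem M) (fun x => x ∈ X) e1' (rel q g) <-> sat (@mem M) (fun x => x ∈ X') e1 g).
    { rewrite sat_rel by (unfold q; lia). rewrite (sat_dom (D' := fun x => x ∈ X')) by (intros x; rewrite hX', hq; tauto).
      apply sat_ext. intros k hk. apply upd_other. unfold q. lia. }
    assert (A2 : sat (@mem M) (fun x => x ∈ Vlev eta) e1' (rel q g) <-> sat (@mem M) (fun x => x ∈ b) e1 g).
    { rewrite sat_rel by (unfold q; lia). rewrite (sat_dom (D' := fun x => x ∈ b)) by (intros x; rewrite hq; split; [tauto|auto]).
      apply sat_ext. intros k hk. apply upd_other. unfold q. lia. }
    assert (A3 : sat (@mem M) (fun x => x ∈ Vlev zeta) (fun n => app i (e1' n)) (rel q g) <-> sat (@mem M) (fun x => x ∈ b) e2 g).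
    { rewrite sat_rel by (unfold q; lia). rewrite (sat_dom (D' := fun x => x ∈ b)).
      2: { intros x. rewrite hq, <- eb. split; [tauto|]. intros hx. split; auto. apply (htrV zeta hoz x b); auto. rewrite eb. now apply (func_in hif). }
      apply sat_ext. intros k hk. unfold e1'. rewrite upd_other by (unfold q; lia). exact (proj2 (proj1 (hii _ _) (he k))). }
    assert (A4 := elementary_sub_sat hXeta (rel q g) he1X). assert (A5 := elementary_sat hi (rel q g) he1X).
    unfold elem_pair. tauto.
Qed.

(** The level is chosen to reflect the listed formulas and their existential quantifications, so
    that truth in it is truth in the universe. The last clause is the Tarski-Vaught property of [X]
    for the list: a witness anywhere can be traded for one in [X]. *)
Theorem exacting_embedding (l : list fml) lam : exacting lam -> exists X i,
  subset (Vlev lam) X /\ lam ∈ X /\ (exists Z, func i X Z) /\ app i lam = lam /\ (exists a, a ∈ lam /\ app i a <> a) /\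
  forall f, In f l -> forall e : nat -> M, (forall k, e k ∈ X) ->
    (sat (@mem M) (@whole M) e f <-> sat (@mem M) (@whole M) (fun k => app i (e k)) f) /\
    forall b, sat (@mem M) (@whole M) (upd e 0 b) f -> exists b', b' ∈ X /\ sat (@mem M) (@whole M) (upd e 0 b') f.
Proof.
  intros hex. assert (hol : ordinal lam) by apply hex.
  destruct (@refl_list M (l ++ map (Ex 0) l)) as [k hk].
  destruct (DD_unbounded k hol) as (th & hlth & hth).
  destruct (@emb_exists (l ++ map (Ex 0) l) lam th hex (DD_ord hth) hlth) as (X & i & h1 & h2 & h3 & h4 & h5 & (a & ha & ha') & h7).
  exists X, i. split; auto. split; auto. split; [eauto|]. split; [now apply (func_app h2)|].
  assert (haX : a ∈ X) by (apply h3; now apply (ord_sub_Vlev hol)).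
  split. { exists a. split; auto. intros e. apply ha'. rewrite <- e at 2. now apply (func_ap h2). }
  assert (H : forall f, In f (l ++ map (Ex 0) l) -> forall e : nat -> M, (forall k, e k ∈ X) ->
    (sat (@mem M) (@whole M) e f <-> sat (@mem M) (fun x => x ∈ X) e f) /\
    (sat (@mem M) (@whole M) e f <-> sat (@mem M) (@whole M) (fun k => app i (e k)) f)).
  { intros f hf e he. destruct (h7 f hf e (fun k => app i (e k))) as [h8 h9]; [intros n; now apply (func_ap h2)|].
    rewrite <- (hk f hf th hth e) by (intros n; apply h1; auto).
    rewrite <- (hk f hf th hth (fun k => app i (e k))) by (intros n; now apply (func_in h2)). tauto. }
  intros f hf e he. split; [apply H; auto; apply in_or_app; auto|]. intros b hb.
  assert (hE : sat (@mem M) (@whole M) e (Ex 0 f)) by (exists b; split; [exact I|auto]).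
  apply (proj1 (H (Ex 0 f) ltac:(apply in_or_app; right; now apply in_map) e he)) in hE. destruct hE as (b' & hb' & hs).
  exists b'. split; auto. apply (proj1 (H f ltac:(apply in_or_app; auto) (upd e 0 b') ltac:(intros n; unfold upd; destruct (n =? 0); auto))). exact hs.
Qed.

End Template.

(** * The critical point *)

Section Critical.
Context {M : zfc_model}.
Implicit Types x y z a b c d f g p s u v w t xi th lam X i Z kap : M.

Definition Pres X i (P : (nat -> M) -> Prop) : Prop :=
  forall e : nat -> M, (forall k, e k ∈ X) -> (P e <-> P (fun k => app i (e k))).

(** An exacting cardinal yields preservation of finitely many properties at a time, so those used
    around the critical point are collected here. *)
Definition basic : list ((nat -> M) -> Prop) :=
  (fun e => e 0 ∈ e 1) :: (fun e => e 0 = e 1) :: (fun e => e 0 = empty) :: (fun e => e 0 = succ (e 1)) ::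
  (fun e => e 0 = opair (e 1) (e 2)) :: (fun e => isV (e 0) (e 1)) :: (fun e => subset (e 0) (e 1)) ::
  (fun e => func (e 0) (e 1) (e 2)) :: (fun e => surj (e 0) (e 1) (e 2)) :: (fun e => e 0 = omega) :: nil.

Lemma basic_dfn P : In P basic -> Dfn cA P.
Proof. simpl. intros h. repeat destruct h as [<-|h]; try tauto; dfn. Qed.

Record pres X i : Prop := {
  pr_mem : forall x y, x ∈ X -> y ∈ X -> (x ∈ y <-> app i x ∈ app i y);
  pr_inj : forall x y, x ∈ X -> y ∈ X -> app i x = app i y -> x = y;
  pr_empty : empty ∈ X -> app i empty = empty;
  pr_succ : forall x, x ∈ X -> succ x ∈ X -> app i (succ x) = succ (app i x);
  pr_opair : forall x y, x ∈ X -> y ∈ X -> opair x y ∈ X -> app i (opair x y) = opair (app i x) (app i y);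
  pr_V : forall a, ordinal a -> a ∈ X -> Vlev a ∈ X -> app i (Vlev a) = Vlev (app i a);
  pr_sub : forall x y, x ∈ X -> y ∈ X -> subset x y -> subset (app i x) (app i y);
  pr_fun : forall f x y, f ∈ X -> x ∈ X -> y ∈ X -> func f x y -> func (app i f) (app i x) (app i y);
  pr_surj : forall f x y, f ∈ X -> x ∈ X -> y ∈ X -> surj f x y -> surj (app i f) (app i x) (app i y);
  pr_omega : omega ∈ X -> app i omega = omega
}.

Lemma basic_pres X i : (forall P, In P basic -> Pres X i P) -> pres X i.
Proof.
  intros h.
  assert (H : forall P, In P basic -> forall x y z, x ∈ X -> y ∈ X -> z ∈ X ->
     (P (fun k => match k with 0 => x | 1 => y | _ => z end) <-> P (fun k => app i (match k with 0 => x | 1 => y | _ => z end)))).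
  { intros P hP x y z hx hy hz. apply (h P hP). intros [|[|k]]; auto. }
  split.
  - intros x y hx hy. exact (H (fun e => e 0 ∈ e 1) ltac:(simpl; tauto) x y y hx hy hy).
  - intros x y hx hy. exact (proj2 (H (fun e => e 0 = e 1) ltac:(simpl; tauto) x y y hx hy hy)).
  - intros hx. exact (proj1 (H (fun e => e 0 = empty) ltac:(simpl; tauto) empty empty empty hx hx hx) eq_refl).
  - intros x hx hs. exact (proj1 (H (fun e => e 0 = succ (e 1)) ltac:(simpl; tauto) (succ x) x x hs hx hx) eq_refl).
  - intros x y hx hy hp. exact (proj1 (H (fun e => e 0 = opair (e 1) (e 2)) ltac:(simpl; tauto) (opair x y) x y hp hx hy) eq_refl).
  - intros a ha hx hv. exact (proj2 (proj1 (H (fun e => isV (e 0) (e 1)) ltac:(simpl; tauto) (Vlev a) a a hv hx hx) (conj ha eq_refl))).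
  - intros x y hx hy. exact (proj1 (H (fun e => subset (e 0) (e 1)) ltac:(simpl; tauto) x y y hx hy hy)).
  - intros f x y hf hx hy. exact (proj1 (H (fun e => func (e 0) (e 1) (e 2)) ltac:(simpl; tauto) f x y hf hx hy)).
  - intros f x y hf hx hy. exact (proj1 (H (fun e => surj (e 0) (e 1) (e 2)) ltac:(simpl; tauto) f x y hf hx hy)).
  - intros hx. exact (proj1 (H (fun e => e 0 = omega) ltac:(simpl; tauto) omega omega omega hx hx hx) eq_refl).
Qed.

(** If [lam] were [succ b], then sending 0 to [b], each n + 1 to n and everything else to itself
    would be a bijection from [b] to [lam]. *)
Lemma infinite_cardinal_limit lam : cardinal lam -> omega ∈ lam -> limit lam.
Proof.
  intros [ho hc] how. split; auto. split; [eauto|]. intros b hb. destruct (succ_le ho hb) as [h|h]; auto. exfalso.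
  apply (hc b hb). assert (hob : ordinal b) by now apply (ord_mem ho).
  assert (hwb : subset omega b).
  { rewrite <- h in how. apply in_succ in how as [h'| ->]; [|apply subset_refl]. apply ord_le; auto. }
  assert (hlam : forall x, x ∈ lam <-> x ∈ b \/ x = b) by (intros x; rewrite <- h; apply in_succ).
  assert (hbo : ~ b ∈ omega) by (intros h'; apply (@mem_irrefl M b); auto).
  destruct (@fun_of_func M (fun x y => (x = empty /\ y = b) \/ (exists n, n ∈ omega /\ x = succ n /\ y = n) \/ (~ x ∈ omega /\ y = x)) b lam)
    as (f & hf & hfE); [dfn| | |].
  - intros x hx. destruct (classic (x ∈ omega)) as [hxo|hxo].
    + destruct (omega_case hxo) as [->|(n & hn & ->)].
      * exists b. split; auto. intros y [[_ ->]|[(n & _ & e & _)|[h' _]]]; auto; [|tauto]. symmetry in e. destruct (succ_neq_empty e).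
      * exists n. split; [right; left; eauto|]. intros y [[e _]|[(n' & _ & e & ->)|[h' _]]]; [destruct (succ_neq_empty e)|now apply succ_inj|tauto].
    + exists x. split; auto. intros y [[-> _]|[(n & hn & -> & _)|[_ ->]]]; auto; destruct hxo; [apply omega0|now apply omegaS].
  - intros x y hx [[_ ->]|[(n & hn & _ & ->)|[_ ->]]]; apply hlam; auto.
  - exists f. split; auto. intros y hy.
    assert (H : forall x, x ∈ b /\ app f x = y <-> opair x y ∈ f).
    { intros x. split; [intros [hx <-]; now apply (func_ap hf)|]. intros hxy. split; [apply (func_dom hf hxy)|apply (func_app hf hxy)]. }
    assert (hu : forall x x', opair x y ∈ f -> opair x' y ∈ f -> x = x').
    { intros x x' h1 h2. apply hfE in h1 as [hx h1], h2 as [hx' h2].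
      destruct h1 as [[-> ->]|[(n & hn & -> & ->)|[h1 ->]]], h2 as [[-> e]|[(n' & hn' & -> & e)|[h2 e]]]; subst; auto; try tauto;
        match goal with h : ?z ∈ ?z |- _ => destruct (mem_irrefl h) end. }
    assert (hex : exists x, opair x y ∈ f).
    { destruct (classic (y ∈ omega)) as [hyo|hyo].
      - exists (succ y). apply hfE. split; [apply hwb; now apply omegaS|]. right. left. eauto.
      - apply hlam in hy as [hy| ->]; [exists y; apply hfE; auto|]. exists empty. apply hfE. split; [apply hwb, omega0|auto]. }
    destruct hex as [x hx]. exists x. split; [now apply H|]. intros x' hx'. apply H in hx'. eauto.
Qed.

Section Crit.
Variables (X i Z lam : M).
Hypothesis hi : func i X Z.
Hypothesis hVX : subset (Vlev lam) X.
Hypothesis hlX : lam ∈ X.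
Hypothesis hil : app i lam = lam.
Hypothesis hcard : cardinal lam.
Hypothesis hpr : pres X i.

Let ol : ordinal lam := proj1 hcard.

Lemma ord_X a : a ∈ lam -> a ∈ X.
Proof. intros h. apply hVX. now apply (ord_sub_Vlev ol). Qed.

Lemma nat_fixed k : k ∈ omega -> k ∈ lam -> app i k = k.
Proof.
  (* [app] is a description operator; the pair in [i] gives instead a predicate definable by a
     formula, as induction in the model requires. *)
  intros hk hkl. enough (H : opair k k ∈ i) by now apply (func_app hi). revert k hk hkl.
  apply (omega_ind (P := fun k => k ∈ lam -> opair k k ∈ i)); [dfn| |].
  - intros h. rewrite <- (pr_empty hpr (ord_X h)) at 2. apply (func_ap hi). now apply ord_X.
  - intros k hk IH h. assert (hkl : k ∈ lam) by (apply (ord_trans ol h); apply in_succ; auto). specialize (IH hkl).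
    assert (e := pr_succ hpr (ord_X hkl) (ord_X h)). rewrite (func_app hi IH) in e. rewrite <- e at 2. apply (func_ap hi). now apply ord_X.
Qed.

Hypothesis hmov : exists a, a ∈ lam /\ app i a <> a.

Lemma crit_infinite : omega ∈ lam.
Proof.
  destruct (ord_lt_or (@ord_omega M) ol) as [h|h]; auto. destruct hmov as (a & ha & hm). destruct hm. apply nat_fixed; auto.
Qed.

Lemma crit_limit : limit lam.
Proof. apply infinite_cardinal_limit; auto. apply crit_infinite. Qed.

Lemma lam_Good : Good (fun x => x ∈ Vlev lam).
Proof. apply limit_Good; [apply crit_limit|apply crit_infinite]. Qed.

(** The critical point is a cardinal: if [f] mapped some y < kap bijectively onto kap, then i(f)
    would map y onto i(kap), which contains kap, although i(f) agrees with [f] because [i] fixes all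
    arguments and values of [f]. *)
Lemma crit_exists : exists kap, kap ∈ lam /\ app i kap <> kap /\ (forall b, b ∈ kap -> app i b = b) /\
  kap ∈ app i kap /\ cardinal kap /\ omega ∈ kap.
Proof.
  destruct (@ord_min M (fun a => a ∈ lam /\ ~ opair a a ∈ i)) as (kap & hok & [hk hkm] & hmin).
  - dfn.
  - destruct hmov as (a & ha & hm). exists a. split; [now apply (ord_mem ol)|]. split; auto. intros h. apply hm. apply (func_app hi h).
  - assert (hfix : forall b, b ∈ kap -> app i b = b).
    { intros b hb. apply (func_app hi). apply NNPP. intros h. apply (hmin b hb). split; auto. now apply (ord_trans ol hk). }
    assert (hne : app i kap <> kap) by (intros e; apply hkm; rewrite <- e at 2; apply (func_ap hi); now apply ord_X).
    assert (hikl : app i kap ∈ lam) by (rewrite <- hil; apply (pr_mem hpr (ord_X hk) hlX); auto).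
    assert (hup : kap ∈ app i kap).
    { destruct (ord_tri hok (ord_mem ol hikl)) as [h|[h|h]]; auto; [destruct hne; auto|].
      assert (e := hfix _ h). apply (pr_inj hpr) in e; [|now apply ord_X|now apply ord_X]. destruct hne. auto. }
    assert (how : ~ kap ∈ omega) by (intros h; apply hne; now apply nat_fixed).
    assert (hon : omega ∈ kap).
    { destruct (ord_tri hok (@ord_omega M)) as [h|[h|h]]; auto; [tauto|]. subst kap. destruct hne. apply (pr_omega hpr). now apply ord_X. }
    exists kap. split; auto. split; auto. split; auto. split; auto. split; auto. split; auto.
    intros y hy (f & hf & hf').
    assert (hyl : y ∈ lam) by now apply (ord_trans ol hk).
    assert (hfX : f ∈ X).
    { apply hVX. apply (Good_func lam_Good (a := y) (b := kap)); auto; now apply (ord_sub_Vlev ol). }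
    assert (hs : surj f y kap).
    { split; auto. intros z hz. destruct (hf' z hz) as (x & [hx <-] & _). exists x. split; auto. now apply (func_ap hf). }
    apply (pr_surj hpr) in hs; auto using ord_X. destruct hs as [hfi hs]. destruct (hs kap hup) as (x & hx & hxk).
    rewrite (hfix y hy) in hx. destruct (func_ex hf hx) as (z & hz & hxz).
    assert (hxk' : x ∈ kap) by now apply (ord_trans hok hy).
    assert (hpX : opair x z ∈ X).
    { apply hVX. apply (good_trans lam_Good hxz). apply (Good_func lam_Good (a := y) (b := kap)); auto; now apply (ord_sub_Vlev ol). }
    assert (hzX : z ∈ X) by (apply ord_X; now apply (ord_trans ol hk)).
    assert (hxX : x ∈ X) by (apply ord_X; now apply (ord_trans ol hk)).
    apply (pr_mem hpr hpX hfX) in hxz. rewrite (pr_opair hpr hxX hzX hpX), (hfix x hxk'), (hfix z hz) in hxz.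
    apply (@mem_irrefl M kap). now rewrite <- (func_fun hfi hxz hxk) at 1.
Qed.

Lemma V_fixed kap : limit kap -> kap ∈ lam -> (forall b, b ∈ kap -> app i b = b) -> forall x, x ∈ Vlev kap -> app i x = x.
Proof.
  intros hlk hk hfix x hx. assert (hok := proj1 hlk). apply (limit_in_Vlev x hlk) in hx as (b & hb & hx). apply (func_app hi).
  enough (H : forall b, b ∈ kap -> forall v, isV v b -> forall x, x ∈ v -> opair x x ∈ i).
  { apply (H b hb (Vlev b)); auto. split; auto. now apply (ord_mem hok). }
  clear b hb x hx. apply (mem_ind (P := fun b => b ∈ kap -> forall v, isV v b -> forall x, x ∈ v -> opair x x ∈ i)); [dfn|].
  intros b IH hb v [hob ->] x hx. apply in_Vlev in hx as (c & hc & hx); auto.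
  assert (hck : c ∈ kap) by now apply (ord_trans hok hb). assert (hcl : c ∈ lam) by now apply (ord_trans ol hk).
  assert (hoc := ord_mem hok hck).
  assert (hVc : Vlev c ∈ X) by (apply hVX; now apply Vlev_lt).
  assert (hxX : x ∈ X) by (apply hVX; apply in_Vlev; eauto).
  assert (hs := pr_sub hpr hxX hVc hx). rewrite (pr_V hpr hoc (ord_X hcl) hVc), (hfix c hck) in hs.
  assert (hyf : forall y, y ∈ Vlev c -> app i y = y) by (intros y hy; apply (func_app hi); apply (IH c hc hck (Vlev c)); auto; now split).
  assert (hyX : forall y, y ∈ Vlev c -> y ∈ X).
  { intros y hy. apply hVX. apply (Vlev_lt_sub ol hcl hy). }
  assert (e : app i x = x).
  { apply ext. intros y. split; intros hy.
    - assert (hyc := hs y hy). rewrite <- (hyf y hyc) in hy. exact (proj2 (pr_mem hpr (hyX y hyc) hxX) hy).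
    - rewrite <- (hyf y (hx y hy)). exact (proj1 (pr_mem hpr (hyX y (hx y hy)) hxX) hy). }
  rewrite <- e at 2. now apply (func_ap hi).
Qed.

End Crit.
End Critical.

(** * Exacting cardinals reflect structures *)

Section Forward.
Context {M : zfc_model}.
Implicit Types x y z a b c d g p s u v w t xi th lam kap mu nu X i j Z L U I A B r Y : M.

Definition hr x a : Prop := exists v, isV v a /\ subset x v /\ forall b, b ∈ a -> forall v', isV v' b -> ~ subset x v'.

Lemma hr_iff x a : has_rank x a <-> hr x a.
Proof.
  split.
  - intros (ha & h1 & h2). exists (Vlev a). split; [now split|]. split; auto. intros b hb v' [_ ->]. auto.
  - intros (v & [ha ->] & h1 & h2). split; auto. split; auto. intros b hb h. apply (h2 b hb (Vlev b)); auto. split; auto. now apply (ord_mem ha).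
Qed.

Definition typ B r mu lam : Prop := exists U I Y D, B = opair U I /\ hr U lam /\ opair (relsym (num 1) r) Y ∈ I /\
  (forall a, a ∈ D <-> a ∈ U /\ singleton (opair empty a) ∈ Y) /\ hr D mu.

Lemma in_pred_ext U I r a : a ∈ pred_ext (opair U I) r <-> a ∈ U /\ singleton (opair empty a) ∈ app I (relsym (num 1) r).
Proof.
  unfold pred_ext. rewrite in_set_of.
  - now rewrite univ_opair, interp_opair.
  - rewrite univ_opair, interp_opair. apply sep. dfn.
Qed.

Lemma typ_iff L B r mu lam : structure L B -> relsym (num 1) r ∈ L -> (has_type r B mu lam <-> typ B r mu lam).
Proof.
  intros hB hr'. apply structure_inv in hB as (U & I & -> & HS). unfold has_type. rewrite univ_opair, !hr_iff. split.
  - intros [h1 h2]. exists U, I, (app I (relsym (num 1) r)), (pred_ext (opair U I) r). split; auto. split; auto.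
    split; [now apply (strc_app _ _ HS)|]. split; auto. apply in_pred_ext.
  - intros (U' & I' & Y & D & e & h1 & h2 & h3 & h4). apply opair_inj in e as [<- <-]. split; auto.
    apply (strc_app _ _ HS) in h2 as [_ <-]. replace (pred_ext (opair U I) r) with D; auto. apply ext. intros a. now rewrite h3, in_pred_ext.
Qed.

(** Recovers the signature as the domain of the interpretation, so that a formula about [B] can
    refer to it without a further parameter. *)
Definition domL B L : Prop := exists U I r, B = opair U I /\ func I L r.

Lemma domL_structure L B : structure L B -> domL B L.
Proof. intros h. apply structure_inv in h as (U & I & -> & [[r hr'] _ _]). exists U, I, r. auto. Qed.

Lemma domL_unique B L L' : domL B L -> domL B L' -> L = L'.
Proof.
  intros (U & I & r & -> & h) (U' & I' & r' & e & h'). apply opair_inj in e as [<- <-].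
  apply ext. intros x. split; intros hx.
  - apply (func_dom h' (func_ap h hx)).
  - apply (func_dom h (func_ap h' hx)).
Qed.

Definition elemc L A B j : Prop := exists U I U' I', A = opair U I /\ B = opair U' I' /\ func j U U' /\
  forall f s, is_formula L f -> func s omega U -> (modc L A f s <-> modc L B f (compc j s)).

Lemma elemc_iff L A B j : structure L A -> structure L B -> (elementary_embedding L A B j <-> elemc L A B j).
Proof.
  intros hA hB. destruct (structure_inv hA) as (U & I & eA & _), (structure_inv hB) as (U' & I' & eB & _).
  unfold elementary_embedding, assignment. split.
  - intros [h1 h2]. exists U, I, U', I'. split; auto. split; auto. rewrite eA, eB, !univ_opair in h1. split; auto.
    intros f s hf hs. rewrite <- !modc_iff by auto. rewrite <- (comp_compc hs h1). apply h2; auto. now rewrite eA, univ_opair.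
  - intros (U1 & I1 & U2 & I2 & e1 & e2 & h1 & h2). rewrite e1 in eA. rewrite e2 in eB. apply opair_inj in eA as [-> ->], eB as [-> ->].
    rewrite e1, e2, !univ_opair in *. split; auto. intros f s hf hs. rewrite !(modc_iff (L := L)) by auto. rewrite (comp_compc hs h1).
    apply h2; auto.
Qed.

Definition padded s0 lam s : Prop := forall q, q ∈ s <-> q ∈ s0 \/ exists k, k ∈ omega /\ (~ exists u, opair k u ∈ s0) /\ q = opair k lam.

(* Truth of the formula c at x, with parameters given by the finite partial
   assignment s0 and equal to lam elsewhere. *)
Definition Tr (n : nat) c s0 lam x : Prop := exists xi w s, DD n xi /\ isV w xi /\ padded s0 lam s /\
  func (supd s empty x) omega w /\ emodels w c (supd s empty x).

(** The ordinal mu is chosen before the class, whereas preservation holds for a fixed finite list.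
    Evaluation in Sigma_n-correct levels makes the defining formula and its parameters arguments of
    a single formula. *)
Lemma Tr_iff (n : nat) (f : fml) (e : nat -> M) s0 lam x : Sigma n f ->
  (forall p, p ∈ s0 -> exists k, p = opair (num k) (e k)) ->
  (forall k, k < bnd f -> opair (num k) (e k) ∈ s0 \/ (e k = lam /\ ~ exists u, opair (num k) u ∈ s0)) ->
  (Tr n (code f) s0 lam x <-> sat (@mem M) (@whole M) (upd e 0 x) f).
Proof.
  intros hf hs1 hs2.
  assert (hk : forall s k, padded s0 lam s -> k < bnd f -> opair (num k) (upd e 0 x k) ∈ supd s empty x).
  { intros s k hs hk. apply supd_in. destruct k as [|k]; [right; auto|left]. split; [apply succ_neq_empty|].
    rewrite upd_other by lia. apply hs. destruct (hs2 (S k) hk) as [h|[h1 h2]]; auto. right. exists (num (S k)).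
    split; [apply num_omega|]. rewrite h1. auto. }
  split.
  - intros (xi & w & s & hx & [ho ->] & hs & hfs & hm). set (e' := fun k => app (supd s empty x) (num k)).
    assert (he' : forall k, e' k ∈ Vlev xi) by (intros k; apply (func_in hfs), num_omega).
    rewrite (@sat_code M (Vlev xi) f e') in hm; [|exact hfs|intros k _; apply (func_ap hfs), num_omega].
    apply (proj1 (refl_Sigma_Pi n) f hf xi hx e' he') in hm. revert hm. apply sat_ext. intros k hk'.
    unfold e'. now rewrite (func_app hfs (hk s k hs hk')).
  - intros hsat. destruct (@sep M (fun q => exists k, k ∈ omega /\ (~ exists u, opair k u ∈ s0) /\ q = opair k lam) (cst lam)) as [s1 hs3]; [dfn|].
    set (s := union2 s0 s1). assert (hs : padded s0 lam s).
    { intros q. unfold s. rewrite in_union2, hs3. split; [tauto|]. intros [h|h]; auto. right. split; auto.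
      destruct h as (k & hk' & _ & ->). now apply cst_in. }
    destruct (ex_level s0) as (a1 & o1 & h1), (ex_level x) as (a2 & o2 & h2), (ex_level lam) as (a3 & o3 & h3).
    destruct (ord_max o1 o2) as (a4 & o4 & h4 & h5), (ord_max o3 o4) as (a & oa & h6 & h7).
    destruct (DD_unbounded n oa) as (xi & hax & hx). assert (ox := DD_ord hx).
    assert (hl : forall b y, y ∈ Vlev b -> b ∈ a -> y ∈ Vlev xi).
    { intros b y hy hb. apply (Vlev_lt_sub ox (ord_trans ox hax hb) hy). }
    assert (hs0 : s0 ∈ Vlev xi) by (apply (hl a1); auto; apply (ord_trans oa h7 h4)).
    assert (hxx : x ∈ Vlev xi) by (apply (hl a2); auto; apply (ord_trans oa h7 h5)).
    assert (hlx : lam ∈ Vlev xi) by (apply (hl a3); auto).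
    assert (hG := DD_Good hx).
    assert (hsf : func s omega (Vlev xi)).
    { apply func_intro.
      - intros p hp. apply hs in hp as [hp|(k & hk' & _ & ->)].
        + destruct (hs1 p hp) as [k ->]. exists (num k), (e k). split; [apply num_omega|]. split; auto. apply (Good_opair_inv hG hs0 hp).
        + eauto.
      - intros k hk'. destruct (classic (exists u, opair k u ∈ s0)) as [[u hu]|hn]; [exists u|exists lam]; apply hs; eauto 6.
      - intros k y z hy hz. apply hs in hy, hz.
        destruct hy as [hy|(k1 & _ & n1 & ey)], hz as [hz|(k2 & _ & n2 & ez)].
        + destruct (hs1 _ hy) as [k3 e3], (hs1 _ hz) as [k4 e4]. apply opair_inj in e3 as [-> ->], e4 as [e4 ->]. apply num_inj in e4. now subst.
        + apply opair_inj in ez as [-> _]. destruct n2. eauto.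
        + apply opair_inj in ey as [-> _]. destruct n1. eauto.
        + apply opair_inj in ey as [-> ->], ez as [_ ->]. reflexivity. }
    assert (hSf : func (supd s empty x) omega (Vlev xi)) by (apply supd_func; auto; apply omega0).
    exists xi, (Vlev xi), s. split; auto. split; [now split|]. split; auto. split; auto.
    set (e' := fun k => app (supd s empty x) (num k)).
    assert (he' : forall k, e' k ∈ Vlev xi) by (intros k; apply (func_in hSf), num_omega).
    apply (@sat_code M (Vlev xi) f e'); [exact hSf|intros k _; apply (func_ap hSf), num_omega|].
    apply (proj1 (refl_Sigma_Pi n) f hf xi hx e' he'). revert hsat. apply sat_ext. intros k hk'.
    unfold e'. now rewrite (func_app hSf (hk s k hs hk')).
Qed.

(** Only parameters inside V_kap are recorded, so that [s0] itself lies in V_kap and is fixed by the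
    embedding; the remaining ones equal [lam] and are supplied by [padded]. *)
Lemma finite_params (e : nat -> M) kap (q : nat) : Good (fun x => x ∈ Vlev kap) -> exists s0, s0 ∈ Vlev kap /\
  (forall p, p ∈ s0 -> exists k, p = opair (num k) (e k) /\ e k ∈ Vlev kap) /\
  forall k, k < q -> e k ∈ Vlev kap -> opair (num k) (e k) ∈ s0.
Proof.
  intros hG. induction q as [|q (s0 & h1 & h2 & h3)].
  - exists empty. split; [apply (good_trans hG (@omega0 M) (good_omega hG))|]. split; [intros p hp; destruct (in_empty hp)|lia].
  - destruct (classic (e q ∈ Vlev kap)) as [h|h].
    + exists (union2 s0 (singleton (opair (num q) (e q)))). split; [|split].
      * apply (Good_union2 hG); auto. rewrite singleton_upair. apply (good_upair hG); apply (Good_opair hG); auto;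
          apply (good_trans hG (num_omega q) (good_omega hG)).
      * intros p hp. rewrite in_union2, in_singleton in hp. destruct hp as [hp| ->]; eauto.
      * intros k hk hek. rewrite in_union2, in_singleton. destruct (Nat.eq_dec k q) as [->|]; auto. left. apply h3; auto. lia.
    + exists s0. split; auto. split; auto. intros k hk hek. apply h3; auto. destruct (Nat.eq_dec k q) as [->|]; [tauto|lia].
Qed.

(** For each standard [n], one formula covers all signatures, symbols and Sigma_n classes. *)
Definition unreflected (n : nat) B c s0 lam r kap : Prop :=
  Tr n c s0 lam B /\ typ B r kap lam /\
  ~ exists L nu A j, domL B L /\ nu ∈ kap /\ Tr n c s0 lam A /\ typ A r nu lam /\ elemc L A B j.

Lemma Dfn_unreflected (n : nat) : Dfn cF (fun e => unreflected n (e 0) (e 1) (e 2) (e 3) (e 4) (e 5)).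
Proof.
  assert (hT : forall (c s0 lam x : (nat -> M) -> M), DfT cF c -> DfT cF s0 -> DfT cF lam -> DfT cF x -> Dfn cF (fun e => Tr n (c e) (s0 e) (lam e) (x e))).
  { intros. unfold Tr, padded. assert (hD : Dfn (M := M) cF (fun e => DD n (e 0))) by (apply Dfn_DD; dfn). dfn. }
  assert (ht : forall (B r mu lam : (nat -> M) -> M), DfT cF B -> DfT cF r -> DfT cF mu -> DfT cF lam -> Dfn cF (fun e => typ (B e) (r e) (mu e) (lam e))).
  { intros. unfold typ, hr. dfnu. }
  unfold unreflected, domL, elemc. dfn; first [apply hT|apply ht]; dfn.
Qed.

Lemma fml_list (PL : list ((nat -> M) -> Prop)) : (forall P, In P PL -> Dfn cF P) ->
  exists l, forall P, In P PL -> exists f, In f l /\ forall e, sat (@mem M) (@whole M) e f <-> P e.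
Proof.
  induction PL as [|P PL IH]; intros h; [exists nil; intros P []|].
  destruct IH as [l hl]; [intros Q hQ; apply h; right; auto|]. destruct (DfnF_fml (h P ltac:(left; auto))) as [f hf].
  exists (f :: l). intros Q [<-|hQ]; [exists f; split; [left|]; auto|]. destruct (hl Q hQ) as (g & hg & hg'). exists g. split; [right|]; auto.
Qed.

Theorem exacting_reflects (n : nat) lam : exacting lam ->
  exists mu, cardinal mu /\ subset mu lam /\
    forall L P, signature L -> subset L (union2 (Vlev mu) (Vlev omega)) -> relsym (num 1) P ∈ L ->
    forall C : M -> Prop, (forall A, C A -> structure L A) ->
      Sigma_definable n (union2 (Vlev mu) (singleton lam)) C ->
    forall B, C B -> has_type P B mu lam ->
    exists nu A j, nu ∈ mu /\ C A /\ has_type P A nu lam /\ elementary_embedding L A B j.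
Proof.
  intros hex. assert (hcard : cardinal lam) by apply hex. assert (ol : ordinal lam) by apply hcard.
  (* Besides the basic notions, the list contains satisfaction of formulas of the model, which gives
     elementarity of the restricted map, and the two projections of a pair, which put the universe
     and the interpretation of a structure into [X]. *)
  set (unr := fun e : nat -> M => unreflected n (e 0) (e 1) (e 2) (e 3) (e 4) (e 5)).
  set (em := fun e : nat -> M => modc (e 0) (e 1) (e 2) (e 3)). set (dl := fun e : nat -> M => domL (e 0) (e 1)).
  set (fst := fun e : nat -> M => exists y, e 1 = opair (e 0) y). set (snd := fun e : nat -> M => exists x, e 1 = opair x (e 0)).
  destruct (@fml_list (unr :: em :: dl :: fst :: snd :: basic)) as [l hl].
  { intros P [<-|[<-|[<-|[<-|[<-|h]]]]].
    - apply Dfn_unreflected.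
    - unfold em. dfn.
    - unfold dl, domL. dfn.
    - unfold fst. dfn.
    - unfold snd. dfn.
    - now apply DfnA_F, basic_dfn. }
  destruct (exacting_embedding l hex) as (X & i & hVX & hlX & (Z & hi) & hil & hmov & hE).
  assert (hP : forall P, In P (unr :: em :: dl :: fst :: snd :: basic) -> Pres X i P).
  { intros P h e he. destruct (hl P h) as (f & hf & hfP). rewrite <- !hfP. now apply hE. }
  assert (hTV : forall P, In P (unr :: em :: dl :: fst :: snd :: basic) -> forall e : nat -> M, (forall k, e k ∈ X) ->
    forall b, P (upd e 0 b) -> exists b', b' ∈ X /\ P (upd e 0 b')).
  { intros P h e he b hb. destruct (hl P h) as (f & hf & hfP). destruct (proj2 (hE f hf e he) b) as (b' & hb' & h'); [now apply hfP|].
    exists b'. split; auto. now apply hfP. }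
  assert (hpr : pres X i) by (apply basic_pres; intros P h; apply hP; simpl in *; tauto).
  destruct (crit_exists hi hVX hlX hil hcard hpr hmov) as (kap & hkl & hkm & hfix & hkik & hck & hwk).
  assert (hll := crit_limit hi hVX hcard hpr hmov). assert (hlG := lam_Good hi hVX hcard hpr hmov).
  assert (ok : ordinal kap) by apply hck. assert (hlk : limit kap) by now apply infinite_cardinal_limit.
  assert (hkG : Good (fun x => x ∈ Vlev kap)) by now apply limit_Good.
  assert (hVk := V_fixed hi hVX hcard hpr hlk hkl hfix).
  assert (hkX : subset (Vlev kap) X) by (intros x hx; apply hVX; apply (Vlev_lt_sub ol hkl hx)).
  exists kap. split; auto. split; [apply ord_le; auto|].
  intros L r _ hL hrL C hC (f & e & hf & he & hCf) B hB htB.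
  assert (hLk : subset L (Vlev kap)).
  { intros x hx. apply hL, in_union2 in hx as [hx|hx]; auto. apply (Vlev_lt_sub ok hwk hx). }
  assert (hrk : r ∈ Vlev kap).
  { apply hLk in hrL. unfold relsym, triple in hrL.
    assert (h : forall x y, opair x y ∈ Vlev kap -> y ∈ Vlev kap).
    { intros x y h. apply (Good_opair_inv hkG (f := singleton (opair x y)) (x := x)).
      - rewrite singleton_upair. now apply (good_upair hkG).
      - now apply in_singleton. }
    now apply h in hrL; apply h in hrL. }
  destruct (finite_params e (bnd f) hkG) as (s0 & hs0 & hs1 & hs2).
  assert (hlnk : ~ lam ∈ Vlev kap) by (intros h; apply (ord_in_Vlev ok ol) in h; apply (mem_asym h hkl)).
  assert (hTr : forall x, Tr n (code f) s0 lam x <-> C x).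
  { intros x. rewrite hCf. apply Tr_iff; auto.
    - intros p hp. destruct (hs1 p hp) as (k & hk & _). eauto.
    - intros k hk. specialize (he k). apply in_union2 in he as [he|he]; [auto|right]. apply in_singleton in he. split; auto.
      intros [u hu]. destruct (hs1 _ hu) as (k' & e' & h'). apply opair_inj in e' as [e' _]. apply num_inj in e'. subst k'.
      rewrite he in h'. auto. }
  assert (hcf : code f ∈ Vlev kap) by (apply eps_form_V; auto; apply code_form).
  apply NNPP. intros hno.
  set (ee := fun b k => match k with 0 => b | 1 => code f | 2 => s0 | 3 => lam | 4 => r | _ => kap end).
  assert (hun : unr (ee B)).
  { split; [now apply hTr|]. split; [now apply (typ_iff _ _ (hC B hB) hrL)|].
    intros (L' & nu & A & j & h1 & h2 & h3 & h4 & h5). apply hno. apply hTr in h3. exists nu, A, j. split; auto. split; auto.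
    split; [now apply (typ_iff _ _ (hC A h3) hrL)|]. apply elemc_iff; auto. now rewrite (domL_unique (domL_structure (hC B hB)) h1). }
  assert (heX : forall b, b ∈ X -> forall k, ee b k ∈ X).
  { intros b hb k. unfold ee. assert (kap ∈ X) by (apply hVX; now apply (ord_sub_Vlev ol)). destruct k as [|[|[|[|[|k]]]]]; auto. }
  (* The Tarski-Vaught property replaces the counterexample by one in [X], to which [i] can be
     applied. *)
  assert (hB2 : exists B2, B2 ∈ X /\ unr (ee B2)).
  { assert (Eu : forall b, upd (ee lam) 0 b = ee b).
    { intros b. apply functional_extensionality. intros [|k]; reflexivity. }
    destruct (hTV unr ltac:(left; auto) (ee lam) (heX lam hlX) B) as (b' & hb' & h'); [now rewrite Eu|].
    exists b'. split; [exact hb'|]. now rewrite Eu in h'. }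
  clear B hB htB hno hun. destruct hB2 as (B & hBX & hun).
  assert (huni := proj1 (hP unr ltac:(left; auto) (ee B) (heX B hBX)) hun).
  unfold unr, ee in huni. rewrite hil, (hVk (code f) hcf), (hVk s0 hs0), (hVk r hrk) in huni.
  destruct hun as (hT & htB & _). destruct huni as (hTi & htBi & hno). unfold ee in hT, htB.
  apply hTr in hT. apply hTr in hTi. assert (hBs := hC _ hT). assert (hBis := hC _ hTi).
  apply hno. destruct (structure_inv hBs) as (U & I & eB & HS). destruct (structure_inv hBis) as (Ui & Ii & eBi & HSi).
  assert (hUl : subset U (Vlev lam)).
  { destruct htB as (U' & I' & Y & D & e1 & h1 & _). rewrite eB in e1. apply opair_inj in e1 as [<- <-]. apply hr_iff in h1. apply h1. }
  assert (hUX : U ∈ X /\ I ∈ X).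
  { split.
    - destruct (hTV fst ltac:(simpl; tauto) (fun _ => B) (fun _ => hBX) U) as (b' & hb' & y & h'); [exists I; exact eB|].
      change (B = opair b' y) in h'. rewrite eB in h'. now apply opair_inj in h' as [-> _].
    - destruct (hTV snd ltac:(simpl; tauto) (fun _ => B) (fun _ => hBX) I) as (b' & hb' & y & h'); [exists U; exact eB|].
      change (B = opair y b') in h'. rewrite eB in h'. now apply opair_inj in h' as [_ ->]. }
  destruct hUX as [hUX hIX].
  assert (eBi' : app i B = opair (app i U) (app i I)) by (rewrite eB; apply (pr_opair hpr); auto; now rewrite <- eB).
  rewrite eBi in eBi'. apply opair_inj in eBi' as [-> ->].
  assert (hLX : L ∈ X).
  { apply hVX. apply in_Vlev; auto. exists kap. auto. }
  (* [L] is a subset of V_kap but possibly not an element. It is fixed because i(B) lies in the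
     class too, so that both structures have signature [L]. *)
  assert (hiL : app i L = L).
  { assert (h := proj1 (hP dl ltac:(simpl; tauto) (fun k => match k with 0 => B | _ => L end) ltac:(intros [|k]; auto)) (domL_structure hBs)).
    unfold dl in h. apply (domL_unique h). now apply domL_structure. }
  assert (hwX : omega ∈ X) by (apply hkX; apply ord_in_Vlev; auto; apply ord_omega).
  assert (hnat : forall k, k ∈ omega -> k ∈ X /\ app i k = k).
  { intros k hk. assert (hkk : k ∈ Vlev kap) by (apply (good_trans hkG hk (good_omega hkG))). split; auto. }
  destruct (@fun_of_func M (fun x y => opair x y ∈ i) U (app i U)) as (j & hj & hjE); [dfn| | |].
  { intros x hx. assert (hxX : x ∈ X) by auto. exists (app i x). split; [now apply (func_ap hi)|]. intros y hy. apply (func_app hi hy). }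
  { intros x y hx hy. rewrite <- (func_app hi hy). exact (proj1 (pr_mem hpr (hVX x (hUl x hx)) hUX) hx). }
  (* The structure i(B) is unreflected below i(kap); but kap < i(kap), and [B], of type (kap,
     lambda), embeds into it by [j]. *)
  exists L, kap, B, j. split; [now apply domL_structure|]. split; auto. split; [now apply hTr|]. split; auto.
  exists U, I, (app i U), (app i I). split; auto. split; auto. split; auto. intros g s hg hs.
  rewrite <- !modc_iff by auto. rewrite eBi, eB.
  destruct (models_support HS hg) as (m1 & hm1 & hsup1), (models_support HSi hg) as (m2 & hm2 & hsup2).
  assert (hm : exists m, m ∈ omega /\ subset m1 m /\ subset m2 m).
  { destruct (ord_lt_or (nat_ord hm1) (nat_ord hm2)) as [h|h]; [exists m2|exists m1]; repeat split; auto using subset_refl.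
    apply ord_le; auto. now apply nat_ord. }
  destruct hm as (m & hm & hm1' & hm2'). destruct (func_ex hs (@omega0 M)) as (a0 & ha0 & _).
  (* The assignment is cut off at the common support [m] and continued by a constant; the result is
     an element of V_lambda and hence of [X]. *)
  destruct (@fun_of_func M (fun k y => (k ∈ m /\ opair k y ∈ s) \/ (~ k ∈ m /\ y = a0)) omega U) as (s' & hs' & hsE); [dfn| | |].
  { intros k hk. destruct (classic (k ∈ m)) as [hkm'|hkm'].
    - destruct (func_ex hs hk) as (y & _ & hy). exists y. split; auto. intros y' [[_ h]|[h _]]; [apply (func_fun hs hy h)|tauto].
    - exists a0. split; auto. intros y' [[h _]|[_ h]]; [tauto|auto]. }
  { intros k y _ [[_ h]|[_ ->]]; auto. apply (func_dom hs h). }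
  assert (hag : agree m s s').
  { intros k hk y. rewrite hsE. assert (hko := nat_sub hm hk). split; [auto|]. intros [_ [[_ h]|[h _]]]; [auto|tauto]. }
  assert (hs'X : s' ∈ Vlev lam).
  { destruct (@sep M (fun p => exists k y, k ∈ m /\ p = opair k y) s) as [sm hsm]; [dfn|].
    assert (hsmf : func sm m (Vlev lam)).
    { apply func_intro.
      - intros p hp. apply hsm in hp as [hp (k & y & hk & ->)]. exists k, y. split; auto. split; auto. apply hUl. apply (func_dom hs hp).
      - intros k hk. destruct (func_ex hs (nat_sub hm hk)) as (y & _ & hy). exists y. apply hsm. eauto.
      - intros k y z h1 h2. apply hsm in h1 as [h1 _], h2 as [h2 _]. apply (func_fun hs h1 h2). }
    apply (good_sub hlG (y := union2 sm (cst a0))).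
    - intros p hp. destruct (proj1 hs' p hp) as (k & y & hk & _ & ->). apply in_union2. apply hsE in hp as [_ [[h1 h2]|[_ ->]]].
      + left. apply hsm. eauto.
      + right. now apply cst_in.
    - apply (Good_union2 hlG); [now apply (@fin_func_V M lam m)|].
      apply (Good_func hlG (good_omega hlG) (b := singleton a0)); [|apply cst_func; now apply in_singleton].
      rewrite singleton_upair. apply (good_upair hlG); auto. }
  assert (hgk : g ∈ Vlev kap) by (apply hg; now apply formula_closed_V).
  assert (e1 : app i s' = compc j s').
  { assert (hf1 := pr_fun hpr (hVX _ hs'X) hwX hUX hs'). rewrite (pr_omega hpr hwX) in hf1. symmetry.
    apply (func_ext (compc_func hs' hj) hf1). intros k z hz. apply compc_in in hz as (y & h1 & h2). apply hjE in h2 as [hyU h2].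
    assert (hko := proj1 (func_dom hs' h1)). destruct (hnat k hko) as [hkX' hki].
    assert (hpX : opair k y ∈ X) by (apply hVX; apply (good_trans hlG h1 hs'X)).
    assert (hyX : y ∈ X) by auto.
    assert (h3 := proj1 (pr_mem hpr hpX (hVX _ hs'X)) h1). rewrite (pr_opair hpr hkX' hyX hpX), hki in h3. now rewrite <- (func_app hi h2). }
  rewrite (hsup1 s s') by (auto; intros k hk; apply hag; auto).
  rewrite (hsup2 (compc j s) (compc j s')).
  2, 3: eapply compc_func; eauto.
  2: { intros k hk z. rewrite !compc_in. split; intros (y & h1 & h2); exists y; split; auto; apply (hag k); auto. }
  rewrite <- eB, <- eBi, !modc_iff by auto. rewrite <- e1.
  (* Preservation of one standard formula, satisfaction, handles [g] of possibly nonstandard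
     length. *)
  assert (h := hP em ltac:(simpl; tauto) (fun k => match k with 0 => L | 1 => B | 2 => g | _ => s' end) ltac:(intros [|[|[|k]]]; auto)).
  unfold em in h. rewrite hiL, (hVk g hgk) in h. exact h.
Qed.

End Forward.

(** * Sigma_1-correct levels *)

Section Collapse.
Context {M : zfc_model}.
Implicit Types x y z a b c d g p s u v w t xi th eta lam kap X i j Y T G : M.

Lemma sat_iso (D D' : M -> Prop) (h : M -> M) : (forall x, D x -> D' (h x)) -> (forall y, D' y -> exists x, D x /\ h x = y) ->
  (forall x y, D x -> D y -> h x = h y -> x = y) -> (forall x y, D x -> D y -> (x ∈ y <-> h x ∈ h y)) ->
  forall (f : fml) (e : nat -> M), (forall k, D (e k)) -> (sat (@mem M) D e f <-> sat (@mem M) D' (fun k => h (e k)) f).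
Proof.
  intros h1 h2 h3 h4.
  assert (E : forall (e : nat -> M) (x : nat) a, (fun k => h (upd e x a k)) = upd (fun k => h (e k)) x (h a)).
  { intros e x a. apply functional_extensionality. intros k. unfold upd. destruct (k =? x); auto. }
  assert (hu : forall (e : nat -> M) (x : nat) a, (forall k, D (e k)) -> D a -> forall k, D (upd e x a k)).
  { intros e x a he ha k. unfold upd. destruct (k =? x); auto. }
  induction f; cbn [sat]; intros e he; try (rewrite IHf by auto; tauto); try (rewrite IHf1, IHf2 by auto; tauto).
  - now apply h4.
  - split; [now intros ->|apply h3; auto].
  - split.
    + intros (a & ha & hs). exists (h a). split; auto. rewrite IHf in hs by auto. now rewrite E in hs.
    + intros (b & hb & hs). destruct (h2 b hb) as (a & ha & <-). exists a. split; auto. rewrite IHf by auto. now rewrite E.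
  - split.
    + intros hs b hb. destruct (h2 b hb) as (a & ha & <-). specialize (hs a ha). rewrite IHf in hs by auto. now rewrite E in hs.
    + intros hs a ha. rewrite IHf by auto. rewrite E. auto.
Qed.

Lemma Sigma1_up (D D' : M -> Prop) f : Sigma 1 f -> (forall x y, x ∈ y -> D y -> D x) -> (forall x, D x -> D' x) ->
  forall e : nat -> M, (forall k, D (e k)) -> sat (@mem M) D e f -> sat (@mem M) D' e f.
Proof.
  intros hf htr hDD. remember 1 as n. induction hf; try discriminate; intros e he.
  - exact (proj1 (Delta0_sat H htr hDD he)).
  - injection Heqn as ->. inversion H; subst. exact (proj1 (Delta0_sat H0 htr hDD he)).
  - cbn [sat]. intros (a & ha & hs). exists a. split; auto. apply IHhf; auto. intros k. unfold upd. destruct (k =? x); auto.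
Qed.

(** The Mostowski collapse of an extensional set. The last clause, that transitive parts stay in
    place, keeps the parameters unchanged. *)
Lemma collapse Y : (forall x y, x ∈ Y -> y ∈ Y -> (forall z, z ∈ Y -> (z ∈ x <-> z ∈ y)) -> x = y) ->
  exists (F : M -> M -> Prop) (h : M -> M) T, Dfn cW (fun e => F (e 0) (e 1)) /\ (forall x y, F x y <-> y = h x) /\
  (forall y, y ∈ T <-> exists x, x ∈ Y /\ y = h x) /\ transitive T /\
  (forall x y, x ∈ Y -> y ∈ Y -> h x = h y -> x = y) /\ (forall x y, x ∈ Y -> y ∈ Y -> (x ∈ y <-> h x ∈ h y)) /\
  forall v, transitive v -> subset v Y -> forall x, x ∈ v -> h x = x.
Proof.
  intros hext.
  destruct (@recursion M (fun x g y => forall u, u ∈ y <-> exists z, z ∈ x /\ z ∈ Y /\ opair z u ∈ g)) as (F & hFd & hFu & hF); [dfn| |].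
  - intros x g. destruct (@sep M (fun u => exists z, z ∈ x /\ z ∈ Y /\ opair z u ∈ g) (bigU (bigU g))) as [y hy]; [dfn|].
    assert (h : forall u, u ∈ y <-> exists z, z ∈ x /\ z ∈ Y /\ opair z u ∈ g).
    { intros u. rewrite hy. split; [tauto|]. intros (z & h1 & h2 & h3). split; eauto. apply (opair_mem2 h3). }
    exists y. split; auto. intros y' h'. apply ext. intros u. now rewrite h, h'.
  - set (h := fun x => the (F x)).
    assert (hh : forall x, F x (h x)).
    { intros x. apply the_spec. destruct (hFu x) as (y & hy & _). eauto. }
    assert (hFh : forall x y, F x y <-> y = h x).
    { intros x y. split; [|intros ->; auto]. intros hy. destruct (hFu x) as (v & _ & hv). now rewrite <- (hv _ hy), (hv _ (hh x)). }
    assert (hE : forall x u, u ∈ h x <-> exists z, z ∈ x /\ z ∈ Y /\ u = h z).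
    { intros x u. destruct (proj1 (hF x (h x)) (hh x)) as (g & hg & H). rewrite H. apply ex_iff. intros z.
      split; intros (h1 & h2 & h3); split; auto; split; auto.
      - apply hg in h3 as (z' & w & _ & h3 & e). apply opair_inj in e as [-> ->]. now apply hFh.
      - apply hg. exists z, u. split; [now apply tc_sub|]. split; auto. now apply hFh. }
    destruct (@repl M F Y hFd) as [T hT]; [auto|].
    assert (hinj : forall x, x ∈ Y -> forall y, y ∈ Y -> h x = h y -> x = y).
    { enough (H : forall x, x ∈ Y -> forall y, y ∈ Y -> (exists v, F x v /\ F y v) -> x = y).
      { intros x hx y hy e. apply H; auto. exists (h x). split; auto. now apply hFh. }
      apply (mem_ind (P := fun x => x ∈ Y -> forall y, y ∈ Y -> (exists v, F x v /\ F y v) -> x = y)); [dfn|].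
      intros x IH hx y hy (v & h1 & h2). apply hFh in h1, h2. apply hext; auto. intros z hz. split; intros hzz.
      - assert (hz' : h z ∈ h y) by (rewrite <- h2, h1; apply hE; eauto). apply hE in hz' as (z' & h3 & h4 & h5).
        rewrite (IH z hzz hz z' h4); auto. exists (h z). split; auto. now apply hFh.
      - assert (hz' : h z ∈ h x) by (rewrite <- h1, h2; apply hE; eauto). apply hE in hz' as (z' & h3 & h4 & h5).
        rewrite <- (IH z' h3 h4 z hz); auto. exists (h z). split; auto. now apply hFh. }
    exists F, h, T. split; auto. split; auto. split; [|split; [|split; [|split]]].
    + intros y. rewrite hT. apply ex_iff. intros x. now rewrite hFh.
    + intros y hy z hz. apply hT in hy as (x & hx & hy). apply hFh in hy as ->. apply hE in hz as (w & h1 & h2 & ->). apply hT. eauto.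
    + intros x y hx hy. now apply hinj.
    + intros x y hx hy. rewrite hE. split; [eauto|]. intros (z & h1 & h2 & h3). now rewrite (hinj x hx z h2 h3).
    + intros v hv hvY x hx. enough (H : F x x) by (symmetry; now apply hFh). revert x hx.
      apply (mem_ind (P := fun x => x ∈ v -> F x x)); [dfn|]. intros x IH hx. apply hFh. apply ext. intros u. rewrite hE. split.
      * intros hu. exists u. split; auto. assert (huv : u ∈ v) by now apply (hv x). split; auto. apply hFh. auto.
      * intros (z & h1 & _ & ->). assert (hzv : z ∈ v) by now apply (hv x). assert (e := IH z h1 hzv). apply hFh in e. now rewrite <- e.
Qed.

(** A Sigma_1 formula true in V holds in some V_xi, hence in a hull that is an image of some V_al
    with al < eta, hence in its transitive collapse [T]. If [T] were not inside V_eta, the ranks of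
    its elements would exhaust eta, and V_al would map onto eta. So [T] lies in V_eta, and the
    formula persists from [T] to V_eta. *)
Lemma beth_in_C eta : limit eta -> omega ∈ eta -> beth eta -> in_C 1 eta.
Proof.
  intros hl hw [hb1 hb2]. assert (ho := proj1 hl). split; [exact ho|]. split; [exists empty; apply (limit_num 0 hl)|].
  intros f hf e he. assert (htr : forall x y : M, x ∈ y -> y ∈ Vlev eta -> x ∈ Vlev eta) by (intros x y hx hy; now apply (Vlev_trans ho hy)).
  split.
  - apply (Sigma1_up hf); auto. intros; exact I.
  - intros hs. assert (hS : Delta0 f \/ S1 (M := M) 0 f).
    { clear -hf. remember 1 as n. induction hf; try discriminate; auto.
      - injection Heqn as ->. inversion H; auto.
      - right. apply S1_Ex. destruct (IHhf Heqn) as [h|h]; auto. now apply refl_S1, refl_Delta0. }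
    destruct hS as [hS|hS]; [apply (@Delta0_sat M (fun x => x ∈ Vlev eta) (@whole M)); auto; intros; exact I|].
    set (q := bnd f). assert (hal : exists al, al ∈ eta /\ limit al /\ forall k, k < q -> e k ∈ Vlev al).
    { assert (H : exists b, b ∈ eta /\ forall k, k < q -> e k ∈ Vlev b).
      { clearbody q. clear -he hl ho. induction q as [|q (b & hb & h)]; [exists empty; split; [apply (limit_omega_sub hl), omega0|lia]|].
        assert (heq := he q). apply (limit_in_Vlev _ hl) in heq as (b' & hb' & h').
        destruct (ord_lt_or (ord_mem ho hb) (ord_mem ho hb')) as [hbb|hbb].
        - exists b'. split; auto. intros k hk. destruct (Nat.eq_dec k q) as [->|]; auto.
          apply (Vlev_lt_sub (ord_mem ho hb') hbb). apply h. lia.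
        - exists b. split; auto. intros k hk. destruct (Nat.eq_dec k q) as [->|]; [|apply h; lia].
          apply (Vlev_mono (ord_mem ho hb) (ord_mem ho hb') hbb h'). }
      destruct H as (b & hb & h). destruct (hb1 b hb) as (al & h1 & h2 & h3). exists al. split; auto. split; auto. intros k hk.
      apply (Vlev_lt_sub (proj1 h3) h2). auto. }
    destruct hal as (al & hae & hall & heal). assert (oal := proj1 hall).
    set (e1 := fun k => if k <? q then e k else e 0). assert (hq := bnd_pos f).
    assert (hee : forall k, k < q -> e1 k = e k) by (intros k hk; unfold e1; now rewrite (proj2 (Nat.ltb_lt _ _) hk)).
    assert (he1 : forall k, e1 k ∈ Vlev al) by (intros k; unfold e1; destruct (Nat.ltb_spec k q); auto).
    destruct (proj2 (proj2 hS) e al oal hs) as (xi & hax & [hxl hxw] & hx). assert (oxi := proj1 hxl).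
    assert (hVV : subset (Vlev al) (Vlev xi)) by now apply Vlev_lt_sub.
    specialize (hx e1 (fun k => hVV _ (he1 k)) hee).
    destruct (@skolem_hull M al (Vlev xi) empty hall hVV (limit_num 0 hxl)) as (Y & G & hY & hVY & _ & hG & hGs).
    rewrite <- (elementary_sub_sat hY) in hx by auto.
    destruct (@collapse Y) as (F & h & T & hFd & hFh & hT & hTt & hinj & hmem & hfix).
    { intros x y hx' hy hxy.
      assert (H := elementary_sub_sat hY (Imp (All 2 (And (Imp (Mem 2 0) (Mem 2 1)) (Imp (Mem 2 1) (Mem 2 0)))) (Eq 0 1)) (e := fun k => if k =? 0 then x else y)).
      cbn in H. apply H.
      - intros n. destruct (n =? 0); auto.
      - intros h. apply ext. intros z. assert (hxV := proj1 hY _ hx'). assert (hyV := proj1 hY _ hy). split; intros hz; apply (h z); auto.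
        + apply (Vlev_trans oxi hxV hz).
        + apply (Vlev_trans oxi hyV hz).
      - intros z hz. split; apply (hxy z hz). }
    assert (hTe : subset T (Vlev eta)).
    { apply NNPP. intros hn. apply (hb2 al hae (Vlev al)); [now split|].
      apply (@surj_from M (fun x a => exists y t, opair x y ∈ G /\ F y t /\ hr t a)).
      - unfold hr. dfn.
      - apply (limit_omega_sub hl), omega0.
      - intros x a a' _ (y & t & h1 & h2 & h3) (y' & t' & h1' & h2' & h3'). rewrite (func_fun hG h1' h1) in h2'.
        apply hFh in h2, h2'. subst. apply hr_iff in h3, h3'. apply (has_rank_unique h3 h3').
      - intros b hb. assert (ob := ord_mem ho hb). destruct (@sep M (fun x => ~ x ∈ Vlev b) T) as [S hS']; [dfn|].
        destruct (zf_foundation M S) as (x & hxS & hxm).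
        + apply NNPP. intros hn'. apply hn. intros x hx'. apply (Vlev_lt_sub ho hb). apply NNPP. intros h'. apply hn'. exists x. apply hS'. auto.
        + apply hS' in hxS as [hxT hxb]. assert (hrx : has_rank x b).
          { split; auto. split.
            - intros y hy. apply NNPP. intros h'. apply (hxm y); auto. apply hS'. split; auto. now apply (hTt x).
            - intros c hc h'. apply hxb. apply in_Vlev; eauto. }
          apply hT in hxT as (y & hy & ->). destruct (hGs y hy) as (z & hz & hzy). exists z. split; auto. exists y, (h y). split; auto.
          split; [now apply hFh|now apply hr_iff]. }
    apply (@sat_iso (fun x => x ∈ Y) (fun x => x ∈ T) h) in hx; auto.
    + apply (@Sigma1_up (fun x => x ∈ T) (fun x => x ∈ Vlev eta)) in hx; auto.
      * revert hx. apply sat_ext. intros k hk. rewrite (hfix (Vlev al)); auto; [|now apply Vlev_trans]. now rewrite hee.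
      * intros x y h1 h2. now apply (hTt y).
      * intros k. apply hT. exists (e1 k). auto.
    + intros x hx'. apply hT. eauto.
    + intros y hy. apply hT in hy as (x & h1 & ->). eauto.
Qed.

End Collapse.

(** * Jonsson functions and fixed points above the critical point *)

Section Jonsson.
Context {M : zfc_model}.
Implicit Types x y z a b c d f g h p q r s u v w t xi lam kap X i j k m n Y S A B F G Z : M.

Lemma dependent_choice S (R : M -> M -> Prop) z : Dfn cW (fun e => R (e 0) (e 1)) -> z ∈ S ->
  (forall x, x ∈ S -> exists y, y ∈ S /\ R x y) ->
  exists f, func f omega S /\ forall n, n ∈ omega -> R (app f n) (app f (succ n)).
Proof.
  intros hd hz hR. destruct (choice_fun (pow S)) as (ch & hc1 & hc2 & hc3).
  set (st := fun x y => exists Y, (forall w, w ∈ Y <-> w ∈ S /\ R x w) /\ opair Y y ∈ ch).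
  assert (hst : forall x y, st x y -> y ∈ S /\ R x y).
  { intros x y (Y & h1 & h2). apply hc1 in h2 as [_ h2]. now apply h1. }
  assert (hstu : forall x y y', st x y -> st x y' -> y = y').
  { intros x y y' (Y & h1 & h2) (Y' & h1' & h2'). replace Y' with Y in h2'; [now apply (hc2 Y)|]. apply ext. intros w. now rewrite h1, h1'. }
  assert (hste : forall x, x ∈ S -> exists y, st x y).
  { intros x hx. destruct (@sep M (fun w => R x w) S) as [Y hY]; [dfn|]. destruct (hc3 Y) as [y hy].
    - apply in_pow. intros w hw. now apply hY in hw.
    - destruct (hR x hx) as (y & h1 & h2). exists y. apply hY. auto.
    - exists y, Y. auto. }
  assert (hstd : Dfn cW (fun e => st (e 0) (e 1))) by (unfold st; dfn).
  set (H := fun n g y => (n = empty /\ y = z) \/ (exists m x, n = succ m /\ opair m x ∈ g /\ st x y /\ forall x', opair m x' ∈ g -> x' = x)).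
  assert (hHd : Dfn cW (fun e => H (e 0) (e 1) (e 2))) by (unfold H; dfn).
  assert (hHu : forall n g y y', H n g y -> H n g y' -> y = y').
  { intros n g y y' [[-> ->]|(m & x & -> & h1 & h2 & h3)] [[e ->]|(m' & x' & e & h1' & h2' & h3')]; auto.
    - symmetry in e. destruct (succ_neq_empty e).
    - destruct (succ_neq_empty e).
    - apply succ_inj in e as <-. rewrite (h3 x' h1') in h2'. now apply (hstu x). }
  destruct (@recursion M (fun n g y => H n g y \/ ((~ exists y', H n g y') /\ y = z))) as (F & hFd & hFu & hF); [dfn| |].
  { intros n g. destruct (classic (exists y, H n g y)) as [[y hy]|hn].
    - exists y. split; auto. intros y' [h|[h _]]; [now apply (hHu n g)|destruct h; eauto].
    - exists z. split; auto. intros y' [h|[_ h]]; auto. destruct hn. eauto. }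
  assert (hS : forall n y, n ∈ omega -> F n y -> y ∈ S /\ forall y', F (succ n) y' -> R y y').
  { enough (HS : forall n, n ∈ omega -> forall y, F n y -> y ∈ S).
    - intros n y hn hy. split; [now apply (HS n)|]. intros y' hy'. apply hF in hy' as (g & hg & hy').
      assert (hgn : forall x, opair n x ∈ g <-> x = y).
      { intros x. rewrite hg. split.
        - intros (n' & x' & _ & h & e). apply opair_inj in e as [-> ->]. destruct (hFu n') as (v & _ & hv). now rewrite <- (hv _ h), (hv _ hy).
        - intros ->. exists n, y. split; auto. apply tc_sub, in_succ. auto. }
      destruct hy' as [[[e _]|(m & x & e & h1 & h2 & _)]|[hn' _]].
      + destruct (succ_neq_empty e).
      + apply succ_inj in e as <-. apply hgn in h1 as ->. now apply hst.
      + destruct hn'. destruct (hste y (HS n hn y hy)) as [y'' hy'']. exists y''. right. exists n, y. split; auto. split; [now apply hgn|].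
        split; auto. intros x'. apply hgn.
    - apply (omega_ind (P := fun n => forall y, F n y -> y ∈ S)); [dfn| |].
      + intros y hy. apply hF in hy as (g & _ & [[[_ ->]|(m & x & e & _)]|[_ ->]]); auto. symmetry in e. destruct (succ_neq_empty e).
      + intros n _ _ y hy. apply hF in hy as (g & _ & [[[_ ->]|(m & x & e & _ & h & _)]|[_ ->]]); auto. now apply hst in h. }
  destruct (@fun_of_func M F omega S hFd) as (f & hf & hfE); [auto|intros; now apply (hS x)|].
  exists f. split; auto. intros n hn. assert (h1 := func_ap hf hn). assert (h2 := func_ap hf (omegaS hn)). apply hfE in h1 as [_ h1], h2 as [_ h2].
  now apply (hS n).
Qed.

Definition inj h y B : Prop := func h y B /\ forall a, a ∈ y -> forall b, b ∈ y -> forall c, c ∈ B -> opair a c ∈ h -> opair b c ∈ h -> a = b.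

Lemma Dfn_inj C (h y B : (nat -> M) -> M) : DfT C h -> DfT C y -> DfT C B -> Dfn C (fun e => inj (h e) (y e) (B e)).
Proof. intros. unfold inj. dfn. Qed.

(** An omega-Jonsson function on a subset [A] of [y]: on the sequences from any subset of [A] as
    large as [y] it takes all values in [A]. Instead of transporting [F] to [y], the bijection [h]
    of [y] with [A] is carried along. *)
Definition jonsson F A h y : Prop :=
  subset A y /\ inj h y A /\ (forall b, b ∈ A -> exists a, a ∈ y /\ opair a b ∈ h) /\
  (forall x, func x omega y -> forall z, z ∈ y -> forall z', z' ∈ y -> opair x z ∈ F -> opair x z' ∈ F -> z = z') /\
  forall B, subset B A -> (exists g, inj g y B) -> forall b, b ∈ A -> exists x, func x omega B /\ opair x b ∈ F.

Lemma Dfn_jonsson C (F A h y : (nat -> M) -> M) : DfT C F -> DfT C A -> DfT C h -> DfT C y -> Dfn C (fun e => jonsson (F e) (A e) (h e) (y e)).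
Proof.
  intros hF hA hh hy. unfold jonsson. dfn; try (apply Dfn_inj; dfn).
  - apply (Good_func (cdom_good H) (good_omega (cdom_good H)) (b := y e)); [now apply (proj1 hy)|]. tauto.
  - destruct H1 as [H1 _]. apply (Good_func (cdom_good H) (a := y (fun i : nat => e (Datatypes.S i))) (b := e 0)); auto. apply (proj1 hy); auto. intros k. apply H0.
  - destruct H1 as [H1 _]. apply (Good_func (cdom_good H) (a := omega) (b := e 1)); auto. apply (good_omega (cdom_good H)).
  - apply (good_sub (cdom_good H) (y := A e)); [|now apply (proj1 hA)]. apply NNPP. tauto.
Qed.

(* The value of F at x is read off the last place where x differs from the
   chosen representative of its class modulo finite changes; constant
   sequences take their constant value, so that a point omitted by F on B
   lies outside B. *)
Lemma jonsson_exists y : exists F A h, jonsson F A h y /\ subset F (pow (pow (union2 (funset omega y) y))).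
Proof.
  set (S := funset omega y).
  set (eqv := fun x x' => exists m, m ∈ omega /\ forall n, n ∈ omega -> ~ n ∈ m -> forall a, opair n a ∈ x <-> opair n a ∈ x').
  assert (hed : Dfn cW (fun e => eqv (e 0) (e 1))) by (unfold eqv; dfn).
  destruct (choice_fun (pow S)) as (ch & hc1 & hc2 & hc3).
  set (rep := fun x r => exists Y, (forall w, w ∈ Y <-> w ∈ S /\ eqv w x) /\ opair Y r ∈ ch).
  assert (hrd : Dfn cW (fun e => rep (e 0) (e 1))) by (unfold rep; dfn).
  assert (hru : forall x r r', rep x r -> rep x r' -> r = r').
  { intros x r r' (Y & h1 & h2) (Y' & h1' & h2'). replace Y' with Y in h2'; [now apply (hc2 Y)|]. apply ext. intros w. now rewrite h1, h1'. }
  set (fv := fun x v => (forall k, k ∈ omega -> opair k v ∈ x) \/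
     ((~ exists a, forall k, k ∈ omega -> opair k a ∈ x) /\ exists r k, rep x r /\ k ∈ omega /\ opair k v ∈ r /\ (~ opair k v ∈ x) /\
        forall n, n ∈ omega -> k ∈ n -> forall a, opair n a ∈ x <-> opair n a ∈ r)).
  assert (hfd : Dfn cW (fun e => fv (e 0) (e 1))) by (unfold fv; dfn).
  assert (hrS : forall x r, rep x r -> func r omega y /\ eqv r x).
  { intros x r (Y & h1 & h2). apply hc1 in h2 as [_ h2]. apply h1 in h2 as [h2 h3]. split; auto. now apply in_funset. }
  assert (hfu : forall x v v', func x omega y -> fv x v -> fv x v' -> v = v').
  { intros x v v' hx [h|[hn (r & k & h1 & h2 & h3 & h4 & h5)]] [h'|[hn' (r' & k' & h1' & h2' & h3' & h4' & h5')]].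
    - apply (func_fun hx (h _ (@omega0 M)) (h' _ (@omega0 M))).
    - destruct hn'. eauto.
    - destruct hn. eauto.
    - rewrite <- (hru _ _ _ h1 h1') in *. destruct (hrS _ _ h1) as [hr _].
      destruct (ord_tri (nat_ord h2) (nat_ord h2')) as [hk|[hk|hk]].
      + destruct h4'. now apply h5.
      + subst k'. apply (func_fun hr h3 h3').
      + destruct h4. now apply h5'. }
  set (large := fun A => subset A y /\ exists g, inj g y A).
  assert (hld : Dfn cW (fun e => large (e 0))) by (unfold large; dfn; apply Dfn_inj; dfn).
  assert (hcl : exists A, large A /\ forall B, subset B A -> large B -> forall b, b ∈ A -> exists x, func x omega B /\ fv x b).
  (* Otherwise each large set has a large subset whose sequences omit one of its points as a value,
     and dependent choice iterates this. *)
  { apply NNPP. intros hn.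
    assert (hneg : forall A, large A -> exists B b, subset B A /\ large B /\ b ∈ A /\ forall x, func x omega B -> ~ fv x b).
    { intros A hA. apply NNPP. intros h. apply hn. exists A. split; auto. intros B hB hBl b hb. apply NNPP. intros h'. apply h. exists B, b. split; auto.
      split; auto. split; auto. intros x hx hv. apply h'. eauto. }
    assert (hly : large y).
    { split; [apply subset_refl|]. exists (idfun y). split; [apply idfun_func, subset_refl|].
      intros a _ b _ c _ h h'. apply idfun_in in h as [_ ->], h' as [_ ->]. reflexivity. }
    destruct (hneg y hly) as (_ & y0 & _ & _ & hy0 & _).
    destruct (@sep M (fun p => exists A a, p = opair A a /\ large A /\ a ∈ y) (pow (pow (union2 (pow y) y)))) as [S2 hS2]; [dfn|].
    assert (hS2' : forall A a, opair A a ∈ S2 <-> large A /\ a ∈ y).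
    { intros A a. rewrite hS2. split.
      - intros (_ & A' & a' & e & h). now apply opair_inj in e as [-> ->].
      - intros [h h']. split; [apply opair_in_pow; auto; apply in_pow; apply h|eauto]. }
    destruct (@dependent_choice S2 (fun p q => exists A a B b, p = opair A a /\ q = opair B b /\ subset B A /\ b ∈ A /\ forall x, func x omega B -> ~ fv x b) (opair y y0))
      as (f & hf & hfR); [dfn|now apply hS2'| |].
    { intros p hp. assert (hp' := hp). apply hS2 in hp as (_ & A & a & -> & hA & ha). destruct (hneg A hA) as (B & b & h1 & h2 & h3 & h4).
      exists (opair B b). split; [apply hS2'; split; auto; apply hA; auto|]. exists A, a, B, b. auto 7. }
    assert (hAn : forall n, n ∈ omega -> exists A a, opair n (opair A a) ∈ f /\ subset A y /\ a ∈ y).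
    { intros n hn'. destruct (func_ex hf hn') as (p & hp & hnp). assert (hp' := hp). apply hS2 in hp as (_ & A & a & -> & hA & ha).
      exists A, a. split; auto. split; auto. apply hA. }
    assert (hstep : forall n A a B b, n ∈ omega -> opair n (opair A a) ∈ f -> opair (succ n) (opair B b) ∈ f -> subset B A /\ b ∈ A /\ forall x, func x omega B -> ~ fv x b).
    { intros n A a B b hn' h1 h2. destruct (hfR n hn') as (A' & a' & B' & b' & e1 & e2 & h). rewrite (func_app hf h1) in e1. rewrite (func_app hf h2) in e2.
      apply opair_inj in e1 as [<- <-], e2 as [<- <-]. exact h. }
    destruct (@fun_of_func M (fun n b => exists B, opair (succ n) (opair B b) ∈ f) omega y) as (x & hx & hxE); [dfn| | |].
    { intros n hn'. destruct (hAn _ (omegaS hn')) as (B & b & h & _). exists b. split; eauto. intros b' (B' & h').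
      assert (e := func_fun hf h h'). now apply opair_inj in e as [_ ->]. }
    { intros n b hn' (B & h). apply (func_dom hf) in h as [_ h]. now apply hS2' in h. }
    assert (hmono : forall n, n ∈ omega -> forall m, m ∈ omega -> (m ∈ n \/ m = n) -> forall A a B b, opair m (opair A a) ∈ f -> opair n (opair B b) ∈ f -> subset B A).
    { apply (omega_ind (P := fun n => forall m, m ∈ omega -> (m ∈ n \/ m = n) -> forall A a B b, opair m (opair A a) ∈ f -> opair n (opair B b) ∈ f -> subset B A)); [dfn| |].
      - intros m _ [h| ->]; [destruct (in_empty h)|]. intros A a B b h h'. assert (e := func_fun hf h h'). apply opair_inj in e as [-> _]. apply subset_refl.
      - intros n hn' IH m hm hmn A a B b h h'. destruct hmn as [hmn| ->].
        + apply in_succ in hmn. destruct (hAn n hn') as (D & d & hD & _). destruct (hstep n D d B b hn' hD h') as [h1 _].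
          intros z hz. apply (IH m hm hmn A a D d h hD). auto.
        + assert (e := func_fun hf h h'). apply opair_inj in e as [-> _]. apply subset_refl. }
    (* the point x n of A_n is omitted by F on A_(n+1) *)
    assert (hxA : forall n m a A c, n ∈ omega -> m ∈ omega -> (m ∈ n \/ m = n) -> opair n a ∈ x -> opair m (opair A c) ∈ f -> a ∈ A).
    { intros n m a A c hn' hm hmn h h'. apply hxE in h as [_ (B & h)]. destruct (hAn n hn') as (D & d & hD & _).
      destruct (hstep n D d B a hn' hD h) as (_ & h1 & _). now apply (hmono n hn' m hm hmn A c D d). }
    assert (hxo : forall n a A c, n ∈ omega -> opair n a ∈ x -> opair (succ n) (opair A c) ∈ f -> forall x', func x' omega A -> ~ fv x' a).
    { intros n a A c hn' h h'. apply hxE in h as [_ (B & h)]. destruct (hAn n hn') as (D & d & hD & _).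
      assert (e := func_fun hf h h'). apply opair_inj in e as [<- <-]. apply (hstep n D d B a hn' hD h). }
    assert (hdist : forall n m a, n ∈ omega -> m ∈ omega -> n ∈ m -> opair n a ∈ x -> ~ opair m a ∈ x).
    { intros n m a hn' hm hnm h h'. destruct (hAn _ (omegaS hn')) as (A & c & hA & _).
      assert (haA : a ∈ A).
      { apply (hxA m (succ n) a A c); auto using omegaS. apply succ_le; auto. now apply nat_ord. }
      apply (hxo n a A c hn' h hA (cst a)); [now apply cst_func|]. left. intros k hk. now apply cst_in. }
    assert (hrx : exists r, rep x r).
    { destruct (@sep M (fun w => eqv w x) S) as [Y hY]; [dfn|]. destruct (hc3 Y) as [r hr].
      - apply in_pow. intros w hw. now apply hY in hw.
      - exists x. apply hY. split; [now apply in_funset|]. exists empty. split; [apply omega0|]. tauto.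
      - exists r, Y. auto. }
    destruct hrx as [r hr]. destruct (hrS x r hr) as [hrf (m & hm & hrm)].
    destruct (func_ex hx hm) as (am & _ & ham). destruct (func_ex hx (omegaS hm)) as (am1 & _ & ham1).
    destruct (func_ex hx (omegaS (omegaS hm))) as (am2 & _ & ham2). destruct (hAn _ (omegaS hm)) as (A & c & hA & _).
    assert (hmm : m ∈ succ m) by (apply in_succ; auto).
    (* The representative [r] agrees with [x] from [m] on. The sequence x' copies [x] after [m] and
       is constantly x(m+1) up to [m]: it stays in A_(m+1) and differs from [r] for the last time at
       [m], so that its value is r(m) = x(m), which is omitted there. *)
    destruct (@fun_of_func M (fun n a => (m ∈ n /\ opair n a ∈ x) \/ (~ m ∈ n /\ a = am1)) omega A) as (x' & hx' & hxE'); [dfn| | |].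
    { intros n hn'. destruct (classic (m ∈ n)) as [h|h].
      - destruct (func_ex hx hn') as (a & _ & ha). exists a. split; auto. intros a' [[_ h']|[h' _]]; [apply (func_fun hx ha h')|tauto].
      - exists am1. split; auto. intros a' [[h' _]|[_ h']]; [tauto|auto]. }
    { intros n a hn' [[h h']|[h ->]].
      - apply (hxA n (succ m) a A c); auto using omegaS. apply succ_le; auto. now apply nat_ord.
      - apply (hxA (succ m) (succ m) am1 A c); auto using omegaS. }
    assert (hxx : forall n, n ∈ omega -> m ∈ n -> forall a, opair n a ∈ x' <-> opair n a ∈ x).
    { intros n hn' h a. rewrite hxE'. split; [intros [_ [[_ h']|[h' _]]]; tauto|auto]. }
    assert (hmn : forall n, n ∈ omega -> m ∈ n -> ~ n ∈ m) by (intros n _ h h'; apply (mem_asym h h')).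
    apply (hxo m am A c hm ham hA x' hx'). right. split.
    - intros (a & ha). assert (h1 := ha _ (omegaS hm)). assert (h2 := ha _ (omegaS (omegaS hm))).
      rewrite hxx in h1 by (auto using omegaS). rewrite hxx in h2 by (auto using omegaS; apply in_succ; auto).
      apply (hdist (succ m) (succ (succ m)) a); auto using omegaS. apply in_succ. auto.
    - exists r, m. split; [|split; [auto|split; [|split]]].
      + destruct hr as (Y & hY1 & hY2). exists Y. split; auto. intros w. rewrite hY1. apply and_iff_compat_l.
        split; intros (m' & hm' & h).
        * assert (hmax : exists m0, m0 ∈ omega /\ subset m' m0 /\ m ∈ m0).
          { destruct (ord_lt_or (nat_ord hm) (nat_ord hm')) as [h'|h']; [exists m'|exists (succ m)]; repeat split; auto using subset_refl, omegaS.
            intros z hz. apply in_succ. auto. }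
          destruct hmax as (m0 & hm0 & h1 & h2). exists m0. split; auto. intros n hn' hnm a. rewrite h by auto. symmetry. apply hxx; auto.
          destruct (ord_lt_or (nat_ord hn') (nat_ord hm0)); [tauto|auto].
        * assert (hmax : exists m0, m0 ∈ omega /\ subset m' m0 /\ m ∈ m0).
          { destruct (ord_lt_or (nat_ord hm) (nat_ord hm')) as [h'|h']; [exists m'|exists (succ m)]; repeat split; auto using subset_refl, omegaS.
            intros z hz. apply in_succ. auto. }
          destruct hmax as (m0 & hm0 & h1 & h2). exists m0. split; auto. intros n hn' hnm a. rewrite h by auto. apply hxx; auto.
          destruct (ord_lt_or (nat_ord hn') (nat_ord hm0)); [tauto|auto].
      + apply hrm; auto. apply mem_irrefl.
      + intros h. apply hxE' in h as [_ [[h _]|[_ ->]]]; [apply (mem_irrefl h)|]. apply (hdist m (succ m) am1); auto using omegaS.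
      + intros n hn' h a. rewrite hxx by auto. symmetry. apply hrm; auto. }
  destruct hcl as (A0 & [hA0 (g & hg & hgi)] & hcl).
  destruct (@sep M (fun b => exists a, opair a b ∈ g) A0) as [A hA]; [dfn|].
  destruct (@sep M (fun p => exists x v, p = opair x v /\ fv x v) (pow (pow (union2 S y)))) as [F hF]; [dfn|].
  assert (hgA : func g y A) by (apply (func_cod hg); intros a b h; apply hA; split; eauto; apply (func_dom hg h)).
  exists F, A, g. split; [|intros p hp; now apply hF in hp].
  split; [|split; [|split; [|split]]].
  - intros z hz. apply hA in hz as [hz _]. auto.
  - split; auto. intros a ha b hb c hc. apply hgi; auto. apply hA in hc. tauto.
  - intros b hb. apply hA in hb as [_ [a ha]]. exists a. split; auto. apply (func_dom hg ha).
  - intros x hx z hz z' hz' h h'. apply hF in h as [_ (x1 & v1 & e1 & h)], h' as [_ (x2 & v2 & e2 & h')].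
    apply opair_inj in e1 as [<- <-], e2 as [<- <-]. now apply (hfu x).
  - intros B hB [g' hg'] b hb. assert (hBA : subset B A0) by (intros z hz; apply hB, hA in hz; tauto).
    assert (hBy : subset B y) by (intros z hz; auto).
    destruct (hcl B hBA) with (b := b) as (x & hx & hv).
    + split; eauto.
    + apply hA in hb. tauto.
    + exists x. split; auto. apply hF. split; [|eauto]. apply opair_in_pow.
      * apply in_funset. apply (func_cod hx). intros k z hz. apply hBy. apply (func_dom hx hz).
      * apply hA in hb as [hb _]. auto.
Qed.


(** * Fixed points of the embedding, and limit cardinals *)

Definition bij f a b : Prop := func f a b /\ forall y, y ∈ b -> exists x, x ∈ a /\ opair x y ∈ f /\ forall x', x' ∈ a -> opair x' y ∈ f -> x' = x.

Lemma bijection_bij f a b : bijection f a b <-> bij f a b.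
Proof.
  split; intros [hf h]; split; auto; intros y hy; specialize (h y hy).
  - destruct h as (x & [hx <-] & hu). exists x. split; auto. split; [now apply (func_ap hf)|]. intros x' hx' h'. symmetry. apply hu. split; auto.
    now apply (func_app hf).
  - destruct h as (x & hx & hxy & hu). exists x. split; [split; auto; now apply (func_app hf)|]. intros x' [hx' <-]. symmetry. apply hu; auto.
    now apply (func_ap hf).
Qed.

(** A rendering of [cardinal] without the description operator [app], suited to absoluteness over
    good domains. *)
Definition card x : Prop := ordinal x /\ forall y, y ∈ x -> ~ exists f, bij f y x.

Lemma cardinal_card x : cardinal x <-> card x.
Proof.
  split; intros [ho h]; split; auto; intros y hy [f hf]; apply (h y hy); exists f; now apply bijection_bij.
Qed.

Lemma Dfn_card C (x : (nat -> M) -> M) : DfT C x -> Dfn C (fun e => card (x e)).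
Proof.
  intros hx. unfold card, bij. dfn.
  destruct H1 as [H1 _]. apply (Good_func (cdom_good H) (a := e 0) (b := x (fun i : nat => e (Datatypes.S i)))); auto. apply (proj1 hx); auto. intros k. apply H0.
Qed.

Section NoFix.
Variables (X i Z lam : M).
Hypothesis hi : func i X Z.
Hypothesis hVX : subset (Vlev lam) X.
Hypothesis hlX : lam ∈ X.
Hypothesis hil : app i lam = lam.
Hypothesis hcard : cardinal lam.
Hypothesis hP : forall P, Dfn cA P -> Pres X i P.
Hypothesis hmov : exists a, a ∈ lam /\ app i a <> a.

Let ol : ordinal lam := proj1 hcard.

Lemma Pres_pres : pres X i.
Proof. apply basic_pres. intros P h. now apply hP, basic_dfn. Qed.

Let hpr := Pres_pres.

Let hm x y (hx : x ∈ X) (hy : y ∈ X) (h : x ∈ y) : app i x ∈ app i y := proj1 (pr_mem hpr hx hy) h.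

Lemma image_pair f a b : f ∈ Vlev lam -> opair a b ∈ f -> opair (app i a) (app i b) ∈ app i f.
Proof.
  intros hf h. assert (G := lam_Good hi hVX hcard hpr hmov). assert (hp := good_trans G h hf). destruct (Good_opair_inv G hf h) as [ha hb].
  cbv beta in *. rewrite <- (pr_opair hpr); auto.
Qed.

(** The pointwise image [B] of [A] has the size of [y] and lies in i(A), so i(F) takes every value
    in i(A) on sequences from [B]. Such a sequence is i(t) for a sequence [t] from [A], because [i]
    fixes the natural numbers and [t] is in V_lambda. Hence i(A) lies in the range of [i], and
    through [h] so does [y]; an order-preserving map of [y] onto [y] is the identity. *)
Lemma fixed_below y : y ∈ lam -> app i y = y -> forall a, a ∈ y -> app i a = a.
Proof.
  intros hy hiy. assert (G := lam_Good hi hVX hcard hpr hmov).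
  assert (hol : omega ∈ lam) by exact (crit_infinite hi hVX hcard hpr hmov).
  assert (hyV : y ∈ Vlev lam) by now apply (ord_sub_Vlev ol). assert (hwV : omega ∈ Vlev lam) by now apply (ord_sub_Vlev ol).
  assert (hyl : forall a, a ∈ y -> a ∈ lam) by (intros a ha; now apply (ord_trans ol hy)).
  destruct (jonsson_exists y) as (F & A & h & hJ & hF).
  assert (hFV : F ∈ Vlev lam).
  { apply (good_sub G hF). repeat apply (good_pow G). apply (Good_union2 G); auto.
    apply (good_sub G (y := pow (pow (pow (union2 omega y))))); [intros f hf; apply in_funset in hf; now apply func_in_pow|].
    repeat apply (good_pow G). now apply (Good_union2 G). }
  assert (hAV : A ∈ Vlev lam) by (apply (good_sub G (y := y)); [apply hJ|auto]).
  assert (hhV : h ∈ Vlev lam) by (apply (Good_func G (a := y) (b := A)); auto; apply hJ).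
  assert (hJ' : jonsson (app i F) (app i A) (app i h) y).
  { rewrite <- hiy. apply (proj1 (@hP (fun e => jonsson (e 0) (e 1) (e 2) (e 3)) ltac:(apply Dfn_jonsson; dfn)
      (fun k : nat => match k with 0 => F | 1 => A | 2 => h | _ => y end) ltac:(intros [|[|[|k]]]; auto))). exact hJ. }
  destruct hJ as (hAy & [hhf hhi] & hhs & _ & _). destruct hJ' as (hAy' & [hhf' hhi'] & _ & hFu & hFs).
  assert (hAX : forall a, a ∈ A -> a ∈ X) by (intros a ha; apply hVX, (good_trans G ha hAV)).
  assert (hiA : forall a, a ∈ A -> app i a ∈ app i A) by (intros a ha; apply hm; auto).
  destruct (@sep M (fun b => exists a, a ∈ A /\ opair a b ∈ i) (app i A)) as [B hB]; [dfn|].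
  assert (hBA : subset B (app i A)) by (intros b hb; now apply hB in hb).
  assert (hgB : exists g, inj g y B).
  { destruct (@fun_of_func M (fun x b => exists a, opair x a ∈ h /\ opair a b ∈ i) y B) as (g & hg & hgE); [dfn| | |].
    - intros x hx. destruct (func_ex hhf hx) as (a & ha & hxa). exists (app i a). split; [exists a; split; auto; apply (func_ap hi); auto|].
      intros b (a' & h1 & h2). rewrite (func_fun hhf hxa h1). now apply (func_app hi).
    - intros x b hx (a & h1 & h2). apply hB. assert (ha := proj2 (func_dom hhf h1)). split; [|eauto]. rewrite <- (func_app hi h2). auto.
    - exists g. split; auto. intros a ha b hb c _ h1 h2. apply hgE in h1 as [_ (a1 & h1 & h1')], h2 as [_ (a2 & h2 & h2')].
      assert (e : a1 = a2).
      { apply (pr_inj hpr); [apply hAX, (func_dom hhf h1)|apply hAX, (func_dom hhf h2)|]. now rewrite (func_app hi h1'), (func_app hi h2'). }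
      subst a2. apply (hhi a ha b hb a1); auto. apply (func_dom hhf h1). }
  assert (honto : forall xi, xi ∈ y -> exists z, z ∈ y /\ app i z = xi).
  { intros xi hxi. destruct (func_ex hhf' hxi) as (b & hb & hxb). destruct (hFs B hBA hgB b hb) as (x & hx & hxF).
    destruct (@fun_of_func M (fun n a => a ∈ A /\ exists b, opair n b ∈ x /\ opair a b ∈ i) omega A) as (t & ht & htE); [dfn| |intros; tauto|].
    { intros n hn. destruct (func_ex hx hn) as (b1 & hb1 & hnb). assert (hb2 := hb1). apply hB in hb1 as [_ (a & ha & hab)]. exists a. split; [eauto|].
      intros a' [ha' (b' & h1 & h2)]. apply (pr_inj hpr); auto. rewrite (func_app hi hab), (func_app hi h2). apply (func_fun hx hnb h1). }
    assert (htV : t ∈ Vlev lam) by (apply (Good_func G (a := omega) (b := A)); auto).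
    (* Both are functions on omega, whose elements [i] fixes, so it suffices to compare values. *)
    assert (eit : app i t = x).
    { assert (hit : func (app i t) omega (app i A)) by (rewrite <- (pr_omega hpr) at 1; [apply (pr_fun hpr); auto|auto]).
      assert (hx' : func x omega (app i A)) by (apply (func_cod hx); intros n b1 h1; apply hBA, (func_dom hx h1)).
      apply ext. intros p.
      assert (H : forall n b1 b2, opair n b1 ∈ app i t -> opair n b2 ∈ x -> b1 = b2).
      { intros n b1 b2 h1 h2. assert (hn := proj1 (func_dom hx h2)). destruct (func_ex ht hn) as (a & ha & hna).
        assert (hi1 := image_pair htV hna). rewrite (nat_fixed hi hVX hcard hpr hn) in hi1 by now apply (ord_trans ol hol).
        rewrite <- (func_fun hit hi1 h1). apply htE in hna as [_ (_ & b3 & h3 & h4)]. rewrite (func_app hi h4). apply (func_fun hx h3 h2). }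
      split; intros hp.
      - destruct (proj1 hit p hp) as (n & b1 & hn & _ & ->). destruct (func_ex hx hn) as (b2 & _ & h2). now rewrite (H n b1 b2 hp h2).
      - destruct (proj1 hx p hp) as (n & b1 & hn & _ & ->). destruct (func_ex hit hn) as (b2 & _ & h2). now rewrite <- (H n b2 b1 h2 hp). }
    assert (hz : exists z, z ∈ A /\ opair t z ∈ F).
    { apply (proj2 (@hP (fun e => exists z, z ∈ e 2 /\ opair (e 0) z ∈ e 1) ltac:(dfn)
        (fun k : nat => match k with 0 => t | 1 => F | _ => A end) ltac:(intros [|[|k]]; auto))). cbn. rewrite eit. eauto. }
    destruct hz as (z & hz & htz). apply (image_pair hFV) in htz. rewrite eit in htz.
    assert (ez : app i z = b).
    { apply (hFu x); auto. apply (func_cod hx). intros n b1 h1. apply hAy', hBA, (func_dom hx h1). }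
    destruct (hhs z hz) as (zt & hzt & hzz). exists zt. split; auto. apply (image_pair hhV) in hzz. rewrite ez in hzz.
    apply (hhi' _) with (c := b); auto. rewrite <- hiy. apply hm; auto. apply hVX. now apply (ord_sub_Vlev ol), hyl. }
  assert (hX : forall a, a ∈ y -> a ∈ X) by (intros a ha; apply hVX; now apply (ord_sub_Vlev ol), hyl).
  intros a ha. apply NNPP. intros hne.
  destruct (@ord_min M (fun a => a ∈ y /\ ~ opair a a ∈ i)) as (k & hok & [hk hkm] & hmin).
  - dfn.
  - exists a. split; [apply (ord_mem ol); auto|]. split; auto. intros h'. apply hne. apply (func_app hi h').
  - assert (hoy : ordinal y) by now apply (ord_mem ol).
    assert (hfix : forall b, b ∈ k -> app i b = b).
    { intros b hb. apply (func_app hi). apply NNPP. intros h'. apply (hmin b hb). split; auto. now apply (ord_trans hoy hk). }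
    assert (hik : app i k <> k) by (intros e; apply hkm; rewrite <- e at 2; apply (func_ap hi); auto).
    destruct (honto k hk) as (z & hz & ez). destruct (ord_tri (ord_mem hoy hz) hok) as [h1|[h1|h1]].
    + rewrite hfix in ez by auto. subst z. apply (mem_irrefl h1).
    + subst z. auto.
    + assert (h2 := h1). apply hm in h1; auto. rewrite ez in h1. assert (e := hfix _ h1). apply (pr_inj hpr) in e; auto.
      apply hX. apply (ord_trans hoy hk h1).
Qed.

(** A largest cardinal [y] below [lam] is definable from [lam] and so fixed. The critical point is a
    cardinal, hence at most [y]; it is not [y], being moved, and not below [y], by [fixed_below]. *)
Lemma embedding_limit_cardinal : limit_cardinal lam.
Proof.
  split; auto. split; [exists omega; exact (crit_infinite hi hVX hcard hpr hmov)|]. intros y hy hyc. apply NNPP. intros hn.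
  assert (hX : forall a, a ∈ lam -> a ∈ X) by (intros a ha; apply hVX; now apply (ord_sub_Vlev ol)).
  assert (hQ : card (app i y) /\ forall z, z ∈ lam -> app i y ∈ z -> ~ card z).
  { rewrite <- hil. apply (proj1 (@hP (fun e => card (e 0) /\ forall z, z ∈ e 1 -> e 0 ∈ z -> ~ card z) ltac:(dfn; apply Dfn_card; dfn)
      (fun k : nat => match k with 0 => y | _ => lam end) ltac:(intros [|k]; auto))). cbn. split; [now apply cardinal_card|].
    intros z hz hyz h. apply hn. exists z. split; auto. now apply cardinal_card. }
  destruct hQ as [hQ1 hQ2]. assert (hil' : app i y ∈ lam) by (rewrite <- hil; apply hm; auto).
  assert (e : app i y = y).
  { destruct (ord_tri (proj1 hQ1) (proj1 hyc)) as [h|[h|h]]; auto; exfalso.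
    - apply (hQ2 y hy h). now apply cardinal_card.
    - apply hn. exists (app i y). split; auto. now apply cardinal_card. }
  destruct (crit_exists hi hVX hlX hil hcard hpr hmov) as (kap & hk & hkm & hfix & _ & hkc & _).
  destruct (ord_tri (proj1 hyc) (proj1 hkc)) as [h|[h|h]].
  - apply hn. exists kap. auto.
  - subst kap. auto.
  - apply hkm. now apply (fixed_below hy e).
Qed.

End NoFix.

End Jonsson.

(** * Classes defined over good levels *)

(** Quantifies the variables 2 to q + 1, leaving 0 for the structure and 1 for lambda. *)
Fixpoint exs (q : nat) (g : fml) : fml := match q with 0 => g | S q => Ex (S (S q)) (exs q g) end.

Section Classes.
Context {M : zfc_model}.

Lemma sat_exs q g : forall e : nat -> M, sat (@mem M) (@whole M) e (exs q g) <->
  exists e', (forall k, k < 2 \/ S q < k -> e' k = e k) /\ sat (@mem M) (@whole M) e' g.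
Proof.
  induction q as [|q IH]; intros e; cbn [exs sat].
  - split; [eauto|]. intros (e' & h & h'). erewrite sat_ext; [exact h'|]. intros k _. symmetry. apply h. lia.
  - split.
    + intros (a & _ & h). apply IH in h as (e' & h1 & h2). exists e'. split; auto. intros k hk. rewrite h1 by lia. apply upd_other. lia.
    + intros (e' & h1 & h2). exists (e' (S (S q))). split; [exact I|]. apply IH. exists e'. split; auto. intros k hk.
      destruct (Nat.eq_dec k (S (S q))) as [->|hk']; [now rewrite upd_same|]. rewrite upd_other by auto. apply h1. lia.
Qed.

Lemma Sigma_exs n q g : Sigma (S n) g -> Sigma (S n) (exs q g).
Proof. intros h. induction q; cbn; auto. now apply Sigma_Ex. Qed.

(** The witnesses beyond the first two arguments, and a good set containing everything, are
    quantified existentially in front of the Pi_1 formula [level_fml]; absoluteness identifies truth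
    of [P] in that set with [P]. *)
Lemma Sigma2_class (P : (nat -> M) -> Prop) (n : nat) (lam x : M) : Dfn cA P -> 2 <= n -> lam ∈ x ->
  Sigma_definable n x (fun A => exists e : nat -> M, e 0 = A /\ e 1 = lam /\ P e).
Proof.
  intros hP hn hl. destruct (DfnA_fml_bnd 4 hP) as (f & h4 & hf). set (w := bnd f).
  assert (hPe : forall W e e', Good (fun x => x ∈ W) -> (forall k, k < bnd f -> e k ∈ W) -> (forall k, k < bnd f -> e' k = e k) ->
     (sat (@mem M) (fun x => x ∈ W) e f <-> P e')).
  { intros W e e' hG he hee. set (e2 := fun k => if k <? bnd f then e k else e 0).
    rewrite (sat_ext (@mem M) (fun x => x ∈ W) (f := f) (e' := e2)) by (intros k hk; unfold e2; now rewrite (proj2 (Nat.ltb_lt _ _) hk)).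
    assert (hd : dom (fun x => x ∈ W) e2) by (intros k; unfold e2; destruct (Nat.ltb_spec k (bnd f)); apply he; auto; lia).
    assert (h1 := hf _ hG e2 hd). rewrite h1, <- (hf _ (@Good_whole M) e2), <- (hf _ (@Good_whole M) e') by (intros k; exact I).
    apply sat_ext. intros k hk. unfold e2. rewrite (proj2 (Nat.ltb_lt _ _) hk). symmetry. auto. }
  exists (exs (w - 2) (Ex w (level_fml w f))), (fun _ => lam). split; [|split; auto].
  { apply (Sigma_le hn). apply Sigma_exs, Sigma_Ex, Sigma_Pi, level_fml_Pi; auto. }
  intros A. rewrite sat_exs. split.
  - intros (e & h0 & h1 & he). set (e' := fun k => if k <? w then e k else lam). exists e'. split.
    + intros k [hk|hk]; unfold e'.
      * rewrite (proj2 (Nat.ltb_lt _ _)) by lia. destruct k as [|[|k]]; [now rewrite upd_same|rewrite upd_other; auto|lia].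
      * rewrite (proj2 (Nat.ltb_ge _ _)) by lia. rewrite upd_other; auto. lia.
    + destruct (fin_level e w) as (a & ha & hin). destruct (@ex_good_level M a a ha) as (t & ht & hto & hat & _).
      exists (Vlev t). split; [exact I|]. rewrite sat_level; auto; [|intros k; exact I]. rewrite upd_same.
      assert (hG := limit_Good ht hto).
      assert (hW : forall k, k < bnd f -> upd e' w (Vlev t) k ∈ Vlev t).
      { intros k hk. rewrite upd_other by (unfold w; lia). unfold e'. rewrite (proj2 (Nat.ltb_lt k w) hk). apply (Vlev_lt_sub (proj1 ht) hat). auto. }
      split; auto. split; auto. apply (hPe _ _ e hG hW); auto. intros k hk. rewrite upd_other by (unfold w; lia). unfold e'. now rewrite (proj2 (Nat.ltb_lt k w) hk).
  - intros (e & he & W & _ & h). rewrite sat_level in h; auto; [|intros k; exact I]. rewrite upd_same in h. destruct h as (hG & hW & h).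
    exists e. split; [rewrite he by lia; apply upd_same|]. split; [rewrite he by lia; now rewrite upd_other|].
    apply (hPe _ _ e hG hW) in h; auto. intros k hk. rewrite upd_other; auto. unfold w. lia.
Qed.

End Classes.

(** * Copies of membership structures *)

Section Copies.
Context {M : zfc_model}.
Implicit Types x y z a b c d f g h p q r s u v w t xi lam kap X i j k m n Y A B F G Z E U R nu mu eta pi L : M.

Lemma structure_of_strc L U I : strc L U I -> structure L (opair U I).
Proof.
  intros h. exists U, I. split; auto. split; [apply h|]. intros n r hn. split.
  - intros hr v hv. apply in_funset. apply (strc_rel h hn hr hv).
  - intros hr. apply (strc_fsym h hn hr).
Qed.

Definition one a : M := singleton (opair empty a).
Definition symP : M := relsym (num 1) (num 0).
Definition symQ : M := relsym (num 1) (num 1).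
(** The binary symbol is [eps_sym] itself, so formulas of set theory are literally formulas of this
    signature. *)
Definition pq_sig : M := union2 (upair eps_sym symP) (singleton symQ).
Definition pq_I E p q : M := union2 (upair (opair eps_sym E) (opair symP p)) (singleton (opair symQ q)).

Lemma one_inj a b : one a = one b -> a = b.
Proof.
  intros e. assert (h : opair empty a ∈ one b) by (rewrite <- e; now apply in_singleton). now apply one_in in h.
Qed.

Lemma pr_inj2 a b c d : pr a b = pr c d -> a = c /\ b = d.
Proof. intros e. destruct (app_pr a b) as [h1 h2], (app_pr c d) as [h3 h4]. rewrite e in h1, h2. split; congruence. Qed.

Lemma in_pq_sig s : s ∈ pq_sig <-> s = eps_sym \/ s = symP \/ s = symQ.
Proof. unfold pq_sig. rewrite in_union2, in_upair, in_singleton. tauto. Qed.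

Lemma in_pq_I E p q s y : opair s y ∈ pq_I E p q <-> (s = eps_sym /\ y = E) \/ (s = symP /\ y = p) \/ (s = symQ /\ y = q).
Proof. unfold pq_I. rewrite in_union2, in_upair, in_singleton, !opair_eq. tauto. Qed.

Lemma relsym_inj n r n' r' : @relsym M n r = relsym n' r' -> n = n' /\ r = r'.
Proof. intros e. apply opair_inj in e as [_ e]. now apply opair_inj in e. Qed.

Lemma eps_P : @eps_sym M <> symP.
Proof. intros e. apply relsym_inj in e as [e _]. apply num_inj in e. discriminate. Qed.
Lemma eps_Q : @eps_sym M <> symQ.
Proof. intros e. apply relsym_inj in e as [e _]. apply num_inj in e. discriminate. Qed.
Lemma P_Q : symP <> symQ.
Proof. intros e. apply relsym_inj in e as [_ e]. apply num_inj in e. discriminate. Qed.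

Lemma pq_func E p q : func (pq_I E p q) pq_sig (union2 (upair E p) (singleton q)).
Proof.
  assert (h1 := eps_P). assert (h2 := eps_Q). assert (h3 := P_Q). apply func_intro.
  - intros x hx. unfold pq_I in hx. rewrite in_union2, in_upair, in_singleton in hx.
    destruct hx as [[->| ->]| ->]; eexists; eexists; (split; [|split; [|reflexivity]]);
      rewrite ?in_pq_sig, ?in_union2, ?in_upair, ?in_singleton; auto.
  - intros x hx. apply in_pq_sig in hx as [->|[->| ->]]; eexists; apply in_pq_I; eauto.
  - intros x y z hy hz. rewrite in_pq_I in hy, hz.
    destruct hy as [[-> ->]|[[-> ->]|[-> ->]]], hz as [[e ->]|[[e ->]|[e ->]]]; congruence.
Qed.

Lemma pq_app E p q : app (pq_I E p q) eps_sym = E /\ app (pq_I E p q) symP = p /\ app (pq_I E p q) symQ = q.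
Proof. split; [|split]; apply (func_app (pq_func E p q)), in_pq_I; auto. Qed.

Lemma pq_strc U E p q : (forall u, u ∈ E -> func u (num 2) U) -> (forall u, u ∈ p -> func u (num 1) U) -> (forall u, u ∈ q -> func u (num 1) U) ->
  strc pq_sig U (pq_I E p q).
Proof.
  intros hE hp hq. destruct (pq_app E p q) as (e1 & e2 & e3). split; [eexists; apply pq_func| |].
  - intros n r hn hr v hv. apply in_pq_sig in hr as [h|[h|h]]; rewrite h, ?e1, ?e2, ?e3 in hv; apply relsym_inj in h as [-> _]; auto.
  - intros n r hn hr. exfalso. apply in_pq_sig in hr as [h|[h|h]]; apply tag_neq in h; discriminate.
Qed.

Lemma pq_signature : signature pq_sig.
Proof.
  intros s hs. apply in_pq_sig in hs as [->|[->| ->]]; eexists; eexists; (split; [|left; reflexivity]); apply num_omega.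
Qed.

Lemma pq_sig_V : subset pq_sig (Vlev omega).
Proof.
  assert (h := @limit_omega M).
  intros s hs. apply in_pq_sig in hs as [->|[->| ->]]; repeat apply limit_opair; auto; try (apply limit_num; auto). apply (limit_num 0 h).
Qed.

Lemma eps_form_pq f : is_formula eps_sig f -> is_formula pq_sig f.
Proof.
  apply (eps_ind (P := fun f => is_formula pq_sig f)); [dfn| | |intros; now apply form_neg|intros; now apply form_and|intros; now apply form_all].
  - intros k l hk hl. apply form_eq; now apply term_var.
  - intros k l hk hl. apply form_rel; [apply num_omega|apply in_pq_sig; now left|]. apply pr_func; apply in_terms; now apply term_var.
Qed.

Lemma pq_elementary U E p q U' E' p' q' j : strc pq_sig U (pq_I E p q) -> strc pq_sig U' (pq_I E' p' q') ->
  elementary_embedding pq_sig (opair U (pq_I E p q)) (opair U' (pq_I E' p' q')) j ->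
  func j U U' /\ (forall a b, a ∈ U -> b ∈ U -> (pr a b ∈ E <-> pr (app j a) (app j b) ∈ E')) /\
  (forall a, a ∈ U -> (one a ∈ p <-> one (app j a) ∈ p')) /\ (forall a, a ∈ U -> (one a ∈ q <-> one (app j a) ∈ q')).
Proof.
  intros HS HS' [hj h]. rewrite !univ_opair in hj. split; auto. unfold assignment in h. rewrite univ_opair in h.
  destruct (pq_app E p q) as (e1 & e2 & e3), (pq_app E' p' q') as (e1' & e2' & e3').
  assert (Hs : forall a b, a ∈ U -> b ∈ U -> exists s, func s omega U /\ app s (num 0) = a /\ app s (num 1) = b /\
     func (comp j s) omega U' /\ app (comp j s) (num 0) = app j a /\ app (comp j s) (num 1) = app j b).
  { intros a b ha hb. set (e := fun k : nat => match k with 0 => a | _ => b end).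
    assert (he : forall k : nat, e k ∈ U) by (intros [|k]; auto). assert (hs := asg_func 2 he).
    assert (h0 := @asg_in M e 2 0 ltac:(lia)). assert (h1 := @asg_in M e 2 1 ltac:(lia)).
    assert (hc := compc_func hs hj). exists (asg e 2). rewrite (comp_compc hs hj). split; auto.
    split; [apply (func_app hs h0)|]. split; [apply (func_app hs h1)|]. split; auto.
    split; apply (func_app hc); apply compc_in; [exists a|exists b]; split; auto; now apply (func_ap hj). }
  assert (o0 := @num_omega M 0). assert (o1 := @num_omega M 1). split; [|split].
  - intros a b ha hb. destruct (Hs a b ha hb) as (s & hs & s0 & s1 & hs' & s0' & s1').
    assert (hr : relsym (num 2) empty ∈ pq_sig) by (apply in_pq_sig; now left).
    assert (H := h (frel (relsym (num 2) empty) (pr (tvar (num 0)) (tvar (num 1)))) s).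
    rewrite (models_rel2 HS hr o0 o1 hs), (models_rel2 HS' hr o0 o1 hs') in H.
    change (relsym (num 2) empty) with (@eps_sym M) in H. rewrite s0, s1, s0', s1', e1, e1' in H. apply H; auto.
    apply form_rel; auto; [apply num_omega|]. apply pr_func; apply in_terms; now apply term_var.
  - intros a ha. destruct (Hs a a ha ha) as (s & hs & s0 & s1 & hs' & s0' & s1').
    assert (hr : relsym (num 1) (num 0) ∈ pq_sig) by (apply in_pq_sig; now right; left).
    assert (H := h (frel (relsym (num 1) (num 0)) (singleton (opair empty (tvar (num 0))))) s).
    rewrite (models_rel1 HS hr o0 hs), (models_rel1 HS' hr o0 hs') in H.
    change (relsym (num 1) (num 0)) with symP in H. rewrite s0, s0', e2, e2' in H. apply H; auto.
    apply form_rel; auto. apply one_func, in_terms. now apply term_var.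
  - intros a ha. destruct (Hs a a ha ha) as (s & hs & s0 & s1 & hs' & s0' & s1').
    assert (hr : relsym (num 1) (num 1) ∈ pq_sig) by (apply in_pq_sig; now right; right).
    assert (H := h (frel (relsym (num 1) (num 1)) (singleton (opair empty (tvar (num 0))))) s).
    rewrite (models_rel1 HS hr o0 hs), (models_rel1 HS' hr o0 hs') in H.
    change (relsym (num 1) (num 1)) with symQ in H. rewrite s0, s0', e3, e3' in H. apply H; auto.
    apply form_rel; auto. apply one_func, in_terms. now apply term_var.
Qed.

(** [pi] is an isomorphism of (X, ∈) with (U, E). The predicate [p] names the ordinal [nu] itself as
    a subset of [U], not its image under [pi], so that its extension has rank [nu]. Bounded
    quantifiers make the notion absolute. *)
Definition copy X pi U E nu p : Prop :=
  func pi X U /\ (forall x, x ∈ X -> forall y, y ∈ X -> forall a, a ∈ U -> opair x a ∈ pi -> opair y a ∈ pi -> x = y) /\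
  (forall a, a ∈ U -> exists x, x ∈ X /\ opair x a ∈ pi) /\
  (forall u, u ∈ E -> exists x, x ∈ X /\ exists y, y ∈ X /\ exists a, a ∈ U /\ exists b, b ∈ U /\
     x ∈ y /\ opair x a ∈ pi /\ opair y b ∈ pi /\ u = pr a b) /\
  (forall x, x ∈ X -> forall y, y ∈ X -> forall a, a ∈ U -> forall b, b ∈ U -> x ∈ y -> opair x a ∈ pi -> opair y b ∈ pi -> pr a b ∈ E) /\
  ordinal nu /\ subset nu U /\ (forall u, u ∈ p -> exists a, a ∈ nu /\ u = one a) /\ (forall a, a ∈ nu -> one a ∈ p).

Lemma Dfn_copy C (X pi U E nu p : (nat -> M) -> M) : DfT C X -> DfT C pi -> DfT C U -> DfT C E -> DfT C nu -> DfT C p ->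
  Dfn C (fun e => copy (X e) (pi e) (U e) (E e) (nu e) (p e)).
Proof. intros. unfold copy, one, pr. dfn. Qed.

Lemma DfT_pq_I C (E p q : (nat -> M) -> M) : DfT C E -> DfT C p -> DfT C q -> DfT C (fun e => pq_I (E e) (p e) (q e)).
Proof. intros. unfold pq_I, symP, symQ. dfnu. Qed.

Lemma copy_exists X pi U nu : func pi X U -> (forall x, x ∈ X -> forall y, y ∈ X -> forall a, a ∈ U -> opair x a ∈ pi -> opair y a ∈ pi -> x = y) ->
  (forall a, a ∈ U -> exists x, x ∈ X /\ opair x a ∈ pi) -> ordinal nu -> subset nu U -> exists E p, copy X pi U E nu p.
Proof.
  intros h1 h2 h3 h4 h5.
  destruct (@sep M (fun u => exists x, x ∈ X /\ exists y, y ∈ X /\ exists a, a ∈ U /\ exists b, b ∈ U /\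
     x ∈ y /\ opair x a ∈ pi /\ opair y b ∈ pi /\ u = pr a b) (funset (num 2) U)) as [E hE]; [unfold pr; dfn|].
  destruct (@sep M (fun u => exists a, a ∈ nu /\ u = one a) (funset (num 1) U)) as [p hp]; [unfold one; dfn|].
  exists E, p. split; auto. split; auto. split; auto. split; [intros u hu; now apply hE in hu|]. split.
  - intros x hx y hy a ha b hb hxy hxa hyb. apply hE. split; [apply in_funset; now apply pr_func|]. exists x. split; auto. exists y. split; auto. exists a. split; auto. exists b. auto.
  - split; auto. split; auto. split; [intros u hu; now apply hp in hu|]. intros a ha. apply hp. split; [apply in_funset, one_func; auto|eauto].
Qed.

Lemma copy_strc X pi U E nu p q : copy X pi U E nu p -> (forall u, u ∈ q -> func u (num 1) U) -> strc pq_sig U (pq_I E p q).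
Proof.
  intros (_ & _ & _ & hE & _ & _ & hn & hp & _) hq. apply pq_strc; auto.
  - intros u hu. destruct (hE u hu) as (x & _ & y & _ & a & ha & b & hb & _ & _ & _ & ->). now apply pr_func.
  - intros u hu. destruct (hp u hu) as (a & ha & ->). apply one_func. auto.
Qed.

Lemma copy_pr X pi U E nu p x y a b : copy X pi U E nu p -> opair x a ∈ pi -> opair y b ∈ pi -> (pr a b ∈ E <-> x ∈ y).
Proof.
  intros (hf & hinj & _ & hE & hE' & _) hx hy. assert (hx' := func_dom hf hx). assert (hy' := func_dom hf hy). split.
  - intros h. destruct (hE _ h) as (x' & h1 & y' & h2 & a' & h3 & b' & h4 & h5 & h6 & h7 & e). apply pr_inj2 in e as [<- <-].
    rewrite (hinj x (proj1 hx') x' h1 a h3), (hinj y (proj1 hy') y' h2 b h4); auto.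
  - intros h. apply (hE' x (proj1 hx') y (proj1 hy') a (proj2 hx') b (proj2 hy')); auto.
Qed.

Lemma copy_pred_ext X pi U E nu p q : copy X pi U E nu p -> pred_ext (opair U (pq_I E p q)) (num 0) = nu.
Proof.
  intros (_ & _ & _ & _ & _ & _ & hn & hp & hp'). apply ext. intros a. rewrite in_pred_ext. change (relsym (num 1) (num 0)) with symP.
  rewrite (proj1 (proj2 (pq_app E p q))). split.
  - intros [_ h]. destruct (hp _ h) as (b & hb & e). apply one_inj in e as ->. auto.
  - intros h. split; auto. now apply hp'.
Qed.

Lemma copy_type X pi U E nu p q nu' lam : copy X pi U E nu p -> (has_type (num 0) (opair U (pq_I E p q)) nu' lam <-> has_rank U lam /\ nu' = nu).
Proof.
  intros h. unfold has_type. rewrite univ_opair, (copy_pred_ext q h). assert (ho : ordinal nu) by apply h.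
  assert (hr : has_rank nu nu) by (apply has_rank_between; auto; [apply subset_refl|intros x hx; now apply (ord_sub_Vlev ho)]).
  split; intros [h1 h2]; split; auto; [now apply (has_rank_unique h2)|now subst].
Qed.

Lemma emodels_eqv X k l s : k ∈ omega -> l ∈ omega -> func s omega X -> (emodels X (feq (tvar k) (tvar l)) s <-> app s k = app s l).
Proof. unfold emodels. rewrite eps_structE. apply (models_eqv (eps_strc X)). Qed.
Lemma emodels_neg X f s : is_formula eps_sig f -> func s omega X -> (emodels X (fneg f) s <-> ~ emodels X f s).
Proof. unfold emodels. rewrite eps_structE. apply (models_neg (eps_strc X)). Qed.
Lemma emodels_and X f g s : is_formula eps_sig f -> is_formula eps_sig g -> func s omega X ->
  (emodels X (fand f g) s <-> emodels X f s /\ emodels X g s).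
Proof. unfold emodels. rewrite eps_structE. apply (models_and (eps_strc X)). Qed.
Lemma emodels_all X k f s : k ∈ omega -> is_formula eps_sig f -> func s omega X ->
  (emodels X (fall k f) s <-> forall a, a ∈ X -> emodels X f (supd s k a)).
Proof. unfold emodels. rewrite eps_structE. apply (models_all (eps_strc X)). Qed.

Lemma compc_app j s a b c x : func s a b -> func j b c -> x ∈ a -> app (compc j s) x = app j (app s x).
Proof.
  intros hs hj hx. apply (func_app (compc_func hs hj)). apply compc_in. exists (app s x). split; [now apply (func_ap hs)|].
  apply (func_ap hj). now apply (func_in hs).
Qed.

Lemma copy_models X pi U E nu p q : copy X pi U E nu p -> strc pq_sig U (pq_I E p q) -> forall f, is_formula eps_sig f -> forall s, func s omega X ->
  (emodels X f s <-> models pq_sig (opair U (pq_I E p q)) f (compc pi s)).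
Proof.
  intros hc HS. assert (hc' := hc). destruct hc' as (hf & hinj & hsur & _). set (B := opair U (pq_I E p q)).
  assert (hB : structure pq_sig B) by now apply structure_of_strc.
  enough (H : forall f, is_formula eps_sig f -> forall s, func s omega X -> (emodels X f s <-> modc pq_sig B f (compc pi s))).
  { intros f hff s hs. rewrite (modc_iff f (compc pi s) hB). auto. }
  assert (hcs : forall s, func s omega X -> func (compc pi s) omega U) by (intros s hs; apply (compc_func hs hf)).
  apply (eps_ind (P := fun f => forall s, func s omega X -> (emodels X f s <-> modc pq_sig B f (compc pi s)))); [dfn| | | | |].
  - intros k l hk hl s hs. rewrite <- (modc_iff _ _ hB), emodels_eqv by auto. unfold B. rewrite (models_eqv HS hk hl (hcs s hs)).
    rewrite !(compc_app hs hf) by auto. split; [congruence|]. intros e. assert (h1 := func_in hs hk). assert (h2 := func_in hs hl).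
    apply (hinj _ h1 _ h2 (app pi (app s k))); [now apply (func_in hf)|now apply (func_ap hf)|]. rewrite e. now apply (func_ap hf).
  - intros k l hk hl s hs. rewrite <- (modc_iff _ _ hB), emodels_mem by auto. unfold B, eps_sym.
    assert (hr : relsym (num 2) empty ∈ pq_sig) by (apply in_pq_sig; now left).
    rewrite (models_rel2 HS hr hk hl (hcs s hs)). change (relsym (num 2) empty) with (@eps_sym M). rewrite (proj1 (pq_app E p q)), !(compc_app hs hf) by auto.
    symmetry. apply (copy_pr hc); apply (func_ap hf); now apply (func_in hs).
  - intros f hff IH s hs. rewrite <- (modc_iff _ _ hB), emodels_neg by auto. unfold B. rewrite (models_neg HS (eps_form_pq hff) (hcs s hs)).
    fold B. rewrite (modc_iff _ _ hB), IH by auto. tauto.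
  - intros f g hff hg IH IH' s hs. rewrite <- (modc_iff _ _ hB), emodels_and by auto. unfold B. rewrite (models_and HS (eps_form_pq hff) (eps_form_pq hg) (hcs s hs)).
    fold B. rewrite !(modc_iff _ _ hB), IH, IH' by auto. tauto.
  - intros k f hk hff IH s hs. rewrite <- (modc_iff _ _ hB), emodels_all by auto. unfold B. rewrite (models_all HS hk (eps_form_pq hff) (hcs s hs)). fold B.
    assert (hsu : forall x a, opair x a ∈ pi -> supd (compc pi s) k a = compc pi (supd s k x)).
    { intros x a hxa. destruct (func_dom hf hxa) as [hx ha].
      apply (func_ext (supd_func (hcs s hs) hk ha) (hcs _ (supd_func hs hk hx))). intros l b h. apply supd_in in h. apply compc_in.
      destruct h as [[hlk h]|[-> ->]].
      - apply compc_in in h as (y & h1 & h2). exists y. split; auto. apply supd_in. auto.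
      - exists x. split; auto. apply supd_in. auto. }
    split; intros h a ha.
    + destruct (hsur a ha) as (x & hx & hxa). rewrite (hsu x a hxa). rewrite (modc_iff _ _ hB). apply IH; [now apply supd_func|auto].
    + apply IH; [now apply supd_func|]. rewrite <- (modc_iff _ _ hB), <- (hsu a (app pi a)) by now apply (func_ap hf).
      apply h. now apply (func_in hf).
Qed.

(** * Elementary substructures, with bounded quantifiers *)

Definition fcl F : Prop :=
  (forall k, k ∈ omega -> forall l, l ∈ omega -> feq (tvar k) (tvar l) ∈ F) /\
  (forall k, k ∈ omega -> forall l, l ∈ omega -> frel eps_sym (pr (tvar k) (tvar l)) ∈ F) /\
  (forall f, f ∈ F -> fneg f ∈ F) /\ (forall f, f ∈ F -> forall g, g ∈ F -> fand f g ∈ F) /\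
  (forall k, k ∈ omega -> forall f, f ∈ F -> fall k f ∈ F).

(** Relational form of [supd], with quantifiers bounded by omega and [X]. *)
Definition updates X s k a t : Prop := opair k a ∈ t /\ forall l, l ∈ omega -> l <> k -> forall b, b ∈ X -> (opair l b ∈ s <-> opair l b ∈ t).

Definition sats F X R : Prop := forall s, func s omega X ->
  (forall k, k ∈ omega -> forall l, l ∈ omega ->
     (opair (feq (tvar k) (tvar l)) s ∈ R <-> exists a, a ∈ X /\ (opair k a ∈ s /\ opair l a ∈ s))) /\
  (forall k, k ∈ omega -> forall l, l ∈ omega ->
     (opair (frel eps_sym (pr (tvar k) (tvar l))) s ∈ R <-> exists a, a ∈ X /\ exists b, b ∈ X /\ (opair k a ∈ s /\ opair l b ∈ s /\ a ∈ b))) /\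
  (forall f, f ∈ F -> (opair (fneg f) s ∈ R <-> ~ opair f s ∈ R)) /\
  (forall f, f ∈ F -> forall g, g ∈ F -> (opair (fand f g) s ∈ R <-> opair f s ∈ R /\ opair g s ∈ R)) /\
  (forall k, k ∈ omega -> forall f, f ∈ F ->
     (opair (fall k f) s ∈ R <-> forall a, a ∈ X -> forall t, func t omega X -> updates X s k a t -> opair f t ∈ R)).

(** Formulas and satisfaction are defined by quantifying over all sets. In an absolute description
    any set [F] closed under the formation rules can stand for the set of formulas, with relations
    [R] and [S] obeying Tarski's clauses on it. *)
Definition subm F R S X v : Prop := subset X v /\ fcl F /\ sats F X R /\ sats F v S /\
  forall f, f ∈ F -> forall s, func s omega X -> (opair f s ∈ R <-> opair f s ∈ S).

Lemma Dfn_subm C (F R S X v : (nat -> M) -> M) : DfT C F -> DfT C R -> DfT C S -> DfT C X -> DfT C v ->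
  Dfn C (fun e => subm (F e) (R e) (S e) (X e) (v e)).
Proof.
  assert (H : forall F X R : (nat -> M) -> M, DfT C F -> DfT C X -> DfT C R -> Dfn C (fun e => sats (F e) (X e) (R e))).
  { intros F' X' R' hF hX hR. unfold sats, updates, pr. dfnu.
    - apply imply_to_and in H1 as [H1 _]. apply (Good_func (cdom_good H) (a := omega) (b := X' (fun i : nat => e (Datatypes.S (Datatypes.S (Datatypes.S (Datatypes.S i))))))); auto;
        [apply (good_omega (cdom_good H))|]. apply (proj1 hX); auto. intros i. apply H0.
    - apply imply_to_and in H1 as [H1 _]. apply (Good_func (cdom_good H) (a := omega) (b := X' e)); auto; [apply (good_omega (cdom_good H))|]. now apply (proj1 hX). }
  intros. unfold subm, fcl, pr. dfnu; try (apply H; dfn).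
  apply imply_to_and in H7 as [H7 _]. apply (Good_func (cdom_good H5) (a := omega) (b := X (fun i : nat => e (Datatypes.S i)))); auto;
    [apply (good_omega (cdom_good H5))|]. apply (proj1 H3); auto. intros i. apply H6.
Qed.

Lemma updates_supd X s k a t : func s omega X -> k ∈ omega -> a ∈ X -> func t omega X -> (updates X s k a t <-> t = supd s k a).
Proof.
  intros hs hk ha ht. split.
  - intros [h1 h2]. apply (func_ext ht (supd_func hs hk ha)). intros l b h. apply supd_in. destruct (classic (l = k)) as [->|hlk].
    + right. split; auto. apply (func_fun ht h h1).
    + left. split; auto. destruct (func_dom ht h) as [hl hb]. now apply (h2 l hl hlk b hb).
  - intros ->. split; [apply supd_in; auto|]. intros l hl hlk b hb. rewrite supd_in. tauto.
Qed.

Lemma app_iff s X k l (Q : M -> M -> Prop) : func s omega X -> k ∈ omega -> l ∈ omega ->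
  ((exists a, a ∈ X /\ exists b, b ∈ X /\ (opair k a ∈ s /\ opair l b ∈ s /\ Q a b)) <-> Q (app s k) (app s l)).
Proof.
  intros hs hk hl. split.
  - intros (a & _ & b & _ & h1 & h2 & h). now rewrite (func_app hs h1), (func_app hs h2).
  - intros h. exists (app s k). split; [now apply (func_in hs)|]. exists (app s l). split; [now apply (func_in hs)|].
    split; [now apply (func_ap hs)|]. split; auto. now apply (func_ap hs).
Qed.

Lemma app_eq_iff s X k l : func s omega X -> k ∈ omega -> l ∈ omega ->
  ((exists a, a ∈ X /\ (opair k a ∈ s /\ opair l a ∈ s)) <-> app s k = app s l).
Proof.
  intros hs hk hl. rewrite <- (app_iff (fun a b => a = b) hs hk hl). split.
  - intros (a & ha & h1 & h2). exists a. split; auto. exists a. auto.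
  - intros (a & ha & b & _ & h1 & h2 & <-). eauto.
Qed.

Lemma sats_emodels F X R : fcl F -> sats F X R -> forall f, is_formula eps_sig f -> f ∈ F /\ forall s, func s omega X -> (emodels X f s <-> opair f s ∈ R).
Proof.
  intros (c1 & c2 & c3 & c4 & c5) hR.
  apply (eps_ind (P := fun f => f ∈ F /\ forall s, func s omega X -> (emodels X f s <-> opair f s ∈ R))); [dfn| | | | |].
  - intros k l hk hl. split; auto. intros s hs. now rewrite (proj1 (hR s hs) k hk l hl), (app_eq_iff hs hk hl), emodels_eqv.
  - intros k l hk hl. split; auto. intros s hs.
    now rewrite (proj1 (proj2 (hR s hs)) k hk l hl), (app_iff (fun a b => a ∈ b) hs hk hl), emodels_mem.
  - intros f hf [hfF IH]. split; auto. intros s hs. rewrite (proj1 (proj2 (proj2 (hR s hs))) f hfF), emodels_neg, IH by auto. tauto.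
  - intros f g hf hg [hfF IH] [hgF IH']. split; auto. intros s hs.
    rewrite (proj1 (proj2 (proj2 (proj2 (hR s hs)))) f hfF g hgF), emodels_and, IH, IH' by auto. tauto.
  - intros k f hk hf [hfF IH]. split; auto. intros s hs. rewrite (proj2 (proj2 (proj2 (proj2 (hR s hs)))) k hk f hfF), emodels_all by auto. split.
    + intros h a ha t ht htu. apply updates_supd in htu as ->; auto. apply IH; auto.
    + intros h a ha. apply IH; [now apply supd_func|]. apply (h a ha); [now apply supd_func|]. apply updates_supd; auto. now apply supd_func.
Qed.

Lemma sats_exists X : exists R, sats (forms eps_sig) X R.
Proof.
  destruct (@sep M (fun q => exists f s, q = opair f s /\ emodels X f s) (pow (pow (union2 (forms eps_sig) (funset omega X))))) as [R hR]; [dfn|].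
  assert (H : forall f s, is_formula eps_sig f -> func s omega X -> (opair f s ∈ R <-> emodels X f s)).
  { intros f s hf hs. rewrite hR. split.
    - intros (_ & f' & s' & e & h). now apply opair_inj in e as [-> ->].
    - intros h. split; [|eauto]. apply opair_in_pow; [now apply in_forms|now apply in_funset]. }
  exists R. intros s hs. split; [|split; [|split; [|split]]].
  - intros k hk l hl. rewrite (app_eq_iff hs hk hl), H, emodels_eqv; auto; [tauto|]. apply form_eq; now apply term_var.
  - intros k hk l hl. rewrite (app_iff (fun a b => a ∈ b) hs hk hl), H, emodels_mem; auto; [tauto|]. apply form_rel; [apply num_omega|now apply in_singleton|].
    apply pr_func; apply in_terms; now apply term_var.
  - intros f hf. apply in_forms in hf. rewrite !H, emodels_neg; auto using form_neg. tauto.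
  - intros f hf g hg. apply in_forms in hf, hg. rewrite !H, emodels_and; auto using form_and. tauto.
  - intros k hk f hf. apply in_forms in hf. rewrite H, emodels_all; auto using form_all. split.
    + intros h a ha t ht htu. apply updates_supd in htu as ->; auto. apply H; auto.
    + intros h a ha. apply H; [auto|now apply supd_func|]. apply (h a ha); [now apply supd_func|]. apply updates_supd; auto. now apply supd_func.
Qed.

Lemma func_sub s X v : subset X v -> func s omega X -> func s omega v.
Proof. intros h hs. apply (func_cod hs). intros x y hy. apply h. apply (func_dom hs hy). Qed.

Lemma elementary_sub_emodels X v : elementary_sub X v <-> subset X v /\
  forall f, is_formula eps_sig f -> forall s, func s omega X -> (emodels X f s <-> emodels v f s).
Proof.
  split; intros [hs h]; split; auto.
  - destruct h as [_ h]. intros f hf s hs'. unfold emodels. rewrite h; auto; [now rewrite (comp_id hs hs')|].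
    unfold assignment. now rewrite eps_structE, univ_opair.
  - split; [rewrite !eps_structE, !univ_opair; now apply idfun_func|]. intros f s hf hs'. unfold assignment in hs'.
    rewrite eps_structE, univ_opair in hs'. rewrite (comp_id hs hs'). now apply h.
Qed.

Lemma elementary_sub_subm X v : elementary_sub X v <-> exists F R S, subm F R S X v.
Proof.
  rewrite elementary_sub_emodels. split.
  - intros [hs h]. destruct (sats_exists X) as [R hR], (sats_exists v) as [S hS].
    assert (hF : fcl (forms eps_sig)).
    { split; [|split; [|split; [|split]]].
      - intros k hk l hl. apply in_forms, form_eq; now apply term_var.
      - intros k hk l hl. apply in_forms, form_rel; [apply num_omega|now apply in_singleton|]. apply pr_func; apply in_terms; now apply term_var.
      - intros f hf. apply in_forms, form_neg. now apply in_forms.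
      - intros f hf g hg. apply in_forms, form_and; now apply in_forms.
      - intros k hk f hf. apply in_forms, form_all; auto. now apply in_forms. }
    exists (forms eps_sig), R, S. split; auto. split; auto. split; auto. split; auto.
    intros f hf s hs'. apply in_forms in hf. rewrite <- (proj2 (sats_emodels hF hR hf) s hs'), <- (proj2 (sats_emodels hF hS hf) s (func_sub hs hs')). auto.
  - intros (F & R & S & hs & hF & hR & hS & h). split; auto. intros f hf s hs'. destruct (sats_emodels hF hR hf) as [hfF hR'].
    rewrite (hR' s hs'), (proj2 (sats_emodels hF hS hf) s (func_sub hs hs')). auto.
Qed.

End Copies.

(** * Reflection yields an exacting cardinal *)

Section Backward.
Context {M : zfc_model}.
Implicit Types x y z a b c d f g h p q r s u v w t xi lam kap X i j k m Y A B F G Z E U R nu mu eta pi L : M.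

(** Induction on initial segments mapped into themselves. If [succ n] is one, order preservation
    puts the images of elements of [n] below the image of [n], hence into [n]; so they are fixed,
    and [n] cannot go to a smaller, already fixed, point. *)
Lemma finite_rigid lam j : lam ∈ omega -> func j lam lam -> (forall a b, a ∈ lam -> b ∈ lam -> a ∈ b -> app j a ∈ app j b) ->
  forall a, a ∈ lam -> app j a = a.
Proof.
  intros hl hj hord. assert (ol := nat_ord hl).
  assert (H : forall n, n ∈ omega -> subset n lam -> (forall a, a ∈ n -> exists b, b ∈ n /\ opair a b ∈ j) -> forall a, a ∈ n -> opair a a ∈ j).
  { apply (omega_ind (P := fun n => subset n lam -> (forall a, a ∈ n -> exists b, b ∈ n /\ opair a b ∈ j) -> forall a, a ∈ n -> opair a a ∈ j)); [dfn| |].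
    - intros _ _ a h. destruct (in_empty h).
    - intros n hn IH hnl hb. assert (hnn : n ∈ succ n) by (apply in_succ; auto).
      destruct (hb n hnn) as (b & hbn & hjn).
      assert (hid : forall a, a ∈ n -> opair a a ∈ j).
      { apply IH; [intros x hx; apply hnl, in_succ; auto|]. intros a ha. assert (ha' : a ∈ succ n) by (apply in_succ; auto).
        destruct (hb a ha') as (a' & h1 & h2). exists a'. split; auto. assert (h := hord a n (hnl a ha') (hnl n hnn) ha).
        rewrite (func_app hj h2), (func_app hj hjn) in h. apply in_succ in hbn as [hbn| ->]; auto. apply (ord_trans (nat_ord hn) hbn h). }
      intros a ha. apply in_succ in ha as [ha| ->]; auto. apply in_succ in hbn as [hbn| ->]; auto. exfalso.
      assert (hbl : b ∈ lam) by (apply hnl, in_succ; auto). assert (h := hord b n hbl (hnl n hnn) hbn).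
      rewrite (func_app hj (hid b hbn)), (func_app hj hjn) in h. apply (mem_irrefl h). }
  intros a ha. apply (func_app hj). apply (H lam hl (@subset_refl M lam)); auto.
  intros b hb. destruct (func_ex hj hb) as (b' & h1 & h2). eauto.
Qed.

(** Serves to rule out a finite [lam]. The pairs (a, a) in [pi] force the copy to be (lam, ∈)
    itself. *)
Definition rigid_class A lam pi E nu p : Prop :=
  A = opair lam (pq_I E p empty) /\ copy lam pi lam E nu p /\ forall a, a ∈ lam -> opair a a ∈ pi.

(** The second predicate marks the code of the pair (lam, nu), so that an elementary map between two
    such copies has to match these pairs. The clauses on [eta] are those of [beth] with the levels
    taken from [v], hence absolute; Sigma_1-correctness follows from them by [beth_in_C]. *)
Definition hull_class A lam pi E nu p U X c eta v F R S u : Prop :=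
  A = opair U (pq_I E p (singleton (one c))) /\ copy X pi U E nu p /\ opair (opair lam nu) c ∈ pi /\
  isV v eta /\ limit eta /\ omega ∈ eta /\ lam ∈ eta /\
  (forall b, b ∈ eta -> exists a, a ∈ eta /\ (b ∈ a /\ limit a)) /\
  (forall a, a ∈ eta -> forall w, w ∈ v -> isV w a -> ~ exists g, surj g w eta) /\
  isV u lam /\ subset u X /\ lam ∈ X /\ subm F R S X v.

Lemma hull_class_beth A lam pi E nu p U X c eta v F R S u : hull_class A lam pi E nu p U X c eta v F R S u -> beth eta.
Proof.
  intros (_ & _ & _ & [ho ->] & _ & _ & _ & h1 & h2 & _). split; auto. intros a ha w [hw ->]. apply (h2 a ha); [|now split]. now apply Vlev_lt.
Qed.

(** The embedding is [j] conjugated by the two copying maps and followed by the inclusion of [Y]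
    into [v]. *)
Lemma copy_embedding lam X piA UA EA nu pA cA Y piB UB EB mu pB cB v j :
  copy X piA UA EA nu pA -> opair (opair lam nu) cA ∈ piA -> copy Y piB UB EB mu pB -> opair (opair lam mu) cB ∈ piB -> elementary_sub Y v ->
  elementary_embedding pq_sig (opair UA (pq_I EA pA (singleton (one cA)))) (opair UB (pq_I EB pB (singleton (one cB)))) j ->
  exists i, eps_elementary X v i /\ app i (opair lam nu) = opair lam mu.
Proof.
  intros hA hcA hB hcB hY hj.
  assert (HQ : forall X pi U E nu p c x, copy X pi U E nu p -> opair x c ∈ pi -> strc pq_sig U (pq_I E p (singleton (one c)))).
  { clear. intros X pi U E nu p c x h hc. apply (copy_strc h). intros u hu. apply in_singleton in hu as ->. apply one_func. apply (func_dom (proj1 h) hc). }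
  assert (SA := HQ _ _ _ _ _ _ _ _ hA hcA). assert (SB := HQ _ _ _ _ _ _ _ _ hB hcB).
  destruct (pq_elementary SA SB hj) as (hjf & _ & _ & hjq). destruct hj as [_ hje].
  assert (hA' := hA). destruct hA' as (fA & iA & sA & _). assert (hB' := hB). destruct hB' as (fB & iB & sB & _).
  destruct (@fun_of_func M (fun x z => exists a b, opair x a ∈ piA /\ opair a b ∈ j /\ opair z b ∈ piB) X Y) as (i & hi & hiE); [dfn| | |].
  { intros x hx. destruct (func_ex fA hx) as (a & ha & hxa). destruct (func_ex hjf ha) as (b & hb & hab). destruct (sB b hb) as (z & hz & hzb).
    exists z. split; [eauto|]. intros z' (a' & b' & h1 & h2 & h3). rewrite <- (func_fun fA hxa h1) in h2. rewrite <- (func_fun hjf hab h2) in h3.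
    apply (iB z hz z' (proj1 (func_dom fB h3)) b); auto. }
  { intros x z hx (a & b & _ & _ & h). apply (func_dom fB h). }
  assert (hi' : func i X v) by (apply (func_cod hi); intros x y h; apply (proj1 hY), (func_dom hi h)).
  exists i. split.
  - split; [now rewrite !eps_structE, !univ_opair|]. intros f s hf hs. unfold assignment in hs. rewrite eps_structE, univ_opair in hs.
    rewrite (comp_compc hs hi'). assert (hs' := compc_func hs hi). change (emodels X f s <-> emodels v f (compc i s)).
    rewrite <- (proj2 (proj1 (elementary_sub_emodels Y v) hY) f hf _ hs'), (copy_models hA SA hf hs), (copy_models hB SB hf hs').
    assert (hsA := compc_func hs fA). rewrite (hje f (compc piA s) (eps_form_pq hf)) by (unfold assignment; now rewrite univ_opair).
    replace (compc piB (compc i s)) with (comp j (compc piA s)); [tauto|]. rewrite (comp_compc hsA hjf).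
    apply (func_ext (compc_func hsA hjf) (compc_func hs' fB)). intros k b h. apply compc_in in h as (a & h1 & h2). apply compc_in in h1 as (x & h0 & h1).
    assert (hb := proj2 (func_dom hjf h2)). destruct (sB b hb) as (z & hz & hzb). apply compc_in. exists z. split; auto. apply compc_in. exists x. split; auto.
    apply hiE. split; [apply (func_dom fA h1)|eauto].
  - apply (func_app hi). apply hiE. split; [apply (func_dom fA hcA)|]. assert (ha := proj2 (func_dom fA hcA)). exists cA, (app j cA). split; auto.
    split; [now apply (func_ap hjf)|]. assert (h : one cA ∈ singleton (one cA)) by now apply in_singleton. apply (hjq cA ha) in h.
    apply in_singleton, one_inj in h as ->. auto.
Qed.

(** Ordinals below [lam] represent themselves, so that [mu] is a subset of [U] and [U] has rank
    [lam]. Any other element is represented by the pair of a chosen preimage and [empty], which is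
    not an ordinal. *)
Lemma hull_copy lam Y G mu : limit lam -> subset (Vlev lam) Y -> surj G (Vlev lam) Y -> ordinal mu -> subset mu lam ->
  exists pi U E p, copy Y pi U E mu p /\ has_rank U lam.
Proof.
  intros hl hVY [hG hGs] hmu hml. assert (ol := proj1 hl). destruct (choice_fun (pow (Vlev lam))) as (ch & c1 & c2 & c3).
  set (T := fun y b => exists Z, (forall x, x ∈ Z <-> x ∈ Vlev lam /\ opair x y ∈ G) /\ opair Z b ∈ ch).
  assert (hTd : Dfn cW (fun e => T (e 0) (e 1))) by (unfold T; dfn).
  assert (hT : forall y b, T y b -> b ∈ Vlev lam /\ opair b y ∈ G).
  { intros y b (Z & h1 & h2). apply h1. now apply c1 in h2. }
  assert (hTu : forall y b b', T y b -> T y b' -> b = b').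
  { intros y b b' (Z & h1 & h2) (Z' & h1' & h2'). replace Z' with Z in h2'; [now apply (c2 Z)|]. apply ext. intros w. now rewrite h1, h1'. }
  assert (hTe : forall y, y ∈ Y -> exists b, T y b).
  { intros y hy. destruct (@sep M (fun x => opair x y ∈ G) (Vlev lam)) as [Z hZ]; [dfn|]. destruct (c3 Z) as [b hb].
    - apply in_pow. intros w hw. now apply hZ in hw.
    - destruct (hGs y hy) as (x & h1 & h2). exists x. now apply hZ.
    - exists b, Z. auto. }
  set (Q := fun y a => (y ∈ lam /\ a = y) \/ (~ y ∈ lam /\ exists b, T y b /\ a = opair b empty)).
  assert (hQd : Dfn cW (fun e => Q (e 0) (e 1))) by (unfold Q; dfn).
  assert (hpair : forall b, ~ opair b empty ∈ lam).
  { intros b h. assert (ho := ord_mem ol h). assert (he : empty ∈ opair b empty).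
    { apply ord_nonempty; auto. intros e. apply (@in_empty M (singleton b)). rewrite <- e. apply in_upair. auto. }
    apply in_upair in he as [e|e]; apply (@in_empty M b); rewrite e; [now apply in_singleton|apply in_upair; auto]. }
  assert (hQV : forall y a, Q y a -> a ∈ Vlev lam).
  { intros y a [[h ->]|[_ (b & h & ->)]]; [now apply (ord_sub_Vlev ol)|]. apply limit_opair; auto; [now apply hT in h|apply (limit_num 0 hl)]. }
  destruct (@sep M (fun a => exists y, y ∈ Y /\ Q y a) (Vlev lam)) as [U hU]; [dfn|].
  destruct (@fun_of_func M Q Y U hQd) as (pi & hpi & hpiE).
  { intros y hy. destruct (classic (y ∈ lam)) as [h|h].
    - exists y. split; [left; auto|]. intros a [[_ ->]|[h' _]]; [auto|tauto].
    - destruct (hTe y hy) as [b hb]. exists (opair b empty). split; [right; eauto|]. intros a [[h' _]|[_ (b' & h' & ->)]]; [tauto|]. now rewrite (hTu y b b'). }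
  { intros y a hy h. apply hU. split; eauto. }
  assert (hlU : subset lam U).
  { intros y hy. assert (hyV := ord_sub_Vlev ol hy). apply hU. split; auto. exists y. split; auto. left. auto. }
  destruct (@copy_exists M Y pi U mu hpi) as (E & p & hc); auto.
  - intros x hx y hy a ha h1 h2. apply hpiE in h1 as [_ h1], h2 as [_ h2].
    destruct h1 as [[h1 ->]|[h1 (b & hb & ->)]], h2 as [[h2 e]|[h2 (b' & hb' & e)]]; auto.
    + rewrite e in h1. destruct (hpair b' h1).
    + rewrite <- e in h2. destruct (hpair b h2).
    + apply opair_inj in e as [<- _]. apply hT in hb as [_ hb], hb' as [_ hb']. apply (func_fun hG hb hb').
  - intros a ha. apply hU in ha as (_ & y & hy & h). exists y. split; auto. apply hpiE. auto.
  - intros x hx. auto.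
  - exists pi, U, E, p. split; auto. apply has_rank_between; auto. intros a ha. now apply hU in ha.
Qed.

Lemma elementary_opair Y v x y : elementary_sub Y v -> Good (fun z => z ∈ v) -> x ∈ Y -> y ∈ Y -> opair x y ∈ Y.
Proof.
  intros hY hG hx hy. destruct (@DfnA_fml M (fun e => e 0 = opair (e 1) (e 2)) ltac:(dfn)) as [f hf].
  set (e := fun k : nat => match k with 0 | 1 => x | _ => y end).
  assert (heY : forall k : nat, e k ∈ Y) by (intros [|[|k]]; auto).
  assert (hYv : subset Y v) by apply hY.
  assert (hd : forall z, z ∈ v -> dom (fun z => z ∈ v) (upd e 0 z)) by (intros z hz [|k]; [auto|apply hYv; apply (heY (S k))]).
  assert (h : sat (@mem M) (fun z => z ∈ v) e (Ex 0 f)).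
  { cbn [sat]. assert (hp := Good_opair hG (hYv _ hx) (hYv _ hy)). exists (opair x y). split; [exact hp|]. apply (hf _ hG _ (hd _ hp)). reflexivity. }
  apply (elementary_sub_sat hY (Ex 0 f) heY) in h. cbn [sat] in h. destruct h as (z & hz & h).
  apply (elementary_sub_sat hY) in h; [|intros [|k]; [auto|apply (heY (S k))]].
  apply (hf _ hG _ (hd _ (hYv _ hz))) in h. cbn in h. now subst z.
Qed.

(** [X] inherits truth from [v], and an absolute property means the same in [v], in [w] and in the
    universe. *)
Lemma embedding_Pres X v w i : elementary_sub X v -> Good (fun z => z ∈ v) -> Good (fun z => z ∈ w) -> eps_elementary X w i ->
  forall P, Dfn cA P -> Pres X i P.
Proof.
  intros hX hv hw hi P hP e he. destruct (DfnA_fml hP) as [f hf].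
  assert (h1 := hf _ hv e (fun k : nat => proj1 hX _ (he k))).
  assert (h2 := hf _ hw (fun k : nat => app i (e k)) (fun k : nat => func_in (eps_elementary_func hi) (he k))).
  rewrite <- h1, <- h2, <- (elementary_sub_sat hX f he). apply (elementary_sat hi f he).
Qed.

Section Reflection.
Variables (n : nat) (lam mu : M).
Hypothesis hn : 2 <= n.
Hypothesis hlam : cardinal lam.
Hypothesis hmu : cardinal mu.
Hypothesis hml : subset mu lam.
Hypothesis hrefl : forall L P, signature L -> subset L (union2 (Vlev mu) (Vlev omega)) -> relsym (num 1) P ∈ L ->
  forall C : M -> Prop, (forall A, C A -> structure L A) -> Sigma_definable n (union2 (Vlev mu) (singleton lam)) C ->
  forall B, C B -> has_type P B mu lam ->
  exists nu A j, nu ∈ mu /\ C A /\ has_type P A nu lam /\ elementary_embedding L A B j.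

Let ol : ordinal lam := proj1 hlam.

(** The reflection hypothesis for classes given by absolute predicates, with the existential
    witnesses of the reflected structure returned in the environment e'. *)
Lemma reflect (P : (nat -> M) -> Prop) : Dfn cA P -> (forall e, P e -> structure pq_sig (e 0)) ->
  forall e, P e -> e 1 = lam -> has_type (num 0) (e 0) mu lam ->
  exists nu (e' : nat -> M) j, nu ∈ mu /\ P e' /\ e' 1 = lam /\ has_type (num 0) (e' 0) nu lam /\ elementary_embedding pq_sig (e' 0) (e 0) j.
Proof.
  intros hP hs e he hel ht.
  destruct (@hrefl pq_sig (num 0)) with (C := fun A => exists e : nat -> M, e 0 = A /\ e 1 = lam /\ P e) (B := e 0) as (nu & A & j & h1 & (e' & <- & h2 & h3) & h4 & h5).
  - apply pq_signature.
  - intros s h. apply in_union2. right. now apply pq_sig_V.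
  - apply in_pq_sig. now right; left.
  - intros A (e' & <- & _ & h). auto.
  - apply Sigma2_class; auto. apply in_union2. right. now apply in_singleton.
  - eauto.
  - auto.
  - exists nu, e', j. auto 6.
Qed.

Definition env (l : list M) : nat -> M := fun k : nat => nth k l empty.

(** For a finite [lam], an embedding between copies of (lam, ∈) is the identity by [finite_rigid];
    but it would have to match a predicate naming nu with one naming mu, although nu < mu. *)
Lemma infinite_limit : limit lam.
Proof.
  assert (hom : ~ lam ∈ omega).
  { intros hlo. assert (hid := idfun_func (@subset_refl M lam)).
    destruct (@copy_exists M lam (idfun lam) lam mu hid) as (E & p & hc).
    { intros x _ y _ a _ h1 h2. apply idfun_in in h1 as [_ ->], h2 as [_ ->]. auto. }
    { intros a ha. exists a. split; auto. now apply idfun_in. }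
    { apply hmu. } { auto. }
    assert (hS : forall A lam pi E nu p, rigid_class A lam pi E nu p -> strc pq_sig lam (pq_I E p empty)).
    { intros A l pi E' nu p' (_ & h & _). apply (copy_strc h). intros u hu. destruct (in_empty hu). }
    assert (hB : rigid_class (opair lam (pq_I E p empty)) lam (idfun lam) E mu p).
    { split; auto. split; auto. intros a ha. now apply idfun_in. }
    destruct (@reflect (fun e => rigid_class (e 0) (e 1) (e 2) (e 3) (e 4) (e 5))) with (e := env (opair lam (pq_I E p empty) :: lam :: idfun lam :: E :: mu :: p :: nil))
      as (nu & e & j & hnu & hA & he & ht & hj).
    - unfold rigid_class. dfn; [apply DfT_pq_I; dfn|apply Dfn_copy; dfn].
    - intros e h. assert (h' := h). destruct h' as [-> _]. apply structure_of_strc. apply (hS _ _ _ _ _ _ h).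
    - exact hB.
    - reflexivity.
    - apply (copy_type empty mu lam hc). split; auto. apply has_rank_between; auto; [apply subset_refl|intros x hx; now apply (ord_sub_Vlev ol)].
    - cbn in hj. rewrite he in hA. assert (SA := hS _ _ _ _ _ _ hA). assert (SB := hS _ _ _ _ _ _ hB). destruct hA as (eA & hcA & hiA). rewrite eA in ht, hj.
      apply (copy_type empty nu lam hcA) in ht as [_ ->].
      destruct (pq_elementary SA SB hj) as (hjf & hjE & hjp & _).
      assert (hfix : app j (e 4) = e 4).
      { apply (finite_rigid hlo hjf); auto. intros a b ha hb hab. assert (h : pr a b ∈ e 3) by now apply (copy_pr hcA (hiA a ha) (hiA b hb)).
        apply hjE in h; auto. refine (proj1 (copy_pr hc _ _) h); apply idfun_in; split; auto; now apply (func_in hjf). }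
      assert (hnp : one (e 4) ∈ p) by (apply hc; auto). rewrite <- hfix in hnp. apply hjp in hnp; auto.
      destruct hcA as (_ & _ & _ & _ & _ & _ & _ & hp & _). destruct (hp _ hnp) as (a & ha & ea). apply one_inj in ea as <-. apply (mem_irrefl ha). }
  destruct (ord_tri (@ord_omega M) ol) as [h|[h|h]].
  - now apply infinite_cardinal_limit.
  - rewrite <- h. apply limit_omega.
  - tauto.
Qed.

Lemma reflection_exacting : exacting lam.
Proof.
  assert (hl := infinite_limit).
  (* The witness has m = 1, so zeta is taken in C^(2). That zeta is also [beth] puts the copy of the
     hull into the class to be reflected. *)
  destruct (@beth_DD M 2 lam ol) as (zeta & hlz & hD & hbz). destruct (DD_limit hD) as [hzl hzo]. assert (oz := proj1 hzl).
  assert (hlV : lam ∈ Vlev zeta) by now apply (ord_sub_Vlev oz).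
  destruct (skolem_hull hl (Vlev_lt_sub oz hlz) hlV) as (Y & G & hY & hVY & hlY & hG).
  destruct (hull_copy hl hVY hG (proj1 hmu) hml) as (pi & U & E & p & hc & hU).
  assert (GZ := limit_Good hzl hzo).
  assert (hmuY : mu ∈ Y).
  { destruct (ord_tri (proj1 hmu) ol) as [h|[->|h]]; auto; [apply hVY; now apply (ord_sub_Vlev ol)|]. destruct (mem_irrefl (hml h)). }
  assert (hpY := elementary_opair hY GZ hlY hmuY). assert (hpi : func pi Y U) by apply hc. assert (hcp := func_ap hpi hpY).
  set (c := app pi (opair lam mu)) in *.
  destruct (proj1 (elementary_sub_subm Y (Vlev zeta)) hY) as (F & R & S & hsub).
  set (B := opair U (pq_I E p (singleton (one c)))).
  assert (hB : hull_class B lam pi E mu p U Y c zeta (Vlev zeta) F R S (Vlev lam)).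
  { split; auto. split; auto. split; auto. split; [now split|]. split; auto. split; auto. split; auto. split; [apply (proj1 hbz)|].
    split; [intros a ha w _ hw; now apply (proj2 hbz a ha)|]. split; [now split|]. auto. }
  destruct (@reflect (fun e => hull_class (e 0) (e 1) (e 2) (e 3) (e 4) (e 5) (e 6) (e 7) (e 8) (e 9) (e 10) (e 11) (e 12) (e 13) (e 14)))
    with (e := env (B :: lam :: pi :: E :: mu :: p :: U :: Y :: c :: zeta :: Vlev zeta :: F :: R :: S :: Vlev lam :: nil))
    as (nu & e & j & hnu & hA & he & ht & hj).
  - unfold hull_class, limit. dfn;
      first [apply DfT_pq_I; unfold one; dfn|apply Dfn_copy; dfn|apply Dfn_subm; dfn|apply (good_trans (cdom_good H) H1); apply H0|idtac].
    apply (Good_func (cdom_good H) (a := e 0) (b := e 11)); [apply H0|apply H0|apply H1].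
  - intros e (-> & h & hce & _). apply structure_of_strc. apply (copy_strc h). intros u hu. apply in_singleton in hu as ->.
    apply one_func. apply (func_dom (proj1 h) hce).
  - exact hB.
  - reflexivity.
  - apply (copy_type _ mu lam hc). auto.
  - cbn in hj. rewrite he in hA. assert (hbe := hull_class_beth hA).
    destruct hA as (eA & hcA & hcpA & [oe ev] & hel & heo & hle & _ & _ & [_ eu] & huX & hlX & hsA).
    rewrite eA in ht, hj. apply (copy_type _ nu lam hcA) in ht as [_ ->]. rewrite ev in hsA. rewrite eu in huX.
    (* Positions in the environment follow the arguments of [hull_class]. *)
    set (eta := e 9) in *. set (X := e 7) in *. set (nu := e 4) in *.
    assert (hX : elementary_sub X (Vlev eta)) by (apply elementary_sub_subm; eauto).
    destruct (copy_embedding hcA hcpA hc hcp hY hj) as (i & hi & hip).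
    assert (GE := limit_Good hel heo). assert (hP := embedding_Pres hX GE GZ hi). assert (hif := eps_elementary_func hi).
    assert (hpr := Pres_pres hP). assert (hnl : nu ∈ lam) by auto.
    assert (hnX : nu ∈ X) by (apply huX; now apply (ord_sub_Vlev ol)).
    rewrite (pr_opair hpr hlX hnX) in hip by (apply (func_dom (proj1 hcA) hcpA)). apply opair_inj in hip as [hil hin].
    assert (hmov : exists a, a ∈ lam /\ app i a <> a).
    { exists nu. split; auto. rewrite hin. intros h. rewrite <- h in hnu. apply (mem_irrefl hnu). }
    split; [exact (embedding_limit_cardinal hif huX hlX hil hlam hP hmov)|].
    exists 1. split; [lia|]. exists eta, X, zeta, i. split; [now apply beth_cardinal|]. split; [now apply beth_in_C|].
    split; auto. split; auto. split; [intros x hx; apply in_union2 in hx as [hx|hx]; auto; apply in_singleton in hx as ->; auto|].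
    split; [now apply beth_cardinal|]. split; [now apply DD_in_C|]. auto.
Qed.

End Reflection.
End Backward.

Theorem theorem6p11 (M : zfc_model) (n : nat) (hn : 2 <= n)
    (lambda : M) (hlambda : cardinal lambda) :
  exacting lambda <->
  exists mu : M, cardinal mu /\ subset mu lambda /\
    forall (L P : M),
      signature L ->
      subset L (union2 (Vlev mu) (Vlev omega)) ->
      relsym (num 1) P ∈ L ->
    forall C : M -> Prop,
      (forall A, C A -> structure L A) ->
      Sigma_definable n (union2 (Vlev mu) (singleton lambda)) C ->
    forall B : M, C B -> has_type P B mu lambda ->
    exists nu A j : M,
      nu ∈ mu /\ C A /\ has_type P A nu lambda /\
      elementary_embedding L A B j.
Proof.
  split.
  - apply exacting_reflects.
  - intros (mu & h1 & h2 & h3). exact (reflection_exacting hn hlambda h1 h2 h3).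
Qed.
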